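(* Let $(M,\mathfrak F,\Lambda)$ be an integral CASK domain with associated projective special Kähler manifold $(\overline M,g_{\overline M})$, let $M_\infty\subset M$ be an open subset invariant under $S^1\subset\mathbb C^\times$ and under the monoid $\mathbb R_{\ge1}\subset\mathbb C^\times$, and let $\Omega$ be a compatible mutually local variation of BPS structures on the integral CASK manifold $(M_\infty,g_M,\omega_M,\nabla,\xi,\Lambda)$ with $\mathrm{Supp}(\Omega)\subset\mathrm{span}_{\mathbb Z}\{\partial_{y_i}\}$. Take $\overline N=\{\mathrm{Arg}(z^0)=0\}\subset P|_{N'}$. Then the quaternionic-Kähler metric $g_{\overline N}$ (defined in the context) has, in the coordinates $\rho,X^i,\widetilde\theta_i,\theta^i,\sigma$, the form $$\begin{aligned} g_{\overline N}=&\frac{\rho+c}{\rho+f^{\mathrm{inst}}}\Big(g_{\overline M}-e^{\mathcal K}\sum_\gamma\Omega(\gamma)V_\gamma^{\mathrm{inst}}\Big|dX_\gamma+X_\gamma\Big(\frac{d\rho}{2(\rho+c)}+\frac{d\mathcal K}2\Big)\Big|^2\Big)\\ &+\frac1{2(\rho+f^{\mathrm{inst}})^2}\Big(\frac{\rho+2c-f^{\mathrm{inst}}}{2(\rho+c)}d\rho^2+2d\rho\,df^{\mathrm{inst}}|_{\overline N}+(df^{\mathrm{inst}})^2|_{\overline N}\Big)\\ &+\frac{4(\rho+c+f_-^{\mathrm{inst}})}{(\rho+f^{\mathrm{inst}})^2(\rho+2c-f_1^{\mathrm{inst}})}\Big(d\sigma-\frac1{4\pi}\langle\theta,d\theta\rangle-\frac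 c4d^c\mathcal K+\eta_+^{\mathrm{inst}}|_{\overline N}+\frac{f_+^{\mathrm{inst}}-c}{\rho+c+f_-^{\mathrm{inst}}}\eta_-^{\mathrm{inst}}|_{\overline N}\Big)^2\\ &-\frac1{2\pi(\rho+f^{\mathrm{inst}})}(W_i+W_i^{\mathrm{inst}}|_{\overline N})(N+N^{\mathrm{inst}})^{ij}(\overline W_j+\overline W_j^{\mathrm{inst}}|_{\overline N})\\ &+\frac{(\rho+c)e^{\mathcal K}}{\pi(\rho+f^{\mathrm{inst}})^2}\Big|X^i(W_i+W_i^{\mathrm{inst}}|_{\overline N})+2\pi i\sum_\gamma\Omega(\gamma)A_\gamma^{\mathrm{inst}}(V)\Big(dX_\gamma+X_\gamma\Big(\frac{d\rho}{2(\rho+c)}+\frac{d\mathcal K}2\Big)\Big)\Big|^2\\ &+\frac{\rho+c+f_-^{\mathrm{inst}}}{\rho+f^{\mathrm{inst}}}\Big(\frac{d^c\mathcal K}2+\frac2{\rho+c+f_-^{\mathrm{inst}}}\eta_-^{\mathrm{inst}}|_{\overline N}\Big)^2-\frac{\rho+c}{\rho+f^{\mathrm{inst}}}\Big(\frac{d^c\mathcal K}2\Big)^2, \end{aligned}$$ where $\mathcal K=-\log(N_{ij}X^i\overline X^j)$ is a Kähler potential for $g_{\overline M}$, $$\eta_\pm^{\mathrm{inst}}:=\frac12\Big(\Big(2\pi\eta^{\mathrm{inst}}-\frac{f_1^{\mathrm{inst}}}2\widetilde\eta\Big)\pm\Big(2\pi\sum_\gamma\Omega(\gamma)\eta_\gamma^{\mathrm{inst}}-\frac{f^{\mathrm{inst}}}2\widetilde\eta\Big)\Big),\qquad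 f_\pm^{\mathrm{inst}}:=(f^{\mathrm{inst}}\pm f_1^{\mathrm{inst}})/2 .$$ Furthermore, the $1$-forms $W_i^{\mathrm{inst}}|_{\overline N}$ and $\eta_\pm^{\mathrm{inst}}|_{\overline N}$ have no $d\rho$ components.
   Context: **CASK domain.** A CASK domain $(M,\mathfrak F)$ is a $\mathbb C^\times$-invariant domain $M\subset\mathbb C^{n+1}\setminus\{0\}$ (coordinates $z^0,\dots,z^n$) with a holomorphic function $\mathfrak F:M\to\mathbb C$ homogeneous of degree $2$ such that $N_{ij}=\mathrm{Im}(\tau_{ij})$, $\tau_{ij}=\partial^2\mathfrak F/\partial z^i\partial z^j$, has signature $(1,n)$ and $N_{ij}z^i\overline z^j>0$ on $M$. Put $w_i=\partial\mathfrak F/\partial z^i$, $x^i=\mathrm{Re}\,z^i$, $y_i=-\mathrm{Re}\,w_i$; $\nabla$ is the connection for which $dx^i,dy_i$ are flat; $g_M=N_{ij}dz^id\overline z^j$, $\omega_M=\frac i2N_{ij}dz^i\wedge d\overline z^j=dx^i\wedge dy_i$, $\xi=z^i\partial_{z^i}+\overline z^i\partial_{\overline z^i}$, $\Lambda=\mathrm{span}_{\mathbb Z}\{\partial_{x^i},\partial_{y_i}\}$; $(M,\mathfrak F,\Lambda)$ is an integral CASK domain. $J$ is the complex structure, $\langle\cdot,\cdot\rangle=\omega_M|_{\Lambda\times\Lambda}$, Darboux frame $(\widetilde\gamma_i,\gamma^i)=(\partial_{x^i},\partial_{y_i})$; the canonical central charge $Z$ (section of $\Lambda^*\otimes\mathbb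 C$) has $Z_{\partial_{y_i}}=z^i$, $Z_{\partial_{x^i}}=w_i$. $r^2=g_M(\xi,\xi)=N_{ij}z^i\overline z^j$, $\widetilde\eta=r^{-2}g_M(J\xi,\cdot)$, $d^c=i(\overline\partial-\partial)$. $\overline M=M/\mathbb C^\times$ with coordinates $X^i=z^i/z^0$ $(i=1,\dots,n)$, $X^0:=1$, and $g_{\overline M}=\frac{\partial^2\mathcal K}{\partial X^i\partial\overline X^j}dX^id\overline X^j$. The coordinates and functions $z^i,w_i,x^i,y_i,\tau_{ij},N_{ij},r$ and the structures $g_M,\omega_M,J,\nabla,\xi,\Lambda,\langle\cdot,\cdot\rangle,Z,\widetilde\eta$ on $M$ are restricted to the open subset $M_\infty\subset M$ (and denoted by the same symbols). **BPS structures.** A mutually local variation of BPS structures is $\Omega:\Lambda\to\mathbb Z$, $\mathrm{Supp}(\Omega)=\{\Omega\ne0\}$, with: $\Omega(-\gamma)=\Omega(\gamma)$; $\langle\gamma,\gamma'\rangle=0$ on $\mathrm{Supp}(\Omega)$; the Kontsevich–Soibelman wall-crossing formula (in this case: $\Omega(\gamma)$ locally constant for flat $\gamma$); for compact $K$ and a covariantly constant norm there is $C>0$ with $|Z_\gamma|>C|\gamma|$ for $\gamma\in\Lambda|_K\cap\mathrm{Supp}(\Omega)$; for each $R>0$, $\sum_{\gamma\in\Lambda_p}|\Omega(\gamma)|e^{-R|Z_\gamma|}$ converges normally on compacta. **Hyperkähler structure.** $N:=T^*M_\infty/\Lambda^*$, projection $\pi_M$; $\theta_\gamma([\alpha])=2\pi\alpha(\gamma)$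 mod $2\pi$; pullbacks omitted; $\langle dA\wedge dB\rangle:=dA_{\widetilde\gamma_i}\wedge dB_{\gamma^i}-dA_{\gamma^i}\wedge dB_{\widetilde\gamma_i}$. With $K_0,K_1$ modified Bessel functions of the second kind, $$V_\gamma^{\mathrm{inst}}=\frac1{2\pi}\sum_{n>0}e^{in\theta_\gamma}K_0(2\pi n|Z_\gamma|),\quad A_\gamma^{\mathrm{inst}}=-\frac1{4\pi}\sum_{n>0}e^{in\theta_\gamma}|Z_\gamma|K_1(2\pi n|Z_\gamma|)\Big(\frac{dZ_\gamma}{Z_\gamma}-\frac{d\overline Z_\gamma}{\overline Z_\gamma}\Big),$$ $$\omega_1+i\omega_2=-\frac1{2\pi}\langle dZ\wedge d\theta\rangle+\sum_\gamma\Big(\Omega(\gamma)dZ_\gamma\wedge A_\gamma^{\mathrm{inst}}+\frac{i\Omega(\gamma)}{2\pi}V_\gamma^{\mathrm{inst}}d\theta_\gamma\wedge dZ_\gamma\Big),$$ $$\omega_3=\frac14\langle dZ\wedge d\overline Z\rangle-\frac1{8\pi^2}\langle d\theta\wedge d\theta\rangle+\sum_\gamma\Big(\frac{i\Omega(\gamma)}2V_\gamma^{\mathrm{inst}}dZ_\gamma\wedge d\overline Z_\gamma+\frac{\Omega(\gamma)}{2\pi}d\theta_\gamma\wedge A_\gamma^{\mathrm{inst}}\Big).$$ Compatible means $T=\pi_M^*g_M+\sum_\gamma\Omega(\gamma)V_\gamma^{\mathrm{inst}}|dZ_\gamma|^2$ is non-degenerate on $TN/\ker d\pi_M$; then $\omega_\alpha=g_N(I_\alpha\cdot,\cdot)$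 for a pseudo-hyperkähler structure $(g_N,I_1,I_2,I_3)$, $I_\alpha=-\omega_\beta^{-1}\circ\omega_\gamma$ (cyclic). $V$ is the $\nabla$-horizontal lift of $J\xi$ to $N$ ($d\theta_\gamma(V)=0$), $X:=2V$. **Circle bundle and QK metric.** Identify $T^*M_\infty\cong\Lambda^*\otimes\mathbb R$ by $\alpha\mapsto\theta=2\pi\alpha|_\Lambda$. $P$ is the quotient of $T^*M_\infty\times\mathbb R_\sigma$ by $(2\pi\delta,\pi k)\cdot(\theta,\sigma)=(\theta+2\pi\delta,\sigma+\pi k+\frac12\langle\delta,\theta\rangle)$, $\delta\in\Lambda^*,k\in\mathbb Z$, where $\langle\delta,\theta\rangle=\delta_{\widetilde\gamma_i}\theta_{\gamma^i}-\delta_{\gamma^i}\theta_{\widetilde\gamma_i}$; $\pi_N:P\to N$ is a principal circle bundle with generator $\partial_\sigma$. Put $$\eta_\gamma^{\mathrm{inst}}=\frac i{8\pi^2}\sum_{n>0}\frac{e^{in\theta_\gamma}}n|Z_\gamma|K_1(2\pi n|Z_\gamma|)\Big(\frac{dZ_\gamma}{Z_\gamma}-\frac{d\overline Z_\gamma}{\overline Z_\gamma}\Big),\quad\eta^{\mathrm{inst}}=\sum_\gamma\Omega(\gamma)\eta_\gamma^{\mathrm{inst}}-\iota_V(g_N-\pi_M^*g_M),$$ $\eta=d\sigma-\frac1{4\pi}\langle\theta,d\theta\rangle+2\pi(-\frac12r^2\widetilde\eta+\eta^{\mathrm{inst}})$ (a connection on $P$). For a fixed $c\in\mathbb R$: $f^{\mathrm{inst}}=4\pi\sum_\gamma\Omega(\gamma)\iota_V\eta_\gamma^{\mathrm{inst}}$,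 $f_1^{\mathrm{inst}}=4\pi\iota_V\eta^{\mathrm{inst}}$, $f=2\pi r^2-c+f^{\mathrm{inst}}$, $f_1=-2\pi r^2-c+f_1^{\mathrm{inst}}$, $N'=\{f\ne0,f_1\ne0,g_N(X,X)\ne0\}\subset N$. On $P|_{N'}$: $g_P=\frac2{f_1}\eta^2+2\pi g_N$, $\theta_0^P=-\frac12df$, $\theta_1^P=\eta+\frac12\iota_X(2\pi g_N)$, $\theta_2^P=\frac12\iota_X(2\pi\omega_2)$, $\theta_3^P=-\frac12\iota_X(2\pi\omega_1)$. Then $g_{\overline N}:=-\frac1f\big(g_P-\frac2f\sum_{i=0}^3(\theta_i^P)^2\big)\big|_{\overline N}$; here $\overline N$ is the locus where $z^0\in\mathbb R_{>0}$, which is transversal to $\widetilde X+f_1\partial_\sigma$ ($\widetilde X$ the $\eta$-horizontal lift of $X$). **Coordinates and local objects.** On $\overline N$: $\rho=2\pi r^2-c$, $X^i$ $(1\le i\le n)$, $\widetilde\theta_i=\theta_{\partial_{x^i}}$, $\theta^i=\theta_{\partial_{y_i}}$ $(0\le i\le n)$, $\sigma$. For $\gamma=n_i(\gamma)\partial_{y_i}\in\mathrm{Supp}(\Omega)$, $X_\gamma:=Z_\gamma/z^0=n_i(\gamma)X^i$. On $\overline N$, $|Z_\gamma|=\sqrt{(\rho+c)/2\pi}\,e^{\mathcal K/2}|X_\gamma|$. Further, $W_i=d\theta_{\partial_{x^i}}-\tau_{ij}d\theta_{\partial_{y_j}}$, $W_i^{\mathrm{inst}}=\sum_\gamma\Omega(\gamma)n_i(\gamma)(2\pi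 A_\gamma^{\mathrm{inst}}-iV_\gamma^{\mathrm{inst}}d\theta_\gamma)$, $N_{ij}^{\mathrm{inst}}=\sum_\gamma\Omega(\gamma)V_\gamma^{\mathrm{inst}}n_i(\gamma)n_j(\gamma)$, and $(N+N^{\mathrm{inst}})^{ij}$ is the inverse matrix of $N_{ij}+N_{ij}^{\mathrm{inst}}$. Sums over $\gamma$ run over $\mathrm{Supp}(\Omega)$; products of $1$-forms are symmetric products; repeated indices are summed. *)

(* Defs.v *)
From HB Require Import structures.
From mathcomp Require Import all_boot all_order all_algebra.
From mathcomp Require Import complex.
From mathcomp Require Import all_classical all_reals all_analysis.
Import Order.TTheory GRing.Theory Num.Theory numFieldNormedType.Exports.

Set Implicit Arguments.
Unset Strict Implicit.
Unset Printing Implicit Defensive.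

Local Open Scope classical_set_scope.
Local Open Scope ring_scope.
Local Open Scope complex_scope.

(* All functions, 1-forms and 2-tensors below take values in R[i], including
   those that are real-valued (f, rho, g_N, and so on): a sum over charges such
   as that of Omega(gamma) V_gamma is a sum of complex terms, and is real only
   because gamma and - gamma contribute complex conjugate terms. *)

Section Analysis.
Variable R : realType.
Local Notation C := R[i].

(* The regular module R[i]^o carries the library's norm and topology, so that
   differentiable and 'D_v on 'rV[R[i]^o]_m are the complex notions. *)
Definition Cvec (m : nat) := 'rV[C^o]_m.

Definition cabs (z : C) : R := complex.Re `|z|.

Definition expi (x : R) : C := cos x +i* sin x.

(* Unordered sum of an absolutely summable family. *)
Definition rsum (T : choiceType) (D : set T) (a : T -> R) : R :=
  let b := fun x => (a x)%:E in
  fine (esum D (b^\+)%E - esum D (b^\-)%E)%E.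

Definition csum (T : choiceType) (D : set T) (a : T -> C) : C :=
  rsum D (fun x => complex.Re (a x)) +i* rsum D (fun x => complex.Im (a x)).

Definition cosh (t : R) : R := (expR t + expR (- t)) / 2.

(* K_nu(x) for 0 < x, by its integral representation
   K_nu(x) = \int_0^oo exp(- x cosh t) cosh(nu t) dt. *)
Definition besselK (nu x : R) : R :=
  Rintegral (@lebesgue_measure R) `[0, +oo[
    (fun t : R => expR (- (x * cosh t)) * cosh (nu * t)).

(* Derivative at t = 0 of a curve in the complex numbers. *)
Definition ddt (g : R -> C) : C :=
  derive1 (fun t => complex.Re (g t) : R^o) 0 +i*
  derive1 (fun t => complex.Im (g t) : R^o) 0.

(* Real differential of f at x, and its (1,0) and (0,1) parts. *)
Definition dR (m : nat) (f : Cvec m -> C) (x v : Cvec m) : C :=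
  ddt (fun t => f (x + t%:C *: v)).

Definition del (m : nat) (f : Cvec m -> C) (x v : Cvec m) : C :=
  (dR f x v - 'i * dR f x ('i *: v)) / 2.

Definition delbar (m : nat) (f : Cvec m -> C) (x v : Cvec m) : C :=
  (dR f x v + 'i * dR f x ('i *: v)) / 2.

Definition dc (m : nat) (f : Cvec m -> C) (x v : Cvec m) : C :=
  'i * (delbar f x v - del f x v).

(* Products of 1-forms at a point; T is the tangent space. *)
Definition wedge (T : Type) (a b : T -> C) (u v : T) : C :=
  a u * b v - a v * b u.

Definition sprod (T : Type) (a b : T -> C) (u v : T) : C :=
  (a u * b v + a v * b u) / 2.

Definition sq (T : Type) (a : T -> C) : T -> T -> C := sprod a a.

Definition conjf (T : Type) (a : T -> C) (u : T) : C := (a u)^*.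

Definition abs2 (T : Type) (a : T -> C) : T -> T -> C := sprod a (conjf a).

End Analysis.

Section CASK.
Variables (R : realType) (n : nat).
Local Notation C := R[i].
Local Notation Cn := (Cvec R n.+1).

Section Prepotential.
Variable F : Cn -> C^o.

Definition w (i : 'I_n.+1) (z : Cn) : C := 'D_(delta_mx 0 i) F z.

Definition tau (i j : 'I_n.+1) (z : Cn) : C :=
  'D_(delta_mx 0 i) (fun y => 'D_(delta_mx 0 j) F y) z.

Definition Nmx (z : Cn) : 'M[R]_n.+1 :=
  \matrix_(i, j) complex.Im (tau i j z).

Definition rsq (z : Cn) : C :=
  \sum_i \sum_j (Nmx z i j)%:C * z 0 i * (z 0 j)^*.

End Prepotential.

Definition signature_1n (A : 'M[R]_n.+1) : Prop :=
  exists2 B : 'M[R]_n.+1, B \in unitmx &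
    B *m A *m B^T = diag_mx (\row_i (if i == ord0 then 1 else -1)).

Record CASK_domain (M : set Cn) (F : Cn -> C^o) : Prop := {
  cask_open : open M;
  cask_connected : connected M;
  cask_neq0 : ~ M 0;
  cask_scale : forall (l : C) z, l != 0 -> M z -> M (l *: z);
  cask_holomorphic : forall z, M z -> differentiable F z;
  cask_homogeneous : forall (l : C) z, l != 0 -> M z ->
    F (l *: z) = l ^+ 2 * F z;
  cask_signature : forall z, M z -> signature_1n (Nmx F z);
  cask_positive : forall z, M z -> 0 < rsq F z
}.

(* The lattice Lambda, trivialised by its global flat frame: the pair (a, b)
   stands for a^i d/dx^i + b_i d/dy_i. *)
Definition Lambda : Type := ('rV[int]_n.+1 * 'rV[int]_n.+1)%type.

Definition frame_x (i : 'I_n.+1) : Lambda := (delta_mx 0 i, 0).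
Definition frame_y (i : 'I_n.+1) : Lambda := (0, delta_mx 0 i).

Definition pairing (g g' : Lambda) : int :=
  \sum_i (g.1 0 i * g'.2 0 i - g.2 0 i * g'.1 0 i).

(* Coefficient n_i(gamma) of d/dy_i. *)
Definition ncoef (i : 'I_n.+1) (g : Lambda) : C := (g.2 0 i)%:~R.

Definition Z (F : Cn -> C^o) (g : Lambda) (z : Cn) : C :=
  \sum_i ((g.1 0 i)%:~R * w F i z + (g.2 0 i)%:~R * z 0 i).

Definition supp (Om : Cn -> Lambda -> int) (z : Cn) : set Lambda :=
  [set g | Om z g != 0].

Definition is_norm (nu : 'rV[R]_n.+1 * 'rV[R]_n.+1 -> R) : Prop :=
  [/\ forall x, nu x = 0 -> x = 0,
      forall (a : R) x, nu (a *: x) = `|a| * nu x &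
      forall x y, nu (x + y) <= nu x + nu y].

Definition Lambda_real (g : Lambda) : 'rV[R]_n.+1 * 'rV[R]_n.+1 :=
  (map_mx intr g.1, map_mx intr g.2).

(* Covariantly constant norms on Lambda over a subset of M are norms of the
   components with respect to the flat frame. *)
Record local_BPS_variation (F : Cn -> C^o) (Minf : set Cn)
    (Om : Cn -> Lambda -> int) : Prop := {
  bps_opp : forall z g, Minf z -> Om z (- g.1, - g.2) = Om z g;
  bps_mutually_local : forall z g g', Minf z ->
    supp Om z g -> supp Om z g' -> pairing g g' = 0;
  bps_wall_crossing : forall z g, Minf z ->
    \forall z' \near z, Om z' g = Om z g;
  bps_support : forall (K : set Cn) nu, compact K -> K `<=` Minf ->
    is_norm nu ->
    exists2 k : R, 0 < k &
      forall z g, K z -> supp Om z g -> k * nu (Lambda_real g) < cabs (Z F g z);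
  bps_convergence : forall (K : set Cn) (r : R), compact K -> K `<=` Minf ->
    K !=set0 -> 0 < r ->
    (esum [set: Lambda] (fun g => ereal_sup
       [set (`|Om z g|%:~R * expR (- (r * cabs (Z F g z))))%:E | z in K])
     < +oo)%E
}.

(* Points of T^*M, the universal cover of N in the fibre directions, and its
   tangent vectors, in the global coordinates
   (z^i, theta_{d/dx^i}, theta_{d/dy_i}); all objects on N are expressed by
   their periodic lifts. *)
Definition TN : Type := (Cn * 'rV[R]_n.+1 * 'rV[R]_n.+1)%type.
Definition zN (p : TN) : Cn := p.1.1.
Definition theta_x (p : TN) : 'rV[R]_n.+1 := p.1.2.
Definition theta_y (p : TN) : 'rV[R]_n.+1 := p.2.

Definition line (p u : TN) (t : R) : TN :=
  (zN p + t%:C *: zN u, theta_x p + t *: theta_x u, theta_y p + t *: theta_y u).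

Definition dN (f : TN -> C) (p u : TN) : C := ddt (fun t => f (line p u t)).

Definition theta (g : Lambda) (p : TN) : R :=
  \sum_i ((g.1 0 i)%:~R * theta_x p 0 i + (g.2 0 i)%:~R * theta_y p 0 i).

Definition dtheta (g : Lambda) (p u : TN) : C :=
  dN (fun q => (theta g q)%:C) p u.

Definition dz (i : 'I_n.+1) (u : TN) : C := zN u 0 i.

(* < dA /\ dB > *)
Definition wpair (a b : Lambda -> TN -> C) (u v : TN) : C :=
  \sum_i (wedge (a (frame_x i)) (b (frame_y i)) u v
          - wedge (a (frame_y i)) (b (frame_x i)) u v).

(* < theta, dtheta > *)
Definition theta_dtheta (p u : TN) : C :=
  \sum_i ((theta (frame_x i) p)%:C * dtheta (frame_y i) p u
          - (theta (frame_y i) p)%:C * dtheta (frame_x i) p u).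

(* Points of T^*M x R, which covers the circle bundle P, and its tangent
   vectors; the last coordinate is sigma.  All tensors on P are expressed by
   their lifts, invariant under the lattice action defining P. *)
Definition TP : Type := (TN * R)%type.

Section Instanton.
Variables (F : Cn -> C^o) (Om : Cn -> Lambda -> int).
Local Notation piC := ((pi : R)%:C).

Definition dZ (g : Lambda) (p u : TN) : C := dN (fun q => Z F g (zN q)) p u.

Definition posnat : set nat := [set k | (0 < k)%N].

Definition bps_sum (p : TN) (a : Lambda -> C) : C :=
  csum (supp Om (zN p)) (fun g => (Om (zN p) g)%:~R * a g).

Definition Vinst (g : Lambda) (p : TN) : C :=
  (2 * piC)^-1 * csum posnat (fun k =>
    expi (k%:R * theta g p) *
    (besselK 0 (2 * pi * k%:R * cabs (Z F g (zN p))))%:C).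

(* dZ_gamma / Z_gamma - its conjugate *)
Definition dlogZ (g : Lambda) (p u : TN) : C :=
  dZ g p u / Z F g (zN p) - (dZ g p u)^* / (Z F g (zN p))^*.

Definition Ainst (g : Lambda) (p u : TN) : C :=
  - (4 * piC)^-1 * csum posnat (fun k =>
    expi (k%:R * theta g p) *
    (cabs (Z F g (zN p)) *
     besselK 1 (2 * pi * k%:R * cabs (Z F g (zN p))))%:C * dlogZ g p u).

Definition etag (g : Lambda) (p u : TN) : C :=
  'i / (8 * piC ^+ 2) * csum posnat (fun k =>
    expi (k%:R * theta g p) / k%:R *
    (cabs (Z F g (zN p)) *
     besselK 1 (2 * pi * k%:R * cabs (Z F g (zN p))))%:C * dlogZ g p u).

Definition omega12 (p u v : TN) : C :=
  - (2 * piC)^-1 * wpair (fun g => dZ g p) (fun g => dtheta g p) u v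
  + bps_sum p (fun g =>
      wedge (dZ g p) (Ainst g p) u v
      + 'i / (2 * piC) * Vinst g p * wedge (dtheta g p) (dZ g p) u v).

Definition omega1 (p u v : TN) : C := (complex.Re (omega12 p u v))%:C.
Definition omega2 (p u v : TN) : C := (complex.Im (omega12 p u v))%:C.

Definition omega3 (p u v : TN) : C :=
  4^-1 * wpair (fun g => dZ g p) (fun g => conjf (dZ g p)) u v
  - (8 * piC ^+ 2)^-1 *
    wpair (fun g => dtheta g p) (fun g => dtheta g p) u v
  + bps_sum p (fun g =>
      'i / 2 * Vinst g p * wedge (dZ g p) (conjf (dZ g p)) u v
      + (2 * piC)^-1 * wedge (dtheta g p) (Ainst g p) u v).

Definition gM (p u v : TN) : C :=
  \sum_i \sum_j (Nmx F (zN p) i j)%:C * sprod (dz i) (conjf (dz j)) u v.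

Definition Tform (p u v : TN) : C :=
  gM p u v + bps_sum p (fun g => Vinst g p * abs2 (dZ g p) u v).

(* Non-degeneracy on TN / ker(d pi_M). *)
Definition compatible (Minf : set Cn) : Prop :=
  forall p u, Minf (zN p) -> (forall v, Tform p u v = 0) -> zN u = 0.

(* I_3 = - omega_1^{-1} o omega_2: the vector w with iota_w omega_1 equal to
   - iota_u omega_2. *)
Definition I3 (p u : TN) : TN :=
  xget (0 : TN) [set w | forall v, omega1 p w v = - omega2 p u v].

(* omega_3 = g_N(I_3 ., .) and I_3^2 = -1 give g_N = - omega_3(I_3 ., .). *)
Definition gN (p u v : TN) : C := - omega3 p (I3 p u) v.

Definition Vvec (p : TN) : TN := ('i *: zN p, 0, 0).

Definition Xvec (p : TN) : TN := Vvec p *+ 2.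

(* J xi is z |-> 'i z, lifted to N as Vvec. *)
Definition etatilde (p u : TN) : C := (rsq F (zN p))^-1 * gM p (Vvec p) u.

Definition etagsum (p u : TN) : C := bps_sum p (fun g => etag g p u).

Definition etainst (p u : TN) : C :=
  etagsum p u - (gN p (Vvec p) u - gM p (Vvec p) u).

Definition eta (q u : TP) : C :=
  u.2%:C - (4 * piC)^-1 * theta_dtheta q.1 u.1
  + 2 * piC * (- 2^-1 * rsq F (zN q.1) * etatilde q.1 u.1 + etainst q.1 u.1).

Definition finst (p : TN) : C :=
  4 * piC * bps_sum p (fun g => etag g p (Vvec p)).

Definition f1inst (p : TN) : C := 4 * piC * etainst p (Vvec p).

Definition fplus (p : TN) : C := (finst p + f1inst p) / 2.
Definition fminus (p : TN) : C := (finst p - f1inst p) / 2.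

Definition etaplus (p u : TN) : C :=
  2^-1 * ((2 * piC * etainst p u - f1inst p / 2 * etatilde p u)
          + (2 * piC * etagsum p u - finst p / 2 * etatilde p u)).
Definition etaminus (p u : TN) : C :=
  2^-1 * ((2 * piC * etainst p u - f1inst p / 2 * etatilde p u)
          - (2 * piC * etagsum p u - finst p / 2 * etatilde p u)).

Section Metric.
Variable c : R.

Definition fN (p : TN) : C := 2 * piC * rsq F (zN p) - c%:C + finst p.
Definition f1N (p : TN) : C := - (2 * piC * rsq F (zN p)) - c%:C + f1inst p.

Definition Nprime (Minf : set Cn) : set TN :=
  [set p | [/\ Minf (zN p), fN p != 0, f1N p != 0 &
               gN p (Xvec p) (Xvec p) != 0]].

Definition gP (q : TP) (u v : TP) : C :=
  2 / f1N q.1 * sq (eta q) u v + 2 * piC * gN q.1 u.1 v.1.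

Definition thetaP0 (q u : TP) : C := - 2^-1 * dN fN q.1 u.1.
Definition thetaP1 (q u : TP) : C :=
  eta q u + 2^-1 * (2 * piC * gN q.1 (Xvec q.1) u.1).
Definition thetaP2 (q u : TP) : C :=
  2^-1 * (2 * piC * omega2 q.1 (Xvec q.1) u.1).
Definition thetaP3 (q u : TP) : C :=
  - 2^-1 * (2 * piC * omega1 q.1 (Xvec q.1) u.1).

Definition gNbar (q u v : TP) : C :=
  - (fN q.1)^-1 *
    (gP q u v - 2 / fN q.1 *
       (sq (thetaP0 q) u v + sq (thetaP1 q) u v
        + sq (thetaP2 q) u v + sq (thetaP3 q) u v)).

(* In R[i], 0 < x means that x is real and positive. *)
Definition Nbar (Minf : set Cn) : set TP :=
  [set q | Nprime Minf q.1 /\ 0 < zN q.1 0 ord0].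

Definition tangent_Nbar (u : TP) : Prop := complex.Im (zN u.1 0 ord0) = 0.

Definition rho (p : TN) : C := 2 * piC * rsq F (zN p) - c%:C.

(* (X^1, ..., X^n), and (X^0 = 1, X^1, ..., X^n). *)
Definition Xcoord (z : Cn) : Cvec R n :=
  \row_(i < n) (z 0 (lift ord0 i) / z 0 ord0).
Definition Xhom (X : Cvec R n) : Cn := row_mx (const_mx 1 : Cvec R 1) X.

(* K as a function of (X^1, ..., X^n) on the quotient of M by C^*. *)
Definition Kpot (X : Cvec R n) : R := - ln (complex.Re (rsq F (Xhom X))).
Definition KpotC (X : Cvec R n) : C := (Kpot X)%:C.

Definition dX (i : 'I_n) (p u : TN) : C :=
  dN (fun q => Xcoord (zN q) 0 i) p u.
Definition dXrow (p u : TN) : Cvec R n := \row_i dX i p u.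

(* Pullbacks to N of e^K, dK, d^c K and the metric of the quotient. *)
Definition expK (p : TN) : C := (expR (Kpot (Xcoord (zN p))))%:C.
Definition dK (p u : TN) : C := dR KpotC (Xcoord (zN p)) (dXrow p u).
Definition dcK (p u : TN) : C := dc KpotC (Xcoord (zN p)) (dXrow p u).

Definition gMbar (p u v : TN) : C :=
  \sum_i \sum_j
    del (fun Y => delbar KpotC Y (delta_mx 0 j)) (Xcoord (zN p)) (delta_mx 0 i)
    * sprod (dX i p) (conjf (dX j p)) u v.

Definition Xg (g : Lambda) (p : TN) : C := Z F g (zN p) / zN p 0 ord0.
Definition dXg (g : Lambda) (p u : TN) : C := dN (Xg g) p u.

Definition W (i : 'I_n.+1) (p u : TN) : C :=
  dtheta (frame_x i) p u
  - \sum_j tau F i j (zN p) * dtheta (frame_y j) p u.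

Definition Winst (i : 'I_n.+1) (p u : TN) : C :=
  bps_sum p (fun g => ncoef i g *
    (2 * piC * Ainst g p u - 'i * Vinst g p * dtheta g p u)).

Definition Wtot (i : 'I_n.+1) (p u : TN) : C := W i p u + Winst i p u.

Definition Ntot (p : TN) : 'M[C]_n.+1 :=
  \matrix_(i, j) ((Nmx F (zN p) i j)%:C
    + bps_sum p (fun g => Vinst g p * ncoef i g * ncoef j g)).

(* dX_gamma + X_gamma (d rho / (2 (rho + c)) + dK / 2) *)
Definition DXg (g : Lambda) (p u : TN) : C :=
  dXg g p u + Xg g p * (dN rho p u / (2 * (rho p + c%:C)) + dK p u / 2).

(* The six lines of the coordinate expression of the metric. *)
Definition line1 (p u v : TN) : C :=
  (rho p + c%:C) / (rho p + finst p) *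
  (gMbar p u v
   - expK p * bps_sum p (fun g => Vinst g p * abs2 (DXg g p) u v)).

Definition line2 (p u v : TN) : C :=
  (2 * (rho p + finst p) ^+ 2)^-1 *
  ((rho p + 2 * c%:C - finst p) / (2 * (rho p + c%:C)) * sq (dN rho p) u v
   + 2 * sprod (dN rho p) (dN finst p) u v
   + sq (dN finst p) u v).

Definition line3 (q u v : TP) : C :=
  let p := q.1 in
  4 * (rho p + c%:C + fminus p) /
    ((rho p + finst p) ^+ 2 * (rho p + 2 * c%:C - f1inst p)) *
  sq (fun x : TP =>
        x.2%:C - (4 * piC)^-1 * theta_dtheta p x.1 - c%:C / 4 * dcK p x.1
        + etaplus p x.1
        + (fplus p - c%:C) / (rho p + c%:C + fminus p) * etaminus p x.1) u v.

Definition line4 (p u v : TN) : C :=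
  - (2 * piC * (rho p + finst p))^-1 *
  \sum_i \sum_j
    invmx (Ntot p) i j * sprod (Wtot i p) (conjf (Wtot j p)) u v.

Definition line5 (p u v : TN) : C :=
  (rho p + c%:C) * expK p / (piC * (rho p + finst p) ^+ 2) *
  abs2 (fun x => \sum_i Xhom (Xcoord (zN p)) 0 i * Wtot i p x
                 + 2 * piC * 'i *
                   bps_sum p (fun g => Ainst g p (Vvec p) * DXg g p x)) u v.

Definition line6 (p u v : TN) : C :=
  (rho p + c%:C + fminus p) / (rho p + finst p) *
    sq (fun x => dcK p x / 2
                 + 2 / (rho p + c%:C + fminus p) * etaminus p x) u v
  - (rho p + c%:C) / (rho p + finst p) * sq (fun x => dcK p x / 2) u v.

Definition gNbar_coord (q u v : TP) : C :=
  line1 q.1 u.1 v.1 + line2 q.1 u.1 v.1 + line3 q u v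
  + line4 q.1 u.1 v.1 + line5 q.1 u.1 v.1 + line6 q.1 u.1 v.1.

(* In the coordinates (rho, X^i, theta_{d/dx^i}, theta_{d/dy_i}, sigma) of
   Nbar, the line spanned by d/drho is the common kernel of the differentials
   of the other coordinates; a 1-form has no drho component when it vanishes
   on this line. *)
Definition no_drho_component (a : TN -> TN -> C) (q : TP) : Prop :=
  forall u : TP, tangent_Nbar u ->
    (forall i, dX i q.1 u.1 = 0) -> theta_x u.1 = 0 -> theta_y u.1 = 0 ->
    u.2 = 0 -> a q.1 u.1 = 0.

End Metric.
End Instanton.
End CASK.

(* Main.v *)
Require Import Defs.
From HB Require Import structures.
From mathcomp Require Import all_boot all_order all_algebra.
From mathcomp Require Import complex ring lra.
From mathcomp Require Import all_classical all_reals all_analysis.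
From mathcomp Require Import measurable_realfun.
Import Order.TTheory GRing.Theory Num.Theory numFieldNormedType.Exports.

(** The idea is to find a coframe in which every tensor of the statement is
    algebraic. Put H = N + N^inst and Y_i = W_i + W_i^inst. As the charges in the
    support lie in the span of the d/dy_i, every dZ_gamma is a combination of the
    dz^i, and the definition of omega_1 + i omega_2 regroups to
      omega_1 + i omega_2 = (2 pi)^-1 sum_i dz^i /\ Y_i   (omega12E).
    Since gamma and - gamma contribute conjugate terms, H is a real symmetric
    matrix; compatibility makes it invertible, so that the dz^i and Y_i form a
    coframe of type (1,0) for I_3 (H_unit, frame_onto, I3_frame). In this
    coframe omega_3 and the metric are block diagonal,
      g_N = H dz dzbar + (4 pi^2)^-1 H^-1 Y Ybar   (omega3E, gNE).

    The other ingredients of the quaternionic metric involve g_N only through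
    g_N(V, .) and G = g_N(V, V): one has f_1 = f - 4 pi G (f1NE),
    eta = theta_1 - 2 pi g_N(V, .) where theta_1 is free of g_N (etaE, thetaP1E),
    and theta_2^2 + theta_3^2 is the square of the contraction of
    omega_1 + i omega_2 with X (theta23). Along the slice z^0 > 0, where
    the argument of z^0 is constant, the contact form of M is - d^c K / 2, the
    form dX_gamma + X_gamma (d rho / (2 (rho + c)) + dK / 2) is dZ_gamma / z^0,
    and g_M / r^2 is the sum of - g_Mbar, the square of d rho / (2 (rho + c)) and
    that of the contact form (etatildeE, DXgE, gMbarE).

    The asserted identity then splits into three rational ones
    (metric_identity). The square of df = d rho + df^inst gives line 2 and the
    radial term of g_M (radial_part). The squares of eta and theta_1 are, after
    completing the square in theta_1, lines 3 and 6 and the contact term of g_M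
    (contact_part). The remaining terms of g_N and theta_2^2 + theta_3^2 are
    what is left of line 1, line 4 and line 5 (rest_part).

    The coordinate field of rho is a real multiple of z, which does not change
    the phases of the Z_gamma; as A_gamma and eta_gamma are multiples of the
    differentials of these phases, they vanish on it, and so do W_i^inst and
    eta_+-^inst.

    Three analytic facts support the algebra. The Hessian of K requires
    tau to be differentiable, while the prepotential is only assumed to have
    one complex derivative; this is obtained from Goursat's theorem, by way of
    Cauchy's formula (hol_D). Linear operations on the sums over charges require
    absolute convergence, which follows from the exponential decay of K_0 and
    K_1 together with the support and convergence properties (bps_dom_summable).
    And df = d rho + df^inst requires the double series f^inst to be
    differentiable along lines (finst_rder), hence Lipschitz bounds for its
    terms that are summable over the charges. *)

Set Implicit Arguments.
Unset Strict Implicit.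
Unset Printing Implicit Defensive.

Local Open Scope classical_set_scope.
Local Open Scope ring_scope.
Local Open Scope complex_scope.

(** * Complex modulus and Frechet derivatives *)

Section ComplexModulus.
Variable R : realType.
Local Notation C := R[i].
Implicit Types (z a b : C) (x y : R).

Lemma cabsE z : `|z| = (cabs z)%:C.
Proof. by rewrite /cabs normc_def. Qed.

Lemma cabs_def z : cabs z = Num.sqrt (complex.Re z ^+ 2 + complex.Im z ^+ 2).
Proof. by rewrite /cabs normc_def. Qed.

Lemma cabs_ge0 z : 0 <= cabs z.
Proof. by rewrite cabs_def sqrtr_ge0. Qed.

Lemma cabsM a b : cabs (a * b) = cabs a * cabs b.
Proof. by apply: complexI; rewrite rmorphM /= -!cabsE normrM. Qed.

Lemma cabsD a b : cabs (a + b) <= cabs a + cabs b.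
Proof. by rewrite -lecR rmorphD /= -!cabsE ler_normD. Qed.

Lemma cabsN a : cabs (- a) = cabs a.
Proof. by apply: complexI; rewrite -!cabsE normrN. Qed.

Lemma cabsBC a b : cabs (a - b) = cabs (b - a).
Proof. by rewrite -cabsN opprB. Qed.

Lemma cabsB a b : cabs (a - b) <= cabs a + cabs b.
Proof. by rewrite (le_trans (cabsD _ _))// cabsN. Qed.

Lemma cabsV a : cabs a^-1 = (cabs a)^-1.
Proof. by apply: complexI; rewrite fmorphV /= -!cabsE normfV. Qed.

Lemma cabs_real x : cabs x%:C = `|x|.
Proof. by rewrite cabs_def /= expr0n /= addr0 sqrtr_sqr. Qed.

Lemma cabs0 : cabs (0 : C) = 0.
Proof. by rewrite (_ : 0 = 0%:C) // cabs_real normr0. Qed.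

Lemma cabs1 : cabs (1 : C) = 1.
Proof. by rewrite (_ : 1 = 1%:C) // cabs_real normr1. Qed.

Lemma cabsi : cabs ('i : C) = 1.
Proof. by rewrite cabs_def /= expr0n /= expr1n add0r sqrtr1. Qed.

Lemma cabsJ a : cabs a^* = cabs a.
Proof. by apply: complexI; rewrite -!cabsE normcJ. Qed.

Lemma cabs_eq0 a : (cabs a == 0) = (a == 0).
Proof.
rewrite -(inj_eq (@complexI R)) /= -cabsE.
by rewrite (_ : 0%:C = 0 :> C) // normr_eq0.
Qed.

Lemma cabs_gt0 a : (0 < cabs a) = (a != 0).
Proof. by rewrite lt_neqAle cabs_ge0 andbT eq_sym cabs_eq0. Qed.

Lemma Re_le_cabs a : `|complex.Re a| <= cabs a.
Proof. by rewrite cabs_def -sqrtr_sqr ler_wsqrtr // lerDl sqr_ge0. Qed.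

Lemma Im_le_cabs a : `|complex.Im a| <= cabs a.
Proof. by rewrite cabs_def -sqrtr_sqr ler_wsqrtr // lerDr sqr_ge0. Qed.

Lemma complex_split a : a = (complex.Re a)%:C + 'i * (complex.Im a)%:C.
Proof. exact: complexE. Qed.

Lemma cabs_le_ReIm a : cabs a <= `|complex.Re a| + `|complex.Im a|.
Proof.
rewrite {1}(complex_split a) (le_trans (cabsD _ _)) //.
by rewrite cabsM cabsi mul1r !cabs_real.
Qed.

Lemma cabsB_le a b : `|cabs a - cabs b| <= cabs (a - b).
Proof.
rewrite ler_norml; apply/andP; split.
  have := cabsD (b - a) a; rewrite subrK cabsBC; lra.
have := cabsD (a - b) b; rewrite subrK; lra.
Qed.

Lemma cabs_sum (I : Type) (r : seq I) (P : pred I) (f : I -> C) :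
  cabs (\sum_(i <- r | P i) f i) <= \sum_(i <- r | P i) cabs (f i).
Proof.
elim/big_ind2: _ => [|x1 x2 y1 y2 h1 h2|//]; first by rewrite cabs0.
by rewrite (le_trans (cabsD _ _)) // lerD.
Qed.

Lemma cabsX a k : cabs (a ^+ k) = cabs a ^+ k.
Proof. by elim: k => [|k ih]; rewrite ?expr0 ?cabs1// !exprS cabsM ih. Qed.

Lemma cabs_nat k : cabs (k%:R : C) = k%:R.
Proof. by rewrite -(rmorph_nat (real_complex R)) cabs_real normr_nat. Qed.

End ComplexModulus.

Section Frechet.
Variable R : realType.
Local Notation C := R[i].

(** One definition, with a linear map L and an arbitrary gauge nu, serves for
    functions of a complex variable and for curves of a real variable, so that
    the differentiation rules are proved once for both. *)
Definition frechet (V : zmodType) (nu : V -> R) (f : V -> C) (x : V)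
    (L : V -> C) :=
  forall e : R, 0 < e -> exists2 d : R, 0 < d &
    forall h, nu h < d -> cabs (f (x + h) - f x - L h) <= e * nu h.

Section Rules.
Variables (V : zmodType) (nu : V -> R).
Hypothesis nu_ge0 : forall h, 0 <= nu h.
Implicit Types (f g : V -> C) (x : V) (L : V -> C).

Lemma eq_frechet f x L L' : frechet nu f x L -> L =1 L' -> frechet nu f x L'.
Proof. by move=> H e; apply: eq_ind H _ _ => //; apply/funext. Qed.

Lemma frechet_near f g x L r : 0 < r ->
  (forall h, nu h < r -> f (x + h) = g (x + h)) -> f x = g x ->
  frechet nu f x L -> frechet nu g x L.
Proof.
move=> r0 fg fgx H e e0; have [d d0 Hd] := H e e0.
exists (Num.min d r); first by rewrite lt_min d0.
by move=> h; rewrite lt_min => /andP[hd hr]; rewrite -fg // -fgx Hd.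
Qed.

Lemma frechet_cst (a : C) x : frechet nu (fun=> a) x (fun=> 0).
Proof.
move=> e e0; exists 1 => // h _; rewrite !subrr cabs0.
by rewrite mulr_ge0 // ltW.
Qed.

Lemma frechetD f g x L L' : frechet nu f x L -> frechet nu g x L' ->
  frechet nu (fun y => f y + g y) x (fun h => L h + L' h).
Proof.
move=> Hf Hg e e0; have e20 : 0 < e / 2 by rewrite divr_gt0.
have [d d0 Hd] := Hf _ e20; have [d' d'0 Hd'] := Hg _ e20.
exists (Num.min d d'); first by rewrite lt_min d0.
move=> h; rewrite lt_min => /andP[/Hd h1 /Hd' h2].
rewrite (_ : _ - _ - _ = (f (x + h) - f x - L h) + (g (x + h) - g x - L' h));
  last by ring.
by rewrite (le_trans (cabsD _ _))//; lra.
Qed.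

Lemma frechetZ f x L (a : C) : frechet nu f x L ->
  frechet nu (fun y => a * f y) x (fun h => a * L h).
Proof.
move=> Hf e e0; have k0 : 0 < cabs a + 1 by have := cabs_ge0 a; lra.
have e20 : 0 < e / (cabs a + 1) by rewrite divr_gt0.
have [d d0 Hd] := Hf _ e20; exists d => // h /Hd H.
rewrite (_ : _ - _ - _ = a * (f (x + h) - f x - L h)); last by ring.
rewrite cabsM (le_trans (ler_wpM2l (cabs_ge0 _) H))//.
rewrite mulrA ler_wpM2r// mulrCA ler_piMr ?ltW//.
by rewrite ltr_pdivrMr// mul1r; lra.
Qed.

Lemma frechetN f x L : frechet nu f x L ->
  frechet nu (fun y => - f y) x (fun h => - L h).
Proof.
move=> /(frechetZ (-1)) H.
rewrite (_ : (fun _ => _) = (fun y => -1 * f y)); last first.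
  by apply/funext => y; rewrite mulN1r.
by apply: (eq_frechet H) => h; rewrite mulN1r.
Qed.

Lemma frechetB f g x L L' : frechet nu f x L -> frechet nu g x L' ->
  frechet nu (fun y => f y - g y) x (fun h => L h - L' h).
Proof. by move=> Hf Hg; apply: frechetD => //; apply: frechetN. Qed.

Lemma frechet_sum (I : Type) (r : seq I) (P : pred I) (f : I -> V -> C) x
    (L : I -> V -> C) :
  (forall i, P i -> frechet nu (f i) x (L i)) ->
  frechet nu (fun y => \sum_(i <- r | P i) f i y) x
    (fun h => \sum_(i <- r | P i) L i h).
Proof.
move=> H; elim: r => [|i r ih].
  apply: (eq_frechet (L := fun=> 0)); last by move=> h; rewrite big_nil.
  rewrite (_ : (fun _ => _) = (fun=> 0)); first exact: frechet_cst.
  by apply/funext => y; rewrite big_nil.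
have [Pi|nPi] := boolP (P i).
  rewrite (_ : (fun _ => _) =
      (fun y => f i y + \sum_(j <- r | P j) f j y)); last first.
    by apply/funext => y; rewrite big_cons Pi.
  apply: (eq_frechet (frechetD (H i Pi) ih)) => h.
  by rewrite big_cons Pi.
rewrite (_ : (fun _ => _) = (fun y => \sum_(j <- r | P j) f j y)).
  by apply: (eq_frechet ih) => h; rewrite big_cons (negbTE nPi).
by apply/funext => y; rewrite big_cons (negbTE nPi).
Qed.

Lemma frechet_conj f x L : frechet nu f x L ->
  frechet nu (fun y => (f y)^*) x (fun h => (L h)^*).
Proof.
move=> Hf e e0; have [d d0 Hd] := Hf _ e0; exists d => // h /Hd H.
by rewrite -!rmorphB /= cabsJ.
Qed.

Definition frechet_bounded L := exists2 B, 0 < B & forall h, cabs (L h) <= B * nu h.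

Lemma frechet_lip f x L : frechet nu f x L -> frechet_bounded L ->
  exists2 B, 0 < B & exists2 d, 0 < d &
    forall h, nu h < d -> cabs (f (x + h) - f x) <= B * nu h.
Proof.
move=> Hf [B B0 HB]; have [d d0 Hd] := Hf 1 ltr01.
exists (B + 1); first lra; exists d => // h /Hd; have := HB h.
have := cabsD (f (x + h) - f x - L h) (L h); rewrite -/(_ + _) subrK; lra.
Qed.

Lemma frechetM f g x L L' : frechet nu f x L -> frechet nu g x L' ->
  frechet_bounded L -> frechet_bounded L' ->
  frechet nu (fun y => f y * g y) x (fun h => f x * L' h + L h * g x).
Proof.
move=> Hf Hg bL bL'.
have [A A0 [d1 d10 H1]] : exists2 B, 0 < B & exists2 d, 0 < d &
    forall h, nu h < d -> cabs (f (x + h) - f x) <= B * nu h.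
  by apply: frechet_lip bL.
have [B B0 [d2 d20 H2]] := frechet_lip Hg bL'.
have Z1 := frechetZ (f x) Hg; have Z2 := frechetZ (g x) Hf.
move=> e e0; have e20 : 0 < e / 2 by lra.
have [d3 d30 H3] := frechetD Z1 Z2 e20.
exists (Num.min (Num.min d1 d2) (Num.min d3 (e / 2 / (A * B)))).
  by rewrite !lt_min d10 d20 d30 divr_gt0// mulr_gt0.
move=> h; rewrite !lt_min => /andP[/andP[/H1 h1 /H2 h2]] /andP[/H3 h3 h4].
set u := (X in cabs X <= e / 2 * _) in h3.
have -> : f (x + h) * g (x + h) - f x * g x - (f x * L' h + L h * g x) =
  u + (f (x + h) - f x) * (g (x + h) - g x) by rewrite /u; ring.
rewrite (le_trans (cabsD _ _))//.
have : cabs ((f (x + h) - f x) * (g (x + h) - g x)) <= e / 2 * nu h.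
  rewrite cabsM (le_trans (ler_pM _ _ h1 h2)) ?cabs_ge0//.
  rewrite mulrA ler_wpM2r// mulrAC mulrC mulrC.
  by rewrite -ler_pdivlMl ?mulr_gt0// mulrC ltW.
lra.
Qed.

Lemma frechetV f x L : frechet nu f x L -> frechet_bounded L -> f x != 0 ->
  frechet nu (fun y => (f y)^-1) x (fun h => - L h / f x ^+ 2).
Proof.
move=> Hf bL fx0.
have [A A0 [d1 d10 H1]] : exists2 B, 0 < B & exists2 d, 0 < d &
    forall h, nu h < d -> cabs (f (x + h) - f x) <= B * nu h.
  by apply: frechet_lip bL.
set m := cabs (f x); have m0 : 0 < m by rewrite cabs_gt0.
move=> e e0.
have k0 : 0 < e * m ^+ 2 / 2 by rewrite divr_gt0// mulr_gt0// exprn_gt0.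
have [d2 d20 H2] := Hf _ k0.
exists (Num.min (Num.min d1 d2) (Num.min (m / 2 / A) (e * m ^+ 3 / 4 / A ^+ 2))).
  rewrite !lt_min d10 d20 !divr_gt0 ?exprn_gt0// mulr_gt0// exprn_gt0//.
move=> h; rewrite !lt_min => /andP[/andP[/H1 h1 /H2 h2]] /andP[h3 h4].
set b := f (x + h) in h1 h2 *.
have bm : m / 2 <= cabs b.
  rewrite ltr_pdivlMr// in h3.
  have := cabsD (f x - b) b; rewrite subrK cabsBC -/m; move: h3 h1; lra.
have b0 : b != 0 by rewrite -cabs_gt0; lra.
have -> : b^-1 - (f x)^-1 - - L h / f x ^+ 2 =
  - (b - f x - L h) / f x ^+ 2 + (b - f x) ^+ 2 / (b * f x ^+ 2).
  by field; apply/andP.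
rewrite (le_trans (cabsD _ _))//.
have m20 : 0 < m ^+ 2 by rewrite exprn_gt0.
rewrite [cabs (- _ / _)]cabsM [cabs (_ / (_ * _))]cabsM !cabsV cabsN.
rewrite [cabs (_ * _ ^+ 2)]cabsM !cabsX -/m.
have i1 : cabs (b - f x - L h) * (m ^+ 2)^-1 <= e / 2 * nu h.
  rewrite ler_pdivrMr//; apply: (le_trans h2); lra.
suff i2 : cabs (b - f x) ^+ 2 * (cabs b * m ^+ 2)^-1 <= e / 2 * nu h by lra.
rewrite ler_pdivrMr; last by rewrite mulr_gt0// (lt_le_trans _ bm)//; lra.
have i3 : cabs (b - f x) ^+ 2 <= (A * nu h) ^+ 2.
  by rewrite lerXn2r// nnegrE ?cabs_ge0// mulr_ge0// ltW.
apply: (le_trans i3).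
apply: (@le_trans _ _ (e / 2 * nu h * (m / 2 * m ^+ 2))).
  rewrite ltr_pdivlMr ?exprn_gt0// in h4.
  have := ler_wpM2r (nu_ge0 h) (ltW h4); rewrite !expr2 !exprS; lra.
rewrite ler_wpM2l//; first by rewrite mulr_ge0//; lra.
by rewrite ler_wpM2r// ltW.
Qed.

End Rules.

Lemma frechet_comp (V : zmodType) (nu : V -> R) (f : V -> C) (x : V) L
    (g : C -> C) (d : C) :
  (forall h, 0 <= nu h) ->
  frechet nu f x L -> frechet_bounded nu L ->
  frechet (@cabs R) g (f x) (fun h => d * h) ->
  frechet nu (fun y => g (f y)) x (fun h => d * L h).
Proof.
move=> nu0 Hf bL Hg.
have [A A0 [d1 d10 H1]] : exists2 B, 0 < B & exists2 d, 0 < d &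
    forall h, nu h < d -> cabs (f (x + h) - f x) <= B * nu h.
  by apply: frechet_lip bL.
have Hd := frechetZ nu0 d Hf.
move=> e e0.
have k0 : 0 < e / 2 / A by rewrite !divr_gt0.
have [d2 d20 H2] := Hg _ k0.
have e20 : 0 < e / 2 by lra.
have [d3 d30 H3] := Hd _ e20.
exists (Num.min (Num.min d1 d3) (d2 / A)).
  by rewrite !lt_min d10 d30 divr_gt0.
move=> h; rewrite !lt_min => /andP[/andP[/H1 h1 /H3 h3]] h4.
have h5 : cabs (f (x + h) - f x) < d2.
  by rewrite (le_lt_trans h1)// mulrC -ltr_pdivlMr.
have := H2 _ h5; rewrite (addrC (f x)) subrK => h6.
set w1 := (X in cabs X <= _) in h3; set w2 := (X in cabs X <= _) in h6.
have -> : g (f (x + h)) - g (f x) - d * L h = w1 + w2 by rewrite /w1 /w2; ring.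
rewrite (le_trans (cabsD _ _))//.
have : e / 2 / A * cabs (f (x + h) - f x) <= e / 2 * nu h.
  rewrite -mulrA ler_wpM2l//; first lra.
  by rewrite mulrC ler_pdivrMr// mulrC.
lra.
Qed.

End Frechet.

Section ComplexAndRealDerivatives.
Variable R : realType.
Local Notation C := R[i].

Definition cder (f : C -> C) (s d : C) := frechet (@cabs R) f s (fun h => d * h).
Definition rder (f : R -> C) (t : R) (d : C) :=
  frechet (fun h : R => `|h|) f t (fun h => d * h%:C).

Lemma cder_bounded (d : C) : frechet_bounded (@cabs R) (fun h => d * h).
Proof.
exists (cabs d + 1); first by have := cabs_ge0 d; lra.
by move=> h; rewrite cabsM ler_wpM2r ?cabs_ge0//; lra.
Qed.

Lemma rder_bounded (d : C) :
  frechet_bounded (fun h : R => `|h|) (fun h => d * h%:C).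
Proof.
exists (cabs d + 1); first by have := cabs_ge0 d; lra.
by move=> h; rewrite cabsM cabs_real ler_wpM2r//; lra.
Qed.

Lemma real_derP (f : R -> R^o) (t d : R) :
  is_derive (t : R^o) (1 : R^o) f d <->
  (forall e, 0 < e -> exists2 r, 0 < r &
    forall h, `|h| < r -> `|f (t + h) - f t - d * h| <= e * `|h|).
Proof.
split.
  case=> df dE e e0.
  have := df; rewrite /derivable => /cvg_ex[l Hl].
  have ld : l = d by rewrite -dE; apply/esym; exact/cvg_lim.
  move: Hl; rewrite ld => /cvgrPdist_le /(_ e e0).
  rewrite /at_right near_withinE => -[r /= r0 Hr].
  exists r => // h hr.
  have [->|h0] := eqVneq h 0.
    by rewrite addr0 mulr0 !subrr normr0 mulr0.
  have /= := Hr h; rewrite sub0r normrN => /(_ hr h0).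
  rewrite /GRing.scale /= mulr1 => H.
  have -> : f (t + h) - f t - d * h = - (d - h^-1 * (f (h + t) - f t)) * h.
    by rewrite (addrC t); field.
  by rewrite normrM normrN ler_wpM2r.
move=> H.
have Hc : (fun h => h^-1 *: ((f \o shift t) (h *: (1 : R^o)) - f t)) @ 0^'
    --> (d : R^o).
  apply/cvgrPdist_le => e e0; have [r r0 Hr] := H e e0.
  rewrite near_withinE; exists r => // h; rewrite /ball_ /= sub0r normrN => hr h0.
  rewrite /GRing.scale /= mulr1.
  have := Hr h hr.
  have -> : f (t + h) - f t - d * h = - (d - h^-1 * (f (h + t) - f t)) * h.
    by rewrite (addrC t); field.
  by rewrite normrM normrN ler_pM2r// normr_gt0.
split; first by apply/cvg_ex; exists d.
exact/cvg_lim.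
Qed.

(** The real and imaginary parts of a curve, differentiated separately, are what
    differentials on N are defined by. *)
Lemma rderP (f : R -> C) (t : R) (d : C) : rder f t d <->
  is_derive (t : R^o) (1 : R^o) (fun x => complex.Re (f x) : R^o) (complex.Re d) /\
  is_derive (t : R^o) (1 : R^o) (fun x => complex.Im (f x) : R^o) (complex.Im d).
Proof.
have E h : f (t + h) - f t - d * h%:C =
   (complex.Re (f (t + h)) - complex.Re (f t) - complex.Re d * h) +i*
   (complex.Im (f (t + h)) - complex.Im (f t) - complex.Im d * h).
  case: (f (t + h)) => a b; case: (f t) => a' b'; case: d => u v.
  by rewrite /=; simpc.
split=> [H|[/real_derP H1 /real_derP H2]].
  split; apply/real_derP => e e0; have [r r0 Hr] := H e e0; exists r => // h /Hr;
  rewrite E; apply: le_trans.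
    by rewrite (le_trans _ (Re_le_cabs _))//.
  by rewrite (le_trans _ (Im_le_cabs _))//.
move=> e e0; have e20 : 0 < e / 2 by lra.
have [r r0 Hr] := H1 _ e20; have [r' r'0 Hr'] := H2 _ e20.
exists (Num.min r r'); first by rewrite lt_min r0.
move=> h; rewrite lt_min => /andP[/Hr h1 /Hr' h2].
by rewrite E (le_trans (cabs_le_ReIm _))//=; lra.
Qed.

Lemma rder_ddt (f : R -> C) (d : C) : rder f 0 d -> ddt f = d.
Proof.
move=> /rderP[[_ H1] [_ H2]]; rewrite /ddt !derive1E H1 H2.
by case: d {H1 H2}.
Qed.

Lemma rder_cst (a : C) t : rder (fun=> a) t 0.
Proof.
by apply: (eq_frechet (frechet_cst _ a t)) => // h; rewrite mul0r.
Qed.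

Lemma rder_eq (f : R -> C) t d d' : rder f t d -> d = d' -> rder f t d'.
Proof. by move=> H <-. Qed.

Lemma rderD f g t d d' : rder f t d -> rder g t d' ->
  rder (fun x => f x + g x) t (d + d').
Proof.
by move=> H H'; apply: (eq_frechet (frechetD H H')) => // h; rewrite mulrDl.
Qed.

Lemma rderN f t d : rder f t d -> rder (fun x => - f x) t (- d).
Proof. by move=> H; apply: (eq_frechet (frechetN _ H)) => // h; rewrite mulNr. Qed.

Lemma rderB f g t d d' : rder f t d -> rder g t d' ->
  rder (fun x => f x - g x) t (d - d').
Proof. by move=> H H'; apply: rderD => //; exact: rderN. Qed.

Lemma rderZ f t d a : rder f t d -> rder (fun x => a * f x) t (a * d).
Proof. by move=> H; apply: (eq_frechet (frechetZ _ a H)) => // h; rewrite mulrA. Qed.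

Lemma rderM f g t d d' : rder f t d -> rder g t d' ->
  rder (fun x => f x * g x) t (f t * d' + d * g t).
Proof.
move=> H H'.
apply: (eq_frechet (frechetM _ H H' (rder_bounded _) (rder_bounded _))) => // h.
by rewrite mulrDl mulrA [d * _ * _]mulrAC.
Qed.

Lemma rderV f t d : rder f t d -> f t != 0 ->
  rder (fun x => (f x)^-1) t (- d / f t ^+ 2).
Proof.
move=> H H'; apply: (eq_frechet (frechetV _ H (rder_bounded _) _)) => // h.
by rewrite -mulNr mulrAC.
Qed.

Lemma rderJ f t d : rder f t d -> rder (fun x => (f x)^*) t d^*.
Proof.
move=> H; apply: (eq_frechet (frechet_conj H)) => // h.
by rewrite rmorphM /= oppr0.
Qed.

Lemma rder_sum (I : Type) (r : seq I) (P : pred I) (f : I -> R -> C) t d :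
  (forall i, P i -> rder (f i) t (d i)) ->
  rder (fun x => \sum_(i <- r | P i) f i x) t (\sum_(i <- r | P i) d i).
Proof.
move=> H; apply: (eq_frechet (frechet_sum (fun=> normr_ge0 _) r H)) => // h.
by rewrite mulr_suml.
Qed.

Lemma rder_id t : rder (fun x => x%:C) t 1.
Proof.
move=> e e0; exists 1 => // h _.
rewrite mul1r rmorphD (_ : _ - _ = 0); last by ring.
by rewrite cabs0 mulr_ge0// ltW.
Qed.

Lemma rder_lin (a b : C) t : rder (fun x => a + x%:C * b) t b.
Proof.
have H := rderD (rder_cst a t) (rderM (rder_id t) (rder_cst b t)).
by apply: (rder_eq H); rewrite mulr0 mul1r !add0r.
Qed.

Lemma rder_comp (g : C -> C) (f : R -> C) t d d' :
  rder f t d -> cder g (f t) d' -> rder (fun x => g (f x)) t (d' * d).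
Proof.
move=> H H'; apply: (eq_frechet (frechet_comp _ H (rder_bounded _) H')) => // h.
by rewrite mulrA.
Qed.

Lemma cder_comp (g f : C -> C) s d d' :
  cder f s d -> cder g (f s) d' -> cder (fun x => g (f x)) s (d' * d).
Proof.
move=> H H'; apply: (eq_frechet (frechet_comp _ H (cder_bounded _) H')) => [h|h].
  exact: cabs_ge0.
by rewrite mulrA.
Qed.

Lemma rder_uniq f t d d' : rder f t d -> rder f t d' -> d = d'.
Proof.
move=> /rderP[H1 H2] /rderP[H3 H4]; apply/eqP; rewrite eq_complex.
by rewrite -(@derive_val _ _ _ _ _ _ _ H1) -(@derive_val _ _ _ _ _ _ _ H2)
  (@derive_val _ _ _ _ _ _ _ H3) (@derive_val _ _ _ _ _ _ _ H4) !eqxx.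
Qed.

Lemma rder_shift f t d : rder (fun x => f (t + x)) 0 d <-> rder f t d.
Proof.
by split=> H e e0; have [r r0 Hr] := H e e0; exists r => // h hr;
  have := Hr h hr; rewrite add0r addr0.
Qed.

End ComplexAndRealDerivatives.

(** * Complex-valued integrals and Goursat's theorem *)

Section CurveIntegrals.
Variable R : realType.
Local Notation C := R[i].
Local Notation mu := (@lebesgue_measure R).
Implicit Types (f g : R -> C) (a b t : R).

(** Continuity of a curve at a point, in the form that the estimates of its
    increments produce. *)
Definition ccont f t := forall e, 0 < e -> exists2 d, 0 < d &
  forall h : R, `|h| < d -> cabs (f (t + h) - f t) <= e.

Lemma ccont_rder f t d : rder f t d -> ccont f t.
Proof.
move=> H; have [B B0 [r r0 Hr]] : exists2 B, 0 < B & exists2 r, 0 < r &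
    forall h : R, `|h| < r -> cabs (f (t + h) - f t) <= B * `|h|.
  exact: frechet_lip H (rder_bounded d).
move=> e e0; exists (Num.min r (e / B)); first by rewrite lt_min r0 divr_gt0.
move=> h; rewrite lt_min => /andP[/Hr h1 h2]; apply: (le_trans h1).
by rewrite mulrC -ler_pdivlMr// ltW.
Qed.

Lemma ccont_lip f t (B d : R) : 0 < d ->
  (forall h : R, `|h| < d -> cabs (f (t + h) - f t) <= B * `|h|) -> ccont f t.
Proof.
move=> d0 Hr e e0; have B0 : 0 < `|B| + 1 by have := normr_ge0 B; lra.
exists (Num.min d (e / (`|B| + 1))); first by rewrite lt_min d0 divr_gt0.
move=> h; rewrite lt_min => /andP[/Hr h1 h2]; apply: (le_trans h1).
rewrite (@le_trans _ _ ((`|B| + 1) * `|h|))//.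
  by rewrite ler_wpM2r//; have := ler_norm B; lra.
by rewrite mulrC -ler_pdivlMr// ltW.
Qed.

Lemma ccontD f g t : ccont f t -> ccont g t -> ccont (fun x => f x + g x) t.
Proof.
move=> Hf Hg e e0; have e20 : 0 < e / 2 by lra.
have [d d0 Hd] := Hf _ e20; have [d' d'0 Hd'] := Hg _ e20.
exists (Num.min d d'); first by rewrite lt_min d0.
move=> h; rewrite lt_min => /andP[/Hd h1 /Hd' h2].
rewrite (_ : _ - _ = (f (t + h) - f t) + (g (t + h) - g t)); last by ring.
by rewrite (le_trans (cabsD _ _))//; lra.
Qed.

Lemma ccontM f g t : ccont f t -> ccont g t -> ccont (fun x => f x * g x) t.
Proof.
move=> Hf Hg e e0.
have [d d0 Hd] := Hf 1 ltr01.
have A0 : 0 < cabs (f t) + 1 by have := cabs_ge0 (f t); lra.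
have B0 : 0 < cabs (g t) + 1 by have := cabs_ge0 (g t); lra.
have [d1 d10 Hd1] := Hf _ (divr_gt0 (divr_gt0 e0 (ltr0n R 2)) B0).
have [d2 d20 Hd2] := Hg _ (divr_gt0 (divr_gt0 e0 (ltr0n R 2)) A0).
exists (Num.min d (Num.min d1 d2)); first by rewrite !lt_min d0 d10.
move=> h; rewrite !lt_min => /andP[/Hd h0 /andP[/Hd1 h1 /Hd2 h2]].
rewrite (_ : _ - _ = f (t + h) * (g (t + h) - g t) + (f (t + h) - f t) * g t);
  last by ring.
rewrite (le_trans (cabsD _ _))// !cabsM.
have i1 : cabs (f (t + h)) <= cabs (f t) + 1.
  by have := cabsD (f (t + h) - f t) (f t); rewrite subrK; lra.
have i2 : cabs (f (t + h)) * cabs (g (t + h) - g t) <= e / 2.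
  rewrite (le_trans (ler_pM (cabs_ge0 _) (cabs_ge0 _) i1 h2))//.
  by rewrite mulrC divfK// gt_eqF.
have i3 : cabs (f (t + h) - f t) * cabs (g t) <= e / 2.
  rewrite (le_trans (ler_pM (cabs_ge0 _) (cabs_ge0 _) h1
     (_ : cabs (g t) <= cabs (g t) + 1)))//; first by lra.
  by rewrite divfK// gt_eqF.
lra.
Qed.

Lemma ccont_ReIm f t : ccont f t ->
  {for t, continuous (fun x => complex.Re (f x) : R^o)} /\
  {for t, continuous (fun x => complex.Im (f x) : R^o)}.
Proof.
move=> H; split; apply/cvgrPdist_le => e e0; have [d d0 Hd] := H e e0;
  exists d => // s /=; rewrite distrC => hs; have := Hd _ hs;
  rewrite (addrC t) subrK distrC; apply: le_trans.
  by have := Re_le_cabs (f s - f t); case: (f s) => ? ?; case: (f t).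
by have := Im_le_cabs (f s - f t); case: (f s) => ? ?; case: (f t).
Qed.

Definition cintegrable f a b :=
  mu.-integrable `[a, b] (EFin \o (fun x => complex.Re (f x))) /\
  mu.-integrable `[a, b] (EFin \o (fun x => complex.Im (f x))).

Definition cint f a b : C :=
  Rintegral mu `[a, b] (fun x => complex.Re (f x)) +i*
  Rintegral mu `[a, b] (fun x => complex.Im (f x)).

Lemma within_pointwise (f : R -> R^o) a b :
  (forall t, a <= t <= b -> {for t, continuous f}) ->
  {within `[a, b], continuous f}.
Proof.
move=> H; apply: continuous_in_subspaceT => x.
by rewrite inE /= in_itv /= => /H.
Qed.

Lemma ccont_integrable f a b : (forall t, a <= t <= b -> ccont f t) ->
  cintegrable f a b.
Proof.
move=> H; split; (apply: continuous_compact_integrable;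
  first exact: segment_compact); apply: within_pointwise => t /H/ccont_ReIm[] //.
Qed.

Lemma eq_cint f g a b : (forall t, a <= t <= b -> f t = g t) ->
  cint f a b = cint g a b.
Proof.
move=> H; congr (_ +i* _); apply: eq_Rintegral => x;
  by rewrite inE /= in_itv /= => /H ->.
Qed.

Lemma RintegrableZ (k : R) (u : R -> R) (i : interval R) :
  mu.-integrable [set` i] (EFin \o u) ->
  mu.-integrable [set` i] (EFin \o (fun x => k * u x)).
Proof.
move=> H; rewrite (_ : EFin \o _ = (fun x => k%:E * (EFin \o u) x)%E) //.
exact: integrableZl.
Qed.

Lemma RintegrableB (u v : R -> R) (i : interval R) :
  mu.-integrable [set` i] (EFin \o u) -> mu.-integrable [set` i] (EFin \o v) ->
  mu.-integrable [set` i] (EFin \o (fun x => u x - v x)).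
Proof.
move=> H1 H2; rewrite (_ : EFin \o _ = (EFin \o u) \- (EFin \o v))%E //.
exact: integrableB.
Qed.

Lemma RintegrableD (u v : R -> R) (i : interval R) :
  mu.-integrable [set` i] (EFin \o u) -> mu.-integrable [set` i] (EFin \o v) ->
  mu.-integrable [set` i] (EFin \o (fun x => u x + v x)).
Proof.
move=> H1 H2; rewrite (_ : EFin \o _ = (EFin \o u) \+ (EFin \o v))%E //.
exact: integrableD.
Qed.

Lemma cintegrableD f g a b : cintegrable f a b -> cintegrable g a b ->
  cintegrable (fun x => f x + g x) a b.
Proof.
move=> [f1 f2] [g1 g2]; split.
  have := RintegrableD f1 g1; apply: eq_integrable => // x _ /=.
  by case: (f x) => ? ?; case: (g x).
have := RintegrableD f2 g2; apply: eq_integrable => // x _ /=.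
by case: (f x) => ? ?; case: (g x).
Qed.

Lemma cintD f g a b : cintegrable f a b -> cintegrable g a b ->
  cint (fun x => f x + g x) a b = cint f a b + cint g a b.
Proof.
move=> [f1 f2] [g1 g2]; rewrite /cint; simpc; congr (_ +i* _).
  rewrite -RintegralD//; apply: eq_Rintegral => x _.
  by case: (f x) => ? ?; case: (g x).
rewrite -RintegralD//; apply: eq_Rintegral => x _.
by case: (f x) => ? ?; case: (g x).
Qed.

Lemma cintegrableZ k f a b : cintegrable f a b ->
  cintegrable (fun x => k * f x) a b.
Proof.
move=> [f1 f2]; case: k => p q; split.
  have := RintegrableB (RintegrableZ p f1) (RintegrableZ q f2).
  by apply: eq_integrable => // x _ /=; case: (f x).
have := RintegrableD (RintegrableZ p f2) (RintegrableZ q f1).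
by apply: eq_integrable => // x _ /=; case: (f x).
Qed.

Lemma cintZ k f a b : cintegrable f a b ->
  cint (fun x => k * f x) a b = k * cint f a b.
Proof.
move=> [f1 f2]; case: k => p q; rewrite /cint; simpc; congr (_ +i* _).
  rewrite -!RintegralZl//.
  rewrite -RintegralB//; do ?exact: RintegrableZ.
  by apply: eq_Rintegral => x _; case: (f x).
rewrite -!RintegralZl//.
rewrite -RintegralD//; do ?exact: RintegrableZ.
by apply: eq_Rintegral => x _; case: (f x).
Qed.

Lemma cintegrableN f a b : cintegrable f a b ->
  cintegrable (fun x => - f x) a b.
Proof.
move=> /(cintegrableZ (-1)); congr cintegrable.
by apply/funext => x; rewrite mulN1r.
Qed.

Lemma cintegrableB f g a b : cintegrable f a b -> cintegrable g a b ->
  cintegrable (fun x => f x - g x) a b.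
Proof. by move=> H1 H2; apply: cintegrableD => //; exact: cintegrableN. Qed.

Lemma cintB f g a b : cintegrable f a b -> cintegrable g a b ->
  cint (fun x => f x - g x) a b = cint f a b - cint g a b.
Proof.
move=> H1 H2; rewrite cintD//; last exact: cintegrableN.
congr (_ + _); rewrite -mulN1r -cintZ//.
by apply: eq_cint => t _; rewrite mulN1r.
Qed.

Lemma Rint_chasles (u : R -> R) a b c : a <= b -> b <= c ->
  mu.-integrable `[a, c] (EFin \o u) ->
  Rintegral mu `[a, c] u = Rintegral mu `[a, b] u + Rintegral mu `[b, c] u.
Proof.
move=> ab bc H; have := @Rintegral_itvB _ u (BLeft a) (BRight c) b H.
rewrite !bnd_simp => /(_ ab bc).
rewrite (@Rintegral_itv_obnd_cbnd _ b (BRight c)).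
  by move/eqP; rewrite subr_eq addrC => /eqP.
by apply: integrableS H => //; apply: subset_itvr; rewrite bnd_simp.
Qed.

Lemma cint_chasles f a b c : a <= b -> b <= c -> cintegrable f a c ->
  cint f a c = cint f a b + cint f b c.
Proof.
by move=> ab bc [f1 f2]; rewrite /cint (Rint_chasles ab bc f1)
  (Rint_chasles ab bc f2).
Qed.

Lemma Rint_le (u : R -> R) a b B : a <= b ->
  mu.-integrable `[a, b] (EFin \o u) ->
  (forall t, a <= t <= b -> `|u t| <= B) ->
  `|Rintegral mu `[a, b] u| <= B * (b - a).
Proof.
move=> ab H uB; apply: (le_trans (le_normr_Rintegral _ H)) => //.
have -> : B * (b - a) = Rintegral mu `[a, b] (cst B).
  rewrite Rintegral_cst//= lebesgue_measure_itv/= lte_fin.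
  case: ltP => [_|ba]; first by rewrite -EFinD.
  by have -> : a = b; [apply/eqP; rewrite eq_le ab | rewrite subrr].
apply: le_Rintegral => //; first exact: integrable_norm.
apply: (continuous_compact_integrable (f := cst B)); first exact: segment_compact.
by apply: continuous_subspaceT => x; exact: cvg_cst.
Qed.

(** The factor 2 comes from the separate estimates of the real and imaginary
    parts; a sharp constant would bring nothing to the limits taken below. *)
Lemma cint_le f a b B : a <= b -> cintegrable f a b ->
  (forall t, a <= t <= b -> cabs (f t) <= B) ->
  cabs (cint f a b) <= 2 * B * (b - a).
Proof.
move=> ab [f1 f2] fB; apply: (le_trans (cabs_le_ReIm _)) => /=.
have h1 : `|Rintegral mu `[a, b] (fun x => complex.Re (f x))| <= B * (b - a).
  by apply: Rint_le => // t /fB; apply: le_trans; exact: Re_le_cabs.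
have h2 : `|Rintegral mu `[a, b] (fun x => complex.Im (f x))| <= B * (b - a).
  by apply: Rint_le => // t /fB; apply: le_trans; exact: Im_le_cabs.
lra.
Qed.

Lemma Rint_ftc (u G : R -> R^o) a b : a < b ->
  (forall t, a <= t <= b -> {for t, continuous u}) ->
  (forall t, is_derive (t : R^o) (1 : R^o) G (u t)) ->
  Rintegral mu `[a, b] u = G b - G a.
Proof.
move=> ab cu dG.
have Gc t : {for t, continuous G}.
  have := dG t; case=> H _.
  by move: H => /derivable1_diffP/differentiable_continuous.
rewrite /Rintegral (@continuous_FTC2 _ u G)//=.
- exact: within_pointwise.
- split=> [x _||]; first by have [] := dG x.
    exact/cvg_at_right_filter/Gc.
  exact/cvg_at_left_filter/Gc.
- by move=> x _; rewrite derive1E; have [] := dG x.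
Qed.

Lemma cint_ftc f G a b : a < b -> (forall t, a <= t <= b -> ccont f t) ->
  (forall t, rder G t (f t)) -> cint f a b = G b - G a.
Proof.
move=> ab cf dG; rewrite /cint.
have -> : Rintegral mu `[a, b] (fun x => complex.Re (f x)) =
    complex.Re (G b) - complex.Re (G a).
  apply: (Rint_ftc (G := fun x => complex.Re (G x))) => // t.
    by move=> /cf/ccont_ReIm[].
  by have /rderP[] := dG t.
have -> : Rintegral mu `[a, b] (fun x => complex.Im (f x)) =
    complex.Im (G b) - complex.Im (G a).
  apply: (Rint_ftc (G := fun x => complex.Im (G x))) => // t.
    by move=> /cf/ccont_ReIm[].
  by have /rderP[] := dG t.
by case: (G b) => ? ?; case: (G a).
Qed.

Lemma cint_cst (k : C) a b : a < b -> cint (fun=> k) a b = (b - a)%:C * k.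
Proof.
move=> ab; rewrite (cint_ftc (G := fun x => 0 + x%:C * k))//.
- by rewrite !add0r -mulrBl rmorphB.
- by move=> t _; exact: ccont_rder (rder_cst k t).
- by move=> t; exact: rder_lin.
Qed.

End CurveIntegrals.

Section Goursat.
Variable R : realType.
Local Notation C := R[i].

Lemma plane_pointE (x y : R) : x +i* y = x%:C + 'i * y%:C :> C.
Proof. by rewrite {1}(complex_split (x +i* y)). Qed.

Lemma rder_hline (x y : R) : rder (fun t => t +i* y) x (1 : C).
Proof.
rewrite (_ : (fun _ => _) = (fun t : R => 'i * y%:C + t%:C * 1)).
  exact: rder_lin.
by apply/funext => t; rewrite plane_pointE mulr1 addrC.
Qed.

Lemma rder_vline (x y : R) : rder (fun t => x +i* t) y ('i : C).
Proof.
rewrite (_ : (fun _ => _) = (fun t : R => x%:C + t%:C * 'i)).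
  exact: rder_lin.
by apply/funext => t; rewrite plane_pointE mulrC.
Qed.

Definition hside (f : C -> C) (a b l : R) : C := cint (fun x => f (x +i* b)) a (a + l).
Definition vside (f : C -> C) (a b l : R) : C := cint (fun y => f (a +i* y)) b (b + l).

Definition contour (f : C -> C) (a b l : R) : C :=
  hside f a b l + 'i * vside f (a + l) b l - hside f a (b + l) l - 'i * vside f a b l.

Definition cderivable_square (f : C -> C) (a b l : R) :=
  forall x y, a <= x <= a + l -> b <= y <= b + l -> exists d, cder f (x +i* y) d.

Section Square.
Variables (f : C -> C) (a b l : R).
Hypothesis l0 : 0 <= l.
Hypothesis df : cderivable_square f a b l.

Lemma hside_ccont y x : b <= y <= b + l -> a <= x <= a + l ->
  ccont (fun t => f (t +i* y)) x.
Proof.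
move=> hy hx; have [d Hd] := df hx hy.
by apply: (@ccont_rder _ _ _ (d * 1)); apply: (rder_comp (rder_hline x y)).
Qed.

Lemma vside_ccont y x : b <= y <= b + l -> a <= x <= a + l ->
  ccont (fun t => f (x +i* t)) y.
Proof.
move=> hy hx; have [d Hd] := df hx hy.
by apply: (@ccont_rder _ _ _ (d * 'i)); apply: (rder_comp (rder_vline x y)).
Qed.

Lemma hside_integrable y : b <= y <= b + l ->
  cintegrable (fun x => f (x +i* y)) a (a + l).
Proof. by move=> hy; apply: ccont_integrable => x; exact: hside_ccont. Qed.

Lemma vside_integrable x : a <= x <= a + l ->
  cintegrable (fun y => f (x +i* y)) b (b + l).
Proof. by move=> hx; apply: ccont_integrable => y hy; exact: vside_ccont. Qed.

Lemma cderivable_subsquare a' b' l' : a <= a' -> a' + l' <= a + l ->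
  b <= b' -> b' + l' <= b + l -> cderivable_square f a' b' l'.
Proof.
by move=> ? ? ? ? x y /andP[? ?] /andP[? ?]; apply: df; apply/andP; split; lra.
Qed.

End Square.

Lemma contourD f g a b l : 0 <= l ->
  cderivable_square f a b l -> cderivable_square g a b l ->
  contour (fun z => f z + g z) a b l = contour f a b l + contour g a b l.
Proof.
move=> l0 df dg.
have e1 : b <= b <= b + l by lra.
have e2 : b <= b + l <= b + l by lra.
have e3 : a <= a <= a + l by lra.
have e4 : a <= a + l <= a + l by lra.
rewrite /contour /hside /vside.
have := (hside_integrable df e1, hside_integrable df e2,
  vside_integrable df e3, vside_integrable df e4).
have := (hside_integrable dg e1, hside_integrable dg e2,
  vside_integrable dg e3, vside_integrable dg e4).
by move=> [[[? ?] ?] ?] [[[? ?] ?] ?]; rewrite !cintD//; ring.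
Qed.

(** The length of the contour is 4 l, and each of the sides loses a factor 2. *)
Lemma contour_le f a b l B : 0 <= l -> cderivable_square f a b l ->
  (forall x y, a <= x <= a + l -> b <= y <= b + l -> cabs (f (x +i* y)) <= B) ->
  cabs (contour f a b l) <= 8 * B * l.
Proof.
move=> l0 df fB.
have e1 : b <= b <= b + l by lra.
have e2 : b <= b + l <= b + l by lra.
have e3 : a <= a <= a + l by lra.
have e4 : a <= a + l <= a + l by lra.
have ineqh y : b <= y <= b + l ->
    cabs (cint (fun x => f (x +i* y)) a (a + l)) <= 2 * B * l.
  move=> hy; rewrite -[X in _ * X](addrK a) (addrC l) -[X in _ <= 2 * B * X]/(a + l - a).
  by apply: cint_le; [lra | exact: hside_integrable hy | move=> x hx; exact: fB].
have ineqv x : a <= x <= a + l ->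
    cabs (cint (fun y => f (x +i* y)) b (b + l)) <= 2 * B * l.
  move=> hx; rewrite -[X in _ * X](addrK b) (addrC l) -[X in _ <= 2 * B * X]/(b + l - b).
  by apply: cint_le; [lra | exact: vside_integrable hx | move=> y hy; exact: fB].
rewrite /contour (le_trans (cabsB _ _))// cabsM cabsi mul1r.
have := cabsB (hside f a b l + 'i * vside f (a + l) b l) (hside f a (b + l) l).
have := cabsD (hside f a b l) ('i * vside f (a + l) b l).
rewrite cabsM cabsi mul1r.
have := ineqh _ e1; have := ineqh _ e2; have := ineqv _ e3; have := ineqv _ e4.
by rewrite /hside /vside; lra.
Qed.

(** The primitive z |-> A z + D z^2 / 2 makes the four sides telescope. *)
Lemma contour_affine (A D : C) a b l : 0 < l ->
  contour (fun z => A + D * z) a b l = 0.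
Proof.
move=> l0; pose Q z := A * z + D / 2 * (z * z) : C.
have line (g : R -> C) t d : rder g t d ->
    rder (fun x => Q (g x)) t ((A + D * g t) * d).
  move=> dg; have := rderD (rderZ A dg) (rderZ (D / 2) (rderM dg dg)).
  by move=> H; apply: (rder_eq H); field.
have ca (g : R -> C) t d : rder g t d -> ccont (fun x => A + D * g x) t.
  move=> dg; exact: ccont_rder (rderD (rder_cst A t) (rderZ D dg)).
have hE y : hside (fun z => A + D * z) a y l = Q ((a + l) +i* y) - Q (a +i* y).
  apply: (cint_ftc (G := fun x => Q (x +i* y))); first lra.
    by move=> t _; exact: ca (rder_hline t y).
  by move=> t; have := line _ _ _ (rder_hline t y); rewrite mulr1.
have vE x : 'i * vside (fun z => A + D * z) x b l = Q (x +i* (b + l)) - Q (x +i* b).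
  rewrite -cintZ; last first.
    by apply: ccont_integrable => t _; exact: ca (rder_vline x t).
  apply: (cint_ftc (G := fun y => Q (x +i* y))); first lra.
    move=> t _; apply: ccontM; first exact: ccont_rder (rder_cst 'i t).
    exact: ca (rder_vline x t).
  by move=> t; have := line _ _ _ (rder_vline x t); rewrite mulrC.
rewrite /contour !hE !vE; ring.
Qed.

Lemma contour_split f a b m : 0 <= m -> cderivable_square f a b (m + m) ->
  contour f a b (m + m) = contour f a b m + contour f (a + m) b m +
    contour f a (b + m) m + contour f (a + m) (b + m) m.
Proof.
move=> m0 df.
have H y : b <= y <= b + (m + m) ->
    hside f a y (m + m) = hside f a y m + hside f (a + m) y m.
  move=> hy; rewrite /hside (@cint_chasles _ _ a (a + m)) ?addrA//; try lra.
  by rewrite -addrA; exact: hside_integrable hy.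
have V x : a <= x <= a + (m + m) ->
    vside f x b (m + m) = vside f x b m + vside f x (b + m) m.
  move=> hx; rewrite /vside (@cint_chasles _ _ b (b + m)) ?addrA//; try lra.
  by rewrite -addrA; exact: vside_integrable hx.
rewrite /contour !H ?V; try (apply/andP; split; lra).
rewrite !addrA; set h1 := hside _ _ _ _; set h2 := hside _ _ _ _.
set h3 := hside _ _ _ _; set h4 := hside _ _ _ _; set h5 := hside _ _ _ _.
set h6 := hside _ _ _ _; set v1 := vside _ _ _ _; set v2 := vside _ _ _ _.
set v3 := vside _ _ _ _; set v4 := vside _ _ _ _; set v5 := vside _ _ _ _.
set v6 := vside _ _ _ _; move: h1 h2 h3 h4 h5 h6 v1 v2 v3 v4 v5 v6; clear.
move=> h1 h2 h3 h4 h5 h6 v1 v2 v3 v4 v5 v6; ring.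
Qed.

Lemma nested_limit (u v : nat -> R) : (forall k, 0 <= v k) ->
  (forall k, u k <= u k.+1) -> (forall k, u k.+1 + v k.+1 <= u k + v k) ->
  exists s, forall k, u k <= s <= u k + v k.
Proof.
move=> v0 u_up uv_down.
have up j k : (j <= k)%N -> u j <= u k.
  exact: (homo_leq (r := fun x y => x <= y) (lexx (T := R)) (le_trans (T := R))).
have down j k : (j <= k)%N -> u k + v k <= u j + v j.
  by move: j k; apply: (homo_leq (r := fun x y => y <= x)) => // y x z /[swap];
    exact: le_trans.
pose S := [set u k | k in [set: nat]].
have ubS k : ubound S (u k + v k).
  move=> _ [j _ <-]; have [kj|jk] := leqP k j.
    by have := down _ _ kj; have := v0 j; lra.
  by have := up _ _ (ltnW jk); have := v0 k; lra.
exists (sup S) => k; apply/andP; split.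
  by apply: ub_le_sup; [exists (u 0%N + v 0%N) | exists k].
by apply: ge_sup => //; exists (u 0%N), 0%N.
Qed.

(** The corners of successively chosen quarters form monotone bounded sequences,
    whose limits are the coordinates of the common point. *)
Lemma quadrisection (bad : R -> R -> R -> bool) a b l : 0 < l ->
  (forall a' b' m, a <= a' -> a' + (m + m) <= a + l ->
    b <= b' -> b' + (m + m) <= b + l -> 0 <= m -> bad a' b' (m + m) ->
    [|| bad a' b' m, bad (a' + m) b' m, bad a' (b' + m) m
      | bad (a' + m) (b' + m) m]) ->
  bad a b l ->
  exists s t, forall k, exists a' b', let m := l / 2 ^+ k in
    [/\ a' <= s <= a' + m, b' <= t <= b' + m,
        a <= a' /\ a' + m <= a + l, b <= b' /\ b' + m <= b + l & bad a' b' m].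
Proof.
move=> l0 split_bad bad0.
pose next (p : R * R) m :=
  if bad p.1 p.2 m then p else if bad (p.1 + m) p.2 m then (p.1 + m, p.2)
  else if bad p.1 (p.2 + m) m then (p.1, p.2 + m) else (p.1 + m, p.2 + m).
pose len k := l / 2 ^+ k.
have len0 k : 0 <= len k by rewrite divr_ge0 ?ltW// exprn_gt0.
have lenS k : len k = len k.+1 + len k.+1.
  by rewrite /len exprS; field; rewrite expf_neq0.
have nextP p m : 0 <= m ->
    (p.1 <= (next p m).1 <= p.1 + m) /\ (p.2 <= (next p m).2 <= p.2 + m).
  by clear; rewrite /next => m0; do 3?[case: ifP => _ /=]; split; lra.
have nextB p m : [|| bad p.1 p.2 m, bad (p.1 + m) p.2 m, bad p.1 (p.2 + m) m
      | bad (p.1 + m) (p.2 + m) m] -> bad (next p m).1 (next p m).2 m.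
  by rewrite /next; do 3?[case: ifP => //=].
pose P := fix P k := if k is k'.+1 then next (P k') (len k) else (a, b).
have inside k : [/\ a <= (P k).1 /\ (P k).1 + len k <= a + l,
    b <= (P k).2 /\ (P k).2 + len k <= b + l & bad (P k).1 (P k).2 (len k)].
  elim: k => [|k [[h1 h2] [h3 h4] h5]]; first by rewrite /len /= expr0 divr1.
  have [h6 h7] := nextP (P k) _ (len0 k.+1).
  rewrite -[P k.+1]/(next (P k) (len k.+1)).
  split.
  - by move: h1 h2 h6 (lenS k); clear; lra.
  - by move: h3 h4 h7 (lenS k); clear; lra.
  - by apply/nextB/split_bad => //; rewrite -lenS.
have [s Hs] : exists s, forall k, (P k).1 <= s <= (P k).1 + len k.
  apply: nested_limit => // k; have [h6 h7] := nextP (P k) _ (len0 k.+1);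
  rewrite -[P k.+1]/(next (P k) (len k.+1)).
    by case/andP: h6.
  by rewrite (lenS k); move: h6; clear; lra.
have [t Ht] : exists t, forall k, (P k).2 <= t <= (P k).2 + len k.
  apply: nested_limit => // k; have [h6 h7] := nextP (P k) _ (len0 k.+1);
  rewrite -[P k.+1]/(next (P k) (len k.+1)).
    by case/andP: h7.
  by rewrite (lenS k); move: h7; clear; lra.
exists s, t => k; exists (P k).1, (P k).2 => /=.
by have [? ? ?] := inside k; split.
Qed.

Lemma half_powers (l r : R) : 0 < l -> 0 < r -> exists k, l / 2 ^+ k < r.
Proof.
move=> l0 r0.
have H : 0 <= l / r by rewrite divr_ge0// ltW.
exists (Num.Def.archi_bound (l / r)); rewrite ltr_pdivrMr ?exprn_gt0//.
have := archi_boundP H; rewrite ltr_pdivrMr// => /lt_le_trans; apply.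
by rewrite mulrC ler_pM2l// -natrX ler_nat ltnW// ltn_expl.
Qed.

Lemma cabs_pigeonhole (c1 c2 c3 c4 : C) (q : R) : 4 * q <= cabs (c1 + c2 + c3 + c4) ->
  [|| q <= cabs c1, q <= cabs c2, q <= cabs c3 | q <= cabs c4].
Proof.
have := cabsD (c1 + c2 + c3) c4; have := cabsD (c1 + c2) c3; have := cabsD c1 c2.
by do 4?[case: leP => //=]; lra.
Qed.

(** Goursat's theorem: if the contour integral were not zero, repeated
    quadrisection would produce nested squares of sides m = l / 2 ^ k on which it
    stays at least e m ^ 2; near the common point of these squares f is affine up
    to an error which makes the integral smaller than that. *)
Theorem goursat f a b l : 0 < l -> cderivable_square f a b l ->
  contour f a b l = 0.
Proof.
move=> l0 df; apply/eqP; rewrite -cabs_eq0; apply/negPn/negP => nz.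
have c0 : 0 < cabs (contour f a b l) by rewrite lt_neqAle eq_sym nz cabs_ge0.
pose e := cabs (contour f a b l) / l ^+ 2.
have e0 : 0 < e by rewrite divr_gt0// exprn_gt0.
have [||s [t nest]] := @quadrisection
  (fun a' b' m => e * m ^+ 2 <= cabs (contour f a' b' m)) a b l l0.
- move=> a' b' m h1 h2 h3 h4 m0 H; apply: cabs_pigeonhole.
  rewrite -contour_split//; last exact: (cderivable_subsquare df).
  by apply: le_trans H; rewrite !expr2; lra.
- by rewrite /e divfK// expf_neq0// gt_eqF.
have [d Hd] : exists d, cder f (s +i* t) d.
  have [a' [b' [h1 h2 [h3 h4] [h5 h6] _]]] := nest 0%N.
  apply: df; move: h1 h2 h3 h4 h5 h6; clear; lra.
(* 8 (e / 32) (2 m) m is half of e m ^ 2 *)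
have e320 : 0 < e / 32 by lra.
have [r r0 Hr] := Hd _ e320.
have [k] := half_powers l0 (divr_gt0 r0 (ltr0n R 2)).
have [a' [b' /= []]] := nest k; set m := l / 2 ^+ k.
move=> hs ht [h1 h2] [h3 h4] big Hk.
have m0 : 0 < m by rewrite divr_gt0// exprn_gt0.
have dk := cderivable_subsquare df h1 h2 h3 h4.
set p := s +i* t in Hd Hr.
have near_p x y : a' <= x <= a' + m -> b' <= y <= b' + m ->
    cabs (x +i* y - p) <= 2 * m.
  move=> hx hy; apply: (le_trans (cabs_le_ReIm _)) => /=.
  have h5 : `|x - s| <= m by rewrite ler_norml; move: hx hs; clear; lra.
  have h6 : `|y - t| <= m by rewrite ler_norml; move: hy ht; clear; lra.
  by move: h5 h6; clear; lra.
pose aff (z : C) := (f p - d * p) + d * z.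
have daff : cderivable_square aff a' b' m.
  move=> x y _ _; exists (0 + d).
  have H : cder (fun z => d * z) (x +i* y) d.
    move=> e' e'0; exists 1 => // h _.
    rewrite (_ : _ - _ - _ = 0); last by ring.
    by rewrite cabs0 mulr_ge0 ?cabs_ge0// ltW.
  apply: (eq_frechet (frechetD (frechet_cst _ _ _) H)) => [h|h].
    exact: cabs_ge0.
  by rewrite mulrDl mul0r.
pose err z := f z - aff z.
have derr : cderivable_square err a' b' m.
  move=> x y hx hy; have [d1 H1] := dk x y hx hy.
  have [d2 H2] := daff x y hx hy; exists (d1 - d2).
  apply: (eq_frechet (frechetB _ H1 H2)) => [h|h]; first exact: cabs_ge0.
  by rewrite mulrBl.
have : cabs (contour f a' b' m) <= 8 * (e / 32 * (2 * m)) * m.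
  have -> : f = (fun z => aff z + err z).
    by apply/funext => z; rewrite /err addrC subrK.
  rewrite contourD//; last exact: ltW.
  rewrite /aff contour_affine// add0r.
  apply: contour_le => //; first exact: ltW.
  move=> x y hx hy; have hp := near_p x y hx hy.
  have Hk2 : 2 * m < r by rewrite mulrC -ltr_pdivlMr.
  have := Hr (x +i* y - p) (le_lt_trans hp Hk2).
  rewrite (addrC p) subrK => H; apply: le_trans (_ : e / 32 * cabs (x +i* y - p) <= _).
    rewrite /err /aff (_ : f _ - _ = f (x +i* y) - f p - d * (x +i* y - p))//.
    ring.
  by rewrite ler_wpM2l// ltW.
move=> /(le_trans big).
have : 0 < e * m ^+ 2 by rewrite mulr_gt0// exprn_gt0.
rewrite !expr2; clear; lra.
Qed.

End Goursat.

(** * Cauchy's formula at the centre of a disc *)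

Section ComplexExponential.
Variable R : realType.
Local Notation C := R[i].

Lemma expi0 : expi 0 = 1 :> C.
Proof. by rewrite /expi cos0 sin0. Qed.

Lemma expiD (x y : R) : expi (x + y) = expi x * expi y :> C.
Proof. by rewrite /expi cosD sinD; simpc; congr (_ +i* _); rewrite addrC mulrC [sin x * _]mulrC. Qed.

Lemma cabs_expi (x : R) : cabs (expi x : C) = 1.
Proof. by rewrite cabs_def /expi /= cos2Dsin2 sqrtr1. Qed.

Lemma expi_neq0 (x : R) : expi x != 0 :> C.
Proof. by rewrite -cabs_gt0 cabs_expi. Qed.

Lemma expiN (x : R) : expi (- x) = (expi x)^* :> C.
Proof. by rewrite /expi cosN sinN. Qed.

Lemma expi_2pi : expi (pi *+ 2) = 1 :> C.
Proof. by rewrite /expi cos2pi sin2pi. Qed.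

Lemma rder_expi (x : R) : rder (@expi R) x ('i * expi x).
Proof.
apply/rderP; rewrite /expi; simpc => /=; split.
  exact: is_derive_cos.
exact: is_derive_sin.
Qed.

Definition cexp (z : C) : C := (expR (complex.Re z))%:C * expi (complex.Im z).

Lemma cabs_cexp z : cabs (cexp z) = expR (complex.Re z).
Proof. by rewrite cabsM cabs_expi mulr1 cabs_real ger0_norm// expR_ge0. Qed.

Lemma cexpD a b : cexp (a + b) = cexp a * cexp b.
Proof.
case: a b => [a1 a2] [b1 b2]; rewrite /cexp /= expRD expiD rmorphM /=.
by rewrite mulrACA.
Qed.

Lemma cexp0 : cexp 0 = 1.
Proof. by rewrite /cexp /= expR0 expi0 mulr1. Qed.

(** e ^ (a + i b) - 1 - (a + i b)
     = (e ^ a - 1 - a) e ^ (i b) + a (e ^ (i b) - 1) + (e ^ (i b) - 1 - i b) *)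
Lemma cder_cexp0 : cder cexp 0 1.
Proof.
move=> e e0; have e40 : 0 < e / 3 by lra.
have /real_derP H1 := is_derive_expR (0 : R).
have [r1 r10 Hr1] := H1 _ e40.
have [r2 r20 Hr2] := rder_expi 0 e40.
have [r3 r30 Hr3] := ccont_rder (rder_expi 0) e40.
exists (Num.min r1 (Num.min r2 r3)); first by rewrite !lt_min r10 r20.
move=> h; rewrite !lt_min => /andP[h1 /andP[h2 h3]].
have ha := Re_le_cabs h; have hb := Im_le_cabs h.
set a := complex.Re h in ha *; set b := complex.Im h in hb *.
have := Hr1 a (le_lt_trans ha h1); have := Hr2 b (le_lt_trans hb h2).
have := Hr3 b (le_lt_trans hb h3); rewrite !add0r expi0 expR0 mul1r mulr1.
move=> h4 h5 h6.
have -> : cexp h - cexp 0 - 1 * h = (expR a - 1 - a)%:C * expi b +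
    a%:C * (expi b - 1) + (expi b - 1 - 'i * b%:C).
  by rewrite {2}(complex_split h) cexp0 /cexp -/a -/b !rmorphB; ring.
rewrite (le_trans (cabsD _ _))//.
have := cabsD ((expR a - 1 - a)%:C * expi b) (a%:C * (expi b - 1)).
rewrite !cabsM cabs_expi !cabs_real mulr1.
have : `|a| * cabs (expi b - 1) <= cabs h * (e / 3).
  by apply: ler_pM => //; exact: cabs_ge0.
have : e / 3 * `|a| <= e / 3 * cabs h by rewrite ler_wpM2l// ltW.
have : e / 3 * `|b| <= e / 3 * cabs h by rewrite ler_wpM2l// ltW.
by move: h5 h6; clear; lra.
Qed.

Lemma cder_cexp z : cder cexp z (cexp z).
Proof.
move=> e e0; have k0 : 0 < cabs (cexp z) by rewrite cabs_cexp expR_gt0.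
have [r r0 Hr] := cder_cexp0 (divr_gt0 e0 k0).
exists r => // h /Hr; rewrite add0r cexp0 mul1r => H.
rewrite cexpD (_ : _ - _ - _ = cexp z * (cexp h - 1 - h)); last by ring.
by rewrite cabsM mulrC -ler_pdivlMr// mulrAC.
Qed.

End ComplexExponential.

Section CauchyFormula.
Variable R : realType.
Local Notation C := R[i].

Lemma complexi_neq0 : ('i : C) != 0.
Proof. by rewrite -cabs_gt0 cabsi. Qed.

(** Goursat's theorem for a function with period i l: the two horizontal sides
    cancel. *)
Lemma vside_periodic (f : C -> C) a b l : 0 < l -> cderivable_square f a b l ->
  (forall x, f (x +i* (b + l)) = f (x +i* b)) ->
  vside f (a + l) b l = vside f a b l.
Proof.
move=> l0 df per; have := goursat l0 df; rewrite /contour.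
have -> : hside f a (b + l) l = hside f a b l.
  by apply: eq_cint => t _; exact: per.
move: (hside _ _ _ _) (vside _ _ _ _) (vside _ _ _ _) => h v1 v2.
rewrite (_ : _ - _ = 'i * v2 - 'i * v1); last by ring.
by move/eqP; rewrite subr_eq0 => /eqP/(mulfI complexi_neq0).
Qed.

Lemma cder_near (f : C -> C) s d r : 0 < r -> cder f s d ->
  forall g : C -> C, (forall z, cabs (z - s) < r -> f z = g z) -> cder g s d.
Proof.
move=> r0 H g fg; apply: (frechet_near r0 _ _ H).
  by move=> h hr; apply: fg; rewrite addrC addKr.
by apply: fg; rewrite subrr cabs0.
Qed.

(** Cauchy's formula for the derivative at the centre of a disc: in the
    logarithmic coordinate zeta, s = exp zeta, the difference quotient of phi at
    0 is 2 i pi periodic, so that Goursat's theorem for squares of side 2 pi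
    shows that its mean over the circle of radius r does not change when log r
    decreases by 2 pi; and the mean tends to phi'(0) when r tends to 0. *)
Lemma cauchy_center (phi : C -> C) (rho r : R) (d0 : C) :
  (forall s, cabs s < rho -> exists d, cder phi s d) -> cder phi 0 d0 ->
  0 < r -> r < rho ->
  cint (fun y => (phi (r%:C * expi y) - phi 0) / (r%:C * expi y)) 0 (pi *+ 2)
    = (pi *+ 2)%:C * d0.
Proof.
move=> dphi dphi0 r0 rrho.
pose q (s : C) := (phi s - phi 0) / s.
have dq s : s != 0 -> cabs s < rho -> exists d, cder q s d.
  move=> s0 /dphi[d Hd].
  have D1 : cder (fun s => phi s - phi 0) s (d - 0).
    have cn := @cabs_ge0 R.
    apply: (eq_frechet (frechetB cn Hd (frechet_cst cn (phi 0) s))) => h.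
    by rewrite mulrBl mul0r.
  have idC : cder id s 1.
    move=> e e0; exists 1 => // h _; rewrite (_ : _ - _ - _ = 0) /=; last by ring.
    by rewrite cabs0 mulr_ge0 ?cabs_ge0// ltW.
  have D2 := frechetV (@cabs_ge0 R) idC (cder_bounded _) s0.
  have b2 : frechet_bounded (@cabs R) (fun h => - (1 * h) / s ^+ 2).
    exists (cabs (s ^+ 2)^-1 + 1); first by have := cabs_ge0 (s ^+ 2)^-1; lra.
    move=> h; rewrite mul1r mulrC cabsM cabsN ler_wpM2r ?cabs_ge0//; lra.
  have D3 := frechetM (@cabs_ge0 R) D1 D2 (cder_bounded _) b2.
  exists ((phi s - phi 0) * (- 1 / s ^+ 2) + (d - 0) * s^-1).
  apply: (eq_frechet D3) => h; ring.
pose psi z := q (cexp z).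
have dpsi z : expR (complex.Re z) < rho -> exists d, cder psi z d.
  rewrite -cabs_cexp => hz.
  have z0 : cexp z != 0 by rewrite -cabs_gt0 cabs_cexp expR_gt0.
  have [d Hd] := dq _ z0 hz.
  by exists (d * cexp z); apply: (cder_comp (cder_cexp z)).
have tpi : 0 < pi *+ 2 :> R by rewrite mulrn_wgt0// pi_gt0.
pose J x := cint (fun y => psi (x +i* y)) 0 (pi *+ 2).
have per x : psi (x +i* (pi *+ 2)) = psi (x +i* 0).
  by rewrite /psi /cexp /= expi_2pi expi0.
(* the means over the circles of radii e ^ x and e ^ (x - 2 pi) agree *)
have Jstep x : x <= ln r -> J x = J (x - pi *+ 2).
  move=> xr; have vE x' : vside psi x' 0 (pi *+ 2) = J x' by rewrite /vside add0r.
  rewrite -!vE -{1}(subrK (pi *+ 2) x); apply: vside_periodic => //.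
    move=> x' y /andP[_ hx] _; apply: dpsi => /=.
    rewrite (le_lt_trans _ rrho)// -[leRHS]lnK ?posrE// ler_expR.
    by move: hx; rewrite subrK => /le_trans; apply.
  by move=> x'; rewrite add0r.
have Jiter k : J (ln r) = J (ln r - (pi *+ 2) *+ k).
  elim: k => [|k ->]; first by rewrite mulr0n subr0.
  rewrite Jstep; first by rewrite -addrA -opprD -mulrSr.
  by rewrite gerBl mulrn_wge0// ltW.
have Jint x : x <= ln r -> cintegrable (fun y => psi (x +i* y)) 0 (pi *+ 2).
  move=> xr; apply: ccont_integrable => t _.
  have hx : expR (complex.Re (x +i* t)) < rho.
    by rewrite /= (le_lt_trans _ rrho)// -[leRHS]lnK ?posrE// ler_expR.
  have [d Hd] := dpsi _ hx.
  exact: ccont_rder (rder_comp (rder_vline x t) Hd).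
have -> : cint (fun y => (phi (r%:C * expi y) - phi 0) / (r%:C * expi y)) 0 (pi *+ 2)
    = J (ln r).
  by apply: eq_cint => t _; rewrite /psi /q /cexp /= lnK.
apply/eqP; rewrite -subr_eq0 -cabs_eq0; apply/negPn/negP => nz.
set D := cabs _ in nz.
have D0 : 0 < D by rewrite lt_neqAle eq_sym nz cabs_ge0.
have e0 : 0 < D / (pi *+ 2) / 4 by rewrite !divr_gt0.
have [t t0 Ht] := dphi0 _ e0.
have [k Hk] : exists k, ln r - (pi *+ 2) *+ k < ln t.
  have [|ge] := ltP (ln r) (ln t); first by exists 0%N; rewrite mulr0n subr0.
  have ge0 : 0 <= (ln r - ln t) / (pi *+ 2).
    by apply: divr_ge0; [rewrite subr_ge0 | exact: ltW].
  exists (Num.Def.archi_bound ((ln r - ln t) / (pi *+ 2))).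
  have := archi_boundP ge0; rewrite ltr_pdivrMr// mulr_natl; lra.
set x := ln r - (pi *+ 2) *+ k in Hk.
have xr : x <= ln r by rewrite gerBl mulrn_wge0// ltW.
(* on a circle this small q is close to d0 *)
suff : D <= 2 * (D / (pi *+ 2) / 4) * (pi *+ 2 - 0).
  rewrite subr0 -mulrA mulrAC divfK; last by rewrite gt_eqF.
  lra.
rewrite {1}/D (Jiter k) -/x -[pi *+ 2 in X in _ - X]subr0 -cint_cst// -cintB//; last first.
- by apply: ccont_integrable => y _; exact: ccont_rder (rder_cst _ y).
- exact: Jint.
apply: cint_le; first exact: ltW.
  apply: cintegrableB; first exact: Jint.
  by apply: ccont_integrable => y _; exact: ccont_rder (rder_cst _ y).
move=> y _.
have ht : cabs (cexp (x +i* y)) < t.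
  by rewrite cabs_cexp /= -[ltRHS]lnK ?posrE// ltr_expR.
have := Ht _ ht; rewrite add0r => H.
have z0 : cexp (x +i* y) != 0 by rewrite -cabs_gt0 cabs_cexp expR_gt0.
rewrite -(ler_pM2r (_ : 0 < cabs (cexp (x +i* y)))) ?cabs_gt0//.
by rewrite -cabsM mulrBl /psi /q divfK.
Qed.

End CauchyFormula.

(** * Directional derivatives of holomorphic functions *)

Section VectorNorm.
Variables (R : realType) (m : nat).
Local Notation C := R[i].
Local Notation Cm := (Cvec R m).
Implicit Types (x y u v : Cm) (s : C).

Definition vnorm (x : Cm) : R := \sum_i cabs (x 0 i).

Lemma vnorm_ge0 x : 0 <= vnorm x.
Proof. by apply: sumr_ge0 => i _; exact: cabs_ge0. Qed.

Lemma vnormD x y : vnorm (x + y) <= vnorm x + vnorm y.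
Proof. by rewrite -big_split /=; apply: ler_sum => i _; rewrite mxE cabsD. Qed.

Lemma vnormZ s x : vnorm (s *: x) = cabs s * vnorm x.
Proof. by rewrite /vnorm mulr_sumr; apply: eq_bigr => i _; rewrite mxE cabsM. Qed.

Lemma vnorm_eq0 x : vnorm x = 0 -> x = 0.
Proof.
move=> /eqP; rewrite psumr_eq0 => [/allP H|i _]; last exact: cabs_ge0.
apply/rowP => i; rewrite mxE; apply/eqP; rewrite -cabs_eq0.
by apply: H; rewrite mem_index_enum.
Qed.

Lemma vnorm0 : vnorm 0 = 0.
Proof. by rewrite /vnorm big1// => i _; rewrite mxE cabs0. Qed.

Lemma gt0_complex (e : C) : 0 < e -> e = (complex.Re e)%:C /\ 0 < complex.Re e.
Proof. by case: e => a b; rewrite ltcE /= => /andP[/eqP -> ->]. Qed.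

Lemma nbhs_vnorm (A : set Cm) x : nbhs x A ->
  exists2 e, 0 < e & forall y, vnorm (y - x) < e -> A y.
Proof.
move=> /nbhs_ballP[e e0 He].
have [eR e1] := gt0_complex e0.
exists (complex.Re e) => // y Hy; apply: He; split=> // i j.
rewrite /ball /= eR cabsE ltcR cabsBC.
apply: le_lt_trans Hy; rewrite /vnorm (bigD1 j)//= (ord1 i).
by rewrite !mxE lerDl sumr_ge0// => k _; exact: cabs_ge0.
Qed.

Lemma near_vnorm x e : 0 < e -> \forall y \near x, vnorm (y - x) < e.
Proof.
move=> e0; apply/nbhs_ballP; exists (e / m.+1%:R)%:C.
  by rewrite /= ltcR divr_gt0.
move=> y Hy; apply: (@le_lt_trans _ _ (\sum_(i < m) e / m.+1%:R)).
  apply: ler_sum => i _; have := Hy.2 0 i; rewrite /ball /= cabsE ltcR cabsBC.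
  by rewrite !mxE => /ltW.
rewrite sumr_const card_ord -[_ *+ m]mulr_natr mulrAC ltr_pdivrMr// ltr_pM2l//.
by rewrite ltr_nat.
Qed.

End VectorNorm.

Section DirectionalDerivative.
Variables (R : realType) (m : nat).
Local Notation C := R[i].
Local Notation Cm := (Cvec R m).
Implicit Types (f : Cm -> C^o) (x y u v : Cm) (s d : C).

Lemma cder_shift (g : C -> C) s d :
  cder (fun t => g (s + t)) 0 d <-> cder g s d.
Proof.
by split=> H e e0; have [r r0 Hr] := H e e0; exists r => // h hr;
  have := Hr h hr; rewrite add0r addr0.
Qed.

Lemma cder_line f x u d :
  cder (fun s => f (x + s *: u)) 0 d <-> is_derive x u f d.
Proof.
have E (h : C) : h != 0 -> d - h^-1 *: (f (h *: u + x) - f x) =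
    - (h^-1 * (f (x + (0 + h) *: u) - f (x + 0 *: u) - d * h)).
  move=> h0; rewrite add0r scale0r addr0 (addrC x) /GRing.scale /=.
  by field.
split=> [H|[df dE] e e0].
  have Hc : (fun h : C^o => h^-1 *: ((f \o shift x) (h *: u) - f x)) @ 0^' --> (d : C^o).
    apply/cvgrPdist_le => e e0.
    have [eR e1] := gt0_complex e0.
    have [r r0 Hr] := H _ e1.
    rewrite near_withinE; exists r%:C; first by rewrite /= ltcR.
    move=> h; rewrite /ball_ /= sub0r normrN cabsE ltcR => hr h0.
    rewrite E// eR cabsE lecR cabsN cabsM cabsV.
    by rewrite mulrC ler_pdivrMr ?cabs_gt0// Hr.
  by split; [apply/cvg_ex; exists d | exact/cvg_lim].
have := df; rewrite /derivable => /cvg_ex[l Hl].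
have ld : l = d by rewrite -dE; apply/esym; exact/cvg_lim.
have e1 : 0 < e%:C :> C by rewrite ltcR.
move: Hl; rewrite ld => /cvgrPdist_le /(_ _ e1).
rewrite near_withinE => -[r /= r0 Hr].
have [rR r1] := gt0_complex r0; exists (complex.Re r) => //.
move=> h hr; have [->|h0] := eqVneq h 0.
  by rewrite addr0 mulr0 !subrr cabs0 mulr0.
have := Hr h; rewrite /ball_ /= sub0r normrN cabsE rR ltcR => /(_ hr h0).
rewrite E// cabsE lecR cabsN cabsM cabsV.
by rewrite mulrC ler_pdivrMr ?cabs_gt0.
Qed.

Lemma cder_derive f x u d : cder (fun s => f (x + s *: u)) 0 d -> 'D_u f x = d.
Proof. by move=> /cder_line[]. Qed.

Lemma cder_scale (g : C -> C) a d : cder g 0 d ->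
  cder (fun s => g (s * a)) 0 (d * a).
Proof.
move=> H; apply: cder_comp (_ : cder (fun s => s * a) 0 a) _; last by rewrite mul0r.
move=> e e0; exists 1 => // h _; rewrite (_ : _ - _ - _ = 0); last by ring.
by rewrite cabs0 mulr_ge0 ?cabs_ge0// ltW.
Qed.

(** The mean value inequality on the unit interval; the factor 2 comes from
    the separate use of the mean value theorem for real and imaginary parts. *)
Lemma rder_mvt (g : R -> C) (g' : R -> C) (K : R) :
  (forall t, 0 <= t <= 1 -> rder g t (g' t)) ->
  (forall t, 0 <= t <= 1 -> cabs (g' t) <= K) -> cabs (g 1 - g 0) <= 2 * K.
Proof.
move=> dg gK.
have real_mvt (h h' : R -> R) :
    (forall t, 0 <= t <= 1 -> is_derive (t : R^o) (1 : R^o) (h : R -> R^o) (h' t)) ->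
    (forall t, 0 <= t <= 1 -> `|h' t| <= K) -> `|h 1 - h 0| <= K.
  move=> dh hK; have [|||t t01 ->] := @MVT R h h' 0 1.
  - exact: ltr01.
  - by move=> t; rewrite in_itv /= => /andP[t0 t1]; apply: dh; rewrite !ltW.
  - apply: within_pointwise => t /dh[+ _].
    by move=> /derivable1_diffP/differentiable_continuous.
  rewrite subr0 mulr1 hK//; move: t01; rewrite in_itv /= => /andP[? ?].
  by rewrite !ltW.
have h1 : `|complex.Re (g 1) - complex.Re (g 0)| <= K.
  apply: (real_mvt (fun t => complex.Re (g t)) (fun t => complex.Re (g' t))) => t ht.
    by have /rderP[] := dg t ht.
  by apply: le_trans (gK t ht); exact: Re_le_cabs.
have h2 : `|complex.Im (g 1) - complex.Im (g 0)| <= K.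
  apply: (real_mvt (fun t => complex.Im (g t)) (fun t => complex.Im (g' t))) => t ht.
    by have /rderP[] := dg t ht.
  by apply: le_trans (gK t ht); exact: Im_le_cabs.
apply: (le_trans (cabs_le_ReIm _)).
move: h1 h2; case: (g 1) => a b; case: (g 0) => a' b' /=; lra.
Qed.

End DirectionalDerivative.

Section Holomorphy.
Variables (R : realType) (m : nat).
Local Notation C := R[i].
Local Notation Cm := (Cvec R m).
Implicit Types (x y z u v : Cm) (s d : C).
Variable M : set Cm.
Hypothesis openM : open M.

(** Holomorphy in the sense of Gateaux, with local boundedness; unlike complex
    differentiability, this notion passes directly to directional derivatives. *)
Definition hol (f : Cm -> C^o) :=
  (forall x u, M x -> derivable f x u) /\
  (forall x, M x -> exists B, \forall y \near x, cabs (f y) <= B).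

Lemma hol_cder f x u s : hol f -> M (x + s *: u) ->
  cder (fun t => f (x + t *: u)) s ('D_u f (x + s *: u)).
Proof.
move=> [df _] Mx; have /derivableP/cder_line H := df _ u Mx; apply/cder_shift.
rewrite (_ : (fun _ => _) = fun t => f (x + s *: u + t *: u))//.
by apply/funext => t; rewrite scalerDl addrA.
Qed.

Lemma hol_DZ f x u s : hol f -> M x -> 'D_(s *: u) f x = s * 'D_u f x.
Proof.
move=> [df _] Mx; have /derivableP/cder_line/(cder_scale s) H := df _ u Mx.
have E : (fun t => f (x + t *: (s *: u))) = (fun t => f (x + (t * s) *: u)).
  by apply/funext => t; rewrite scalerA.
by rewrite mulrC; apply: cder_derive; rewrite E.
Qed.

Section SmallBall.
Variables (f : Cm -> C^o) (z : Cm) (r B : R).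
Hypotheses (hf : hol f) (r0 : 0 < r).
Hypothesis ballM : forall y, vnorm (y - z) < r -> M y /\ cabs (f y) <= B.
Local Notation tp := ((pi *+ 2)%:C : C).

Lemma twopi_neq0 : tp != 0.
Proof. by rewrite (inj_eq (@complexI R) _ 0) gt_eqF// mulrn_wgt0// pi_gt0. Qed.

Lemma twopi_div (a b : C) : a = tp * b -> a / tp = b.
Proof. by move=> ->; rewrite mulrC mulKf// twopi_neq0. Qed.

Lemma taylor_diff (p q p' q' d d' w : C) :
  (p - q) - (p' - q') - w * (d - d') = (p - p' - w * d) - (q - q' - w * d').
Proof. ring. Qed.

Lemma twopi_gt0 : 0 < pi *+ 2 :> R. Proof. by rewrite mulrn_wgt0// pi_gt0. Qed.

Lemma bound_ge0 : 0 <= B.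
Proof.
have [|_] := @ballM z; first by rewrite subrr vnorm0.
by apply: le_trans; exact: cabs_ge0.
Qed.

Lemma vnorm_move y s u (a b : R) : vnorm (y - z) < a -> cabs s * vnorm u <= b ->
  vnorm (y + s *: u - z) < a + b :> R.
Proof.
move=> h1 h2; rewrite addrAC (le_lt_trans (vnormD _ _))// vnormZ.
exact: ltr_leD.
Qed.

(** Cauchy's formula on the unit circle of the complex line through y with
    direction u; the smallness of u stands for that of the radius. *)
Lemma D_cauchy y u : vnorm (y - z) < r / 2 -> vnorm u <= r / 4 ->
  cint (fun t => (f (y + expi t *: u) - f y) / expi t) 0 (pi *+ 2) =
  tp * 'D_u f y.
Proof.
move=> hy hu.
have inM s : cabs s < 2 -> M (y + s *: u).
  move=> hs; have [|//] := @ballM (y + s *: u).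
  rewrite [ltRHS](_ : r = r / 2 + 2 * (r / 4)); last by lra.
  by apply: vnorm_move => //; apply: ler_pM => //; [exact: cabs_ge0|exact: vnorm_ge0|exact: ltW].
have := @cauchy_center R (fun s => f (y + s *: u)) 2 1 ('D_u f y).
rewrite scale0r addr0 => <-//.
- by apply: eq_cint => t _; rewrite mul1r.
- by move=> s hs; exists ('D_u f (y + s *: u)); apply: hol_cder => //; exact: inM.
- have := @hol_cder f y u 0 hf; rewrite scale0r addr0; apply.
  by have := inM 0; rewrite scale0r addr0; apply; rewrite cabs0.
- by rewrite ltr1n.
Qed.

Lemma f_circle_ccont y u (t : R) : M (y + expi t *: u) ->
  ccont (fun x : R => f (y + expi x *: u)) t.
Proof.
move=> hM.
exact: ccont_rder (rder_comp (rder_expi t) (hol_cder (s := expi t) hf hM)).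
Qed.

Lemma expiV_ccont (t : R) : ccont (fun x : R => (expi x)^-1 : C) t.
Proof. exact: ccont_rder (rderV (rder_expi t) (expi_neq0 t)). Qed.

Lemma ccont_cst (a : C) (t : R) : ccont (fun=> a) t.
Proof. exact: ccont_rder (rder_cst a t). Qed.

(** The form in which Cauchy's formula bounds a derivative: a is the mean over
    the circle of g divided by the variable. *)
Lemma circle_le (g : R -> C) K (a : C) : (forall t, ccont g t) ->
  (forall t, cabs (g t) <= K) ->
  cint (fun t => g t / expi t) 0 (pi *+ 2) = tp * a -> cabs a <= 2 * K.
Proof.
move=> cg gK H.
have := @cint_le R (fun t => g t / expi t) 0 (pi *+ 2) K (ltW twopi_gt0).
rewrite H cabsM cabs_real ger0_norm; last by rewrite ltW// twopi_gt0.
rewrite subr0 mulrC ler_pM2r ?twopi_gt0//; apply.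
  by apply: ccont_integrable => t _; apply: ccontM => //; exact: expiV_ccont.
by move=> t _; rewrite cabsM cabsV cabs_expi invr1 mulr1.
Qed.

Lemma circle_inball y u (t a b : R) : vnorm (y - z) < a -> vnorm u <= b ->
  vnorm (y + expi t *: u - z) < a + b.
Proof. by move=> h1 h2; apply: vnorm_move => //; rewrite cabs_expi mul1r. Qed.

Lemma circle_diff_ccont y u (t : R) : M (y + expi t *: u) ->
  ccont (fun x : R => f (y + expi x *: u) - f y) t.
Proof. by move=> H; apply: ccontD; [exact: f_circle_ccont|exact: ccont_cst]. Qed.

(** Values of f at distance less than r from z are bounded by B, and those of
    its differences by 2 B. *)
Lemma D_le_small y u : vnorm (y - z) < r / 2 -> vnorm u <= r / 4 ->
  cabs ('D_u f y) <= 4 * B.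
Proof.
move=> hy hu; have inb t : vnorm (y + expi t *: u - z) < r.
  by apply: lt_trans (circle_inball t hy hu) _; move: r0; lra.
have [|_ fy] := @ballM y; first by apply: lt_trans hy _; move: r0; lra.
rewrite [leRHS](_ : _ = 2 * (B + B)); last by ring.
apply: circle_le (D_cauchy hy hu).
  by move=> t; apply: circle_diff_ccont; have [] := ballM (inb t).
by move=> t; apply: (le_trans (cabsB _ _)); apply: lerD => //; have [] := ballM (inb t).
Qed.

Definition lip_const := 16 * B / r.

Lemma lip_const_ge0 : 0 <= lip_const.
Proof. by rewrite divr_ge0 ?(ltW r0)// mulr_ge0// bound_ge0. Qed.

(** Complex homogeneity in u reduces an arbitrary u to one of length r / 4. *)
Lemma D_le y u : vnorm (y - z) < r / 2 -> cabs ('D_u f y) <= lip_const * vnorm u.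
Proof.
move=> hy; have [|My _] := @ballM y.
  by apply: lt_trans hy _; move: r0; lra.
have [u0|u0] := eqVneq (vnorm u) 0.
  rewrite u0 mulr0 (vnorm_eq0 u0) -(scale0r (0 : Cm)) hol_DZ// mul0r.
  by rewrite cabs0.
have un : 0 < vnorm u by rewrite lt_neqAle eq_sym u0 vnorm_ge0.
pose l := r / 4 / vnorm u.
have l0 : 0 < l by rewrite !divr_gt0.
have hl : vnorm (l%:C *: u) <= r / 4.
  by rewrite vnormZ cabs_real gtr0_norm// /l divfK.
have := D_le_small hy hl.
rewrite hol_DZ// cabsM cabs_real gtr0_norm// -ler_pdivlMl//.
move=> /le_trans; apply; rewrite /lip_const /l le_eqVlt; apply/orP; left; apply/eqP.
by field; rewrite u0 gt_eqF.
Qed.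

Lemma segment_inball y y' (a t : R) : vnorm (y - z) < a -> vnorm (y' - z) < a ->
  0 <= t <= 1 -> vnorm (y' + t%:C *: (y - y') - z) < a.
Proof.
move=> h1 h2 /andP[t0 t1].
have -> : y' + t%:C *: (y - y') - z = t%:C *: (y - z) + (1 - t)%:C *: (y' - z).
  by rewrite rmorphB scalerBl !scalerBr scale1r; apply/rowP => i; rewrite !mxE; ring.
apply: (le_lt_trans (vnormD _ _)); rewrite !vnormZ !cabs_real.
rewrite !ger0_norm ?subr_ge0//.
have [t1'|t1'] := ltP t 1.
  have : (1 - t) * vnorm (y' - z) < (1 - t) * a by rewrite ltr_pM2l// subr_gt0.
  have : t * vnorm (y - z) <= t * a by rewrite ler_wpM2l// ltW.
  lra.
have -> : t = 1 by apply/eqP; rewrite eq_le t1.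
by rewrite subrr mul0r addr0 mul1r.
Qed.

Lemma f_lip y y' : vnorm (y - z) < r / 2 -> vnorm (y' - z) < r / 2 ->
  cabs (f y - f y') <= 2 * (lip_const * vnorm (y - y')).
Proof.
move=> h1 h2; pose g (t : R) : C := f (y' + t%:C *: (y - y')).
have -> : f y - f y' = g 1 - g 0.
  by rewrite /g scale1r scale0r addr0 (addrC y') subrK.
have inb t : 0 <= t <= 1 -> vnorm (y' + t%:C *: (y - y') - z) < r / 2.
  exact: segment_inball.
apply: (rder_mvt (g' := fun t => 'D_(y - y') f (y' + t%:C *: (y - y')) * 1)) => t ht.
  apply: (rder_comp (g := fun l => f (y' + l *: (y - y'))) (rder_id t)); apply: hol_cder => //.
  have [] := @ballM (y' + t%:C *: (y - y')) => //.
  by apply: lt_trans (inb t ht) _; move: r0; lra.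
by rewrite mulr1; apply/D_le/inb.
Qed.

(** Cauchy's formula expresses the difference of the derivatives by differences
    of values of f, to which its Lipschitz estimate applies. *)
Lemma D_lip u y y' : vnorm u <= r / 4 ->
  vnorm (y - z) < r / 4 -> vnorm (y' - z) < r / 4 ->
  cabs ('D_u f y - 'D_u f y') <= 8 * (lip_const * vnorm (y - y')).
Proof.
move=> hu hy hy'.
have r42 x : vnorm (x - z) < r / 4 -> vnorm (x - z) < r / 2.
  by move=> h; apply: (lt_trans h); move: r0; lra.
have inb x t : vnorm (x - z) < r / 4 -> vnorm (x + expi t *: u - z) < r / 2.
  by move=> h; have := circle_inball t h hu; rewrite (_ : r / 4 + r / 4 = r / 2)//; lra.
have inM x t : vnorm (x - z) < r / 4 -> M (x + expi t *: u).
  move=> h; have [] := @ballM (x + expi t *: u) => //.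
  by apply: lt_trans (inb x t h) _; move: r0; lra.
rewrite [leRHS](_ : _ = 2 * (2 * (lip_const * vnorm (y - y')) + 2 * (lip_const * vnorm (y - y'))));
  last by ring.
apply: (@circle_le (fun t => (f (y + expi t *: u) - f y) - (f (y' + expi t *: u) - f y'))).
- move=> t; apply: ccontD; first exact/circle_diff_ccont/inM.
  rewrite (_ : (fun _ => _) = (fun x : R => (-1) * (f (y' + expi x *: u) - f y'))).
    by apply: ccontM; [exact: ccont_cst | exact/circle_diff_ccont/inM].
  by apply/funext => x; rewrite mulN1r.
- move=> t; rewrite (_ : _ - _ = (f (y + expi t *: u) - f (y' + expi t *: u)) -
    (f y - f y')); last by ring.
  apply: (le_trans (cabsB _ _)); apply: lerD; last by apply: f_lip; exact: r42.
  apply: le_trans (f_lip (inb _ t hy) (inb _ t hy')) _.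
  by rewrite (_ : _ - _ = y - y')//; apply/rowP => i; rewrite !mxE; ring.
have I1 x : vnorm (x - z) < r / 4 ->
    cintegrable (fun t : R => (f (x + expi t *: u) - f x) / expi t) 0 (pi *+ 2).
  move=> hx; apply: ccont_integrable => t _; apply: ccontM; last exact: expiV_ccont.
  exact/circle_diff_ccont/inM.
have E1 := D_cauchy (r42 _ hy) hu; have E2 := D_cauchy (r42 _ hy') hu.
rewrite mulrBr; have {E1 E2}<- := f_equal2 (fun a b : C => a - b) E1 E2.
have <- := cintB (I1 _ hy) (I1 _ hy').
by apply: eq_cint => t _; rewrite mulrBl.
Qed.

(** Along a complex line the remainder has derivative 'D_v f at the moving point
    minus 'D_v f y, which is of the order of s by the Lipschitz estimate for
    'D_v f. *)
Lemma D_taylor y v s : vnorm v <= r / 4 -> vnorm (y - z) < r / 8 ->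
  vnorm (s *: v) <= r / 8 ->
  cabs (f (y + s *: v) - f y - s * 'D_v f y) <=
    16 * lip_const * vnorm v * cabs s ^+ 2.
Proof.
move=> hv hy hs.
pose g (t : R) : C := f (y + t%:C *: (s *: v)) - t%:C * (s * 'D_v f y).
have -> : f (y + s *: v) - f y - s * 'D_v f y = g 1 - g 0.
  by rewrite /g scale1r scale0r addr0 mul0r subr0 mul1r addrAC.
have inb t : 0 <= t <= 1 -> vnorm (y + t%:C *: (s *: v) - z) < r / 4.
  move=> /andP[t0 t1]; rewrite (_ : r / 4 = r / 8 + r / 8); last by lra.
  apply: vnorm_move => //; rewrite cabs_real ger0_norm//.
  by apply: le_trans hs; apply: ler_piMl => //; exact: vnorm_ge0.
have yb : vnorm (y - z) < r / 4 by apply: lt_trans hy _; move: r0; lra.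
rewrite [leRHS](_ : _ = 2 * (8 * (lip_const * (cabs s * vnorm v)) * cabs s)); last by ring.
apply: (rder_mvt (g' := fun t =>
    'D_(s *: v) f (y + t%:C *: (s *: v)) * 1 - s * 'D_v f y)) => t ht.
  apply: rderB.
    apply: (rder_comp (g := fun l => f (y + l *: (s *: v))) (rder_id t)); apply: hol_cder => //.
    have [] := @ballM (y + t%:C *: (s *: v)) => //.
    by apply: lt_trans (inb t ht) _; move: r0; lra.
  have := rder_lin 0 (s * 'D_v f y) t; congr rder.
  by apply/funext => x; rewrite add0r.
have Mt : M (y + t%:C *: (s *: v)).
  have [] := @ballM (y + t%:C *: (s *: v)) => //.
  by apply: lt_trans (inb t ht) _; move: r0; lra.
rewrite mulr1 hol_DZ// -mulrBr cabsM mulrC ler_wpM2r ?cabs_ge0//.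
apply: le_trans (D_lip hv (inb t ht) yb) _.
rewrite ler_wpM2l// ler_wpM2l ?lip_const_ge0//.
rewrite addrAC subrr add0r vnormZ cabs_real vnormZ.
case/andP: ht => t0 t1; rewrite ger0_norm// ler_piMl//.
by rewrite mulr_ge0 ?cabs_ge0// vnorm_ge0.
Qed.

Lemma D_circle_ccont u v (t : R) : vnorm v <= r / 4 -> vnorm u <= r / 8 ->
  ccont (fun x : R => 'D_v f (z + expi x *: u)) t.
Proof.
move=> hv hu.
have zb (x : R) : vnorm (z + expi x *: u - z) < r / 4.
  rewrite addrAC subrr add0r vnormZ cabs_expi mul1r (le_lt_trans hu)//.
  by move: r0; lra.
have [A A0 [e e0 He]] := frechet_lip (rder_expi t) (rder_bounded _).
apply: (@ccont_lip _ _ _ (8 * (lip_const * (A * vnorm u))) e e0) => h /He hA.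
apply: le_trans (D_lip hv (zb _) (zb _)) _.
rewrite -mulrA ler_wpM2l// -mulrA ler_wpM2l ?lip_const_ge0//.
rewrite (_ : _ - _ = (expi (t + h) - expi t) *: u); last first.
  by rewrite scalerBl; apply/rowP => i; rewrite !mxE; ring.
by rewrite vnormZ mulrAC ler_wpM2r ?vnorm_ge0.
Qed.

(** Differentiation of Cauchy's formula for 'D_u f in the direction v. *)
Lemma D_D_small u v : vnorm u <= r / 16 -> vnorm v <= r / 16 ->
  cder (fun s => 'D_u f (z + s *: v)) 0
   (cint (fun t => ('D_v f (z + expi t *: u) - 'D_v f z) / expi t) 0 (pi *+ 2) / tp).
Proof.
move=> hu hv; set I := cint _ _ _.
have hu4 : vnorm u <= r / 4 by apply: le_trans hu _; move: r0; lra.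
have hv4 : vnorm v <= r / 4 by apply: le_trans hv _; move: r0; lra.
have hu8 : vnorm u <= r / 8 by apply: le_trans hu _; move: r0; lra.
have K0 : 0 <= lip_const * vnorm v by rewrite mulr_ge0 ?lip_const_ge0 ?vnorm_ge0.
move=> e e0; exists (Num.min 1 (e / (64 * (lip_const * vnorm v) + 1))).
  by rewrite lt_min ltr01 divr_gt0// ltr_wpDl// mulr_ge0.
move=> s; rewrite lt_min add0r scale0r addr0 => /andP[s1 s2].
have hsv : vnorm (s *: v) <= r / 16.
  rewrite vnormZ; apply: le_trans hv; apply: ler_piMl; [exact: vnorm_ge0|exact: ltW].
have hsv8 : vnorm (s *: v) <= r / 8 by apply: le_trans hsv _; move: r0; lra.
have z8 : vnorm (z - z) < r / 8 by rewrite subrr vnorm0 divr_gt0.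
have zu8 t : vnorm (z + expi t *: u - z) < r / 8.
  rewrite addrAC subrr add0r vnormZ cabs_expi mul1r (le_lt_trans hu)//.
  by move: r0; lra.
have z2 : vnorm (z - z) < r / 2 by rewrite subrr vnorm0 divr_gt0.
have zs2 : vnorm (z + s *: v - z) < r / 2.
  by rewrite addrAC subrr add0r (le_lt_trans hsv)//; move: r0; lra.
have Mzu t : M (z + expi t *: u).
  have [] := @ballM (z + expi t *: u) => //.
  by apply: lt_trans (zu8 t) _; move: r0; lra.
have Mzsu t : M (z + s *: v + expi t *: u).
  have [] := @ballM (z + s *: v + expi t *: u) => //.
  by apply: lt_le_trans (circle_inball t zs2 hu4) _; move: r0; lra.
(* a is the mean of this g, a difference of two Taylor remainders of order s ^ 2 *)
pose g (t : R) := (f (z + s *: v + expi t *: u) - f (z + s *: v)) -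
   (f (z + expi t *: u) - f z) - s * ('D_v f (z + expi t *: u) - 'D_v f z).
have cN (h : R -> C) (t : R) : ccont h t -> ccont (fun x : R => - h x) t.
  move=> H; rewrite (_ : (fun _ => _) = fun x : R => (-1) * h x).
    by apply: ccontM => //; exact: ccont_cst.
  by apply/funext => x; rewrite mulN1r.
have c1 t : ccont (fun t : R => f (z + s *: v + expi t *: u) - f (z + s *: v)) t.
  exact/circle_diff_ccont.
have c2 t : ccont (fun t : R => f (z + expi t *: u) - f z) t.
  exact/circle_diff_ccont.
have c3 t : ccont (fun t : R => 'D_v f (z + expi t *: u) - 'D_v f z) t.
  by apply: ccontD; [exact: D_circle_ccont | exact: ccont_cst].
have ciV (h : R -> C) : (forall t, ccont h t) ->
    cintegrable (fun t => h t / expi t) 0 (pi *+ 2).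
  by move=> ch; apply: ccont_integrable => t _; apply: ccontM => //; exact: expiV_ccont.
set a := _ - _ - _.
have aE : cint (fun t => g t / expi t) 0 (pi *+ 2) = tp * a.
  have E1 := D_cauchy zs2 hu4; have E2 := D_cauchy z2 hu4.
  have E3 : s * I = tp * (I / tp * s) by rewrite mulrA [tp * _]mulrC divfK ?twopi_neq0// mulrC.
  rewrite /a !mulrBr; have {E1 E2 E3}<- :=
    f_equal2 (fun a b : C => a - b) (f_equal2 (fun a b : C => a - b) E1 E2) E3.
  have <- := cintZ s (ciV _ c3); have <- := cintB (ciV _ c1) (ciV _ c2).
  have <- := cintB (cintegrableB (ciV _ c1) (ciV _ c2)) (cintegrableZ s (ciV _ c3)).
  apply: eq_cint => t _; rewrite /g [LHS]mulrBl; congr (_ - _).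
    exact: mulrBl.
  by rewrite mulrA.
have gc t : ccont g t.
  apply: ccontD; first by apply: ccontD => //; exact: cN.
  by apply: cN; apply: ccontM => //; exact: ccont_cst.
have gle t : cabs (g t) <= 32 * (lip_const * vnorm v) * cabs s ^+ 2.
  have -> : g t =
    (f (z + expi t *: u + s *: v) - f (z + expi t *: u) - s * 'D_v f (z + expi t *: u)) -
    (f (z + s *: v) - f z - s * 'D_v f z).
    by rewrite /g (addrAC z); exact: taylor_diff.
  have := D_taylor hv4 (zu8 t) hsv8; have := D_taylor hv4 z8 hsv8.
  move=> h1 h2; apply: (le_trans (cabsB _ _)); apply: (le_trans (lerD h2 h1)).
  by rewrite le_eqVlt; apply/orP; left; apply/eqP; ring.
have := circle_le gc gle aE.
move=> /le_trans; apply.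
rewrite ltr_pdivlMr in s2; last by rewrite ltr_wpDl// mulr_ge0.
have sq : cabs s * (cabs s * (64 * (lip_const * vnorm v) + 1)) <= cabs s * e.
  by rewrite ler_wpM2l ?cabs_ge0// ltW.
have := cabs_ge0 s; rewrite expr2.
have : 0 <= cabs s * cabs s by rewrite mulr_ge0// cabs_ge0.
move: sq; lra.
Qed.

End SmallBall.

Lemma hol_ball f z : hol f -> M z -> exists r B, 0 < r /\
  forall y, vnorm (y - z) < r -> M y /\ cabs (f y) <= B.
Proof.
move=> [_ bf] Mz; have [B HB] := bf z Mz.
have HM : \forall y \near z, M y by exact: open_nbhs_nbhs.
have [r r0 Hr] := nbhs_vnorm (filterI HM HB).
by exists r, B.
Qed.

Lemma small_multiple u (a : R) : 0 < a ->
  exists2 l : C, l != 0 & vnorm (l *: u) <= a.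
Proof.
move=> a0; have k0 : 0 < vnorm u + 1 by have := vnorm_ge0 u; lra.
have l0 : 0 < a / (vnorm u + 1) by rewrite divr_gt0.
exists (a / (vnorm u + 1))%:C.
  by rewrite -cabs_gt0 cabs_real normr_gt0 gt_eqF.
rewrite vnormZ cabs_real gtr0_norm// mulrAC ler_pdivrMr// ler_wpM2l ?ltW//.
by lra.
Qed.

Lemma line_inball x u (a : R) : 0 < a -> exists2 e : R, 0 < e &
  forall s, cabs s < e -> vnorm (x + s *: u - x) < a.
Proof.
move=> a0; have k0 : 0 < vnorm u + 1 by have := vnorm_ge0 u; lra.
exists (a / (vnorm u + 1)); first by rewrite divr_gt0.
move=> s; rewrite ltr_pdivlMr// addrAC subrr add0r vnormZ => hs.
by have := cabs_ge0 s; lra.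
Qed.

(** Rescaling u and v by nonzero complex numbers makes them small enough for
    the differentiation of Cauchy's formula. *)
Lemma hol_D_cder f x u v : hol f -> M x ->
  exists d, cder (fun s => 'D_u f (x + s *: v)) 0 d.
Proof.
move=> hf Mx; have [r [B [r0 Hr]]] := hol_ball hf Mx.
have r160 : 0 < r / 16 by lra.
have [a a0 ha] := small_multiple u r160.
have [b b0 hb] := small_multiple v r160.
have := D_D_small hf r0 Hr ha hb; set d := (_ / _) => /(cder_scale b^-1) H.
have := frechetZ (@cabs_ge0 R) a^-1 H => H2.
exists (a^-1 * (d * b^-1)).
have [e e0 He] := line_inball x v r0.
apply: (@cder_near R (fun s => a^-1 * 'D_(a *: u) f (x + (s * b^-1) *: (b *: v))) _ _ _ e0).
  by apply: (eq_frechet H2) => h; rewrite mulrA.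
move=> s; rewrite subr0 => hs.
rewrite scalerA divfK// hol_DZ//; first by rewrite mulKf.
by have [] := Hr _ (He s hs).
Qed.

Lemma hol_D f u : hol f -> hol (fun y => 'D_u f y).
Proof.
move=> hf; split=> [x v Mx|x Mx].
  by have [d /(@cder_line _ _ (fun y => 'D_u f y))[]] := hol_D_cder u v hf Mx.
have [r [B [r0 Hr]]] := hol_ball hf Mx.
exists (lip_const r B * vnorm u).
have r20 : 0 < r / 2 by lra.
apply: filterS (near_vnorm x r20) => y hy; exact: (D_le hf r0 Hr).
Qed.

(** Mixed directional derivatives agree, since Cauchy's formula expresses both
    by the same integral. *)
Lemma hol_D_sym f u v x : hol f -> M x ->
  'D_v (fun y => 'D_u f y) x = 'D_u (fun y => 'D_v f y) x.
Proof.
move=> hf Mx; have [r [B [r0 Hr]]] := hol_ball hf Mx.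
have hu := hol_D u hf; have hv := hol_D v hf.
have r160 : 0 < r / 16 by lra.
have [a a0 ha] := small_multiple u r160.
have [b b0 hb] := small_multiple v r160.
have inM s : cabs s < 2 -> M (x + s *: (a *: u)).
  move=> hs; have [] := Hr (x + s *: (a *: u)) => //.
  rewrite addrAC subrr add0r vnormZ.
  rewrite (@le_lt_trans _ _ (2 * (r / 16)))//; last by move: r0; lra.
  by apply: ler_pM => //; [exact: cabs_ge0 | exact: vnorm_ge0 | exact: ltW].
have hbv := hol_D (b *: v) hf.
have Hl := @cder_derive _ _ (fun y => 'D_(a *: u) f y) _ _ _ (D_D_small hf r0 Hr ha hb).
have Hs : 'D_(b *: v) (fun y => 'D_(a *: u) f y) x =
          'D_(a *: u) (fun y => 'D_(b *: v) f y) x.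
  apply: (etrans Hl); have := @cauchy_center R
    (fun s => 'D_(b *: v) f (x + s *: (a *: u))) 2 1
    ('D_(a *: u) (fun y => 'D_(b *: v) f y) x).
  rewrite scale0r addr0 => H.
  have h1 s : cabs s < 2 ->
      exists d, cder (fun s0 => 'D_(b *: v) f (x + s0 *: (a *: u))) s d.
    by move=> hs; eexists; apply: (hol_cder hbv); exact: inM.
  have h2 : cder (fun s => 'D_(b *: v) f (x + s *: (a *: u))) 0
      ('D_(a *: u) (fun y => 'D_(b *: v) f y) x).
    have := @hol_cder _ x (a *: u) 0 hbv; rewrite scale0r addr0; exact.
  have {}H := H h1 h2 ltr01 (_ : 1 < 2).
  have E : cint (fun t : R => ('D_(b *: v) f (x + expi t *: (a *: u)) -
      'D_(b *: v) f x) / expi t) 0 (pi *+ 2) =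
      (pi *+ 2)%:C * 'D_(a *: u) (fun y => 'D_(b *: v) f y) x.
    by rewrite -H ?ltr1n//; apply: eq_cint => t _; rewrite mul1r.
  exact: twopi_div E.
have scaleD (w1 w2 : Cm) (p q : C) :
    'D_(p *: w1) (fun y => 'D_(q *: w2) f y) x =
    p * (q * 'D_w1 (fun y => 'D_w2 f y) x).
  apply: (etrans (@hol_DZ (fun y => 'D_(q *: w2) f y) x w1 p (hol_D _ hf) Mx)).
  congr (_ * _).
  apply: (@cder_derive _ _ (fun y => 'D_(q *: w2) f y)).
  have := @hol_cder _ x w1 0 (hol_D w2 hf); rewrite scale0r addr0 => /(_ Mx) H0.
  have := frechetZ (@cabs_ge0 R) q H0 => H2.
  have [e e0 He] := line_inball x w1 r0.
  apply: (@cder_near _ (fun s => q * 'D_w2 f (x + s *: w1)) _ _ _ e0).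
    by apply: (eq_frechet H2) => h; rewrite mulrA.
  move=> s; rewrite subr0 => hs; have [Ms _] := Hr _ (He s hs).
  exact: (esym (hol_DZ w2 q hf Ms)).
have := etrans (etrans (esym (scaleD v u b a)) Hs) (scaleD u v a b).
by rewrite mulrCA => /(mulfI a0)/(mulfI b0).
Qed.

End Holomorphy.

(** * The prepotential *)

Section Directional.
Variables (R : realType) (m : nat) (M : set (Cvec R m)).
Local Notation C := R[i].
Local Notation Cm := (Cvec R m).
Hypothesis openM : open M.
Implicit Types (f g : Cm -> C^o) (x u v : Cm).

Lemma cder_rder (f : C -> C) d : cder f 0 d -> rder (fun t => f t%:C) 0 d.
Proof. by move=> H; have := rder_comp (rder_id 0) H; rewrite mulr1. Qed.

Lemma cder_uniq (f : C -> C) d d' : cder f 0 d -> cder f 0 d' -> d = d'.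
Proof. by move=> /cder_rder H /cder_rder; exact: rder_uniq. Qed.

Lemma near_line x u : M x -> exists2 e : R, 0 < e &
  forall s : C, cabs s < e -> M (x + s *: u).
Proof.
move=> Mx; have HM : \forall y \near x, M y by exact: open_nbhs_nbhs.
have [r r0 Hr] := nbhs_vnorm HM.
have [e e0 He] := line_inball x u r0.
by exists e => // s /He; exact: Hr.
Qed.

Lemma near_segment x u : M x -> exists2 e : R, 0 < e &
  forall t : R, `|t| < e -> M (x + t%:C *: u).
Proof.
move=> /(near_line u)[e e0 He]; exists e => // t ht.
by apply: He; rewrite cabs_real.
Qed.

Lemma hol_cder0 f x u : hol M f -> M x ->
  cder (fun s => f (x + s *: u)) 0 ('D_u f x).
Proof.
move=> hf Mx; have := @hol_cder _ _ M f x u 0 hf.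
by rewrite scale0r addr0; exact.
Qed.

Lemma cder_local (f g : C -> C) d e : 0 < e ->
  (forall s, cabs s < e -> f s = g s) -> cder f 0 d -> cder g 0 d.
Proof.
by move=> e0 fg H; apply: (cder_near e0 H) => s; rewrite subr0; exact: fg.
Qed.

Lemma rder_local (f g : R -> C) d e : 0 < e ->
  (forall t, `|t| < e -> f t = g t) -> rder f 0 d -> rder g 0 d.
Proof.
move=> e0 fg; apply: (frechet_near e0).
  by move=> h he; rewrite fg// add0r.
by apply: fg; rewrite normr0.
Qed.

Lemma cderZ (f : C -> C) d a : cder f 0 d -> cder (fun s => a * f s) 0 (a * d).
Proof.
by move=> H; apply: (eq_frechet (frechetZ (@cabs_ge0 R) a H)) => h; rewrite mulrA.
Qed.

(** A homogeneous function of degree k, for which a = l ^ k, has derivatives that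
    are homogeneous of degree k - 1. *)
Lemma D_homogeneous f (l a : C) x u : hol M f -> l != 0 ->
  (forall y, M y -> M (l *: y)) -> (forall y, M y -> f (l *: y) = a * f y) ->
  M x -> 'D_u f (l *: x) = a / l * 'D_u f x.
Proof.
move=> hf l0 Ml fl Mx; apply: cder_derive.
have H := cderZ a (cder_scale l^-1 (hol_cder0 u hf Mx)).
rewrite (_ : a / l * _ = a * ('D_u f x * l^-1)); last by rewrite mulrAC mulrA.
have [e e0 He] := near_line (l^-1 *: u) Mx.
apply: cder_local e0 _ H => s hs; rewrite -fl.
  by rewrite scalerDr scalerA mulrC mulrVK ?unitfE.
by rewrite -scalerA; exact: He.
Qed.

Lemma differentiable_hol f : (forall x, M x -> differentiable f x) -> hol M f.
Proof.
move=> df; split=> [x u Mx|x Mx]; first exact/diff_derivable/df.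
have cf := differentiable_continuous (df x Mx).
exists (cabs (f x) + 1).
have /cvgrPdist_lt := cf => /(_ 1 ltr01); apply: filterS => y.
rewrite cabsE (_ : 1 = 1%:C :> C)// ltcR => h.
by have := cabsD (f y - f x) (f x); rewrite subrK cabsBC; lra.
Qed.

Lemma D_linear f x u : differentiable f x ->
  'D_u f x = \sum_j u 0 j * 'D_(delta_mx 0 j) f x.
Proof.
move=> df; rewrite deriveE// {1}(row_sum_delta u) linear_sum.
by apply: eq_bigr => j _; rewrite linearZ deriveE.
Qed.

End Directional.

Section Prepotential.
Variables (R : realType) (n : nat) (M : set (Cvec R n.+1)).
Variable F : Cvec R n.+1 -> R[i]^o.
Local Notation C := R[i].
Local Notation Cn := (Cvec R n.+1).
Hypothesis hM : CASK_domain M F.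

Let openM : open M := cask_open hM.

Lemma F_hol : hol M F.
Proof. by apply: differentiable_hol => x; exact: cask_holomorphic. Qed.

Lemma w_hol i : hol M (w F i).
Proof. exact: (hol_D openM (delta_mx 0 i) F_hol). Qed.

Lemma tau_hol i j : hol M (tau F i j).
Proof. exact: (hol_D openM (delta_mx 0 i) (w_hol j)). Qed.

Lemma tau_sym i j z : M z -> tau F i j z = tau F j i z.
Proof. by move=> Mz; exact: (hol_D_sym openM _ _ F_hol Mz). Qed.

Lemma w_cder i z u : M z ->
  cder (fun s => w F i (z + s *: u)) 0 (\sum_j tau F i j z * u 0 j).
Proof.
move=> Mz; have H := hol_cder0 u (w_hol i) Mz.
suff E : 'D_u (w F i : Cn -> C^o) z = \sum_j tau F i j z * u 0 j by move: H; rewrite E.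
apply: (etrans (hol_D_sym openM _ _ F_hol Mz)).
apply: (@cder_derive _ _ (fun y => 'D_u F y)).
have H2 : cder (fun s => \sum_j u 0 j * w F j (z + s *: delta_mx 0 i)) 0
    (\sum_j tau F i j z * u 0 j).
  have H1 j : predT j -> cder (fun s => u 0 j * w F j (z + s *: delta_mx 0 i)) 0
      (u 0 j * tau F i j z).
    by move=> _; exact: cderZ (u 0 j) (hol_cder0 (delta_mx 0 i) (w_hol j) Mz).
  apply: (eq_frechet (frechet_sum (@cabs_ge0 R) (index_enum _) H1)) => h.
  by rewrite mulr_suml; apply: eq_bigr => j _; rewrite [u 0 j * _]mulrC.
have [e e0 He] := near_line openM (delta_mx 0 i) Mz.
apply: (cder_local e0 _ H2) => s /He Ms.
by rewrite D_linear//; exact: (cask_holomorphic hM).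
Qed.

(** Only one complex derivative of the prepotential is assumed; that its second
    derivatives tau are again differentiable is the regularity theorem for
    holomorphic functions. *)
Lemma tau_cder i j z u : M z -> exists d,
  cder (fun s => tau F i j (z + s *: u)) 0 d.
Proof.
by move=> Mz; exists ('D_u (tau F i j : Cn -> C^o) z); exact: (hol_cder0 u (tau_hol i j) Mz).
Qed.

Lemma w_homogeneous i l z : l != 0 -> M z -> w F i (l *: z) = l * w F i z.
Proof.
move=> l0 Mz.
apply: (etrans (D_homogeneous openM (a := l ^+ 2) (delta_mx 0 i) F_hol l0 _ _ Mz)).
- by move=> y; exact: (cask_scale hM).
- by move=> y; exact: (cask_homogeneous hM).
- by rewrite expr2 mulfK.
Qed.

Lemma tau_homogeneous i j l z : l != 0 -> M z -> tau F i j (l *: z) = tau F i j z.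
Proof.
move=> l0 Mz.
apply: (etrans (D_homogeneous openM (a := l) (delta_mx 0 i) (w_hol j) l0 _ _ Mz)).
- by move=> y; exact: (cask_scale hM).
- by move=> y; exact: w_homogeneous.
- by rewrite divff// mul1r.
Qed.

(** Euler's relation for w_i, which is homogeneous of degree 1. *)
Lemma w_euler i z : M z -> w F i z = \sum_j tau F i j z * z 0 j.
Proof.
move=> Mz; apply: cder_uniq (w_cder i z Mz).
have H : cder (fun s : C => w F i z + s * w F i z) 0 (w F i z).
  move=> e e0; exists 1 => // h _; rewrite (_ : _ - _ - _ = 0); last by ring.
  by rewrite cabs0 mulr_ge0 ?cabs_ge0// ltW.
apply: (cder_local ltr01 _ H) => s hs.
have s1 : 1 + s != 0.
  apply/eqP => /eqP; rewrite addrC addr_eq0 => /eqP s1.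
  by move: hs; rewrite s1 cabsN cabs1 ltxx.
have -> : z + s *: z = (1 + s) *: z by rewrite scalerDl scale1r.
rewrite w_homogeneous//.
by rewrite mulrDl mul1r.
Qed.

Lemma w_rder i z u : M z ->
  rder (fun t => w F i (z + t%:C *: u)) 0 (\sum_j tau F i j z * u 0 j).
Proof. by move=> Mz; exact: (cder_rder (w_cder i u Mz)). Qed.

End Prepotential.

(** * Unordered sums *)

Section RealSums.
Variables (R : realType) (T : choiceType).
Implicit Types (D : set T) (a b : T -> R).

Definition rsummable D a := (\esum_(x in D) (`|a x|)%:E < +oo)%E.

Lemma rsummableE D a : rsummable D a = summable D (EFin \o a).
Proof. by []. Qed.

Lemma eq_rsum D a b : (forall x, D x -> a x = b x) -> rsum D a = rsum D b.
Proof.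
move=> ab; rewrite /rsum; congr fine; congr (_ - _)%E; apply: eq_esum => x Dx.
  by rewrite !funeposE ab.
by rewrite !funenegE ab.
Qed.

Lemma le_rsummable D a b : (forall x, D x -> `|a x| <= `|b x|) ->
  rsummable D b -> rsummable D a.
Proof.
by move=> ab; apply: le_lt_trans; apply: le_esum => x Dx; rewrite lee_fin ab.
Qed.

Lemma esum_fine D a : (forall x, D x -> 0 <= a x) -> rsummable D a ->
  (\esum_(x in D) (a x)%:E = (fine (\esum_(x in D) (a x)%:E))%:E)%E.
Proof.
move=> a0; rewrite rsummableE summableE => /fineK; rewrite -/(esum _ _).
have -> // : (\esum_(x in D) `|(EFin \o a) x| = \esum_(x in D) (a x)%:E)%E.
by apply: eq_esum => x Dx /=; rewrite ger0_norm// a0.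
Qed.

Lemma rsumB_fine D a b : (forall x, D x -> 0 <= a x) -> (forall x, D x -> 0 <= b x) ->
  rsummable D a -> rsummable D b ->
  rsum D (fun x => a x - b x) =
  fine (\esum_(x in D) (a x)%:E)%E - fine (\esum_(x in D) (b x)%:E)%E.
Proof.
move=> a0 b0 sa sb; rewrite /rsum.
rewrite (esumB (f := EFin \o a) (g := EFin \o b))//.
by rewrite (esum_fine a0 sa) (esum_fine b0 sb).
Qed.

Lemma rsum_ge0E D a : (forall x, D x -> 0 <= a x) -> rsummable D a ->
  rsum D a = fine (\esum_(x in D) (a x)%:E)%E.
Proof.
move=> a0 sa; rewrite (eq_rsum (b := fun x => a x - (fun=> 0) x)); last first.
  by move=> x _; rewrite subr0.
have s0 : rsummable D (fun=> 0) by rewrite /rsummable esum1// => x _; rewrite normr0.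
rewrite (rsumB_fine a0 _ sa s0)// [X in _ - fine X](_ : _ = 0%E) ?subr0//.
exact: esum1.
Qed.

Lemma esum_rsum D a : (forall x, D x -> 0 <= a x) -> rsummable D a ->
  (\esum_(x in D) (a x)%:E = (rsum D a)%:E)%E.
Proof. by move=> a0 sa; rewrite (esum_fine a0 sa) -rsum_ge0E. Qed.

Lemma rsummableD D a b : rsummable D a -> rsummable D b ->
  rsummable D (fun x => a x + b x).
Proof.
rewrite !rsummableE => sa sb.
exact: (summableD (f := EFin \o a) (g := EFin \o b)).
Qed.

Lemma rsummableN D a : rsummable D a -> rsummable D (fun x => - a x).
Proof. by apply: le_rsummable => x _; rewrite normrN. Qed.

Lemma rsummable_norm D a : rsummable D a -> rsummable D (fun x => `|a x|).
Proof. by apply: le_rsummable => x _; rewrite normr_id. Qed.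

Lemma rsumD_ge0 D a b : (forall x, D x -> 0 <= a x) -> (forall x, D x -> 0 <= b x) ->
  rsummable D a -> rsummable D b ->
  rsum D (fun x => a x + b x) = rsum D a + rsum D b.
Proof.
move=> a0 b0 sa sb; have ab0 x : D x -> 0 <= a x + b x.
  by move=> Dx; rewrite addr_ge0 ?a0 ?b0.
apply: EFin_inj; rewrite EFinD -!esum_rsum//; last exact: rsummableD.
by rewrite -esumD.
Qed.

Lemma rsumB_ge0 D a b : (forall x, D x -> 0 <= a x) -> (forall x, D x -> 0 <= b x) ->
  rsummable D a -> rsummable D b ->
  rsum D (fun x => a x - b x) = rsum D a - rsum D b.
Proof. by move=> a0 b0 sa sb; rewrite rsumB_fine// !rsum_ge0E. Qed.

(** The sum of a family is defined through its positive and negative parts. *)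
Definition rpos a x := Num.max (a x) 0.
Definition rneg a x := Num.max (- a x) 0.

Lemma rpos_ge0 a x : 0 <= rpos a x. Proof. by rewrite /rpos le_max lexx orbT. Qed.
Lemma rneg_ge0 a x : 0 <= rneg a x. Proof. by rewrite /rneg le_max lexx orbT. Qed.

Lemma rposneg a x : a x = rpos a x - rneg a x.
Proof.
rewrite /rpos /rneg; have [h|h] := leP (a x) 0.
  by rewrite max_l ?oppr_ge0// sub0r opprK.
by rewrite max_r ?oppr_le0 ?ltW// subr0.
Qed.

Lemma rpos_le_norm a x : rpos a x <= `|a x|.
Proof. by rewrite /rpos ge_max normr_ge0 ler_norm. Qed.

Lemma rneg_le_norm a x : rneg a x <= `|a x|.
Proof. by rewrite /rneg ge_max normr_ge0 -normrN ler_norm. Qed.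

Lemma rsummable_pos D a : rsummable D a -> rsummable D (rpos a).
Proof. by apply: le_rsummable => x _; rewrite ger0_norm ?rpos_ge0// rpos_le_norm. Qed.

Lemma rsummable_neg D a : rsummable D a -> rsummable D (rneg a).
Proof. by apply: le_rsummable => x _; rewrite ger0_norm ?rneg_ge0// rneg_le_norm. Qed.

Lemma rsum_posneg D a : rsummable D a ->
  rsum D a = rsum D (rpos a) - rsum D (rneg a).
Proof.
move=> sa; rewrite -rsumB_ge0//.
- by apply: eq_rsum => x _; rewrite -rposneg.
- by move=> x _; exact: rpos_ge0.
- by move=> x _; exact: rneg_ge0.
- exact: rsummable_pos.
- exact: rsummable_neg.
Qed.

Lemma rsumN D a : rsummable D a -> rsum D (fun x => - a x) = - rsum D a.
Proof.
move=> sa; rewrite (rsum_posneg sa) opprB -rsumB_ge0//.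
- by apply: eq_rsum => x _; rewrite {1}(rposneg a x) opprB.
- by move=> x _; exact: rneg_ge0.
- by move=> x _; exact: rpos_ge0.
- exact: rsummable_neg.
- exact: rsummable_pos.
Qed.

Lemma rsumD D a b : rsummable D a -> rsummable D b ->
  rsum D (fun x => a x + b x) = rsum D a + rsum D b.
Proof.
move=> sa sb.
rewrite (eq_rsum (b := fun x => (rpos a x + rpos b x) - (rneg a x + rneg b x))).
  have pa x (_ : D x) := rpos_ge0 a x; have pb x (_ : D x) := rpos_ge0 b x.
  have na x (_ : D x) := rneg_ge0 a x; have nb x (_ : D x) := rneg_ge0 b x.
  have spa := rsummable_pos sa; have spb := rsummable_pos sb.
  have sna := rsummable_neg sa; have snb := rsummable_neg sb.
  rewrite (rsumB_ge0 _ _ (rsummableD spa spb) (rsummableD sna snb)); last 2 first.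
  - by move=> x Dx; rewrite addr_ge0 ?pa ?pb.
  - by move=> x Dx; rewrite addr_ge0 ?na ?nb.
  rewrite (rsumD_ge0 pa pb spa spb) (rsumD_ge0 na nb sna snb).
  by rewrite (rsum_posneg sa) (rsum_posneg sb) opprD addrACA.
by move=> x _; rewrite {1}(rposneg a x) {1}(rposneg b x); ring.
Qed.

Lemma esumZ_le D a k : 0 < k -> (forall x, D x -> 0 <= a x) ->
  (\esum_(x in D) (k * a x)%:E <= k%:E * \esum_(x in D) (a x)%:E)%E.
Proof.
move=> k0 a0; apply: ge_ereal_sup => _ [X [fX XD] <-].
have H0 : (0 <= \esum_(x in D) (a x)%:E)%E by apply: esum_ge0.
rewrite fsbig_finite//= sumEFin -mulr_sumr EFinM -sumEFin -fsbig_finite//.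
apply: lee_wpmul2l; first by rewrite lee_fin ltW.
by apply: esum_ge; exists X.
Qed.

Lemma rsummableZ D a k : rsummable D a -> rsummable D (fun x => k * a x).
Proof.
move=> sa; have k0 : 0 < `|k| + 1 by have := normr_ge0 k; lra.
apply: (@le_rsummable _ _ (fun x => (`|k| + 1) * `|a x|)).
  by move=> x _; rewrite !normrM normr_id ler_wpM2r// [leRHS]ger0_norm ?(ltW k0)// lerDl.
rewrite /rsummable; under eq_esum do rewrite normrM normr_id ger0_norm ?(ltW k0)//.
apply: (le_lt_trans (esumZ_le k0 _)) => //.
by rewrite lte_mul_pinfty// lee_fin ltW.
Qed.

Lemma rsumZ_gt0 D a k : 0 < k -> (forall x, D x -> 0 <= a x) -> rsummable D a ->
  rsum D (fun x => k * a x) = k * rsum D a.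
Proof.
move=> k0 a0 sa; have ka0 x : D x -> 0 <= k * a x.
  by move=> Dx; rewrite mulr_ge0 ?a0// ltW.
apply: EFin_inj; rewrite EFinM -!esum_rsum//; last exact: rsummableZ.
apply/eqP; rewrite eq_le esumZ_le//=.
rewrite -lee_pdivlMl//; apply: le_trans (esumZ_le _ _) => //; last by rewrite invr_gt0.
by apply: le_esum => x Dx; rewrite mulKf// gt_eqF.
Qed.

Lemma rsumZ D a k : rsummable D a -> rsum D (fun x => k * a x) = k * rsum D a.
Proof.
have pos l b : 0 < l -> rsummable D b -> rsum D (fun x => l * b x) = l * rsum D b.
  move=> l0 sb; rewrite (eq_rsum (b := fun x => l * rpos b x - l * rneg b x)).
    have pb x (_ : D x) := rpos_ge0 b x; have nb x (_ : D x) := rneg_ge0 b x.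
    have spb := rsummable_pos sb; have snb := rsummable_neg sb.
    rewrite (rsumB_ge0 _ _ (rsummableZ l spb) (rsummableZ l snb)); last 2 first.
    - by move=> x Dx; rewrite mulr_ge0 ?pb ?ltW.
    - by move=> x Dx; rewrite mulr_ge0 ?nb ?ltW.
    rewrite (rsumZ_gt0 l0 pb spb) (rsumZ_gt0 l0 nb snb).
    by rewrite -mulrBr -rsum_posneg.
  by move=> x _; rewrite {1}(rposneg b x) mulrBr.
move=> sa; case: (ltgtP k 0) => [k0|k0|->].
- rewrite (eq_rsum (b := fun x => - (- k * a x))); last by move=> x _; ring.
  rewrite rsumN; last exact: rsummableZ.
  rewrite pos//; [ring|lra].
- exact: pos.
- rewrite mul0r (eq_rsum (b := fun=> 0 - 0)); last by move=> x _; rewrite mul0r subr0.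
  have s0 : rsummable D (fun=> 0) by rewrite /rsummable esum1// => x _; rewrite normr0.
  by rewrite rsumB_fine// subrr.
Qed.

Lemma ler_rsum D a b : rsummable D a -> rsummable D b ->
  (forall x, D x -> a x <= b x) -> rsum D a <= rsum D b.
Proof.
move=> sa sb ab; rewrite -subr_ge0 -(rsumN sa) -rsumD//; last exact: rsummableN.
have s0 x : D x -> 0 <= b x - a x by move=> /ab; rewrite subr_ge0.
rewrite rsum_ge0E//; last by apply: rsummableD => //; exact: rsummableN.
by apply: fine_ge0; apply: esum_ge0.
Qed.

Lemma rsum_norm D a : rsummable D a -> `|rsum D a| <= rsum D (fun x => `|a x|).
Proof.
move=> sa; rewrite ler_norml; apply/andP; split.
  rewrite lerNl -rsumN//; apply: ler_rsum.
  - exact: rsummableN.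
  - exact: rsummable_norm.
  - by move=> x _; rewrite -normrN ler_norm.
apply: ler_rsum => //; first exact: rsummable_norm.
by move=> x _; exact: ler_norm.
Qed.

Lemma reindex_rsum (D D' : set T) (e : T -> T) a : set_bij D D' e ->
  rsum D' a = rsum D (fun x => a (e x)).
Proof.
move=> be; rewrite /rsum; congr (fine (_ - _)%E).
  by rewrite (@reindex_esum R T T D D' e _ be); apply: eq_esum => x _; rewrite !funeposE.
by rewrite (@reindex_esum R T T D D' e _ be); apply: eq_esum => x _; rewrite !funenegE.
Qed.

(** A finite set that carries the sum of m up to e does so for every family
    that m dominates; this uniformity is what termwise differentiation
    needs. *)
Lemma rsum_tail D m e : (forall x, D x -> 0 <= m x) -> rsummable D m -> 0 < e ->
  exists2 s : seq T, {in s, forall x, D x} & forall b,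
    (forall x, D x -> 0 <= b x <= m x) -> rsum D b <= \sum_(x <- s) b x + e.
Proof.
move=> m0 sm e0.
have : (\esum_(x in D) (m x)%:E - e%:E < \esum_(x in D) (m x)%:E)%E.
  by rewrite esum_rsum// -EFinB lte_fin; lra.
rewrite {2}/esum => /ereal_sup_gt[_ [X [fX XD] <-]] HX.
exists (finmap.enum_fset (fset_set X)) => [x|b bm]; first by rewrite in_fset_set// inE => /XD.
have b0 x : D x -> 0 <= b x by move=> /bm/andP[].
have sb : rsummable D b.
  apply: le_rsummable sm => x Dx; case/andP: (bm x Dx) => b0x bmx.
  by rewrite !ger0_norm// m0.
have DX : D `&` X = X by apply/setIidr.
have mX : (\esum_(x in D) (m x)%:E = \sum_(x \in X) (m x)%:E +
    \esum_(x in D `&` ~` X) (m x)%:E)%E.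
  rewrite (esumID X) ?DX; last by move=> x Dx; rewrite lee_fin m0.
  by rewrite esum_fset// => x; rewrite inE => /XD/m0; rewrite lee_fin.
have bX : (\esum_(x in D) (b x)%:E = \sum_(x \in X) (b x)%:E +
    \esum_(x in D `&` ~` X) (b x)%:E)%E.
  rewrite (esumID X) ?DX; last by move=> x Dx; rewrite lee_fin b0.
  by rewrite esum_fset// => x; rewrite inE => /XD/b0; rewrite lee_fin.
have le : (\esum_(x in D `&` ~` X) (b x)%:E <= e%:E)%E.
  apply: (@le_trans _ _ (\esum_(x in D `&` ~` X) (m x)%:E)%E).
    by apply: le_esum => x [Dx _]; rewrite lee_fin; case/andP: (bm x Dx).
  move: HX; rewrite mX fsbig_finite//= sumEFin.
  case: (\esum_(x in D `&` ~` X) (m x)%:E)%E => [v||].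
  - rewrite -!EFinD lte_fin lee_fin; lra.
  - by rewrite addey// addye.
  - by rewrite leNye.
rewrite -lee_fin -esum_rsum// bX fsbig_finite//= sumEFin EFinD.
by rewrite leeD2l.
Qed.

End RealSums.

Section ComplexSums.
Variables (R : realType) (T : choiceType).
Local Notation C := R[i].
Implicit Types (D : set T) (a b : T -> C).

Definition csummable D a := rsummable D (fun x => cabs (a x)).

Lemma eq_csum D a b : (forall x, D x -> a x = b x) -> csum D a = csum D b.
Proof. by move=> ab; rewrite /csum; congr (_ +i* _); apply: eq_rsum => x /ab ->. Qed.

Lemma le_csummable D a (m : T -> R) : (forall x, D x -> cabs (a x) <= m x) ->
  rsummable D m -> csummable D a.
Proof.
move=> am; apply: le_rsummable => x Dx.
by rewrite ger0_norm ?cabs_ge0// (le_trans (am x Dx))// ler_norm.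
Qed.

Lemma eq_csummable D a b : (forall x, D x -> a x = b x) -> csummable D a ->
  csummable D b.
Proof. by move=> ab; apply: le_rsummable => x /ab ->. Qed.

Lemma csummable_Re D a : csummable D a -> rsummable D (fun x => complex.Re (a x)).
Proof.
by apply: le_rsummable => x _; rewrite [leRHS]ger0_norm ?cabs_ge0// Re_le_cabs.
Qed.

Lemma csummable_Im D a : csummable D a -> rsummable D (fun x => complex.Im (a x)).
Proof.
by apply: le_rsummable => x _; rewrite [leRHS]ger0_norm ?cabs_ge0// Im_le_cabs.
Qed.

Lemma csummableD D a b : csummable D a -> csummable D b ->
  csummable D (fun x => a x + b x).
Proof. by move=> sa sb; apply: le_csummable (rsummableD sa sb) => x _; exact: cabsD. Qed.

Lemma csummableZ D a k : csummable D a -> csummable D (fun x => k * a x).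
Proof.
by move=> sa; apply: le_csummable (rsummableZ (cabs k) sa) => x _; rewrite cabsM.
Qed.

Lemma csummable0 D : csummable D (fun=> 0).
Proof. by rewrite /csummable /rsummable esum1// => x _; rewrite cabs0 normr0. Qed.

Lemma csum0 D : csum D (fun=> 0 : C) = 0.
Proof.
have H : rsum D (fun=> 0 : R) = 0.
  have s0 : rsummable D (fun=> 0 : R) by rewrite /rsummable esum1// => x _; rewrite normr0.
  by rewrite rsum_ge0E// esum1.
by rewrite /csum /= H.
Qed.

Lemma csumD D a b : csummable D a -> csummable D b ->
  csum D (fun x => a x + b x) = csum D a + csum D b.
Proof.
move=> sa sb; rewrite /csum; simpc; congr (_ +i* _).
  rewrite -rsumD; [|exact: csummable_Re..].
  by apply: eq_rsum => x _; case: (a x) => ? ?; case: (b x).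
rewrite -rsumD; [|exact: csummable_Im..].
by apply: eq_rsum => x _; case: (a x) => ? ?; case: (b x).
Qed.

Lemma csumZ D a k : csummable D a -> csum D (fun x => k * a x) = k * csum D a.
Proof.
move=> sa; have sr := csummable_Re sa; have si := csummable_Im sa.
case: k => p q; rewrite /csum; simpc; congr (_ +i* _).
  rewrite -!rsumZ// -rsumN; last exact: rsummableZ.
  rewrite -rsumD; [|exact: rsummableZ|exact/rsummableN/rsummableZ].
  by apply: eq_rsum => x _; case: (a x).
rewrite -!rsumZ// -rsumD; [|exact: rsummableZ..].
by apply: eq_rsum => x _; case: (a x).
Qed.

Lemma csumN D a : csummable D a -> csum D (fun x => - a x) = - csum D a.
Proof.
by move=> sa; rewrite -mulN1r -csumZ//; apply: eq_csum => x _; rewrite mulN1r.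
Qed.

Lemma csummableN D a : csummable D a -> csummable D (fun x => - a x).
Proof. by apply: le_rsummable => x _; rewrite cabsN. Qed.

Lemma csumB D a b : csummable D a -> csummable D b ->
  csum D (fun x => a x - b x) = csum D a - csum D b.
Proof. by move=> sa sb; rewrite csumD ?csumN//; exact: csummableN. Qed.

Lemma csumZr D a k : csummable D a -> csum D (fun x => a x * k) = csum D a * k.
Proof. by move=> sa; rewrite mulrC -csumZ//; apply: eq_csum => x _; rewrite mulrC. Qed.

Lemma csumJ D a : csummable D a -> csum D (fun x => (a x)^*) = (csum D a)^*.
Proof.
move=> sa; rewrite /csum /=; congr (_ +i* _).
  by apply: eq_rsum => x _; case: (a x).
rewrite -rsumN; last exact: csummable_Im.
by apply: eq_rsum => x _; case: (a x).
Qed.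

Lemma csummable_sum (I : Type) (r : seq I) (f : I -> T -> C) D :
  (forall i, csummable D (f i)) -> csummable D (fun x => \sum_(i <- r) f i x).
Proof.
move=> sf; elim: r => [|i r ih].
  by apply: eq_csummable (csummable0 D) => x _; rewrite big_nil.
by apply: eq_csummable (csummableD (sf i) ih) => x _; rewrite big_cons.
Qed.

Lemma csum_sum (I : Type) (r : seq I) (f : I -> T -> C) D :
  (forall i, csummable D (f i)) ->
  csum D (fun x => \sum_(i <- r) f i x) = \sum_(i <- r) csum D (f i).
Proof.
move=> sf; elim: r => [|i r ih].
  by rewrite big_nil -[RHS](csum0 D); apply: eq_csum => x _; rewrite big_nil.
rewrite big_cons -ih -csumD//; last exact: csummable_sum.
by apply: eq_csum => x _; rewrite big_cons.
Qed.

Lemma reindex_csum (D D' : set T) (e : T -> T) a : set_bij D D' e ->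
  csum D' a = csum D (fun x => a (e x)).
Proof.
by move=> be; rewrite /csum; congr (_ +i* _); rewrite (reindex_rsum _ be).
Qed.

(** The factor 2 comes from the separate sums of the real and imaginary
    parts. *)
Lemma cabs_csum_le D a (m : T -> R) : (forall x, D x -> cabs (a x) <= m x) ->
  rsummable D m -> cabs (csum D a) <= 2 * rsum D m.
Proof.
move=> am sm; have sa := le_csummable am sm.
have sr := csummable_Re sa; have si := csummable_Im sa.
apply: (le_trans (cabs_le_ReIm _)) => /=.
have h1 : `|rsum D (fun x => complex.Re (a x))| <= rsum D m.
  apply: le_trans (rsum_norm sr) _; apply: ler_rsum => //; first exact: rsummable_norm.
  by move=> x Dx; apply: le_trans (am x Dx); exact: Re_le_cabs.
have h2 : `|rsum D (fun x => complex.Im (a x))| <= rsum D m.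
  apply: le_trans (rsum_norm si) _; apply: ler_rsum => //; first exact: rsummable_norm.
  by move=> x Dx; apply: le_trans (am x Dx); exact: Im_le_cabs.
lra.
Qed.

Lemma rder_le (f : R -> C) (d : C) (m e : R) : 0 < e -> rder f 0 d ->
  (forall t, `|t| < e -> cabs (f t - f 0) <= m * `|t|) -> cabs d <= m.
Proof.
move=> e0 df fm; rewrite leNgt; apply/negP => dm.
have k0 : 0 < (cabs d - m) / 2 by lra.
have [r r0 Hr] := df _ k0.
pose t := Num.min e r / 2.
have t0 : 0 < t by rewrite divr_gt0// lt_min e0.
have te : `|t| < e.
  rewrite gtr0_norm// /t ltr_pdivrMr//.
  have : Num.min e r <= e by rewrite ge_min lexx.
  lra.
have tr : `|t| < r.
  rewrite gtr0_norm// /t ltr_pdivrMr//.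
  have : Num.min e r <= r by rewrite ge_min lexx orbT.
  lra.
have := Hr t tr; have := fm t te; rewrite add0r.
have := cabsB (f t - f 0) (f t - f 0 - d * t%:C).
rewrite (_ : _ - _ = d * t%:C); last by ring.
rewrite cabsM cabs_real gtr0_norm// => h1 h2 h3.
have : cabs d * t <= (m + (cabs d - m) / 2) * t by lra.
by rewrite ler_pM2r//; lra.
Qed.

(** The difference quotients of the terms are dominated by m for all small t, so
    that their errors are uniformly small outside a finite set. *)
Lemma csum_rder D (h : T -> R -> C) (d : T -> C) (m : T -> R) (e : R) :
  0 < e -> rsummable D m -> csummable D (fun x => h x 0) ->
  (forall x, D x -> rder (h x) 0 (d x)) ->
  (forall x t, D x -> `|t| < e -> cabs (h x t - h x 0) <= m x * `|t|) ->
  rder (fun t => csum D (fun x => h x t)) 0 (csum D d) /\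
  forall t, `|t| < e -> cabs (csum D (fun x => h x t) - csum D (fun x => h x 0))
    <= 2 * rsum D m * `|t|.
Proof.
move=> e0 sm sh dh hm.
have dm x : D x -> cabs (d x) <= m x.
  by move=> Dx; apply: (rder_le e0 (dh x Dx)) => t te; exact: hm.
have m0 x : D x -> 0 <= m x by move=> /dm; apply: le_trans; exact: cabs_ge0.
have sd := le_csummable dm sm.
have sdiff t : `|t| < e -> csummable D (fun x => h x t - h x 0).
  move=> te; apply: le_csummable (rsummableZ `|t| sm) => x Dx.
  by rewrite mulrC hm.
have sht t : `|t| < e -> csummable D (fun x => h x t).
  move=> te; apply: eq_csummable (csummableD (sdiff t te) sh) => x _.
  by rewrite subrK.
have lip t : `|t| < e -> cabs (csum D (fun x => h x t) - csum D (fun x => h x 0))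
    <= 2 * rsum D m * `|t|.
  move=> te; rewrite -csumB//; last exact: sht.
  rewrite -mulrA [X in 2 * X]mulrC -rsumZ//.
  apply: cabs_csum_le; last exact: rsummableZ.
  by move=> x Dx; rewrite mulrC hm.
split=> // k k0.
have m20 x : D x -> 0 <= 2 * m x by move=> /m0 ?; rewrite mulr_ge0.
have k40 : 0 < k / 4 by lra.
(* finitely many terms are differentiated one by one, the others are small *)
have [s sD Hs] := rsum_tail m20 (rsummableZ 2 sm) k40.
have [r r0 Hr] : exists2 r, 0 < r & forall x t, x \in s -> `|t| < r ->
    cabs (h x t - h x 0 - d x * t%:C) <= k / 4 / (size s).+1%:R * `|t|.
  have : 0 < k / 4 / (size s).+1%:R by rewrite divr_gt0.
  move: (k / 4 / _) => k' k'0; elim: s sD {Hs} => [|x s ih] sD.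
    by exists 1.
  have [|r r0 Hr] := ih; first by move=> y ys; apply: sD; rewrite inE ys orbT.
  have [r' r'0 Hr'] := dh x (sD x (mem_head _ _)) _ k'0.
  exists (Num.min r r'); first by rewrite lt_min r0.
  move=> y t; rewrite inE lt_min => /predU1P[->|ys] /andP[tr tr'].
    by have := Hr' t tr'; rewrite add0r.
  exact: Hr.
exists (Num.min e r); first by rewrite lt_min e0.
move=> t; rewrite lt_min add0r => /andP[te tr].
have [->|t0] := eqVneq t 0.
  by rewrite mulr0 !subrr cabs0 normr0 mulr0.
have nt0 : 0 < `|t| by rewrite normr_gt0.
(* the error quotients are dominated by 2 m, uniformly in t *)
pose b x := cabs (h x t - h x 0 - d x * t%:C) / `|t|.
have bm x : D x -> 0 <= b x <= 2 * m x.
  move=> Dx; rewrite divr_ge0 ?cabs_ge0//= ler_pdivrMr//.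
  apply: (le_trans (cabsB _ _)); rewrite cabsM cabs_real.
  have := hm x t Dx te.
  have : cabs (d x) * `|t| <= m x * `|t| by rewrite ler_wpM2r// dm.
  lra.
have sb : rsummable D b.
  apply: le_rsummable (rsummableZ 2 sm) => x Dx; case/andP: (bm x Dx) => ? ?.
  by rewrite !ger0_norm// m20.
have := Hs b bm; have le2 : \sum_(x <- s) b x <= k / 4.
  apply: (@le_trans _ _ (\sum_(x <- s) k / 4 / (size s).+1%:R)).
    rewrite big_seq [leRHS]big_seq; apply: ler_sum => x xs.
    by rewrite ler_pdivrMr// Hr.
  rewrite big_const_seq count_predT iter_addr_0 -[leLHS]mulr_natr mulrAC ler_pdivrMr//.
  by rewrite ler_pM2l// ler_nat.
move=> le1; rewrite -csumB//; last exact: sht.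
rewrite -csumZr// -csumB; [|exact: sdiff|]; last first.
  by apply: eq_csummable (csummableZ t%:C sd) => x _; rewrite mulrC.
apply: (@le_trans _ _ (2 * rsum D (fun x => `|t| * b x))).
  apply: cabs_csum_le; last exact: rsummableZ.
  by move=> x Dx; rewrite /b [`|t| * _]mulrC divfK// gt_eqF.
rewrite rsumZ// mulrA mulrAC ler_wpM2r//; lra.
Qed.

End ComplexSums.

(** * Bessel functions *)

Section Bessel.
Variable R : realType.
Local Notation mu := (@lebesgue_measure R).
Local Notation D := (`[0, +oo[%classic : set R).
Implicit Types (t x y a c u : R).

Lemma expR_sub1 u : 0 <= expR u - 1 - u.
Proof. by have := expR_ge1Dx u; lra. Qed.

Lemma expR_sub1_le u : expR u - 1 - u <= u ^+ 2 * expR `|u|.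
Proof.
have h1 : expR u - 1 <= u * expR u.
  have := expR_ge1Dx (- u); rewrite expRN => h.
  have e0 := expR_gt0 u; have : (1 - u) * expR u <= 1.
    by rewrite -ler_pdivlMr// div1r.
  by rewrite mulrBl mul1r; lra.
have h2 := expR_ge1Dx u.
have [u0|u0] := leP 0 u.
  rewrite ger0_norm//; have : u * (expR u - 1) <= u * (u * expR u) by rewrite ler_wpM2l.
  rewrite expr2; lra.
rewrite ltr0_norm//; have h3 := expR_ge1Dx (- u).
have : (- u) * (1 - expR u) <= (- u) * (- u) by rewrite ler_wpM2l//; lra.
have : u ^+ 2 * 1 <= u ^+ 2 * expR (- u).
  by rewrite ler_wpM2l ?sqr_ge0//; lra.
rewrite mulr1 !expr2; lra.
Qed.

Lemma expR_lip a c : a <= c -> expR (- a) - expR (- c) <= (c - a) * expR (- a).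
Proof.
move=> ac; have := expR_ge1Dx (a - c); rewrite -(ler_pM2l (expR_gt0 (- a))).
by rewrite -expRD (_ : - a + (a - c) = - c); [lra | ring].
Qed.

Lemma cosh_ge1 t : 1 <= cosh t.
Proof.
rewrite /cosh; have e0 := expR_gt0 t; have e1 := expR_gt0 (- t).
have : expR t * expR (- t) = 1 by rewrite -expRD subrr expR0.
have : 0 <= (expR t - expR (- t)) ^+ 2 by rewrite sqr_ge0.
rewrite sqrrB -mulr_natl => h1 h2.
set A := expR t in e0 h1 h2 *; set B := expR (- t) in e1 h1 h2 *.
have h3 : 4 <= (A + B) ^+ 2 by rewrite sqrrD -mulr_natl h2; lra.
rewrite ler_pdivlMr// mul1r leNgt; apply/negP => h4.
have : (A + B) * (A + B) < 2 * 2 by apply: ltr_pM => //; lra.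
by rewrite -expr2; lra.
Qed.

Lemma cosh_ge0 t : 0 <= cosh t. Proof. by have := cosh_ge1 t; lra. Qed.

Lemma cosh_ge t : t <= 2 * cosh t.
Proof. by rewrite /cosh; have := expR_ge1Dx t; have := expR_gt0 (- t); lra. Qed.

Lemma cosh_mul0 t : cosh (0 * t) = 1.
Proof. by rewrite mul0r /cosh oppr0 expR0; lra. Qed.

Lemma measurable_cosh : measurable_fun [set: R] (@cosh R).
Proof.
apply: measurable_funM => //; apply: measurable_funD; first exact: measurable_expR.
by apply: measurableT_comp; [exact: measurable_expR | exact: oppr_measurable].
Qed.

(** The integrands of K_0 and K_1 are the cases k = 0 and 1. Each derivative in
    a brings, up to sign, one more factor cosh t, so that k = 3 bounds the second
    order Taylor remainder of the integrand of K_1. *)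
Definition bessel_term k a t : R := cosh t ^+ k * expR (- (a * cosh t)).

Lemma bessel_term_ge0 k a t : 0 <= bessel_term k a t.
Proof. by rewrite mulr_ge0 ?exprn_ge0 ?cosh_ge0 ?expR_ge0. Qed.

Lemma measurable_bessel_term k a : measurable_fun D (bessel_term k a).
Proof.
apply: measurable_funTS; apply: measurable_funM.
  by apply: measurable_funX; exact: measurable_cosh.
apply: measurableT_comp; first exact: measurable_expR.
apply: measurableT_comp; first exact: oppr_measurable.
by apply: measurable_funM => //; exact: measurable_cosh.
Qed.

Lemma integrable_expRN a : 0 < a ->
  mu.-integrable D (EFin \o (fun t => expR (- (a * t)))).
Proof.
move=> a0; apply/integrableP; split.
  apply/measurable_EFinP; apply: measurable_funTS.
  apply: measurableT_comp; first exact: measurable_expR.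
  apply: measurableT_comp; first exact: oppr_measurable.
  exact: measurable_funM.
have H : (\int[mu]_(t in D) (a * expR (- a * t))%:E = 1)%E.
  rewrite integral_mkcond -(integral_exponential_pdf a0); apply: eq_integral => t _.
  by rewrite /exponential_pdf !patchE; case: ifP.
under eq_integral => t _ do rewrite /= ger0_norm ?expR_ge0//.
rewrite (_ : (\int[mu]_(t in D) (expR (- (a * t)))%:E)%E =
    (\int[mu]_(t in D) (a^-1%:E * (a * expR (- a * t))%:E))%E).
  rewrite ge0_integralZl//=.
  - by rewrite H mule1 ltry.
  - apply/measurable_EFinP; apply: measurable_funTS; apply: measurable_funM => //.
    apply: measurableT_comp; first exact: measurable_expR.
    exact: measurable_funM.
  - by move=> t _; rewrite lee_fin mulr_ge0 ?expR_ge0// ltW.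
  - by rewrite lee_fin invr_ge0 ltW.
by apply: eq_integral => t _; rewrite -EFinM mulKf ?gt_eqF// mulNr.
Qed.

(** Half of the exponent absorbs the power of cosh t; the rest is bounded by
    an integrable function of t, since t <= 2 cosh t. *)
Lemma cosh3_le a t : 0 < a ->
  cosh t ^+ 3 * expR (- (a * cosh t)) <= (6 / a) ^+ 3 * expR (- (a / 4 * t)).
Proof.
move=> a0; set c := cosh t; have c1 := cosh_ge1 t; have ct := cosh_ge t.
have ca : c <= 6 / a * expR (a * c / 6).
  have := expR_ge1Dx (a * c / 6) => h.
  have : a * c / 6 <= expR (a * c / 6) by lra.
  move=> h2; have := ler_wpM2l (ltW (divr_gt0 (ltr0n R 6) a0)) h2.
  by rewrite (_ : 6 / a * (a * c / 6) = c)//; field; rewrite gt_eqF.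
have h1 : c ^+ 3 <= (6 / a) ^+ 3 * expR (a * c / 2).
  have -> : expR (a * c / 2) = expR (a * c / 6) ^+ 3.
    by rewrite -expRM_natl; congr expR; lra.
  by rewrite -exprMn lerXn2r// nnegrE ?cosh_ge0// mulr_ge0 ?expR_ge0// divr_ge0// ltW.
apply: (le_trans (ler_wpM2r (expR_ge0 _) h1)).
rewrite -[leLHS]mulrA -expRD ler_wpM2l//; first by rewrite exprn_ge0// divr_ge0// ltW.
rewrite ler_expR; have : a / 4 * t <= a / 4 * (2 * c) by rewrite ler_wpM2l// divr_ge0// ltW.
rewrite /c; lra.
Qed.

Lemma bessel_term_le k a t : (k <= 3)%N -> bessel_term k a t <= bessel_term 3 a t.
Proof.
move=> k3; by rewrite ler_wpM2r ?expR_ge0// ler_weXn2l// cosh_ge1.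
Qed.

Lemma integrable_bessel_term k a : (k <= 3)%N -> 0 < a ->
  mu.-integrable D (EFin \o bessel_term k a).
Proof.
move=> k3 a0; have a40 : 0 < a / 4 by rewrite divr_gt0.
have := integrableZl (mu := mu) (D := D) _ ((6 / a) ^+ 3) (integrable_expRN a40).
move=> /(_ (measurable_itv _)); apply: le_integrable => //.
  by apply/measurable_EFinP; exact: measurable_bessel_term.
move=> t _ /=; rewrite lee_fin !ger0_norm ?bessel_term_ge0//; last first.
  by rewrite mulr_ge0 ?expR_ge0// exprn_ge0// divr_ge0// ltW.
exact: le_trans (bessel_term_le a t k3) (cosh3_le t a0).
Qed.

Lemma besselK0E x : besselK 0 x = Rintegral mu D (bessel_term 0 x).
Proof.
by apply: eq_Rintegral => t _; rewrite cosh_mul0 /bessel_term expr0 mul1r mulr1.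
Qed.

Lemma besselK1E x : besselK 1 x = Rintegral mu D (bessel_term 1 x).
Proof. by apply: eq_Rintegral => t _; rewrite mul1r /bessel_term expr1 mulrC. Qed.

Lemma bessel_term_decay k d x t : (k <= 3)%N -> 0 <= x -> d <= x ->
  bessel_term k x t <= expR (- (x / 2)) * bessel_term 3 (d / 2) t.
Proof.
move=> k3 x0 dx; apply: (le_trans (bessel_term_le x t k3)).
rewrite /bessel_term [leRHS]mulrCA ler_wpM2l ?exprn_ge0 ?cosh_ge0// -expRD ler_expR.
have : x * 1 <= x * cosh t by rewrite ler_wpM2l ?cosh_ge1.
have : d * cosh t <= x * cosh t by rewrite ler_wpM2r// cosh_ge0.
lra.
Qed.

Definition bessel_mass a := Rintegral mu D (bessel_term 3 a).

Lemma bessel_mass_ge0 a : 0 <= bessel_mass a.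
Proof. by apply: Rintegral_ge0 => t _; exact: bessel_term_ge0. Qed.

Lemma Rint_bessel_le k d x : (k <= 3)%N -> 0 < d -> d <= x ->
  Rintegral mu D (bessel_term k x) <= expR (- (x / 2)) * bessel_mass (d / 2).
Proof.
move=> k3 d0 dx; have x0 : 0 < x by lra.
have d20 : 0 < d / 2 by lra.
have i3 : mu.-integrable D (EFin \o bessel_term 3 (d / 2)) by exact: integrable_bessel_term.
rewrite -RintegralZl//; apply: le_Rintegral => //.
- exact: integrable_bessel_term.
- exact: (RintegrableZ _ i3).
- by move=> t _; apply: bessel_term_decay => //; exact: ltW.
Qed.

(** As cosh t >= 1, half of the exponent x cosh t yields the decay in x, and the
    other half keeps the integral finite. *)
Lemma besselK0_le d x : 0 < d -> d <= x ->
  `|besselK 0 x| <= expR (- (x / 2)) * bessel_mass (d / 2).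
Proof.
move=> d0 dx; rewrite besselK0E ger0_norm; first exact: Rint_bessel_le.
by apply: Rintegral_ge0 => t _; exact: bessel_term_ge0.
Qed.

Lemma besselK1_le d x : 0 < d -> d <= x ->
  `|besselK 1 x| <= expR (- (x / 2)) * bessel_mass (d / 2).
Proof.
move=> d0 dx; rewrite besselK1E ger0_norm; first exact: Rint_bessel_le.
by apply: Rintegral_ge0 => t _; exact: bessel_term_ge0.
Qed.

Lemma besselK1_lip_le d x y : 0 < d -> d <= x -> x <= y ->
  `|besselK 1 x - besselK 1 y| <= (y - x) * (expR (- (x / 2)) * bessel_mass (d / 2)).
Proof.
move=> d0 dx xy; have x0 : 0 < x by lra. 
have y0 : 0 < y by lra.
have ix := integrable_bessel_term (isT : (1 <= 3)%N) x0.
have iy := integrable_bessel_term (isT : (1 <= 3)%N) y0.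
have i2 := integrable_bessel_term (isT : (2 <= 3)%N) x0.
have ixy := RintegrableB ix iy.
have mono t : 0 <= bessel_term 1 x t - bessel_term 1 y t.
  rewrite subr_ge0 ler_wpM2l ?expr1 ?cosh_ge0// ler_expR lerN2 ler_wpM2r ?cosh_ge0//.
rewrite !besselK1E -RintegralB// ger0_norm; last by apply: Rintegral_ge0 => t _; exact: mono.
apply: (@le_trans _ _ ((y - x) * Rintegral mu D (bessel_term 2 x))).
  rewrite -RintegralZl//; apply: le_Rintegral => //.
    exact: RintegrableZ.
  move=> t _; rewrite /bessel_term expr1 expr2.
  have H := expR_lip (ler_wpM2r (cosh_ge0 t) xy).
  have := ler_wpM2l (cosh_ge0 t) H.
  move: (expR (- (x * cosh t))) (expR (- (y * cosh t))) (cosh t) => e1 e2 c; lra.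
by rewrite ler_wpM2l ?subr_ge0//; exact: Rint_bessel_le.
Qed.

Lemma besselK1_lip d x y : 0 < d -> d <= x -> d <= y ->
  `|besselK 1 x - besselK 1 y| <=
  `|x - y| * (expR (- (Num.min x y / 2)) * bessel_mass (d / 2)).
Proof.
move=> d0 dx dy; have [xy|yx] := leP x y.
  by rewrite (ler0_norm (_ : x - y <= 0)) ?subr_le0// opprB; exact: besselK1_lip_le.
rewrite distrC (gtr0_norm (_ : 0 < x - y)) ?subr_gt0//.
exact: besselK1_lip_le (ltW yx).
Qed.

(** Differentiation under the integral: the Taylor remainder of the exponential
    at order 2 brings two factors cosh t more than the integrand of K_1, and
    half of the exponential absorbs the increment of x. *)
Lemma besselK1_der x : 0 < x -> exists d, is_derive (x : R^o) (1 : R^o)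
  (besselK 1 : R^o -> R^o) d.
Proof.
move=> x0; exists (- Rintegral mu D (bessel_term 2 x)); apply/real_derP => e e0.
have x20 : 0 < x / 2 by lra.
have m0 : 0 < bessel_mass (x / 2) + 1 by have := bessel_mass_ge0 (x / 2); lra.
exists (Num.min (x / 2) (e / (bessel_mass (x / 2) + 1))).
  by rewrite lt_min x20 divr_gt0.
move=> h; rewrite lt_min => /andP[hx he].
have xh0 : 0 < x + h by move: hx; rewrite ltr_norml; lra.
have ix := integrable_bessel_term (isT : (1 <= 3)%N) x0.
have ixh := integrable_bessel_term (isT : (1 <= 3)%N) xh0.
have i2 := integrable_bessel_term (isT : (2 <= 3)%N) x0.
have i3 := integrable_bessel_term (isT : (3 <= 3)%N) x20.
have iB := RintegrableB ixh ix.
have iZ k a l : mu.-integrable D (EFin \o bessel_term k a) ->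
    mu.-integrable D (EFin \o (fun t => l * bessel_term k a t)).
  exact: RintegrableZ.
have iBD := RintegrableD iB (iZ _ _ h i2).
rewrite !besselK1E mulNr opprK [_ * h]mulrC -RintegralB// -RintegralZl// -RintegralD//; last exact: iZ.
apply: le_trans (_ : h ^+ 2 * bessel_mass (x / 2) <= _); last first.
  rewrite -real_normK ?num_real// expr2 -mulrA [leRHS]mulrC ler_wpM2l//.
  rewrite ltr_pdivlMr// in he; have := normr_ge0 h; lra.
rewrite /bessel_mass -RintegralZl//.
apply: (le_trans (le_normr_Rintegral _ iBD)) => //.
apply: le_Rintegral => //; first exact: integrable_norm; first exact: iZ.
move=> t _; set c := cosh t; have c0 : 0 <= c := cosh_ge0 t.
have -> : bessel_term 1 (x + h) t - bessel_term 1 x t + h * bessel_term 2 x t =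
    c * expR (- (x * c)) * (expR (- (h * c)) - 1 - - (h * c)).
  rewrite /bessel_term -/c mulrDl opprD expRD expr1; ring.
rewrite normrM (ger0_norm (expR_sub1 _)) ger0_norm ?mulr_ge0 ?expR_ge0//.
apply: (le_trans (ler_wpM2l _ (expR_sub1_le _))).
  by rewrite mulr_ge0 ?expR_ge0.
rewrite /bessel_term -/c normrN normrM (ger0_norm c0) sqrrN.
have -> : c * expR (- (x * c)) * ((h * c) ^+ 2 * expR (`|h| * c)) =
   (h ^+ 2 * c ^+ 3) * (expR (- (x * c)) * expR (`|h| * c)) by ring.
have k0 : 0 <= h ^+ 2 * c ^+ 3.
  by apply: mulr_ge0; [exact: sqr_ge0 | exact: exprn_ge0].
rewrite [leRHS]mulrA; apply: (ler_wpM2l k0).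
rewrite -expRD ler_expR.
have : `|h| * c <= x / 2 * c by rewrite ler_wpM2r// ltW.
lra.
Qed.

End Bessel.

(** * Sums over the charges *)

Lemma esum_ge_term (R : realType) (T : choiceType) (W : T -> \bar R) (g : T) :
  (W g <= \esum_(i in [set: T]) W i)%E.
Proof. by apply: esum_ge; exists [set g]; rewrite ?fsbig_set1//; split. Qed.

Section ExponentialBounds.
Variable R : realType.
Implicit Types (x y b : R).

Lemma geometric_rsummable (q : R) : 0 < q -> q < 1 ->
  rsummable (posnat) (fun k : nat => q ^+ k).
Proof.
move=> q0 q1; rewrite /rsummable.
apply: (@le_lt_trans _ _ (\esum_(k in [set: nat]) (q ^+ k)%:E)%E).
  apply: (@le_trans _ _ (\esum_(k in posnat) (q ^+ k)%:E)%E).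
    by apply: le_esum => k _; rewrite ger0_norm// exprn_ge0// ltW.
  rewrite [leRHS](esumID posnat) ?setTI; last first.
    by move=> k _; rewrite lee_fin exprn_ge0// ltW.
  by rewrite leeDl// esum_ge0// => k _; rewrite lee_fin exprn_ge0// ltW.
rewrite -nneseries_esumT; last by move=> k; rewrite lee_fin exprn_ge0// ltW.
apply: (@le_lt_trans _ _ ((1 * (1 - q)^-1)%:E)); last exact: ltry.
apply: lime_le.
  by apply: is_cvg_nneseries => k _ _; rewrite lee_fin exprn_ge0// ltW.
apply: nearW => k; rewrite sumEFin lee_fin.
have q1' : `|q| < 1 by rewrite gtr0_norm.
apply: le_trans (geometric_le_lim k ler01 q0 q1').
by rewrite /series /=; under [leRHS]eq_bigr do rewrite mul1r.
Qed.

Lemma expRM_nat b k : expR (- (b * k%:R)) = expR (- b) ^+ k.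
Proof. by rewrite -expRM_natl; congr expR; rewrite mulrC mulrN. Qed.

Lemma expRN_rsummable b : 0 < b -> rsummable posnat (fun k : nat => expR (- (b * k%:R))).
Proof.
move=> b0; apply: le_rsummable (@geometric_rsummable (expR (- b)) _ _).
- by move=> k _; rewrite expRM_nat.
- exact: expR_gt0.
- by rewrite -[ltRHS]expR0 ltr_expR; lra.
Qed.

Lemma mul_expRN_le b y : 0 < b -> y * expR (- (b * y)) <= 2 / b * expR (- (b / 2 * y)).
Proof.
move=> b0; have -> : expR (- (b * y)) = expR (- (b / 2 * y)) * expR (- (b / 2 * y)).
  by rewrite -expRD; congr expR; lra.
rewrite mulrA ler_wpM2r ?expR_ge0// -ler_pdivlMr ?expR_gt0// expRN invrK.
have := expR_ge1Dx (b / 2 * y) => h; have h2 : b / 2 * y <= expR (b / 2 * y) by lra.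
have := ler_wpM2l (ltW (divr_gt0 (ltr0n R 2) b0)) h2.
by rewrite (_ : 2 / b * (b / 2 * y) = y)//; field; rewrite gt_eqF.
Qed.

Lemma mul_expRN_rsummable b : 0 < b ->
  rsummable posnat (fun k : nat => k%:R * expR (- (b * k%:R))).
Proof.
move=> b0; have b20 : 0 < b / 2 by lra.
apply: le_rsummable (rsummableZ (2 / b) (expRN_rsummable b20)) => k _.
rewrite !ger0_norm ?mul_expRN_le// ?mulr_ge0 ?expR_ge0//.
by rewrite invr_ge0 ltW.
Qed.

Lemma rder_comp_real (g : R -> R[i]) (l : R -> R) (t b : R) (d : R[i]) :
  rder g (l t) d -> is_derive (t : R^o) (1 : R^o) (l : R^o -> R^o) b ->
  rder (fun x => g (l x)) t (d * b%:C).
Proof.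
move=> /rderP[H1 H2] dl; apply/rderP; split.
  apply: is_derive_eq (@is_derive1_comp R (fun x => complex.Re (g x)) l t _ b H1 dl) _.
  by case: d {H1 H2} => p q /=; rewrite mulr0 subr0.
apply: is_derive_eq (@is_derive1_comp R (fun x => complex.Im (g x)) l t _ b H2 dl) _.
by case: d {H1 H2} => p q /=; rewrite mulr0 add0r.
Qed.

Lemma expi_lip (x y : R) : cabs (expi x - expi y : R[i]) <= 2 * `|x - y|.
Proof.
pose g (t : R) : R[i] := expi (y + t * (x - y)).
have -> : expi x - expi y = g 1 - g 0 by rewrite /g mul1r mul0r addr0 (addrC y) subrK.
apply: (rder_mvt (g' := fun t => 'i * expi (y + t * (x - y)) * (x - y)%:C)).
  move=> t _; have dl : is_derive (t : R^o) (1 : R^o) (fun t : R^o => y + t * (x - y) : R^o) (x - y).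
    apply/real_derP => e e0; exists 1 => // h _.
    rewrite (_ : _ - _ - _ = 0) ?normr0; [by rewrite mulr_ge0// ltW | by ring].
  exact: (rder_comp_real (rder_expi _) dl).
by move=> t _; rewrite !cabsM cabsi cabs_expi !mul1r cabs_real.
Qed.

End ExponentialBounds.

Section Charges.
Variables (R : realType) (n : nat).
Local Notation C := R[i].
Local Notation Cn := (Cvec R n.+1).
Implicit Types (z u : Cn) (g : Lambda n).

Definition charge_norm (g : Lambda n) : R := \sum_i `|(g.2 0 i)%:~R : R|.

Definition lattice_norm (x : 'rV[R]_n.+1 * 'rV[R]_n.+1) : R :=
  \sum_i `|x.1 0 i| + \sum_i `|x.2 0 i|.

Lemma lattice_norm_is_norm : is_norm lattice_norm.
Proof.
split=> [x|a x|x y].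
- move=> /eqP; rewrite paddr_eq0 ?sumr_ge0// => /andP[h1 h2].
  case: x h1 h2 => x1 x2 /= h1 h2.
  have row0 (v : 'rV[R]_n.+1) : \sum_i `|v 0 i| == 0 -> v = 0.
    rewrite psumr_eq0// => /allP H; apply/rowP => i; rewrite mxE.
    by apply/eqP; rewrite -normr_eq0; apply: H; rewrite mem_index_enum.
  by rewrite (row0 _ h1) (row0 _ h2).
- rewrite /lattice_norm mulrDr !mulr_sumr; congr (_ + _);
  by apply: eq_bigr => i _; rewrite mxE normrM.
- have le (v w : 'rV[R]_n.+1) : \sum_i `|(v + w) 0 i| <= \sum_i `|v 0 i| + \sum_i `|w 0 i|.
    by rewrite -big_split /=; apply: ler_sum => i _; rewrite mxE ler_normD.
  by case: x y => x1 x2 [y1 y2]; rewrite /lattice_norm /= [leRHS]addrACA; apply: lerD; exact: le.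
Qed.

Lemma lattice_normE g : g.1 = 0 -> lattice_norm (Lambda_real R g) = charge_norm g.
Proof.
move=> g0; rewrite /lattice_norm /= g0 big1 ?add0r.
  by apply: eq_bigr => i _; rewrite mxE.
by move=> i _; rewrite !mxE normr0.
Qed.

Lemma charge_norm_ge0 g : 0 <= charge_norm g.
Proof. by apply: sumr_ge0. Qed.

Lemma cabs_ncoef i g : cabs (ncoef R i g) = `|(g.2 0 i)%:~R|.
Proof.
rewrite /ncoef (_ : (g.2 0 i)%:~R = ((g.2 0 i)%:~R : R)%:C) ?cabs_real//.
by rewrite rmorph_int.
Qed.

Lemma ncoef_le i g : cabs (ncoef R i g) <= charge_norm g.
Proof. by rewrite cabs_ncoef /charge_norm (bigD1 i)//= lerDl sumr_ge0. Qed.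

Lemma charge_norm_ge1 g : charge_norm g != 0 -> 1 <= charge_norm g.
Proof.
move=> gn0; have [i gi] : exists i, g.2 0 i != 0.
  apply/existsP; apply: contraNT gn0 => /existsPn H.
  by rewrite /charge_norm big1// => i _; have := H i; rewrite negbK => /eqP ->; rewrite normr0.
apply: (@le_trans _ _ `|(g.2 0 i)%:~R|); last first.
  by rewrite /charge_norm (bigD1 i)//= lerDl sumr_ge0.
by rewrite -intr_norm -[1]/(1%:~R) ler_int -gtz0_ge1 normr_gt0.
Qed.

(** Z_gamma for gamma in the span of the d/dy_i, where it is linear in z and does
    not involve the prepotential. *)
Definition Zy (g : Lambda n) (z : Cn) : C := \sum_i ncoef R i g * z 0 i.

Lemma Z_Zy F g z : g.1 = 0 -> Z F g z = Zy g z.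
Proof. by move=> g0; apply: eq_bigr => i _; rewrite g0 mxE mul0r add0r. Qed.

Lemma Zy_le g z : cabs (Zy g z) <= charge_norm g * vnorm z.
Proof.
apply: (le_trans (cabs_sum _ _ _)); rewrite /vnorm mulr_sumr; apply: ler_sum => i _.
by rewrite cabsM ler_wpM2r ?cabs_ge0// ncoef_le.
Qed.

Lemma ZyD g z u (s : C) : Zy g (z + s *: u) = Zy g z + s * Zy g u.
Proof.
rewrite /Zy mulr_sumr -big_split /=; apply: eq_bigr => i _.
by rewrite !mxE mulrDr mulrCA.
Qed.

End Charges.

Section BPSBounds.
Variables (R : realType) (n : nat) (F : Cvec R n.+1 -> R[i]^o).
Variables (Minf : set (Cvec R n.+1)) (Om : Cvec R n.+1 -> Lambda n -> int).
Local Notation C := R[i].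
Local Notation Cn := (Cvec R n.+1).
Hypothesis hOm : local_BPS_variation F Minf Om.
Hypothesis hOm_support : forall z g, Minf z -> supp Om z g -> g.1 = 0.
Implicit Types (z u : Cn) (g : Lambda n).

(** The support property for the norm of the coefficients. It also excludes the
    charge 0, for which the strict inequality would read 0 < 0, and the other
    charges have norm at least 1 by integrality. *)
Lemma supp_lower (K : set Cn) : compact K -> K `<=` Minf ->
  exists2 l : R, 0 < l & forall z g, K z -> supp Om z g ->
    l * charge_norm R g <= cabs (Zy g z) /\ 1 <= charge_norm R g.
Proof.
move=> cK KM; have [l l0 H] := bps_support hOm cK KM (lattice_norm_is_norm R n).
exists l => // z g Kz sg; have g0 := hOm_support (KM z Kz) sg.
have := H z g Kz sg; rewrite lattice_normE// (Z_Zy F z g0) => h; split; first exact: ltW.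
apply: charge_norm_ge1; apply/eqP => N0.
have := Zy_le g z; rewrite N0 mul0r => h2.
by move: h; rewrite N0 mulr0 ltNge h2.
Qed.

(** Since |Z_gamma| is at most a multiple of the norm of gamma on a bounded set,
    the convergence property holds with the exponential of that norm; the
    majorant m does not depend on the point, as needed for differentiation. *)
Lemma supp_mass (K : set Cn) (r B : R) : compact K -> K `<=` Minf -> K !=set0 ->
  0 < r -> (forall z, K z -> vnorm z <= B) ->
  exists2 m : Lambda n -> R, rsummable setT m & forall z g, K z -> supp Om z g ->
    `|(Om z g)%:~R| * expR (- (r * charge_norm R g)) <= m g.
Proof.
move=> cK KM K0 r0 hB.
have B0 : 0 < `|B| + 1 by have := normr_ge0 B; lra.
have rB : 0 < r / (`|B| + 1) by rewrite divr_gt0.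
have := bps_convergence hOm cK KM K0 rB.
set W := fun g => ereal_sup _ => HW.
have W0 g : (0 <= W g)%E.
  have [z Kz] := K0; apply: le_trans (ereal_sup_ubound _); last by exists z.
  by rewrite lee_fin mulr_ge0// expR_ge0.
have Wfin g : W g \is a fin_num.
  rewrite ge0_fin_numE//; apply: le_lt_trans HW.
  exact: esum_ge_term.
exists (fun g => fine (W g)).
  rewrite /rsummable; apply: le_lt_trans HW; apply: le_esum => g _.
  by rewrite ger0_norm ?fine_ge0// fineK.
move=> z g Kz sg; rewrite -lee_fin fineK//.
apply: le_trans (ereal_sup_ubound _); last by exists z.
rewrite lee_fin intr_norm ler_wpM2l// ler_expR lerN2.
rewrite mulrAC ler_pdivrMr// -mulrA ler_wpM2l ?(ltW r0)//.
rewrite (Z_Zy F z (hOm_support (KM z Kz) sg)).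
apply: (le_trans (Zy_le g z)); rewrite ler_wpM2l ?charge_norm_ge0//.
by apply: (le_trans (hB z Kz)); have := ler_norm B; lra.
Qed.

(** Families on the support at z that decay exponentially in the charge; they
    are summable against Omega, and stable under multiplication by charges. *)
Definition bps_dom z (a : Lambda n -> C) :=
  exists A r, [/\ 0 <= A, 0 < r & forall g, supp Om z g ->
    cabs (a g) <= A * expR (- (r * charge_norm R g))].

Lemma bps_dom_summable z a : Minf z -> bps_dom z a ->
  csummable (supp Om z) (fun g => (Om z g)%:~R * a g).
Proof.
move=> Mz [A [r [A0 r0 Ha]]].
have cz : compact [set z] by exact: compact_set1.
have zM : [set z] `<=` Minf by move=> _ ->.
have z0 : [set z] !=set0 by exists z.
have [|m sm Hm] := @supp_mass [set z] r (vnorm z) cz zM z0 r0; first by move=> _ ->.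
have sm' : rsummable (supp Om z) m.
  apply: le_lt_trans sm; rewrite [leRHS](esumID (supp Om z))// setTI.
  by rewrite leeDl// esum_ge0.
apply: le_csummable (rsummableZ A sm') => g sg.
have := Hm z g erefl sg; rewrite cabsM.
have -> : cabs ((Om z g)%:~R : C) = `|(Om z g)%:~R|.
  by rewrite (_ : (Om z g)%:~R = ((Om z g)%:~R : R)%:C) ?cabs_real// rmorph_int.
move=> h; apply: (@le_trans _ _ (`|(Om z g)%:~R| * (A * expR (- (r * charge_norm R g))))).
  by rewrite ler_wpM2l// Ha.
by rewrite mulrCA ler_wpM2l.
Qed.

Lemma bps_domZ z a (k : C) : bps_dom z a -> bps_dom z (fun g => k * a g).
Proof.
move=> [A [r [A0 r0 Ha]]]; exists (cabs k * A), r; split=> //.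
  by rewrite mulr_ge0 ?cabs_ge0.
by move=> g sg; rewrite cabsM -mulrA ler_wpM2l ?cabs_ge0// Ha.
Qed.

Lemma bps_domD z a b : bps_dom z a -> bps_dom z b -> bps_dom z (fun g => a g + b g).
Proof.
move=> [A [r [A0 r0 Ha]]] [B [s [B0 s0 Hb]]].
exists (A + B), (Num.min r s); split; [exact: addr_ge0 | by rewrite lt_min r0 |].
move=> g sg; apply: (le_trans (cabsD _ _)); rewrite mulrDl; apply: lerD.
  apply: (le_trans (Ha g sg)); rewrite ler_wpM2l// ler_expR lerN2.
  by rewrite ler_wpM2r ?charge_norm_ge0// ge_min lexx.
apply: (le_trans (Hb g sg)); rewrite ler_wpM2l// ler_expR lerN2.
by rewrite ler_wpM2r ?charge_norm_ge0// ge_min lexx orbT.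
Qed.

Lemma eq_bps_dom z a b : (forall g, supp Om z g -> a g = b g) -> bps_dom z a -> bps_dom z b.
Proof.
by move=> ab [A [r [A0 r0 Ha]]]; exists A, r; split=> // g sg; rewrite -ab// Ha.
Qed.

Lemma bps_dom0 z : bps_dom z (fun=> 0).
Proof. by exists 0, 1; split=> // g _; rewrite cabs0 mul0r. Qed.

Lemma bps_domM_le z a b (k : R) : 0 <= k -> bps_dom z a ->
  (forall g, supp Om z g -> cabs (b g) <= k * charge_norm R g) ->
  bps_dom z (fun g => b g * a g).
Proof.
move=> k0 [A [r [A0 r0 Ha]]] Hb; exists (k * (A * (2 / r))), (r / 2); split.
- by rewrite !mulr_ge0// invr_ge0 ltW.
- by rewrite divr_gt0.
move=> g sg; rewrite cabsM.
apply: (le_trans (ler_pM (cabs_ge0 _) (cabs_ge0 _) (Hb g sg) (Ha g sg))).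
rewrite -!mulrA ler_wpM2l// mulrCA ler_wpM2l//.
by have := mul_expRN_le (charge_norm R g) r0; rewrite -!mulrA.
Qed.

Lemma bps_dom_ncoef z a i : bps_dom z a -> bps_dom z (fun g => ncoef R i g * a g).
Proof.
move=> H; apply: (bps_domM_le ler01 H) => g _; rewrite mul1r; exact: ncoef_le.
Qed.

Lemma bps_sumD z a b : Minf z -> bps_dom z a -> bps_dom z b ->
  csum (supp Om z) (fun g => (Om z g)%:~R * (a g + b g)) =
  csum (supp Om z) (fun g => (Om z g)%:~R * a g) +
  csum (supp Om z) (fun g => (Om z g)%:~R * b g).
Proof.
move=> Mz Ha Hb; rewrite -csumD; do ?exact: bps_dom_summable.
by apply: eq_csum => g _; rewrite mulrDr.
Qed.

Lemma bps_sumZ z a k : Minf z -> bps_dom z a ->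
  csum (supp Om z) (fun g => (Om z g)%:~R * (k * a g)) =
  k * csum (supp Om z) (fun g => (Om z g)%:~R * a g).
Proof.
move=> Mz Ha; rewrite -csumZ; last exact: bps_dom_summable.
by apply: eq_csum => g _; rewrite mulrCA.
Qed.

Lemma bps_sum_sum z (I : Type) (r : seq I) (f : I -> Lambda n -> C) : Minf z ->
  (forall i, bps_dom z (f i)) ->
  csum (supp Om z) (fun g => (Om z g)%:~R * (\sum_(i <- r) f i g)) =
  \sum_(i <- r) csum (supp Om z) (fun g => (Om z g)%:~R * f i g).
Proof.
move=> Mz Hf; rewrite -csum_sum; last by move=> i; exact: bps_dom_summable.
by apply: eq_csum => g _; rewrite mulr_sumr.
Qed.

Definition lopp (g : Lambda n) : Lambda n := (- g.1, - g.2).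

Lemma lopp_supp z g : Minf z -> supp Om z g -> supp Om z (lopp g).
Proof. by move=> Mz; rewrite /supp /= (bps_opp hOm). Qed.

Lemma lopp_bij z : Minf z -> set_bij (supp Om z) (supp Om z) lopp.
Proof.
move=> Mz; split.
- by move=> g; exact: lopp_supp.
- move=> [a b] [a' b'] _ _ /= [/oppr_inj -> /oppr_inj ->] //.
- move=> g sg; exists (lopp g); first exact: lopp_supp.
  by case: g {sg} => a b; rewrite /lopp /= !opprK.
Qed.

(** Charges of opposite sign contribute complex conjugate terms. *)
Lemma bps_sum_real z a : Minf z -> bps_dom z a ->
  (forall g, supp Om z g -> a (lopp g) = (a g)^*) ->
  (csum (supp Om z) (fun g => (Om z g)%:~R * a g))^* =
  csum (supp Om z) (fun g => (Om z g)%:~R * a g).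
Proof.
move=> Mz Ha aJ; rewrite -csumJ; last exact: bps_dom_summable.
rewrite [RHS](reindex_csum _ (lopp_bij Mz)); apply: eq_csum => g sg.
rewrite aJ// rmorphM /=; congr (_ * _).
by rewrite (bps_opp hOm)// -[LHS]/((_ : {rmorphism C -> C}) _) rmorph_int.
Qed.

End BPSBounds.

(** * The Bessel series along a line *)

Section InstantonTerms.
Variable R : realType.
Local Notation C := R[i].
Implicit Types (l B N : R) (k : nat).

(** As k and N are at least 1, k N >= (k + N) / 2. *)
Lemma expRN_split (l N : R) k : 0 < l -> 1 <= N -> (0 < k)%N ->
  expR (- (pi * k%:R * (l * N))) <=
  expR (- (pi * l / 2 * N)) * expR (- (pi * l / 2 * k%:R)).
Proof.
move=> l0 N1 k0; rewrite -expRD ler_expR -opprD lerN2 -mulrDr.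
have p0 := pi_gt0 R.
rewrite [leRHS](_ : _ = pi * l * (k%:R * N)); last by ring.
rewrite [leLHS](_ : _ = pi * l * ((N + k%:R) / 2)); last by ring.
rewrite ler_wpM2l//; first by rewrite mulr_ge0 ?ltW.
have k1 : 1 <= k%:R :> R by rewrite ler1n.
have : 0 <= (k%:R - 1) * (N - 1) by rewrite mulr_ge0// subr_ge0.
lra.
Qed.

(** The k-th term for a charge of norm N decays exponentially in k and in N
    separately. *)
Lemma besselK_arg_le (nu l N x : R) k : 0 < l -> 1 <= N -> (0 < k)%N ->
  (forall d y, 0 < d -> d <= y ->
     `|besselK nu y| <= expR (- (y / 2)) * bessel_mass (d / 2)) ->
  l * N <= x -> `|besselK nu (2 * pi * k%:R * x)| <=
  bessel_mass (pi * l) * (expR (- (pi * l / 2 * N)) * expR (- (pi * l / 2 * k%:R))).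
Proof.
move=> l0 N1 k0 HK lx; have p0 := pi_gt0 R.
have k1 : 1 <= k%:R :> R by rewrite ler1n.
have lN : l <= l * N by rewrite ler_peMr// ltW.
have d0 : 0 < 2 * pi * l by rewrite mulr_gt0// mulr_gt0.
have dx : 2 * pi * l <= 2 * pi * k%:R * x.
  rewrite -[leRHS]mulrA ler_wpM2l//; first by rewrite mulr_ge0// ltW.
  apply: (@le_trans _ _ (1 * x)); first by lra.
  by rewrite ler_wpM2r//; lra.
apply: (le_trans (HK _ _ d0 dx)).
rewrite mulrC (_ : 2 * pi * l / 2 = pi * l); last by field.
rewrite ler_wpM2l ?bessel_mass_ge0//; apply: le_trans (expRN_split l0 N1 k0).
rewrite ler_expR lerN2 [leRHS](_ : _ = pi * k%:R * x); last by field.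
by rewrite ler_wpM2l// mulr_ge0// ltW.
Qed.

Lemma prod3_diff (e1 e0 : C) (a1 a0 k1 k0 : R) :
  e1 * (a1 * k1)%:C - e0 * (a0 * k0)%:C = (e1 - e0) * (a1 * k1)%:C +
    (e0 * ((a1 - a0) * k1)%:C + e0 * (a0 * (k1 - k0))%:C).
Proof. by rewrite !rmorphM !rmorphB /=; ring. Qed.

Section Path.
Variables (Z0 Z1 : C) (th0 th1 l B N e : R).
Hypotheses (l0 : 0 < l) (N1 : 1 <= N) (B0 : 0 <= B) (e0 : 0 < e).
Let Zt (t : R) : C := Z0 + t%:C * Z1.
Hypothesis Z_lo : forall t, `|t| < e -> l * N <= cabs (Zt t).
Hypothesis Z_hi : forall t, `|t| < e -> cabs (Zt t) <= B * N.
Hypothesis Z1_hi : cabs Z1 <= B * N.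
Hypothesis th1_hi : `|th1| <= B * N.

Let E k (t : R) : C := expi (k%:R * (th0 + t * th1)) / k%:R.
Let a (t : R) : R := cabs (Zt t).
Let kap k (t : R) : R := besselK 1 (2 * pi * k%:R * a t).
(** The terms of f^inst for one charge along a line in N, where Z_gamma and
    theta_gamma are affine functions of t. *)
Definition fterm k (t : R) : C := E k t * (a t * kap k t)%:C.

Let ek k := expR (- (pi * l / 2 * N)) * expR (- (pi * l / 2 * k%:R)) : R.
Let D := bessel_mass (pi * l) : R.

Lemma phase_le k t : (0 < k)%N -> cabs (E k t) <= 1.
Proof.
move=> k0; rewrite cabsM cabs_expi cabsV cabs_nat mul1r invf_le1 ?ltr0n//.
by rewrite ler1n.
Qed.

Lemma besselK1_path_le k t : (0 < k)%N -> `|t| < e -> `|kap k t| <= D * ek k.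
Proof.
move=> k0 te; apply: besselK_arg_le => //; last exact: Z_lo.
by move=> d y; exact: besselK1_le.
Qed.

Lemma cabs_path_lip s t : `|a s - a t| <= B * N * `|s - t|.
Proof.
apply: (le_trans (cabsB_le _ _)); rewrite /Zt.
rewrite (_ : _ - _ = (s - t)%:C * Z1); last by rewrite rmorphB; ring.
by rewrite cabsM cabs_real mulrC ler_wpM2r.
Qed.

Lemma path_center : `|0 : R| < e. Proof. by rewrite normr0. Qed.

Lemma besselK1_path_lip k t : (0 < k)%N -> `|t| < e ->
  `|kap k t - kap k 0| <= 2 * pi * k%:R * (B * N * `|t|) * (D * ek k).
Proof.
move=> k0 te; have p0 := pi_gt0 R.
have k1 : 1 <= k%:R :> R by rewrite ler1n.
have lN : l <= l * N by rewrite ler_peMr// ltW.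
have d0 : 0 < 2 * pi * l by rewrite mulr_gt0// mulr_gt0.
have c0 : 0 <= 2 * pi * k%:R :> R by rewrite !mulr_ge0// ltW.
have dx s : `|s| < e -> 2 * pi * l <= 2 * pi * k%:R * a s.
  move=> /Z_lo hs.
  rewrite -[leRHS]mulrA ler_wpM2l//; first by rewrite mulr_ge0// ltW.
  apply: (@le_trans _ _ (1 * a s)); first by rewrite mul1r (le_trans lN).
  by rewrite ler_wpM2r// cabs_ge0.
apply: (le_trans (besselK1_lip d0 (dx t te) (dx 0 path_center))).
have -> : 2 * pi * k%:R * a t - 2 * pi * k%:R * a 0 = 2 * pi * k%:R * (a t - a 0).
  by ring.
rewrite normrM (ger0_norm c0); apply: ler_pM => //.
- by rewrite mulr_ge0.
- by rewrite mulr_ge0 ?expR_ge0 ?bessel_mass_ge0.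
- by rewrite ler_wpM2l//; have := cabs_path_lip t 0; rewrite subr0.
rewrite mulrC (_ : 2 * pi * l / 2 = pi * l); last by field.
rewrite ler_wpM2l ?bessel_mass_ge0//; apply: le_trans (expRN_split l0 N1 k0).
rewrite ler_expR lerN2.
have lo s : `|s| < e -> pi * k%:R * (l * N) <= 2 * pi * k%:R * a s / 2.
  move=> /Z_lo hs; rewrite [leRHS](_ : _ = pi * k%:R * a s); last by field.
  by rewrite ler_wpM2l// mulr_ge0// ltW.
by rewrite /Num.min; case: ifP => _; [exact: lo | exact: lo path_center].
Qed.

(** The three summands come from the increments of the phase, of |Z_gamma| and
    of the argument of K_1. *)
Definition fterm_lip_const := D * (2 * B ^+ 2 + B + 2 * pi * B ^+ 2).

Lemma fterm_lip_const_ge0 : 0 <= fterm_lip_const.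
Proof.
have p0 := pi_gt0 R.
by rewrite mulr_ge0 ?bessel_mass_ge0// !addr_ge0// ?mulr_ge0 ?exprn_ge0// ltW.
Qed.

Lemma fterm_lip k t : (0 < k)%N -> `|t| < e ->
  cabs (fterm k t - fterm k 0) <= fterm_lip_const * N ^+ 2 *
    expR (- (pi * l / 2 * N)) * (k%:R * expR (- (pi * l / 2 * k%:R))) * `|t|.
Proof.
move=> k0 te; have p0 := pi_gt0 R.
have k1 : 1 <= k%:R :> R by rewrite ler1n.
have ek0 : 0 <= ek k by rewrite mulr_ge0 ?expR_ge0.
have D0 : 0 <= D by exact: bessel_mass_ge0.
have -> : fterm k t - fterm k 0 = (E k t - E k 0) * (a t * kap k t)%:C +
    (E k 0 * ((a t - a 0) * kap k t)%:C + E k 0 * (a 0 * (kap k t - kap k 0))%:C).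
  exact: prod3_diff.
apply: (le_trans (cabsD _ _)).
have h1 : cabs ((E k t - E k 0) * (a t * kap k t)%:C) <=
    2 * (B * N) * `|t| * (B * N * (D * ek k)).
  rewrite cabsM cabs_real normrM.
  have hE : cabs (E k t - E k 0) <= 2 * (B * N) * `|t|.
    rewrite -mulrBl cabsM cabsV cabs_nat ler_pdivrMr ?ltr0n//.
    apply: (le_trans (expi_lip _ _)).
    rewrite mul0r addr0 (_ : k%:R * (th0 + t * th1) - k%:R * th0 = k%:R * (t * th1)); last by ring.
    rewrite !normrM normr_nat.
    have : k%:R * (`|t| * `|th1|) <= k%:R * (`|t| * (B * N)).
      by rewrite ler_wpM2l// ler_wpM2l.
    lra.
  apply: ler_pM; [exact: cabs_ge0 | by rewrite mulr_ge0 | exact: hE |].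
  apply: ler_pM => //; last exact: besselK1_path_le.
  by rewrite ger0_norm ?cabs_ge0// Z_hi.
have h2 : cabs (E k 0 * ((a t - a 0) * kap k t)%:C) <= B * N * `|t| * (D * ek k).
  rewrite cabsM cabs_real normrM -[leRHS]mul1r.
  apply: ler_pM; [exact: cabs_ge0 | by rewrite mulr_ge0 | exact: phase_le |].
  apply: ler_pM => //; last exact: besselK1_path_le.
  by have := cabs_path_lip t 0; rewrite subr0.
have h3 : cabs (E k 0 * (a 0 * (kap k t - kap k 0))%:C) <=
    B * N * (2 * pi * k%:R * (B * N * `|t|) * (D * ek k)).
  rewrite cabsM cabs_real normrM -[leRHS]mul1r.
  apply: ler_pM; [exact: cabs_ge0 | by rewrite mulr_ge0 | exact: phase_le |].
  apply: ler_pM => //; last exact: besselK1_path_lip.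
  by rewrite ger0_norm ?cabs_ge0// Z_hi// path_center.
apply: (le_trans (lerD h1 (le_trans (cabsD _ _) (lerD h2 h3)))).
rewrite [leRHS](_ : _ = (fterm_lip_const * N ^+ 2 * k%:R) * (ek k * `|t|)); last first.
  by rewrite /ek; ring.
rewrite [leLHS](_ : _ = (D * (2 * B ^+ 2 * (N * N) + B * N + 2 * pi * B ^+ 2 * (N * N * k%:R))) *
   (ek k * `|t|)); last by ring.
rewrite ler_wpM2r ?mulr_ge0//.
rewrite [leRHS](_ : _ = D * ((2 * B ^+ 2 + B + 2 * pi * B ^+ 2) * (N ^+ 2 * k%:R))); last first.
  by rewrite /fterm_lip_const; ring.
rewrite ler_wpM2l//.
have N0 : 0 <= N := le_trans ler01 N1.
have NN : N <= N * N by rewrite ler_peMr.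
have NN0 : 0 <= N * N by rewrite mulr_ge0.
have NNk : N * N <= N ^+ 2 * k%:R by rewrite expr2 ler_peMr.
have i1 : 2 * B ^+ 2 * (N * N) <= 2 * B ^+ 2 * (N ^+ 2 * k%:R).
  by rewrite ler_wpM2l// mulr_ge0// exprn_ge0.
have i2 : B * N <= B * (N ^+ 2 * k%:R) by rewrite ler_wpM2l// (le_trans NN).
have -> : 2 * pi * B ^+ 2 * (N * N * k%:R) = 2 * pi * B ^+ 2 * (N ^+ 2 * k%:R).
  by rewrite expr2.
by rewrite [leRHS]mulrDl lerD2r [leRHS]mulrDl lerD.
Qed.

Lemma fterm_le k : (0 < k)%N -> cabs (fterm k 0) <=
  B * D * (N * expR (- (pi * l / 2 * N))) * expR (- (pi * l / 2 * k%:R)).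
Proof.
move=> k0; rewrite cabsM cabs_real normrM.
apply: (@le_trans _ _ (1 * (B * N * (D * ek k)))).
  apply: ler_pM; [exact: cabs_ge0 | by rewrite mulr_ge0 | exact: phase_le |].
  apply: ler_pM => //; last exact: (besselK1_path_le k0 path_center).
  by rewrite ger0_norm ?cabs_ge0// Z_hi// path_center.
by rewrite mul1r /ek le_eqVlt; apply/orP; left; apply/eqP; ring.
Qed.

Lemma real_rder (f : R -> R) t d : is_derive (t : R^o) (1 : R^o) (f : R^o -> R^o) d ->
  rder (fun x => (f x)%:C) t d%:C.
Proof.
move=> H; apply/rderP; split=> //=.
exact: is_derive_cst.
Qed.

Lemma fterm_rder k : (0 < k)%N -> exists d, rder (fterm k) 0 d.
Proof.
move=> k0; have p0 := pi_gt0 R.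
have dZ : rder Zt 0 Z1 := rder_lin Z0 Z1 0.
have /rderP[dRe dIm] := dZ.
pose q (t : R) := complex.Re (Zt t) ^+ 2 + complex.Im (Zt t) ^+ 2.
have a0 : 0 < a 0.
  by apply: lt_le_trans (Z_lo path_center); rewrite mulr_gt0// (lt_le_trans ltr01).
have q0 : 0 < q 0 by rewrite -sqrtr_gt0 -cabs_def.
have [dq Hq] : exists dq, is_derive (0 : R^o) (1 : R^o) (q : R^o -> R^o) dq.
  eexists; apply: is_deriveD; apply: is_deriveX.
have Ha : is_derive (0 : R^o) (1 : R^o) (a : R^o -> R^o) ((2 * Num.sqrt (q 0))^-1 * dq).
  rewrite (_ : a = Num.sqrt \o q); last by apply/funext => t; rewrite /a cabs_def.
  exact: is_derive1_comp (is_derive1_sqrt q0) Hq.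
have Hx : is_derive (0 : R^o) (1 : R^o) (fun t : R^o => 2 * pi * k%:R * a t : R^o)
    (2 * pi * k%:R * ((2 * Num.sqrt (q 0))^-1 * dq)).
  exact: (@is_deriveZ R R^o R^o a (2 * pi * k%:R) 0 1 _ Ha).
have x0 : 0 < 2 * pi * k%:R * a 0 by rewrite !mulr_gt0// ltr0n.
have [dK HK] := besselK1_der x0.
have Hkap := @is_derive1_comp R _ (fun t => 2 * pi * k%:R * a t) 0 _ _ HK Hx.
have Hl : is_derive (0 : R^o) (1 : R^o) (fun t : R^o => k%:R * (th0 + t * th1) : R^o) (k%:R * th1).
  apply/real_derP => r r0; exists 1 => // h _.
  rewrite (_ : _ - _ - _ = 0) ?normr0; [by rewrite mulr_ge0// ltW | by ring].
have HE := rder_comp_real (rder_expi _) Hl.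
have H1 := rderM HE (rder_cst (k%:R^-1 : C) 0).
have H2 := rderM (real_rder Ha) (real_rder Hkap).
eexists; have := rderM H1 H2.
rewrite (_ : (fun x => _) = fterm k); last first.
  by apply/funext => t; rewrite /fterm rmorphM.
exact.
Qed.

End Path.
End InstantonTerms.

(** * Instanton sums *)


Section Conjugation.
Variable R : realType.
Local Notation C := R[i].
Implicit Types a b : C.

Lemma conjCE a : Num.conj a = a^*%C. Proof. by []. Qed.
Lemma cJM a b : (a * b)^*%C = a^*%C * b^*%C. Proof. exact: (rmorphM (Num.conj : {rmorphism C -> C})). Qed.
Lemma cJD a b : (a + b)^*%C = a^*%C + b^*%C. Proof. exact: (rmorphD (Num.conj : {rmorphism C -> C})). Qed.
Lemma cJB a b : (a - b)^*%C = a^*%C - b^*%C. Proof. exact: (rmorphB (Num.conj : {rmorphism C -> C})). Qed.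
Lemma cJN a : (- a)^*%C = - a^*%C. Proof. exact: (rmorphN (Num.conj : {rmorphism C -> C})). Qed.
Lemma cJV a : (a^-1)^*%C = (a^*%C)^-1. Proof. exact: (fmorphV (Num.conj : {rmorphism C -> C})). Qed.
Lemma cJX a k : (a ^+ k)^*%C = (a^*%C) ^+ k.
Proof. exact: (rmorphXn (Num.conj : {rmorphism C -> C})). Qed.
Lemma cJ_nat k : (k%:R : C)^*%C = k%:R. Proof. exact: (rmorph_nat (Num.conj : {rmorphism C -> C})). Qed.
Lemma cJ_int (k : int) : (k%:~R : C)^*%C = k%:~R. Proof. exact: (rmorph_int (Num.conj : {rmorphism C -> C})). Qed.
Lemma cJ_real (x : R) : (x%:C)^*%C = x%:C. Proof. by rewrite /= oppr0. Qed.
Lemma cJi : 'i^*%C = - 'i :> C. Proof. exact: conjCi. Qed.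
Lemma cJK a : (a^*%C)^*%C = a. Proof. exact: conjcK. Qed.
Lemma cJ_sum (I : Type) (r : seq I) (f : I -> C) :
  (\sum_(i <- r) f i)^*%C = \sum_(i <- r) (f i)^*%C.
Proof. exact: (rmorph_sum (Num.conj : {rmorphism C -> C})). Qed.

Definition cJE := (conjCE, cJM, cJD, cJB, cJN, cJV, cJX, cJ_nat, cJ_int, cJ_real, cJi, cJK).

End Conjugation.

Section InstantonSums.
Variables (R : realType) (n : nat) (F : Cvec R n.+1 -> R[i]^o).
Variables (Minf : set (Cvec R n.+1)) (Om : Cvec R n.+1 -> Lambda n -> int).
Local Notation C := R[i].
Local Notation Cn := (Cvec R n.+1).
Local Notation piC := ((pi : R)%:C).
Hypothesis hOm : local_BPS_variation F Minf Om.
Hypothesis hOm_support : forall z g, Minf z -> supp Om z g -> g.1 = 0.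
Implicit Types (z : Cn) (g : Lambda n) (p u v : TN R n).

Lemma rder_ext (f g : R -> C) t d : (forall x, f x = g x) -> rder f t d -> rder g t d.
Proof. by move=> /funext ->. Qed.

Lemma theta_line g p u (t : R) : theta g (line p u t) = theta g p + t * theta g u.
Proof.
rewrite /theta mulr_sumr -big_split /=; apply: eq_bigr => i _.
by rewrite /theta_x /theta_y /line /= !mxE; ring.
Qed.

Lemma dthetaE g p u : dtheta g p u = (theta g u)%:C.
Proof.
apply: rder_ddt; apply: rder_ext (rder_lin (theta g p)%:C (theta g u)%:C 0) => t.
by rewrite theta_line rmorphD rmorphM.
Qed.

Lemma dZ_Zy g p u : g.1 = 0 -> dZ F g p u = Zy g (zN u).
Proof.
move=> g0; apply: rder_ddt; apply: rder_ext (rder_lin (Zy g (zN p)) (Zy g (zN u)) 0) => t.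
by rewrite Z_Zy// /zN /= ZyD.
Qed.

Lemma Zy_scale g z (s : C) : Zy g (s *: z) = s * Zy g z.
Proof. by rewrite /Zy mulr_sumr; apply: eq_bigr => i _; rewrite mxE mulrCA. Qed.

(** V_gamma, A_gamma and eta_gamma are multiples of the series with (nu, e) equal
    to (0, 0), (1, 0) and (1, 1). *)
Definition bsum (nu : R) (e : nat) g p : C := csum posnat (fun k =>
  expi (k%:R * theta g p) / k%:R ^+ e *
  (besselK nu (2 * pi * k%:R * cabs (Z F g (zN p))))%:C).

Definition bessel_tame (nu : R) := forall d y : R, 0 < d -> d <= y ->
  `|besselK nu y| <= expR (- (y / 2)) * bessel_mass (d / 2).

Lemma bessel_tame0 : bessel_tame 0. Proof. by move=> d y; exact: besselK0_le. Qed.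
Lemma bessel_tame1 : bessel_tame 1. Proof. by move=> d y; exact: besselK1_le. Qed.

Section Point.
Variable p : TN R n.
Hypothesis Mp : Minf (zN p).

Lemma supp_lower_point : exists2 l : R, 0 < l & forall g, supp Om (zN p) g ->
  [/\ g.1 = 0, l * charge_norm R g <= cabs (Zy g (zN p)) & 1 <= charge_norm R g].
Proof.
have [|l l0 H] := supp_lower hOm hOm_support (@compact_set1 _ (zN p)); first by move=> _ ->.
by exists l => // g sg; have [h1 h2] := H (zN p) g erefl sg; split=> //; exact: hOm_support sg.
Qed.

Lemma Z_neq0 g : supp Om (zN p) g -> Zy g (zN p) != 0.
Proof.
have [l l0 H] := supp_lower_point => /H[_ h1 h2].
by rewrite -cabs_gt0; apply: lt_le_trans h1; rewrite mulr_gt0// (lt_le_trans ltr01).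
Qed.


Lemma bsum_term_le nu e l g k : bessel_tame nu -> 0 < l -> 1 <= charge_norm R g ->
  g.1 = 0 -> l * charge_norm R g <= cabs (Zy g (zN p)) -> (0 < k)%N ->
  cabs (expi (k%:R * theta g p) / k%:R ^+ e *
    (besselK nu (2 * pi * k%:R * cabs (Z F g (zN p))))%:C) <=
  bessel_mass (pi * l) * expR (- (pi * l / 2 * charge_norm R g)) *
    expR (- (pi * l / 2 * k%:R)).
Proof.
move=> Hnu l0 N1 g0 lZ k0; rewrite !cabsM cabs_expi mul1r cabs_real cabsV cabsX cabs_nat Z_Zy//.
rewrite -[leRHS]mul1r; apply: ler_pM => //.
- by rewrite invf_le1 ?exprn_gt0 ?ltr0n// exprn_ege1// ler1n.
- by rewrite -[leRHS]mulrA; exact: (besselK_arg_le l0 N1 k0 Hnu lZ).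
Qed.

Lemma bsum_summable nu e g : bessel_tame nu -> supp Om (zN p) g ->
  csummable posnat (fun k => expi (k%:R * theta g p) / k%:R ^+ e *
    (besselK nu (2 * pi * k%:R * cabs (Z F g (zN p))))%:C).
Proof.
move=> Hnu sg; have [l l0 H] := supp_lower_point; have [g0 h1 h2] := H g sg.
apply: le_csummable; first by move=> k k0; exact: bsum_term_le h1 k0.
by apply/rsummableZ/expRN_rsummable; rewrite divr_gt0// mulr_gt0// pi_gt0.
Qed.

Lemma bsum_dom nu e : bessel_tame nu -> bps_dom Om (zN p) (fun g => bsum nu e g p).
Proof.
move=> Hnu; have [l l0 H] := supp_lower_point.
have r0 : 0 < pi * l / 2 by rewrite divr_gt0// mulr_gt0// pi_gt0.
have sr := expRN_rsummable r0; set S := rsum posnat (fun k : nat => expR (- (pi * l / 2 * k%:R))).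
have S0 : 0 <= S.
  have <- : rsum posnat (fun=> 0 : R) = 0.
    by rewrite -[RHS](mul0r S) -rsumZ//; apply: eq_rsum => k _; rewrite mul0r.
  apply: ler_rsum sr _ => [|k _]; last exact: expR_ge0.
  by apply: le_rsummable (expRN_rsummable r0) => k _; rewrite normr0.
exists (2 * (bessel_mass (pi * l) * S)), (pi * l / 2); split=> //.
  by rewrite !mulr_ge0 ?bessel_mass_ge0.
move=> g /H[g0 h1 h2].
apply: (le_trans (cabs_csum_le _ (rsummableZ _ sr))).
  by move=> k k0; exact: bsum_term_le h1 k0.
by rewrite rsumZ// -/S le_eqVlt; apply/orP; left; apply/eqP; ring.
Qed.

Lemma VinstE g : supp Om (zN p) g -> Vinst F g p = (2 * piC)^-1 * bsum 0 0 g p.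
Proof. by move=> sg; congr (_ * _); apply: eq_csum => k _; rewrite expr0 divr1. Qed.

Lemma AinstE g u : supp Om (zN p) g ->
  Ainst F g p u = - (4 * piC)^-1 * ((cabs (Zy g (zN p)))%:C * bsum 1 0 g p) * dlogZ F g p u.
Proof.
move=> sg; have g0 := hOm_support Mp sg.
rewrite -mulrA; congr (_ * _); rewrite -csumZ; last exact: bsum_summable bessel_tame1 sg.
rewrite -csumZr; last by apply: csummableZ; exact: bsum_summable bessel_tame1 sg.
by apply: eq_csum => k _; rewrite expr0 divr1 -(Z_Zy F)// rmorphM; ring.
Qed.

Lemma etagE g u : supp Om (zN p) g ->
  etag F g p u = 'i / (8 * piC ^+ 2) * ((cabs (Zy g (zN p)))%:C * bsum 1 1 g p) * dlogZ F g p u.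
Proof.
move=> sg; have g0 := hOm_support Mp sg.
rewrite -[RHS]mulrA; congr (_ * _); rewrite -csumZ; last exact: bsum_summable bessel_tame1 sg.
rewrite -csumZr; last by apply: csummableZ; exact: bsum_summable bessel_tame1 sg.
by apply: eq_csum => k _; rewrite expr1 -(Z_Zy F)// rmorphM; ring.
Qed.

Lemma dlogZ_Zy g u : supp Om (zN p) g ->
  dlogZ F g p u = Zy g (zN u) / Zy g (zN p) - (Zy g (zN u) / Zy g (zN p))^*%C.
Proof.
move=> sg; have g0 := hOm_support Mp sg.
by rewrite /dlogZ dZ_Zy// Z_Zy// !cJE.
Qed.

Lemma dlogZ_le u : exists2 k : R, 0 <= k & forall g, supp Om (zN p) g ->
  cabs (dlogZ F g p u) <= k.
Proof.
have [l l0 H] := supp_lower_point.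
exists (2 * (vnorm (zN u) / l)); first by rewrite !mulr_ge0 ?vnorm_ge0// invr_ge0 ltW.
move=> g sg; have [g0 h1 h2] := H g sg; rewrite dlogZ_Zy//.
have h : cabs (Zy g (zN u) / Zy g (zN p)) <= vnorm (zN u) / l.
  rewrite cabsM cabsV ler_pdivrMr ?cabs_gt0 ?Z_neq0//.
  apply: (le_trans (Zy_le _ _)).
  have := ler_wpM2l (divr_ge0 (vnorm_ge0 (zN u)) (ltW l0)) h1.
  by rewrite (_ : _ / l * _ = charge_norm R g * vnorm (zN u))//; field; rewrite gt_eqF.
apply: (le_trans (cabsB _ _)); rewrite cabsJ; lra.
Qed.

Lemma Zabs_dom (a : Lambda n -> C) z : bps_dom Om (zN p) a ->
  bps_dom Om (zN p) (fun g => (cabs (Zy g z))%:C * a g).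
Proof.
move=> Ha; apply: (bps_domM_le (vnorm_ge0 z) Ha) => g _.
by rewrite cabs_real ger0_norm ?cabs_ge0// mulrC; exact: Zy_le.
Qed.

Lemma Zy_dom (a : Lambda n -> C) z : bps_dom Om (zN p) a ->
  bps_dom Om (zN p) (fun g => Zy g z * a g).
Proof.
by move=> Ha; apply: (bps_domM_le (vnorm_ge0 z) Ha) => g _; rewrite mulrC; exact: Zy_le.
Qed.

Lemma dlogZ_dom (a : Lambda n -> C) u : bps_dom Om (zN p) a ->
  bps_dom Om (zN p) (fun g => a g * dlogZ F g p u).
Proof.
move=> Ha; have [k k0 Hk] := dlogZ_le u; have [l l0 H] := supp_lower_point.
apply: eq_bps_dom (bps_domM_le (b := fun g => dlogZ F g p u) k0 Ha _).
  by move=> g _; rewrite mulrC.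
move=> g sg; apply: (le_trans (Hk g sg)); have [_ _ h] := H g sg.
by rewrite ler_peMr.
Qed.

Lemma Vinst_dom : bps_dom Om (zN p) (fun g => Vinst F g p).
Proof.
apply: eq_bps_dom (bps_domZ _ (bsum_dom 0 bessel_tame0)) => g sg.
by rewrite (VinstE sg).
Qed.

Lemma Ainst_dom u : bps_dom Om (zN p) (fun g => Ainst F g p u).
Proof.
apply: eq_bps_dom (dlogZ_dom u (bps_domZ (- (4 * piC)^-1) (Zabs_dom (zN p) (bsum_dom 0 bessel_tame1)))) => g sg.
by rewrite (AinstE u sg).
Qed.

Lemma etag_dom u : bps_dom Om (zN p) (fun g => etag F g p u).
Proof.
apply: eq_bps_dom (dlogZ_dom u (bps_domZ ('i / (8 * piC ^+ 2)) (Zabs_dom (zN p) (bsum_dom 1 bessel_tame1)))) => g sg.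
by rewrite (etagE u sg).
Qed.

Lemma theta_lopp g : theta (lopp g) p = - theta g p.
Proof.
rewrite /theta -sumrN; apply: eq_bigr => i _; rewrite /lopp /= !mxE !rmorphN /=; ring.
Qed.

Lemma Zy_lopp g z : Zy (lopp g) z = - Zy g z.
Proof.
rewrite /Zy -sumrN; apply: eq_bigr => i _.
by rewrite /ncoef /lopp /= mxE rmorphN mulNr.
Qed.

(** Z_gamma and theta_gamma change sign with gamma, and K_nu depends on
    |Z_gamma| only. *)
Lemma bsum_lopp nu e g : bessel_tame nu -> supp Om (zN p) g ->
  bsum nu e (lopp g) p = (bsum nu e g p)^*%C.
Proof.
move=> Hnu sg; rewrite -csumJ; last exact: bsum_summable sg.
have g0 := hOm_support Mp sg; have g0' := hOm_support Mp (lopp_supp hOm Mp sg).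
apply: eq_csum => k _; rewrite theta_lopp mulrN expiN !Z_Zy// Zy_lopp cabsN.
by rewrite !cJE.
Qed.

Lemma Vinst_lopp g : supp Om (zN p) g -> Vinst F (lopp g) p = (Vinst F g p)^*%C.
Proof.
move=> sg; rewrite (VinstE sg) (VinstE (lopp_supp hOm Mp sg)) bsum_lopp//; last exact: bessel_tame0.
by rewrite !cJE.
Qed.

Lemma dlogZ_lopp g u : supp Om (zN p) g -> dlogZ F (lopp g) p u = dlogZ F g p u.
Proof.
move=> sg; rewrite (dlogZ_Zy u sg) (dlogZ_Zy u (lopp_supp hOm Mp sg)).
by rewrite !Zy_lopp invrN mulrNN.
Qed.

Lemma dlogZ_conj g u : supp Om (zN p) g -> (dlogZ F g p u)^*%C = - dlogZ F g p u.
Proof. by move=> sg; rewrite (dlogZ_Zy u sg) !cJE opprB. Qed.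

Lemma Ainst_lopp g u : supp Om (zN p) g -> Ainst F (lopp g) p u = - (Ainst F g p u)^*%C.
Proof.
move=> sg; rewrite (AinstE u sg) (AinstE u (lopp_supp hOm Mp sg)) bsum_lopp//; last exact: bessel_tame1.
rewrite dlogZ_lopp// Zy_lopp cabsN !cJM dlogZ_conj//.
by rewrite !cJE mulrN opprK.
Qed.

(** V rotates Z_gamma by i, hence d Z_gamma / Z_gamma takes the value i. *)
Lemma dlogZ_V g : supp Om (zN p) g -> dlogZ F g p (Vvec p) = 2 * 'i.
Proof.
move=> sg; rewrite dlogZ_Zy// /Vvec /zN /= Zy_scale mulfK ?Z_neq0//.
by rewrite !cJE opprK mulr2n mulrDl mul1r.
Qed.

End Point.

Section Derivative.
Hypothesis hMinf_open : open Minf.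
Variables (p u : TN R n).
Hypothesis Mp : Minf (zN p).
Local Notation seg t := (zN p + t%:C *: zN u : Cn).

Lemma segment_compact (e : R) : 0 < e -> compact [set seg t | t in `[- e, e]].
Proof.
move=> e0; apply: continuous_compact; last exact: segment_compact.
apply: continuous_subspaceT => t A /nbhs_vnorm[r r0 Hr].
have [d d0 Hd] : exists2 d : R, 0 < d & d * vnorm (zN u) < r.
  exists (r / (vnorm (zN u) + 1)); first by rewrite divr_gt0// ltr_wpDl ?vnorm_ge0.
  rewrite mulrAC ltr_pdivrMr ?ltr_wpDl ?vnorm_ge0// mulrDr mulr1.
  by rewrite ltrDl.
have Ht : \forall s \near (t : R^o), `|t - s| < d by exact: (@cvgr_dist_lt _ R^o _ (nbhs (t : R^o)) _ id t cvg_id d d0).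
apply: filterS Ht => s Hs; apply: Hr.
rewrite (_ : _ - _ = (s - t)%:C *: zN u); last by rewrite rmorphB scalerBl opprD addrACA subrr add0r.
rewrite vnormZ cabs_real; apply: le_lt_trans Hd.
by rewrite distrC ler_wpM2r ?vnorm_ge0// ltW.
Qed.

(** A locally constant function has zero derivative, so that the mean value
    inequality makes Omega constant along a segment. *)
Lemma Om_segment (e : R) g : (forall t, `|t| <= e -> Minf (seg t)) ->
  forall t, `|t| <= e -> Om (seg t) g = Om (zN p) g.
Proof.
move=> He t te; pose phi (s : R) : C := (Om (seg (s * t)) g)%:~R.
have dphi s : 0 <= s <= 1 -> rder phi s 0.
  move=> /andP[s0 s1]; have Ms : Minf (seg (s * t)).
    by apply: He; rewrite normrM ger0_norm//; apply: le_trans te; rewrite ler_piMl.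
  have [r r0 Hr] := nbhs_vnorm (bps_wall_crossing hOm g Ms).
  apply/rder_shift.
  have d0 : 0 < r / (`|t| * vnorm (zN u) + 1).
    by rewrite divr_gt0// ltr_wpDl// mulr_ge0 ?vnorm_ge0.
  apply: (rder_local d0 _ (rder_cst (phi s) 0)) => h hd.
  congr (_%:~R); apply/esym/Hr => /=.
  rewrite (_ : _ - _ = (h * t)%:C *: zN u); last first.
    by rewrite [in X in X%:C *: _]mulrDl rmorphD scalerDl opprD addrACA subrr add0r addrAC subrr add0r.
  rewrite vnormZ cabs_real normrM -mulrA.
  move: hd; rewrite ltr_pdivlMr; last by rewrite ltr_wpDl// mulr_ge0 ?vnorm_ge0.
  by apply: le_lt_trans; rewrite ler_wpM2l// lerDl.
have := rder_mvt (K := 0) dphi (fun s _ => eq_ind_r (fun x => x <= 0) (lexx 0) (cabs0 R)).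
rewrite mulr0 /phi mul1r mul0r scale0r addr0 => h.
apply/eqP; rewrite -(eqr_int C) -subr_eq0 -cabs_eq0.
by apply/eqP/le_anti; rewrite h cabs_ge0.
Qed.

Lemma theta_le g v : g.1 = 0 -> `|theta g v| <= charge_norm R g * \sum_i `|theta_y v 0 i|.
Proof.
move=> g0; apply: (le_trans (ler_norm_sum _ _ _)); rewrite mulr_sumr; apply: ler_sum => i _.
rewrite g0 mxE mul0r add0r normrM ler_wpM2r//.
by rewrite /charge_norm (bigD1 i)//= lerDl sumr_ge0.
Qed.

Lemma sq_expRN_le (b y : R) : 0 < b -> 0 <= y ->
  y ^+ 2 * expR (- (b * y)) <= 8 / b ^+ 2 * expR (- (b / 4 * y)).
Proof.
move=> b0 y0; have b20 : 0 < b / 2 by rewrite divr_gt0.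
rewrite expr2 -mulrA; apply: (le_trans (ler_wpM2l y0 (mul_expRN_le y b0))).
rewrite mulrCA; apply: (le_trans (ler_wpM2l (divr_ge0 (ler0n R 2) (ltW b0)) (mul_expRN_le y b20))).
rewrite le_eqVlt; apply/orP; left; apply/eqP.
rewrite mulrA (_ : b / 2 / 2 = b / 4); last by field.
by congr (_ * _); field; rewrite gt_eqF.
Qed.

Lemma cabs_intr_le (k : int) : cabs (k%:~R : C) <= `|(k%:~R : R)|.
Proof. by rewrite (_ : k%:~R = (k%:~R : R)%:C) ?cabs_real// rmorph_int. Qed.

(** The Lipschitz constant for a charge of norm N, with the factor N ^ 2 absorbed
    by three quarters of the exponential; m majorises Omega times the remaining
    quarter. *)
Lemma instanton_bound (b N A c0 X f S t m : R) : 0 < b -> 0 <= N -> 0 <= A -> 0 <= c0 ->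
  0 <= f -> 0 <= S -> 0 <= t ->
  X <= 2 * (2 * (f * N ^+ 2 * expR (- (b * N))) * S) * t ->
  A * expR (- (b / 4 * N)) <= m ->
  A * (c0 * X) <= c0 * (2 * (2 * f * S)) * (8 / b ^+ 2) * m * t.
Proof.
move=> b0 N0 A0 c00 f0 S0 t0 hX hm.
apply: (@le_trans _ _ (A * (c0 * (2 * (2 * (f * N ^+ 2 * expR (- (b * N))) * S) * t)))).
  by rewrite !ler_wpM2l.
rewrite [leLHS](_ : _ = c0 * (2 * (2 * f * S)) * t * A * (N ^+ 2 * expR (- (b * N)))); last by ring.
have k0 : 0 <= c0 * (2 * (2 * f * S)) * t by rewrite !mulr_ge0.
apply: (le_trans (ler_wpM2l (mulr_ge0 k0 A0) (sq_expRN_le b0 N0))).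
rewrite [leLHS](_ : _ = c0 * (2 * (2 * f * S)) * t * (8 / b ^+ 2) * (A * expR (- (b / 4 * N)))); last by ring.
have k1 : 0 <= c0 * (2 * (2 * f * S)) * t * (8 / b ^+ 2).
  by rewrite mulr_ge0// divr_ge0// exprn_ge0// ltW.
apply: (le_trans (ler_wpM2l k1 hm)).
by rewrite le_eqVlt; apply/orP; left; apply/eqP; ring.
Qed.

Lemma finst_line g t : Minf (seg t) -> supp Om (seg t) g ->
  etag F g (line p u t) (Vvec (line p u t)) = 'i / (8 * piC ^+ 2) *
  csum posnat (fun k => 2 * 'i * fterm (Zy g (zN p)) (Zy g (zN u)) (theta g p) (theta g u) k t).
Proof.
move=> Mt st; have g0 := hOm_support Mt st.
have hV := @dlogZ_V (line p u t) Mt g st.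
rewrite /etag; apply: f_equal; apply: eq_csum => k _.
rewrite [dlogZ _ _ _ _]hV [LHS]mulrC; apply: f_equal.
have hz : Z F g (zN (line p u t)) = Zy g (zN p) + t%:C * Zy g (zN u) by rewrite Z_Zy// -ZyD.
by rewrite /fterm hz theta_line.
Qed.

(** A double application of termwise differentiation, over the multiples k and
    over the charges. On a compact segment the support property bounds |Z_gamma|
    below by a multiple of the norm of gamma, and the Lipschitz constants of the
    terms are then dominated by a product of exponentials in k and in this
    norm. *)
Lemma finst_rder : exists d, rder (fun t => finst F Om (line p u t)) 0 d.
Proof.
have [e1 e10 He1] := near_segment hMinf_open (zN u) Mp.
(* a compact segment inside M_infty, of parameter length at most 1 *)
pose e := Num.min e1 1 / 2.
have e0 : 0 < e by rewrite divr_gt0// lt_min e10 ltr01.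
have me1 : Num.min e1 1 <= e1 by rewrite ge_min lexx.
have m1 : Num.min e1 1 <= 1 by rewrite ge_min lexx orbT.
have ee1 : e < e1 by rewrite /e ltr_pdivrMr//; lra.
have e_1 : e <= 1 by rewrite /e ler_pdivrMr//; lra.
have Ms t : `|t| <= e -> Minf (seg t) by move=> te; apply: He1; exact: le_lt_trans ee1.
pose K := [set seg t | t in `[- e, e]].
have inK t : `|t| <= e -> K (seg t) by move=> te; exists t => //=; rewrite in_itv /= -ler_norml.
have KM : K `<=` Minf.
  by move=> _ [t + <-]; rewrite /= in_itv /= -ler_norml; exact: Ms.
have cK : compact K := segment_compact e0.
have p_seg : zN p = seg 0 by rewrite scale0r addr0.
have Kp : K (zN p) by rewrite p_seg; apply: inK; rewrite normr0 ltW.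
have [l l0 Hl] := supp_lower hOm hOm_support cK KM.
pose r := pi * l / 2; have r0 : 0 < r by rewrite divr_gt0// mulr_gt0// pi_gt0.
have r40 : 0 < r / 4 by rewrite divr_gt0.
pose B0 := vnorm (zN p) + vnorm (zN u).
have KB z : K z -> vnorm z <= B0.
  move=> [t + <-]; rewrite /= in_itv /= -ler_norml => te.
  apply: (le_trans (vnormD _ _)); rewrite lerD2l vnormZ cabs_real.
  by rewrite ler_piMl ?vnorm_ge0// (le_trans te).
(* a quarter of the exponent is kept for the sum over the charges *)
have [m sm Hm] := supp_mass hOm hOm_support cK KM (ex_intro _ _ Kp) r40 KB.
pose B := B0 + \sum_i `|theta_y u 0 i|.
have S0 : 0 <= \sum_i `|theta_y u 0 i| by exact: sumr_ge0.
have B00 : 0 <= B0 by rewrite addr_ge0 ?vnorm_ge0.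
have B0' : 0 <= B by rewrite addr_ge0.
have Omt t g : `|t| <= e -> Om (seg t) g = Om (zN p) g by exact: Om_segment.
have suppt t : `|t| <= e -> supp Om (seg t) = supp Om (zN p).
  by move=> te; apply/funext => g; rewrite /supp /= Omt.
pose T g k t := 2 * 'i * fterm (Zy g (zN p)) (Zy g (zN u)) (theta g p) (theta g u) k t.
have path g : supp Om (zN p) g -> [/\ 1 <= charge_norm R g,
    forall t, `|t| < e -> l * charge_norm R g <= cabs (Zy g (zN p) + t%:C * Zy g (zN u)),
    forall t, `|t| < e -> cabs (Zy g (zN p) + t%:C * Zy g (zN u)) <= B * charge_norm R g,
    cabs (Zy g (zN u)) <= B * charge_norm R g & `|theta g u| <= B * charge_norm R g].
  move=> sg; have N0 := charge_norm_ge0 R g; split.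
  - by have [] := Hl (zN p) g Kp sg.
  - move=> t /ltW te; rewrite -ZyD; have := Hl (seg t) g (inK t te).
    by rewrite suppt// => /(_ sg)[].
  - move=> t /ltW te; rewrite -ZyD; apply: (le_trans (Zy_le _ _)).
    by rewrite mulrC ler_wpM2r//; apply: (le_trans (KB _ (inK t te))); rewrite lerDl.
  - apply: (le_trans (Zy_le _ _)); rewrite mulrC ler_wpM2r// /B /B0.
    by rewrite -addrA addrCA lerDl addr_ge0// vnorm_ge0.
  - apply: (le_trans (theta_le u (hOm_support Mp sg))); rewrite mulrC ler_wpM2r//.
    by rewrite /B lerDr.
pose sk := fun k : nat => k%:R * expR (- (r * k%:R)) : R.
have ssk : rsummable posnat sk by exact: mul_expRN_rsummable.
pose fc := fterm_lip_const l B.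
have fc0 : 0 <= fc by apply: fterm_lip_const_ge0.
have inner g : supp Om (zN p) g -> exists2 d, rder (fun t => csum posnat (fun k => T g k t)) 0 d &
    forall t, `|t| < e -> cabs (csum posnat (fun k => T g k t) - csum posnat (fun k => T g k 0)) <=
      2 * rsum posnat (fun k => 2 * (fc * charge_norm R g ^+ 2 * expR (- (r * charge_norm R g))) * sk k) * `|t|.
  move=> sg; have [N1 Zlo Zhi Z1hi thhi] := path g sg.
  have dT k : (0 < k)%N -> exists d, rder (fun t => T g k t) 0 d.
    move=> k0; have [d Hd] := fterm_rder (theta g p) (theta g u) l0 N1 e0 Zlo k0.
    by exists (2 * 'i * d); exact: rderZ.
  have [d Hd] : exists d : nat -> C, forall k, posnat k -> rder (fun t => T g k t) 0 (d k).
    have /choice[d Hd] : forall k, exists d, posnat k -> rder (fun t => T g k t) 0 d.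
      move=> k; case: (posnP k) => [->|k0]; first by exists 0.
      by have [d Hd] := dT k k0; exists d.
    by exists d.
  have sm2 := rsummableZ (2 * (fc * charge_norm R g ^+ 2 * expR (- (r * charge_norm R g)))) ssk.
  have s0 : csummable posnat (fun k => T g k 0).
    apply: (@csummableZ R nat posnat (fun k => fterm (Zy g (zN p)) (Zy g (zN u)) (theta g p) (theta g u) k 0)).
    apply: (le_csummable (m := fun k : nat => B * bessel_mass (pi * l) *
      (charge_norm R g * expR (- (r * charge_norm R g))) * expR (- (r * k%:R)))).
      by move=> k k0; exact: (fterm_le _ _ l0 N1 e0 Zlo Zhi k0).
    exact: rsummableZ (expRN_rsummable r0).
  have Tlip k t : posnat k -> `|t| < e -> cabs (T g k t - T g k 0) <=
      2 * (fc * charge_norm R g ^+ 2 * expR (- (r * charge_norm R g))) * sk k * `|t|.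
    move=> k0 te; rewrite /T -mulrBr cabsM.
    have -> : cabs (2 * 'i : C) = 2 by rewrite cabsM cabsi cabs_nat mulr1.
    have := fterm_lip (theta g p) (th1 := theta g u) l0 N1 B0' e0 Zlo Zhi Z1hi thhi k0 te.
    by move=> /(ler_wpM2l (ler0n R 2)); rewrite /sk -/r !mulrA.
  have [H1 H2] := csum_rder e0 sm2 s0 Hd Tlip.
  by exists (csum posnat d).
pose c0 : C := 'i / (8 * piC ^+ 2).
have /choice[d Hd] : forall g, exists d, supp Om (zN p) g ->
    rder (fun t => csum posnat (fun k => T g k t)) 0 d.
  move=> g; have [sg|nsg] := pselect (supp Om (zN p) g).
    by have [d Hd _] := inner g sg; exists d.
  by exists 0.
pose h g t : C := (Om (zN p) g)%:~R * (c0 * csum posnat (fun k => T g k t)).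
have [] := @csum_rder R (Lambda n) (supp Om (zN p)) h
  (fun g => (Om (zN p) g)%:~R * (c0 * d g))
  (fun g => (cabs c0 * (2 * (2 * fc * rsum posnat sk)) * (8 / r ^+ 2)) * m g) e e0.
- apply: rsummableZ; apply: le_lt_trans sm; rewrite [leRHS](esumID (supp Om (zN p)))// setTI.
  by rewrite leeDl// esum_ge0.
- apply: eq_csummable (bps_dom_summable hOm hOm_support Mp (etag_dom Mp (Vvec p))) => g sg.
  congr (_ * _); have := @finst_line g 0; rewrite scale0r addr0 => /(_ Mp sg).
  rewrite (_ : line p u 0 = p); last first.
    by rewrite /line !scale0r !addr0; case: (p) => [[? ?] ?].
  by [].
- by move=> g sg; apply: rderZ; apply: rderZ; exact: Hd.
- move=> g t sg te; rewrite /h -!mulrBr cabsM (cabsM c0).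
  have [_ _ Hlip] := inner g sg.
  rewrite rsumZ// in Hlip.
  have S1 : 0 <= rsum posnat sk.
    have <- : rsum posnat (fun=> 0 : R) = 0.
      by rewrite -[RHS](mul0r (rsum posnat sk)) -rsumZ//; apply: eq_rsum => k _; rewrite mul0r.
    apply: ler_rsum => [||k _].
    - by apply: le_rsummable ssk => k _; rewrite normr0.
    - exact: ssk.
    - by rewrite mulr_ge0// expR_ge0.
  apply: instanton_bound (Hlip t te) _ => //; try exact: cabs_ge0; try exact: charge_norm_ge0.
  exact: (le_trans (ler_wpM2r (expR_ge0 _) (cabs_intr_le _)) (Hm (zN p) g Kp sg)).
move=> H1 _.
exists (4 * piC * csum (supp Om (zN p)) (fun g => (Om (zN p) g)%:~R * (c0 * d g))).
apply: (rder_local e0 _ (rderZ (4 * piC) H1)) => t te.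
have te' := ltW te; rewrite /finst /bps_sum; congr (_ * _).
have -> : supp Om (zN (line p u t)) = supp Om (zN p) := suppt t te'.
apply: eq_csum => g sg; rewrite /h.
rewrite (_ : Om (zN (line p u t)) g = Om (zN p) g); last by rewrite -(Omt t g te').
by congr (_ * _); rewrite finst_line//; [exact: Ms | rewrite suppt].
Qed.

End Derivative.
End InstantonSums.

(** * The hyperkahler metric *)

Section Dot.
Variables (K : fieldType) (m : nat).
Implicit Types (x y b : 'rV[K]_m) (A G H T : 'M[K]_m) (c : K).

Definition dot x y : K := \sum_i x 0 i * y 0 i.

Lemma dotC x y : dot x y = dot y x.
Proof. by apply: eq_bigr => i _; rewrite mulrC. Qed.

Lemma dotDl x x' y : dot (x + x') y = dot x y + dot x' y.
Proof. by rewrite -big_split /=; apply: eq_bigr => i _; rewrite mxE mulrDl. Qed.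

Lemma dotZl c x y : dot (c *: x) y = c * dot x y.
Proof. by rewrite mulr_sumr; apply: eq_bigr => i _; rewrite mxE mulrA. Qed.

Lemma dotNl x y : dot (- x) y = - dot x y.
Proof. by rewrite -scaleN1r dotZl mulN1r. Qed.

Lemma dotBl x x' y : dot (x - x') y = dot x y - dot x' y.
Proof. by rewrite dotDl dotNl. Qed.

Lemma dotDr x y y' : dot x (y + y') = dot x y + dot x y'.
Proof. by rewrite dotC dotDl !(dotC _ x). Qed.

Lemma dotZr c x y : dot x (c *: y) = c * dot x y.
Proof. by rewrite dotC dotZl dotC. Qed.

Lemma dotNr x y : dot x (- y) = - dot x y.
Proof. by rewrite dotC dotNl dotC. Qed.

Lemma dotBr x y y' : dot x (y - y') = dot x y - dot x y'.
Proof. by rewrite dotDr dotNr. Qed.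

Lemma dot0l y : dot 0 y = 0.
Proof. by rewrite /dot big1// => i _; rewrite mxE mul0r. Qed.

Lemma dot_mulmx A x y : \sum_i \sum_j A i j * (x 0 i * y 0 j) = dot (x *m A) y.
Proof.
rewrite exchange_big /=; apply: eq_bigr => j _; rewrite mxE mulr_suml.
by apply: eq_bigr => i _; rewrite mulrA (mulrC (A i j)).
Qed.

Lemma dot_sym A x y : A^T = A -> dot (x *m A) y = dot (y *m A) x.
Proof.
move=> sA; rewrite -!dot_mulmx exchange_big /=; apply: eq_bigr => i _; apply: eq_bigr => j _.
by rewrite -{1}sA mxE (mulrC (x 0 j)).
Qed.

(** The terms without y are symmetric under the exchange of u and v, and so are
    those quadratic in y, because T - T' = c H makes T H^-1 T' symmetric; what is
    left is bilinear in b and y. *)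
Lemma antisym_inverse_form c H T T' bu bv yu yv : H \in unitmx ->
  H^T = H -> T^T = T -> T'^T = T' -> T - T' = c *: H ->
  dot ((bu - yu *m T) *m invmx H) (bv - yv *m T') -
  dot ((bv - yv *m T) *m invmx H) (bu - yu *m T') = c * (dot bu yv - dot bv yu).
Proof.
move=> uH sH sT sT' TT'; set G := invmx H.
have sG : G^T = G by rewrite /G trmx_inv sH.
have ETG : T *m G = T' *m G + c%:M.
  by rewrite -[T](subrK T') TT' mulmxDl -scalemxAl mulmxV// scalemx1 addrC.
have EGT : G *m T = G *m T' + c%:M.
  by rewrite -[T](subrK T') TT' mulmxDr -scalemxAr mulVmx// scalemx1 addrC.
have move_r x y A : A^T = A -> dot x (y *m A) = dot (x *m A) y.
  by move=> sA; rewrite dotC (dot_sym _ _ sA).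
have e1 x y : dot (x *m T *m G) y = dot (y *m (G *m T' + c%:M)) x.
  by rewrite -EGT mulmxA -move_r// -move_r// dotC.
have sT'GT' : (T' *m G *m T')^T = T' *m G *m T'.
  by rewrite !trmx_mul sT' sG mulmxA.
have e2 x y : dot (x *m T *m G *m T') y = dot (x *m (T' *m G *m T')) y + c * dot (x *m T') y.
  have -> : x *m T *m G *m T' = x *m (T' *m G *m T') + c *: (x *m T').
    by rewrite -(mulmxA x T G) ETG mulmxDr mulmxDl !mulmxA mul_mx_scalar scalemxAl.
  by rewrite dotDl dotZl.
rewrite !mulmxBl !dotBl !dotBr !move_r// !e1 !e2.
rewrite (dot_sym yv yu sT'GT') (dot_sym yv yu sT') (dot_sym bv bu sG).
rewrite !mulmxDr !mulmxA !dotDl !mul_mx_scalar !dotZl; ring.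
Qed.

End Dot.

Section Matrices.
Variable R : realType.
Local Notation C := R[i].

Definition cj m k (A : 'M[C]_(m, k)) : 'M[C]_(m, k) := map_mx (@conjc R) A.
(** Real matrices have to be mapped to complex ones before they can multiply
    rows of dz^i. *)
Definition rc m k (A : 'M[R]_(m, k)) : 'M[C]_(m, k) := map_mx (fun x => x%:C) A.

Lemma cjE m k (A : 'M[C]_(m, k)) i j : cj A i j = (A i j)^*%C.
Proof. by rewrite mxE. Qed.
Lemma cjM m k l (A : 'M[C]_(m, k)) (B : 'M[C]_(k, l)) : cj (A *m B) = cj A *m cj B.
Proof. exact: (map_mxM (Num.conj : {rmorphism C -> C})). Qed.
Lemma cjD m k (A B : 'M[C]_(m, k)) : cj (A + B) = cj A + cj B.
Proof. exact: (map_mxD (Num.conj : {rmorphism C -> C})). Qed.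
Lemma cjN m k (A : 'M[C]_(m, k)) : cj (- A) = - cj A.
Proof. exact: (map_mxN (Num.conj : {rmorphism C -> C})). Qed.
Lemma cjB m k (A B : 'M[C]_(m, k)) : cj (A - B) = cj A - cj B.
Proof. by rewrite cjD cjN. Qed.
Lemma cjZ m k (c : C) (A : 'M[C]_(m, k)) : cj (c *: A) = c^*%C *: cj A.
Proof. exact: (map_mxZ (Num.conj : {rmorphism C -> C})). Qed.
Lemma cjK m k (A : 'M[C]_(m, k)) : cj (cj A) = A.
Proof. by apply/matrixP => i j; rewrite !mxE cJK. Qed.
Lemma cj_rc m k (A : 'M[R]_(m, k)) : cj (rc A) = rc A.
Proof. by apply/matrixP => i j; rewrite !mxE cJ_real. Qed.
Lemma rc_Re m k (A : 'M[C]_(m, k)) : cj A = A -> rc (map_mx (@complex.Re R) A) = A.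
Proof.
move=> /matrixP HA; apply/matrixP => i j; rewrite !mxE; have := HA i j; rewrite mxE.
by case: (A i j) => a b /= [] /eqP; rewrite eqNr => /eqP ->.
Qed.
Lemma dotJ n (x y : 'rV[C]_n) : (dot x y)^*%C = dot (cj x) (cj y).
Proof. by rewrite cJ_sum; apply: eq_bigr => i _; rewrite cJM !mxE. Qed.

Lemma subr_conj (a : C) : a - a^*%C = 2 * 'i * (complex.Im a)%:C.
Proof.
case: a => x y; rewrite -mulrA mulr_natl mulr2n; apply/eqP; rewrite eq_complex /=.
by apply/andP; split; apply/eqP; ring.
Qed.


Variable n : nat.
Local Notation rV := ('rV[C]_n.+1).
Implicit Types x y : rV.

Definition herm (A : 'M[C]_n.+1) (x y : rV) : C :=
  2^-1 * (dot (x *m A) (cj y) + dot (y *m A) (cj x)).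

Lemma hermD (A B : 'M[C]_n.+1) x y : herm (A + B) x y = herm A x y + herm B x y.
Proof. by rewrite /herm !mulmxDr !dotDl -mulrDr addrACA. Qed.

Lemma hermDl A x x' y : herm A (x + x') y = herm A x y + herm A x' y.
Proof.
by rewrite /herm mulmxDl cjD dotDl dotDr -mulrDr addrACA.
Qed.

Lemma herm_swap A x y : herm A x y = herm A y x.
Proof. by rewrite /herm addrC. Qed.

Lemma hermZl A (k : R) x y : herm A (k%:C *: x) y = k%:C * herm A x y.
Proof.
by rewrite /herm cjZ cJ_real -scalemxAl dotZl dotZr -mulrDr mulrCA.
Qed.

Lemma hermZr A (k : R) x y : herm A x (k%:C *: y) = k%:C * herm A x y.
Proof. by rewrite herm_swap hermZl herm_swap. Qed.

Lemma herm_conj A x y : A^T = A -> cj A = A -> (herm A x y)^*%C = herm A x y.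
Proof.
move=> sA rA; rewrite /herm cJM cJV cJ_nat cJD !dotJ !cjM rA !cjK.
by rewrite (dot_sym _ _ sA) (dot_sym (cj y) _ sA) addrC.
Qed.

End Matrices.

Section PeriodMatrix.
Variables (R : realType) (n : nat) (M : set (Cvec R n.+1)) (F : Cvec R n.+1 -> R[i]^o).
Local Notation C := R[i].
Local Notation rV := ('rV[R[i]]_n.+1).
Hypothesis hM : CASK_domain M F.
Variable z : Cvec R n.+1.
Hypothesis Mz : M z.

Definition period_mx : 'M[C]_n.+1 := \matrix_(i, j) tau F i j z.

Lemma period_sym : period_mx^T = period_mx.
Proof. by apply/matrixP => i j; rewrite !mxE (tau_sym hM). Qed.

Lemma Nmx_sym : (Nmx F z)^T = Nmx F z.
Proof. by apply/matrixP => i j; rewrite !mxE (tau_sym hM). Qed.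

Lemma rcNmx_sym : (rc (Nmx F z))^T = rc (Nmx F z).
Proof. by rewrite -[in RHS]Nmx_sym; apply/matrixP => i j; rewrite !mxE. Qed.

Lemma periodB : period_mx - cj period_mx = (2 * 'i) *: rc (Nmx F z).
Proof. by apply/matrixP => i j; rewrite !mxE subr_conj. Qed.

(** The symplectic pairing of (dz^i, dw_i) with its complex conjugate is given,
    up to a constant, by N: so the metric of M arises from its symplectic
    form. *)
Lemma dot_period (x y : rV) : dot (x *m period_mx) y - dot x (y *m cj period_mx) =
  2 * 'i * dot (x *m rc (Nmx F z)) y.
Proof.
have st : (cj period_mx)^T = cj period_mx.
  by rewrite -[in RHS]period_sym; apply/matrixP => i j; rewrite !mxE.
rewrite (dotC x (y *m cj period_mx)) (dot_sym _ _ st) -dotBl -mulmxBr periodB.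
by rewrite -scalemxAr dotZl.
Qed.

End PeriodMatrix.

Section Hyperkahler.
Variables (R : realType) (n : nat) (M : set (Cvec R n.+1)) (F : Cvec R n.+1 -> R[i]^o).
Variables (Minf : set (Cvec R n.+1)) (Om : Cvec R n.+1 -> Lambda n -> int).
Local Notation C := R[i].
Local Notation rV := ('rV[R[i]]_n.+1).
Local Notation piC := ((pi : R)%:C).
Hypothesis hM : CASK_domain M F.
Hypothesis hMinf_sub : Minf `<=` M.
Hypothesis hOm : local_BPS_variation F Minf Om.
Hypothesis hOm_support : forall z g, Minf z -> supp Om z g -> g.1 = 0.
Implicit Types (g : Lambda n) (u v : TN R n).

Definition zr u : rV := zN u.
Definition thx u : rV := rc (theta_x u).
Definition thy u : rV := rc (theta_y u).

Lemma theta_frame_x i u : theta (frame_x i) u = theta_x u 0 i.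
Proof.
rewrite /theta (bigD1 i)//= big1 => [|j ji]; rewrite /frame_x /= !mxE ?eqxx ?(negbTE ji) /=.
  by rewrite mul1r mul0r !addr0.
by rewrite !mul0r addr0.
Qed.

Lemma theta_frame_y i u : theta (frame_y i) u = theta_y u 0 i.
Proof.
rewrite /theta (bigD1 i)//= big1 => [|j ji]; rewrite /frame_y /= !mxE ?eqxx ?(negbTE ji) /=.
  by rewrite mul1r mul0r add0r addr0.
by rewrite !mul0r addr0.
Qed.

Lemma Z_frame_x i z : Z F (frame_x i) z = w F i z.
Proof.
rewrite /Z (bigD1 i)//= big1 => [|j ji]; rewrite /frame_x /= !mxE ?eqxx ?(negbTE ji) /=.
  by rewrite mul1r mul0r !addr0.
by rewrite !mul0r addr0.
Qed.

Lemma Z_frame_y i z : Z F (frame_y i) z = z 0 i.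
Proof.
rewrite /Z (bigD1 i)//= big1 => [|j ji]; rewrite /frame_y /= !mxE ?eqxx ?(negbTE ji) /=.
  by rewrite mul1r mul0r add0r addr0.
by rewrite !mul0r addr0.
Qed.

Variable p : TN R n.
Hypothesis Mp : Minf (zN p).
Let MMp : M (zN p) := hMinf_sub Mp.

Local Notation taum := (period_mx F (zN p)).
Definition NIm : 'M[C]_n.+1 :=
  \matrix_(i, j) bps_sum Om p (fun g => Vinst F g p * ncoef R i g * ncoef R j g).
(** tau corrected by the instanton sum: the coefficients of W_i + W_i^inst along
    the - d theta_{d/dy_j}. *)
Definition Tm : 'M[C]_n.+1 := taum + 'i *: NIm.
(** The part of W_i^inst that comes from A_gamma, which depends on the component
    of the tangent vector along M only. *)
Definition avec u : rV := \row_i (2 * piC * bps_sum Om p (fun g => ncoef R i g * Ainst F g p u)).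
Definition Yvec u : rV := \row_i Wtot F Om i p u.
Local Notation H := (Ntot F Om p).

Lemma dZ_frame_x i u : dZ F (frame_x i) p u = (zr u *m taum) 0 i.
Proof.
rewrite mxE; apply: rder_ddt.
apply: rder_ext (rder_eq (w_rder hM i (zN u) MMp) _) => [t|].
  by rewrite Z_frame_x.
by apply: eq_bigr => j _; rewrite mxE mulrC (tau_sym hM)//.
Qed.

Lemma dZ_frame_y i u : dZ F (frame_y i) p u = zr u 0 i.
Proof.
apply: rder_ddt; apply: rder_ext (rder_lin (zN p 0 i) (zN u 0 i) 0) => t.
by rewrite Z_frame_y /zN /= !mxE.
Qed.

Lemma dtheta_frame_x i u : dtheta (frame_x i) p u = thx u 0 i.
Proof. by rewrite dthetaE theta_frame_x mxE. Qed.

Lemma dtheta_frame_y i u : dtheta (frame_y i) p u = thy u 0 i.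
Proof. by rewrite dthetaE theta_frame_y mxE. Qed.

Lemma ncoef_real i g : (ncoef R i g)^*%C = ncoef R i g.
Proof. exact: cJ_int. Qed.

Lemma Zy_conj g (x : rV) : (Zy g x)^*%C = Zy g (cj x).
Proof. by rewrite /Zy cJ_sum; apply: eq_bigr => i _; rewrite cJM ncoef_real mxE. Qed.

Lemma dtheta_Zy g u : g.1 = 0 -> dtheta g p u = Zy g (thy u).
Proof.
move=> g0; rewrite dthetaE /theta rmorph_sum; apply: eq_bigr => i _.
by rewrite g0 !mxE mul0r add0r rmorphM rmorph_int.
Qed.

Lemma eq_bps_sum a b : (forall g, supp Om (zN p) g -> a g = b g) ->
  bps_sum Om p a = bps_sum Om p b.
Proof. by move=> ab; apply: eq_csum => g sg; rewrite ab. Qed.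

Local Notation dom := (bps_dom Om (zN p)).

Lemma bpsD a b : dom a -> dom b ->
  bps_sum Om p (fun g => a g + b g) = bps_sum Om p a + bps_sum Om p b.
Proof. exact: (bps_sumD hOm hOm_support Mp). Qed.

Lemma bpsZ a (k : C) : dom a -> bps_sum Om p (fun g => k * a g) = k * bps_sum Om p a.
Proof. exact: (bps_sumZ hOm hOm_support k Mp). Qed.

Lemma bps_comb4 a b c d (k1 k2 k3 k4 sa sb sc sd : C) :
  dom a -> dom b -> dom c -> dom d ->
  bps_sum Om p a = sa -> bps_sum Om p b = sb -> bps_sum Om p c = sc -> bps_sum Om p d = sd ->
  bps_sum Om p (fun g => k1 * a g + k2 * b g + k3 * c g + k4 * d g) =
  k1 * sa + k2 * sb + k3 * sc + k4 * sd.
Proof.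
move=> da db dc dd <- <- <- <-; have da' := bps_domZ k1 da; have db' := bps_domZ k2 db.
have dc' := bps_domZ k3 dc; have dd' := bps_domZ k4 dd.
by rewrite (bpsD (bps_domD (bps_domD da' db') dc') dd') (bpsD (bps_domD da' db') dc') (bpsD da' db') !bpsZ.
Qed.

Lemma dom_ncoef a i : dom a -> dom (fun g => ncoef R i g * a g).
Proof. exact: bps_dom_ncoef. Qed.

Lemma bps_Zy a (x : rV) : dom a -> bps_sum Om p (fun g => Zy g x * a g) =
  \sum_i x 0 i * bps_sum Om p (fun g => ncoef R i g * a g).
Proof.
move=> Ha.
transitivity (bps_sum Om p (fun g => \sum_i x 0 i * (ncoef R i g * a g))).
  by apply: eq_bps_sum => g _; rewrite /Zy mulr_suml; apply: eq_bigr => i _; rewrite mulrA (mulrC (x 0 i)).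
rewrite /bps_sum (bps_sum_sum hOm hOm_support _ Mp); last first.
  by move=> i; apply: bps_domZ; exact: dom_ncoef.
by apply: eq_bigr => i _; apply: bpsZ; exact: dom_ncoef.
Qed.

Lemma bps_real a : dom a -> (forall g, supp Om (zN p) g -> a (lopp g) = (a g)^*%C) ->
  (bps_sum Om p a)^*%C = bps_sum Om p a.
Proof. exact: (bps_sum_real hOm hOm_support Mp). Qed.

Let Vdom : dom (fun g => Vinst F g p) := Vinst_dom hOm hOm_support Mp.
Let Adom u : dom (fun g => Ainst F g p u) := Ainst_dom hOm hOm_support Mp u.

Lemma bps_VZZ (x y : rV) : bps_sum Om p (fun g => Vinst F g p * Zy g x * Zy g y) =
  dot (x *m NIm) y.
Proof.
rewrite -dot_mulmx.
transitivity (bps_sum Om p (fun g => Zy g x * (Zy g y * Vinst F g p))).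
  by apply: eq_bps_sum => g _; ring.
rewrite bps_Zy; last exact: Zy_dom.
apply: eq_bigr => i _.
transitivity (x 0 i * bps_sum Om p (fun g => Zy g y * (ncoef R i g * Vinst F g p))).
  by congr (_ * _); apply: eq_bps_sum => g _; ring.
rewrite bps_Zy; last exact: dom_ncoef.
rewrite mulr_sumr; apply: eq_bigr => j _; rewrite mxE.
rewrite (mulrC (bps_sum _ _ _)) -mulrA; congr (_ * (_ * _)); apply: eq_bps_sum => g _; ring.
Qed.

Lemma pi2_neq0 : 2 * piC != 0 :> C.
Proof.
have -> : 2 * piC = (2 * pi : R)%:C by rewrite rmorphM rmorph_nat.
by rewrite -cabs_gt0 cabs_real normr_gt0 mulf_neq0// gt_eqF// pi_gt0.
Qed.

Lemma bps_AZ (x : rV) v : bps_sum Om p (fun g => Zy g x * Ainst F g p v) =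
  (2 * piC)^-1 * dot x (avec v).
Proof.
rewrite bps_Zy// mulr_sumr; apply: eq_bigr => i _.
by rewrite mxE [RHS]mulrCA (mulKf pi2_neq0).
Qed.

Lemma NIm_sym : NIm^T = NIm.
Proof. by apply/matrixP => i j; rewrite !mxE; apply: eq_bps_sum => g _; ring. Qed.

Lemma Tm_sym : Tm^T = Tm.
Proof. by rewrite linearD linearZ /= (period_sym hM MMp) NIm_sym. Qed.

Lemma dom_VZZ (x y : rV) : dom (fun g => Vinst F g p * Zy g x * Zy g y).
Proof.
apply: (@eq_bps_dom _ _ _ _ (fun g => Zy g y * (Zy g x * Vinst F g p))).
  by move=> g _; ring.
by do 2!apply: Zy_dom.
Qed.

Lemma ncoef_lopp i g : ncoef R i (lopp g) = - ncoef R i g.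
Proof. by rewrite /ncoef /lopp /= mxE rmorphN. Qed.

Lemma NIm_real : cj NIm = NIm.
Proof.
apply/matrixP => i j; rewrite !mxE; apply: bps_real.
  apply: (@eq_bps_dom _ _ _ _ (fun g => ncoef R i g * (ncoef R j g * Vinst F g p))).
    by move=> g _; ring.
  by do 2!apply: dom_ncoef.
move=> g sg; rewrite !ncoef_lopp (Vinst_lopp hOm hOm_support Mp sg) !cJM !ncoef_real; ring.
Qed.

Lemma avec_real u : cj (avec u) = avec u.
Proof.
apply/rowP => i; rewrite !mxE !cJM cJ_nat cJ_real; congr (_ * _); apply: bps_real.
  exact: dom_ncoef.
move=> g sg; rewrite ncoef_lopp (Ainst_lopp hOm hOm_support Mp u sg) !cJM !ncoef_real; ring.
Qed.

Lemma HmE : H = rc (Nmx F (zN p)) + NIm.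
Proof. by apply/matrixP => i j; rewrite !mxE. Qed.

Lemma H_sym : H^T = H.
Proof.
by rewrite HmE linearD /= NIm_sym; congr (_ + _); rewrite -{2}(Nmx_sym hM MMp); apply/matrixP => i j; rewrite !mxE.
Qed.

Lemma H_real : cj H = H.
Proof. by rewrite HmE cjD cj_rc NIm_real. Qed.

(** N^inst is real, because gamma and - gamma contribute conjugate terms. *)
Lemma TmB : Tm - cj Tm = (2 * 'i) *: H.
Proof.
rewrite HmE scalerDr -periodB /Tm cjD cjZ NIm_real cJi scaleNr.
rewrite opprD opprK addrACA; congr (_ + _).
by rewrite -scalerDl mulr_natl mulr2n.
Qed.

Lemma YvecE u : Yvec u = (thx u + avec u) - thy u *m Tm.
Proof.
apply/rowP => i; rewrite mxE /Wtot /W dtheta_frame_x /Winst.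
have -> : \sum_j tau F i j (zN p) * dtheta (frame_y j) p u = (thy u *m taum) 0 i.
  rewrite mxE; apply: eq_bigr => j _; rewrite dtheta_frame_y !mxE mulrC.
  by rewrite (tau_sym hM).
have -> : bps_sum Om p (fun g => ncoef R i g *
    (2 * piC * Ainst F g p u - 'i * Vinst F g p * dtheta g p u)) =
    avec u 0 i - 'i * (thy u *m NIm) 0 i.
  have e0 : bps_sum Om p (fun g => Zy g (thy u) * (ncoef R i g * Vinst F g p)) = (thy u *m NIm) 0 i.
    rewrite bps_Zy; last exact: dom_ncoef.
    rewrite mxE; apply: eq_bigr => j _; congr (_ * _); rewrite [RHS]mxE.
    by apply: eq_bps_sum => g _; ring.
  rewrite -e0 mxE -!bpsZ; [|by apply: Zy_dom; exact: dom_ncoef | exact: dom_ncoef].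
  rewrite -mulN1r -bpsZ; last by apply: bps_domZ; apply: Zy_dom; exact: dom_ncoef.
  rewrite -bpsD; last 2 first.
  - by apply: bps_domZ; exact: dom_ncoef.
  - by do 2!apply: bps_domZ; apply: Zy_dom; exact: dom_ncoef.
  apply: eq_bps_sum => g sg; rewrite (dtheta_Zy u (hOm_support Mp sg)); ring.
rewrite /Tm mulmxDr -scalemxAr !mxE; ring.
Qed.


Lemma wpairE (a b : Lambda n -> TN R n -> C) (ax ay bx by_ : TN R n -> rV) u v :
  (forall i u, a (frame_x i) u = ax u 0 i) -> (forall i u, a (frame_y i) u = ay u 0 i) ->
  (forall i u, b (frame_x i) u = bx u 0 i) -> (forall i u, b (frame_y i) u = by_ u 0 i) ->
  wpair a b u v = dot (ax u) (by_ v) - dot (ax v) (by_ u)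
    - (dot (ay u) (bx v) - dot (ay v) (bx u)).
Proof.
move=> h1 h2 h3 h4; rewrite /dot -!sumrB; apply: eq_bigr => i _.
by rewrite /wedge !h1 !h2 !h3 !h4.
Qed.

Lemma cdZ_frame_x i u : conjf (dZ F (frame_x i) p) u = (cj (zr u) *m cj taum) 0 i.
Proof. by rewrite -cjM cjE /conjf dZ_frame_x. Qed.
Lemma cdZ_frame_y i u : conjf (dZ F (frame_y i) p) u = cj (zr u) 0 i.
Proof. by rewrite cjE /conjf dZ_frame_y. Qed.

Lemma dZ_dot g u : supp Om (zN p) g -> dZ F g p u = Zy g (zr u).
Proof. by move=> sg; rewrite dZ_Zy// (hOm_support Mp sg). Qed.

Lemma dom_AZ (x : rV) v : dom (fun g => Zy g x * Ainst F g p v).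
Proof. exact: Zy_dom. Qed.

Lemma omega12_term (k zu zv Au Av V yu yv : C) :
  zu * Av - zv * Au + k * V * (yu * zv - yv * zu) =
  1 * (zu * Av) + -1 * (zv * Au) + k * (V * yu * zv) + - k * (V * yv * zu).
Proof. ring. Qed.

Lemma omega12_bps (k l a b c d : C) :
  1 * (k * a) + -1 * (k * b) + l * c + - l * d = k * (a - b) + l * (c - d).
Proof. ring. Qed.

Lemma dot_Yvec x u : dot x (Yvec u) =
  dot x (thx u) + dot x (avec u) - dot (x *m taum) (thy u) - 'i * dot (thy u *m NIm) x.
Proof.
rewrite YvecE dotBr dotDr (dotC x (thy u *m Tm)) (dot_sym (thy u) x Tm_sym).
rewrite /Tm mulmxDr dotDl -scalemxAr dotZl (dot_sym x _ NIm_sym) opprD.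
by rewrite [LHS]addrA.
Qed.

Lemma omega12_sum (k i a b a' b' c d e f : C) :
  - k * (c - d - (a - b)) + (k * (a' - b') + i * k * (e - f)) =
  k * ((a + a' - c - i * f) - (b + b' - d - i * e)).
Proof. ring. Qed.

(** As the charges lie in the span of the d/dy_i, dZ_gamma is a combination of
    the dz^i, and so are all the instanton terms of omega_1 + i omega_2; what
    multiplies dz^i is W_i + W_i^inst. *)
Lemma omega12E u v : omega12 F Om p u v =
  (2 * piC)^-1 * (dot (zr u) (Yvec v) - dot (zr v) (Yvec u)).
Proof.
rewrite /omega12 (wpairE _ _ dZ_frame_x dZ_frame_y dtheta_frame_x dtheta_frame_y).
have -> : bps_sum Om p (fun g => wedge (dZ F g p) (Ainst F g p) u v +
    'i / (2 * piC) * Vinst F g p * wedge (dtheta g p) (dZ F g p) u v) =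
  (2 * piC)^-1 * (dot (zr u) (avec v) - dot (zr v) (avec u)) +
  'i / (2 * piC) * (dot (thy u *m NIm) (zr v) - dot (thy v *m NIm) (zr u)).
  have e g : supp Om (zN p) g -> wedge (dZ F g p) (Ainst F g p) u v +
      'i / (2 * piC) * Vinst F g p * wedge (dtheta g p) (dZ F g p) u v =
      1 * (Zy g (zr u) * Ainst F g p v) + -1 * (Zy g (zr v) * Ainst F g p u) +
      'i / (2 * piC) * (Vinst F g p * Zy g (thy u) * Zy g (zr v)) +
      - ('i / (2 * piC)) * (Vinst F g p * Zy g (thy v) * Zy g (zr u)).
    move=> sg; have g0 := hOm_support Mp sg.
    rewrite /wedge (dtheta_Zy u g0) (dtheta_Zy v g0) (dZ_dot u sg) (dZ_dot v sg).
    exact: omega12_term.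
  rewrite (eq_bps_sum e) (bps_comb4 _ _ _ _ (dom_AZ _ _) (dom_AZ _ _) (dom_VZZ _ _) (dom_VZZ _ _)
    (bps_AZ _ _) (bps_AZ _ _) (bps_VZZ _ _) (bps_VZZ _ _)).
  exact: omega12_bps.
rewrite (dot_Yvec (zr u) v) (dot_Yvec (zr v) u); exact: omega12_sum.
Qed.


Lemma sum_sprod (A : 'M[C]_n.+1) (a : 'I_n.+1 -> TN R n -> C) (ar : TN R n -> rV) u v :
  (forall i u, a i u = ar u 0 i) ->
  \sum_i \sum_j A i j * sprod (a i) (conjf (a j)) u v = herm A (ar u) (ar v).
Proof.
move=> aE; rewrite /herm -!dot_mulmx -big_split mulr_sumr; apply: eq_bigr => i _.
rewrite -big_split mulr_sumr; apply: eq_bigr => j _.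
by rewrite /sprod /conjf !aE !cjE /= -!mulrDr [RHS]mulrCA (mulrC _ 2^-1).
Qed.

Lemma gME u v : gM F p u v = herm (rc (Nmx F (zN p))) (zr u) (zr v).
Proof.
rewrite -(@sum_sprod _ (@dz R n))//; apply: eq_bigr => i _; apply: eq_bigr => j _.
by rewrite [rc _ _ _]mxE.
Qed.

Lemma conj_dZ g u : supp Om (zN p) g -> conjf (dZ F g p) u = Zy g (cj (zr u)).
Proof. by move=> sg; rewrite /conjf (dZ_dot u sg) Zy_conj. Qed.

Lemma abs2_term (V a b c d : C) :
  V * ((a * b + c * d) / 2) = 2^-1 * (V * a * b) + 2^-1 * (V * c * d) + 0 * 0 + 0 * 0.
Proof. by rewrite !mulr0 !addr0; ring. Qed.

Lemma bps_sum0 : bps_sum Om p (fun=> 0) = 0.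
Proof.
by rewrite -[RHS](mul0r (bps_sum Om p (fun=> 0))) -(bpsZ 0 (bps_dom0 Om _)); apply: eq_bps_sum => g _; rewrite mul0r.
Qed.

Lemma bps_abs2 (b : Lambda n -> TN R n -> C) (xu xv : rV) u v :
  (forall g, supp Om (zN p) g -> b g u = Zy g xu) ->
  (forall g, supp Om (zN p) g -> b g v = Zy g xv) ->
  bps_sum Om p (fun g => Vinst F g p * abs2 (b g) u v) = herm NIm xu xv.
Proof.
move=> bu bv; have e g : supp Om (zN p) g -> Vinst F g p * abs2 (b g) u v =
    2^-1 * (Vinst F g p * Zy g xu * Zy g (cj xv)) +
    2^-1 * (Vinst F g p * Zy g xv * Zy g (cj xu)) + 0 * 0 + 0 * 0.
  move=> sg; rewrite /abs2 /sprod /conjf (bu g sg) (bv g sg) (Zy_conj g xu) (Zy_conj g xv).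
  exact: abs2_term.
rewrite (eq_bps_sum e) (bps_comb4 _ _ _ _ (dom_VZZ _ _) (dom_VZZ _ _)
  (bps_dom0 Om _) (bps_dom0 Om _) (bps_VZZ _ _) (bps_VZZ _ _) bps_sum0 bps_sum0).
by rewrite !mulr0 !addr0 /herm mulrDr.
Qed.

Lemma TformE u v : Tform F Om p u v = herm H (zr u) (zr v).
Proof.
rewrite HmE hermD /Tform gME; congr (_ + _).
by apply: bps_abs2 => g sg; exact: dZ_dot.
Qed.

Hypothesis hcompat : compatible F Om Minf.

(** A row in the kernel of N + N^inst would be a horizontal vector in the
    kernel of T. *)
Lemma H_unit : H \in unitmx.
Proof.
rewrite -row_free_unit; apply: inj_row_free => x xH.
have := hcompat (u := (x : Cvec R n.+1, 0, 0)) Mp; apply=> v.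
have zx : zr (x : Cvec R n.+1, 0, 0) = x by [].
rewrite TformE zx /herm xH dot0l add0r.
rewrite (dot_sym _ _ H_sym) -[X in _ *m X]H_real -cjM xH.
suff -> : cj (0 : rV) = 0 by rewrite dot0l mulr0.
by apply/rowP => i; rewrite !mxE; exact: (rmorph0 (Num.conj : {rmorphism C -> C})).
Qed.

Lemma avecE u i : avec u 0 i = 2 * piC * bps_sum Om p (fun g => ncoef R i g * Ainst F g p u).
Proof. by rewrite mxE. Qed.

Lemma avec_zN u v : zN u = zN v -> avec u = avec v.
Proof.
move=> uv; apply/rowP => i; apply: etrans (avecE u i) (etrans _ (esym (avecE v i))).
apply: (congr1 (fun s => 2 * piC * s)); apply: eq_bps_sum => g sg.
apply: (congr1 (fun s => ncoef R i g * s)).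
apply: etrans (AinstE hOm hOm_support Mp u sg) (etrans _ (esym (AinstE hOm hOm_support Mp v sg))).
apply: (congr1 (fun s => _ * s)).
by rewrite [LHS](dlogZ_Zy F hOm_support Mp u sg) [RHS](dlogZ_Zy F hOm_support Mp v sg) uv.
Qed.

Lemma imaginary_part_solution (A : 'M[C]_n.+1) (t : rV) : A \in unitmx -> cj A = A ->
  let y := - (2 * 'i)^-1 *: ((t - cj t) *m invmx A) in
  cj y = y /\ y *m ((2 * 'i) *: A) = - (t - cj t).
Proof.
move=> uA rA y; have i2 : 2 * 'i != 0 :> C by rewrite mulf_neq0 ?pnatr_eq0 ?complexi_neq0.
have cA : cj (invmx A) = invmx A.
  by rewrite -[in RHS]rA; exact: (map_invmx (Num.conj : {rmorphism C -> C})).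
split.
  rewrite cjZ cjM cA cjB cjK !cJE mulrN invrN opprK /y -(opprB t) mulNmx scalerN.
  by rewrite scaleNr.
by rewrite -scalemxAr -scalemxAl mulmxKV// scalerA mulrN divff// scaleN1r.
Qed.

Lemma real_solution (T A : 'M[C]_n.+1) (t a y : rV) : T - cj T = (2 * 'i) *: A ->
  cj a = a -> cj y = y -> y *m ((2 * 'i) *: A) = - (t - cj t) ->
  cj (t + y *m T - a) = t + y *m T - a.
Proof.
move=> TA ca cy; rewrite -TA mulmxBr => h; rewrite cjB cjD cjM ca cy.
apply: (f_equal (fun x => x - a)).
have -> : y *m T = - (t - cj t) + y *m cj T by rewrite -h subrK.
by rewrite opprB addrA subrKC.
Qed.

(** The forms dz^i and W_i + W_i^inst are independent: as the coefficients of the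
    W_i + W_i^inst along d theta_{d/dy_j} have the invertible imaginary part - H, the
    components of v along the theta_{d/dy_i} can be chosen so that what remains
    of t is real, and the components along the theta_{d/dx^i} make it up. *)
Lemma frame_onto (s t : rV) : exists v, zr v = s /\ Yvec v = t.
Proof.
pose y := - (2 * 'i)^-1 *: ((t - cj t) *m invmx H).
have [cy yH] : cj y = y /\ y *m ((2 * 'i) *: H) = - (t - cj t).
  exact: imaginary_part_solution H_unit H_real.
pose v0 : TN R n := (s : Cvec R n.+1, 0, 0).
pose x := t + y *m Tm - avec v0.
have cx : cj x = x.
  exact: real_solution TmB (avec_real v0) cy yH.
exists (s : Cvec R n.+1, map_mx (@complex.Re R) x, map_mx (@complex.Re R) y); split=> //.
rewrite YvecE; set v : TN R n := (_, _, _).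
rewrite (avec_zN (v := v0))// /thx /thy /theta_x /theta_y /= !rc_Re//.
by rewrite /x subrK addrK.
Qed.

Lemma dot_cj_eq0 (x : rV) : complex.Re (dot x (cj x)) = 0 -> x = 0.
Proof.
move=> h; apply/rowP => i; rewrite [RHS]mxE; apply/eqP; rewrite -cabs_eq0 -sqrf_eq0.
have e j : complex.Re (x 0 j * cj x 0 j) = cabs (x 0 j) ^+ 2.
  by rewrite cjE cabs_def sqr_sqrtr ?addr_ge0 ?sqr_ge0//; case: (x 0 j) => a b /=; ring.
have : \sum_j cabs (x 0 j) ^+ 2 = 0.
  rewrite -[RHS]h (raddf_sum (@complex.Re R)); apply: eq_bigr => j _; exact/esym/e.
move/eqP; rewrite psumr_eq0; last by move=> j _; exact: sqr_ge0.
by move/allP => /(_ i (mem_index_enum _)) /=.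
Qed.


Lemma Re_scale (k : R) (a : C) : complex.Re (k%:C * a) = k * complex.Re a.
Proof. by case: a => x y /=; rewrite mul0r subr0. Qed.
Lemma Im_scale (k : R) (a : C) : complex.Im (k%:C * a) = k * complex.Im a.
Proof. by case: a => x y /=; rewrite mul0r addr0. Qed.
Lemma Re_subi (a b : C) : complex.Re (a - 'i * b) = complex.Re a + complex.Im b.
Proof. by case: a b => [x y] [z t] /=; rewrite mul0r mul1r sub0r opprK. Qed.

Lemma I3_condition (k : R) (a b : C) : k != 0 ->
  ((complex.Re (k%:C * a))%:C = - (complex.Im (k%:C * b))%:C) <-> complex.Re (a - 'i * b) = 0.
Proof.
move=> k0; rewrite Re_scale Im_scale Re_subi -rmorphN; split.
  move=> /complexI /eqP; rewrite -subr_eq0 opprK -mulrDr mulf_eq0 (negbTE k0) /=.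
  by move=> /eqP.
by move=> /eqP; rewrite addr_eq0 => /eqP ->; rewrite mulrN.
Qed.

Lemma dot_subZ (a b x y a' b' : rV) (i : C) :
  dot (a - i *: a') x - dot y (b - i *: b') = (dot a x - dot y b) - i * (dot a' x - dot y b').
Proof.
rewrite dotBl dotZl dotBr dotZr; move: (dot a x) (dot a' x) (dot y b) (dot y b') => p1 p2 p3 p4.
ring.
Qed.

(** The condition that defines w = I_3 u says that the real part of
    (z_w - i z_u) . Y_v - z_v . (Y_w - i Y_u) vanishes for all v; as z_v and Y_v
    are arbitrary, both differences vanish. *)
Lemma I3_frame u : zr (I3 F Om p u) = 'i *: zr u /\ Yvec (I3 F Om p u) = 'i *: Yvec u.
Proof.
have p0 : (2 * pi)^-1 != 0 :> R by rewrite invr_eq0 mulf_neq0// gt_eqF// pi_gt0.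
have pE : (2 * piC)^-1 = ((2 * pi)^-1)%:C by rewrite fmorphV rmorphM rmorph_nat.
have key w v : omega1 F Om p w v = - omega2 F Om p u v <->
    complex.Re (dot (zr w - 'i *: zr u) (Yvec v) - dot (zr v) (Yvec w - 'i *: Yvec u)) = 0.
  rewrite /omega1 /omega2 (omega12E w v) (omega12E u v) pE dot_subZ.
  exact: I3_condition.
have [w0 [zw0 Yw0]] := frame_onto ('i *: zr u) ('i *: Yvec u).
have ex : exists w, forall v, omega1 F Om p w v = - omega2 F Om p u v.
  exists w0 => v; apply/(key w0 v).2; rewrite zw0 Yw0 !subrr dot0l dotC dot0l subr0 //.
have Pw : forall v, omega1 F Om p (I3 F Om p u) v = - omega2 F Om p u v.
  exact: (xgetPex (0 : TN R n) ex).
move: (I3 F Om p u) Pw => w Pw.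
set D := zr w - 'i *: zr u; set E := Yvec w - 'i *: Yvec u.
have DE v : complex.Re (dot D (Yvec v) - dot (zr v) E) = 0 by apply/(key w v).1.
split; apply/eqP; rewrite -subr_eq0; apply/eqP.
  (* testing on a vector dual to the conjugate gives the norm of the difference *)
  have [v [zv Yv]] := frame_onto 0 (cj D).
  by apply: dot_cj_eq0; have := DE v; rewrite zv Yv dot0l subr0.
have [v [zv Yv]] := frame_onto (- cj E) 0.
by apply: dot_cj_eq0; have := DE v; rewrite zv Yv dotC dot0l sub0r dotNl opprK dotC.
Qed.

Lemma omega3_sum (q i A1 A2 A3 A4 Nuv Nvu Iuv Ivu Xuyv Xvyu yuav yvau L : C) :
  q != 0 -> i * i = -1 -> A1 - A3 = 2 * i * Nuv -> A2 - A4 = 2 * i * Nvu ->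
  L = 2 * i * ((Xuyv + yvau) - (Xvyu + yuav)) ->
  4^-1 * (A1 - A2 - (A3 - A4)) - (8 * q ^+ 2)^-1 * (Xuyv - Xvyu - (Xvyu - Xuyv)) +
  (i / 2 * Iuv + - (i / 2) * Ivu + (2 * q)^-1 * ((2 * q)^-1 * yuav)
   + - (2 * q)^-1 * ((2 * q)^-1 * yvau)) =
  i / 2 * ((Nuv + Iuv) - (Nvu + Ivu)) + i / 2 * ((4 * q ^+ 2)^-1 * L).
Proof.
move=> q0 ii h1 h2 ->.
have -> : A1 = A3 + 2 * i * Nuv by rewrite -h1 subrKC.
have -> : A2 = A4 + 2 * i * Nvu by rewrite -h2 subrKC.
have e : i / 2 * ((4 * q ^+ 2)^-1 * (2 * i * (Xuyv + yvau - (Xvyu + yuav)))) =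
  (i * i) * ((4 * q ^+ 2)^-1 * (Xuyv + yvau - (Xvyu + yuav))) by field.
by rewrite e ii; field.
Qed.

Lemma omega3_term (V k a1 a2 b1 b2 y1 y2 c1 c2 l : C) :
  k * V * (a1 * b2 - a2 * b1) + l * (y1 * c2 - y2 * c1) =
  k * (V * a1 * b2) + - k * (V * a2 * b1) + l * (y1 * c2) + - l * (y2 * c1).
Proof. ring. Qed.

Lemma piC_neq0 : piC != 0 :> C.
Proof. by rewrite -cabs_gt0 cabs_real normr_gt0 gt_eqF// pi_gt0. Qed.

Lemma complexii : 'i * 'i = -1 :> C.
Proof. by rewrite -expr2 sqr_i. Qed.

Lemma antisym_rows c (A T T' : 'M[C]_n.+1) (xu xv au av yu yv Yu Yv cYu cYv : rV) :
  A \in unitmx -> A^T = A -> T^T = T -> T'^T = T' -> T - T' = c *: A ->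
  Yu = (xu + au) - yu *m T -> Yv = (xv + av) - yv *m T ->
  cYu = (xu + au) - yu *m T' -> cYv = (xv + av) - yv *m T' ->
  dot (Yu *m invmx A) cYv - dot (Yv *m invmx A) cYu =
  c * ((dot xu yv + dot yv au) - (dot xv yu + dot yu av)).
Proof.
move=> uA sA sT sT' TT' -> -> -> ->; rewrite (antisym_inverse_form _ _ _ _ uA sA sT sT' TT').
by rewrite !dotDl (dotC au) (dotC av).
Qed.

(** The terms quadratic in d theta_{d/dy_i} cancel by the symmetry of T, and the
    inverse of H disappears from the others. *)
Lemma Yvec_antisym u v :
  dot (Yvec u *m invmx H) (cj (Yvec v)) - dot (Yvec v *m invmx H) (cj (Yvec u)) =
  2 * 'i * ((dot (thx u) (thy v) + dot (thy v) (avec u)) - (dot (thx v) (thy u) + dot (thy u) (avec v))).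
Proof.
have sT : (cj Tm)^T = cj Tm by rewrite -[in RHS]Tm_sym; apply/matrixP => i j; rewrite !mxE.
have cY w : cj (Yvec w) = thx w + avec w - thy w *m cj Tm.
  by rewrite YvecE cjB cjD cjM !cj_rc avec_real.
exact: (antisym_rows H_unit H_sym Tm_sym sT TmB (YvecE u) (YvecE v) (cY u) (cY v)).
Qed.

(** The two blocks of omega_3: its semi-flat part along M together with the
    V_gamma terms gives H, and the terms in d theta, including those with
    A_gamma, give the inverse of H by the preceding identity. *)
Lemma omega3E u v : omega3 F Om p u v =
  'i / 2 * (dot (zr u *m H) (cj (zr v)) - dot (zr v *m H) (cj (zr u))) +
  'i / 2 * ((4 * piC ^+ 2)^-1 *
    (dot (Yvec u *m invmx H) (cj (Yvec v)) - dot (Yvec v *m invmx H) (cj (Yvec u)))).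
Proof.
rewrite /omega3 (wpairE _ _ dZ_frame_x dZ_frame_y cdZ_frame_x cdZ_frame_y).
rewrite (wpairE _ _ dtheta_frame_x dtheta_frame_y dtheta_frame_x dtheta_frame_y).
have e g : supp Om (zN p) g ->
    'i / 2 * Vinst F g p * wedge (dZ F g p) (conjf (dZ F g p)) u v +
    (2 * piC)^-1 * wedge (dtheta g p) (Ainst F g p) u v =
    'i / 2 * (Vinst F g p * Zy g (zr u) * Zy g (cj (zr v))) +
    - ('i / 2) * (Vinst F g p * Zy g (zr v) * Zy g (cj (zr u))) +
    (2 * piC)^-1 * (Zy g (thy u) * Ainst F g p v) +
    - (2 * piC)^-1 * (Zy g (thy v) * Ainst F g p u).
  move=> sg; have g0 := hOm_support Mp sg.
  rewrite /wedge (conj_dZ u sg) (conj_dZ v sg) (dtheta_Zy u g0) (dtheta_Zy v g0) (dZ_dot u sg) (dZ_dot v sg).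
  exact: omega3_term.
rewrite (eq_bps_sum e) (bps_comb4 _ _ _ _ (dom_VZZ _ _) (dom_VZZ _ _) (dom_AZ _ _) (dom_AZ _ _)
  (bps_VZZ _ _) (bps_VZZ _ _) (bps_AZ _ _) (bps_AZ _ _)).
rewrite HmE !mulmxDr !dotDl (dotC (thy u) (thx v)) (dotC (thy v) (thx u)) -HmE.
exact: (omega3_sum _ _ piC_neq0 complexii (dot_period hM MMp _ _) (dot_period hM MMp _ _) (Yvec_antisym u v)).
Qed.

Lemma gN_sum (i k a b c d : C) : i * i = -1 ->
  - (i / 2 * (i * a - (- i) * b) + i / 2 * (k * (i * c - (- i) * d))) =
  2^-1 * (a + b) + k * (2^-1 * (c + d)).
Proof.
move=> ii; have -> : - (i / 2 * (i * a - (- i) * b) + i / 2 * (k * (i * c - (- i) * d))) =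
  - (i * i) * (2^-1 * (a + b) + k * (2^-1 * (c + d))) by ring.
by rewrite ii opprK mul1r.
Qed.

Lemma I3_omega3_herm (A B : 'M[C]_n.+1) (k : C) (zw zu zv Yw Yu Yv : rV) :
  zw = 'i *: zu -> Yw = 'i *: Yu ->
  - ('i / 2 * (dot (zw *m A) (cj zv) - dot (zv *m A) (cj zw)) +
     'i / 2 * (k * (dot (Yw *m B) (cj Yv) - dot (Yv *m B) (cj Yw)))) =
  herm A zu zv + k * herm B Yu Yv.
Proof.
by move=> -> ->; rewrite !cjZ cJi -!scalemxAl !dotZl !dotZr; exact: (gN_sum _ _ _ _ _ complexii).
Qed.

(** I_3 multiplies the dz^i and the W_i + W_i^inst by i, and both blocks of
    omega_3 are sesquilinear in them. *)
Lemma gNE u v : gN F Om p u v =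
  herm H (zr u) (zr v) + (4 * piC ^+ 2)^-1 * herm (invmx H) (Yvec u) (Yvec v).
Proof.
have [zI YI] := I3_frame u.
apply: etrans (I3_omega3_herm H (invmx H) _ (zr v) (Yvec v) zI YI).
by rewrite /gN omega3E.
Qed.

End Hyperkahler.

(** * The quotient and the slice *)

Section DotDerivative.
Variables (R : realType) (n : nat).
Local Notation C := R[i].
Local Notation rV := ('rV[C]_n.+1).

Definition rder_row (a : R -> rV) (t : R) (a' : rV) := forall i, rder (fun t => a t 0 i) t (a' 0 i).

Lemma rder_dot (a b : R -> rV) a' b' : rder_row a 0 a' -> rder_row b 0 b' ->
  rder (fun t => dot (a t) (b t)) 0 (dot (a 0) b' + dot a' (b 0)).
Proof.
move=> Ha Hb; rewrite /dot -big_split /=; apply: (rder_sum (index_enum _)) => i _.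
exact: rderM (Ha i) (Hb i).
Qed.

Lemma rder_row_cj a a' t : rder_row a t a' -> rder_row (fun t => cj (a t)) t (cj a').
Proof.
by move=> Ha i; rewrite cjE; apply: rder_ext (rderJ (Ha i)) => x; rewrite cjE.
Qed.

Lemma rder_row_cst (a : rV) t : rder_row (fun=> a) t 0.
Proof. by move=> i; rewrite mxE; exact: rder_cst. Qed.

Lemma rder_row_lin (z u : rV) : rder_row (fun t => z + t%:C *: u) 0 u.
Proof.
move=> i; apply: rder_ext (rder_lin (z 0 i) (u 0 i) 0) => t.
by rewrite !mxE.
Qed.

Lemma rder_Nln (g : R -> C) (d : C) : rder g 0 d -> 0 < complex.Re (g 0) ->
  rder (fun t => (- ln (complex.Re (g t)))%:C) 0 (- (complex.Re d / complex.Re (g 0)))%:C.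
Proof.
move=> /rderP[Hg _] g0; apply: real_rder.
apply: (@is_deriveN R R^o R^o (fun t => ln (complex.Re (g t)))).
apply: is_derive_eq (is_derive1_comp (is_derive1_ln g0) Hg) _.
by rewrite mulrC.
Qed.

Lemma conj_fixed (a : C) : a^*%C = a -> a = (complex.Re a)%:C.
Proof. by case: a => x y /= [] /eqP; rewrite eqNr => /eqP ->. Qed.

Lemma real_quotient (a b : C) : a^*%C = a -> b^*%C = b ->
  (- (complex.Re a / complex.Re b))%:C = - (a / b).
Proof.
by move=> /conj_fixed -> /conj_fixed ->; rewrite rmorphN rmorphM fmorphV.
Qed.

Lemma herm_bar_scalar (i a b : C) : i * i = -1 ->
  2^-1 * (a + b) + i * (2^-1 * (i * a + - i * b)) = b.
Proof.
move=> ii; have -> : i * (2^-1 * (i * a + - i * b)) = (i * i) * (2^-1 * (a - b)) by ring.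
by rewrite ii; field.
Qed.

Lemma herm_del_scalar (i a b : C) : i * i = -1 ->
  2^-1 * (a + b) - i * (2^-1 * (i * a + - i * b)) = a.
Proof.
move=> ii; have -> : i * (2^-1 * (i * a + - i * b)) = (i * i) * (2^-1 * (a - b)) by ring.
by rewrite ii; field.
Qed.

Lemma half_double (a : C) : 2^-1 * (a + a) = a.
Proof. by field. Qed.

Lemma herm_bar A (x y : rV) : herm A x y + 'i * herm A ('i *: x) y = dot (y *m A) (cj x).
Proof.
by rewrite /herm cjZ cJi -scalemxAl dotZl dotZr; exact: (herm_bar_scalar _ _ (complexii R)).
Qed.

Lemma herm_del A (x y : rV) : herm A x y - 'i * herm A ('i *: x) y = dot (x *m A) (cj y).
Proof.
by rewrite /herm cjZ cJi -scalemxAl dotZl dotZr; exact: (herm_del_scalar _ _ (complexii R)).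
Qed.

End DotDerivative.

Section Potential.
Variables (R : realType) (n : nat) (M : set (Cvec R n.+1)) (F : Cvec R n.+1 -> R[i]^o).
Local Notation C := R[i].
Local Notation rV := ('rV[C]_n.+1).
Hypothesis hM : CASK_domain M F.
Implicit Types (z u : Cvec R n.+1).
Local Notation Nc z := (rc (Nmx F z)).

Lemma rsqE z : rsq F z = dot ((z : rV) *m Nc z) (cj (z : rV)).
Proof.
rewrite -dot_mulmx; apply: eq_bigr => i _; apply: eq_bigr => j _.
by rewrite [Nc z i j]mxE cjE -mulrA.
Qed.

Lemma rsq_herm z : rsq F z = herm (Nc z) z z.
Proof.
by rewrite rsqE /herm half_double.
Qed.

Lemma rsq_real z : M z -> rsq F z = (complex.Re (rsq F z))%:C.
Proof.
move=> Mz; apply: conj_fixed; rewrite rsq_herm herm_conj//; first exact: (rcNmx_sym hM Mz).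
exact: cj_rc.
Qed.

Lemma rsq_gt0 z : M z -> 0 < complex.Re (rsq F z).
Proof. by move=> Mz; have [_ ] := gt0_complex (cask_positive hM Mz). Qed.

Lemma rsq_neq0 z : M z -> rsq F z != 0.
Proof. by move=> Mz; rewrite gt_eqF// (cask_positive hM Mz). Qed.

Definition wrow z : rV := \row_i w F i z.

Lemma wrowE z : M z -> wrow z = (z : rV) *m period_mx F z.
Proof.
move=> Mz; apply/rowP => i; rewrite !mxE (w_euler hM i Mz); apply: eq_bigr => j _.
by rewrite mxE mulrC (tau_sym hM).
Qed.

Lemma i2_neq0 : 2 * 'i != 0 :> C.
Proof. by rewrite mulf_neq0 ?pnatr_eq0 ?complexi_neq0. Qed.

(** The Euler relations w_i = tau_ij z^j remove the second derivatives of the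
    prepotential, so that the derivative of r^2 involves no third ones. *)
Lemma rsq_dot z : M z -> rsq F z =
  (2 * 'i)^-1 * (dot (wrow z) (cj (z : rV)) - dot (z : rV) (cj (wrow z))).
Proof.
move=> Mz; rewrite (wrowE Mz) cjM (dot_period hM Mz) rsqE.
by rewrite (mulKf i2_neq0).
Qed.

Lemma wrow_rder z u : M z ->
  rder_row (fun t => wrow (z + t%:C *: u)) 0 ((u : rV) *m period_mx F z).
Proof.
move=> Mz i; apply: rder_ext (rder_eq (w_rder hM i u Mz) _) => [t|].
  by rewrite mxE.
by rewrite mxE; apply: eq_bigr => j _; rewrite mxE mulrC (tau_sym hM).
Qed.

Lemma drsq_sum (k a b c d a' b' : C) : k != 0 -> a - b = k * a' -> c - d = k * b' ->
  k^-1 * ((a + c) - (b + d)) = 2 * (2^-1 * (b' + a')).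
Proof.
move=> k0 h1 h2; rewrite opprD addrACA h1 h2 -mulrDr (mulKf k0) mulVKf ?pnatr_eq0//.
by rewrite addrC.
Qed.

(** The derivative of N does not contribute, again by homogeneity. *)
Lemma rsq_rder z u : M z ->
  rder (fun t => rsq F (z + t%:C *: u)) 0 (2 * herm (Nc z) u z).
Proof.
move=> Mz; have [e e0 He] := near_segment (cask_open hM) u Mz.
have Hw := wrow_rder u Mz; have Hl := @rder_row_lin R n z u.
have H := rderZ (2 * 'i)^-1 (rderB (rder_dot Hw (rder_row_cj Hl)) (rder_dot Hl (rder_row_cj Hw))).
apply: rder_eq (rder_local e0 _ H) _ => [t te|]; first by rewrite rsq_dot//; exact: He.
rewrite /= scale0r addr0 (wrowE Mz) !cjM.
have h1 := dot_period hM Mz z (cj (u : rV)); have h2 := dot_period hM Mz u (cj (z : rV)).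
exact: (drsq_sum i2_neq0 h1 h2).
Qed.

(** Tangent vectors of the quotient, in the chart z^0 = 1. *)
Definition ext (v : Cvec R n) : rV := row_mx (0 : Cvec R 1) v.

Lemma row_coords (x y : rV) : x 0 ord0 = y 0 ord0 ->
  (forall i : 'I_n, x 0 (lift ord0 i) = y 0 (lift ord0 i)) -> x = y.
Proof.
by move=> h0 hS; apply/rowP => i; case: (unliftP ord0 i) => [j|] ->.
Qed.

Lemma ord0_lshift : ord0 = lshift n (ord0 : 'I_1) :> 'I_n.+1.
Proof. exact: val_inj. Qed.
Lemma lift_rshift (i : 'I_n) : lift ord0 i = rshift 1 i :> 'I_n.+1.
Proof. exact: val_inj. Qed.

Lemma Xhom0 (X : Cvec R n) : Xhom X 0 ord0 = 1 :> C.
Proof. by rewrite ord0_lshift; apply: etrans (row_mxEl _ _ _ _) _; rewrite mxE. Qed.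
Lemma XhomS (X : Cvec R n) i : Xhom X 0 (lift ord0 i) = X 0 i :> C.
Proof. by rewrite lift_rshift; exact: row_mxEr. Qed.
Lemma ext0 v : ext v 0 ord0 = 0.
Proof. by rewrite ord0_lshift; apply: etrans (row_mxEl _ _ _ _) _; rewrite mxE. Qed.
Lemma extS v i : ext v 0 (lift ord0 i) = v 0 i.
Proof. by rewrite lift_rshift; exact: row_mxEr. Qed.

Lemma Xhom_line X (v : Cvec R n) (s : C) : Xhom (X + s *: v) = Xhom X + s *: ext v.
Proof. apply: row_coords => [|i]; rewrite [RHS]mxE [X in _ = _ + X]mxE.
  by rewrite !Xhom0 ext0 mulr0 addr0.
by rewrite !XhomS extS !mxE. Qed.

Lemma extZ (s : C) (v : Cvec R n) : ext (s *: v) = s *: ext v.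
Proof. apply: row_coords => [|i]; rewrite [in RHS]mxE; first by rewrite !ext0 mulr0.
by rewrite !extS mxE. Qed.

Lemma KpotC_dR X v : M (Xhom X) ->
  dR (KpotC F) X v = - (2 * herm (Nc (Xhom X)) (ext v) (Xhom X) / rsq F (Xhom X)).
Proof.
move=> My; have y0 := rsq_gt0 My.
have H := rsq_rder (ext v : Cvec R n.+1) My.
have := @rder_Nln R (fun t => rsq F (Xhom X + t%:C *: ext v)) _ H.
rewrite scale0r addr0 => /(_ y0) H2.
apply: rder_ddt; apply: rder_ext (rder_eq H2 _) => [t|].
  by rewrite /KpotC /Kpot Xhom_line.
apply: real_quotient; last by rewrite [in LHS](rsq_real My) cJ_real -(rsq_real My).
by rewrite cJM cJ_nat herm_conj ?cj_rc// (rcNmx_sym hM My).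
Qed.

Lemma KpotC_delbar X v : M (Xhom X) -> delbar (KpotC F) X v =
  - (dot ((Xhom X : rV) *m Nc (Xhom X)) (cj (ext v)) / rsq F (Xhom X)).
Proof.
move=> My; rewrite /delbar (KpotC_dR v My) (KpotC_dR ('i *: v) My) extZ -herm_bar.
move: (herm _ _ _) (herm _ _ _) (rsq_neq0 My) => a b r0.
by field.
Qed.


Lemma ext_delta_real j : cj (ext (delta_mx 0 j)) = ext (delta_mx 0 j).
Proof.
apply: row_coords => [|i]; rewrite cjE.
  by rewrite ext0; exact: (rmorph0 (Num.conj : {rmorphism C -> C})).
by rewrite extS mxE; exact: (rmorph_nat (Num.conj : {rmorphism C -> C})).
Qed.

Lemma dot_N_sum (k a b c d : C) : k != 0 -> a - b = k * c ->
  k^-1 * (a - (d + b)) = c - k^-1 * d.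
Proof.
by move=> k0 h; rewrite opprD addrCA h mulrDr (mulKf k0) mulrN addrC.
Qed.

(** With a real row e, these are the derivatives in the directions u and i u of
    the coefficients of - r^2 delbar K. Since z N = (w - z conj tau) / 2 i, the
    only derivative of tau that occurs is conjugate, and its contributions D in
    the two directions cancel in the (1,0) derivative. *)
Lemma dot_N_rder z u (e : rV) : M z -> cj e = e -> exists D : rV,
  rder (fun t => dot ((z + t%:C *: u : rV) *m Nc (z + t%:C *: u)) e) 0
    (dot ((u : rV) *m Nc z) e - (2 * 'i)^-1 * dot (z : rV) (cj D)) /\
  rder (fun t => dot ((z + t%:C *: ('i *: u) : rV) *m Nc (z + t%:C *: ('i *: u))) e) 0
    (dot (('i *: u : rV) *m Nc z) e - (2 * 'i)^-1 * dot (z : rV) (cj ('i *: D))).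
Proof.
move=> Mz re.
have /choice[D HD] : forall i, exists d, cder (fun s => ((e *m period_mx F (z + s *: u)) 0 i : C)) 0 d.
  move=> i; have /choice[d Hd] : forall j, exists d, cder (fun s => tau F j i (z + s *: u)) 0 d.
    by move=> j; exact: (tau_cder hM).
  exists (\sum_j e 0 j * d j).
  have H1 j : predT j -> cder (fun s => e 0 j * tau F j i (z + s *: u)) 0 (e 0 j * d j).
    by move=> _; exact: cderZ (e 0 j) (Hd j).
  apply: (eq_frechet (frechet_near ltr01 _ _ (frechet_sum (@cabs_ge0 R) (index_enum _) H1))).
  - by move=> h _; rewrite add0r mxE; apply: eq_bigr => j _; rewrite mxE.
  - by rewrite mxE; apply: eq_bigr => j _; rewrite mxE.
  - by move=> h; rewrite mulr_suml.
exists (\row_i D i).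
have gen (v : Cvec R n.+1) (D' : rV) :
    rder_row (fun t => e *m period_mx F (z + t%:C *: v)) 0 D' ->
    rder (fun t => dot ((z + t%:C *: v : rV) *m Nc (z + t%:C *: v)) e) 0
    (dot ((v : rV) *m Nc z) e - (2 * 'i)^-1 * dot (z : rV) (cj D')).
  move=> HD'; have [r r0 Hr] := near_segment (cask_open hM) v Mz.
  have Hw := wrow_rder v Mz; have Hl := @rder_row_lin R n z v.
  have H := rderZ (2 * 'i)^-1 (rderB (rder_dot Hw (rder_row_cst e 0)) (rder_dot Hl (rder_row_cj HD'))).
  apply: rder_eq (rder_local r0 _ H) _ => [t tr|].
    have Mt := Hr t tr; rewrite (wrowE Mt) cjM re (dot_period hM Mt) (mulKf i2_neq0) //.
  rewrite /= scale0r addr0 dotC dot0l add0r cjM re.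
  have h := dot_period hM Mz v e.
  exact: (dot_N_sum _ i2_neq0 h).
have DE i : (\row_i D i) 0 i = D i by rewrite mxE.
split; apply: gen => i; first by rewrite DE; exact: (cder_rder (HD i)).
apply: rder_eq (rder_ext _ (cder_rder (cder_scale 'i (HD i)))) _ => [t|].
  by rewrite scalerA.
by rewrite [RHS]mxE DE mulrC.
Qed.


Lemma dot_iN (x y e : rV) (N : 'M[C]_n.+1) (D x' : rV) : x' = 'i *: x ->
  dot (x' *m N) e - (2 * 'i)^-1 * dot y (cj ('i *: D)) =
  'i * dot (x *m N) e + 'i * ((2 * 'i)^-1 * dot y (cj D)).
Proof.
by move=> ->; rewrite cjZ cJi -scalemxAl dotZl dotZr mulrCA mulNr opprK.
Qed.

Lemma hess_sum (i A Q B r h1 h2 L : C) : i * i = -1 -> r != 0 -> h1 - i * h2 = L ->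
  (- (B * (- (2 * h1) / r ^+ 2) + (A - Q) / r) -
    i * - (B * (- (2 * h2) / r ^+ 2) + (i * A + i * Q) / r)) / 2 =
  - (A / r) + B * L / r ^+ 2.
Proof.
move=> ii r0 <-; have -> : (i * A + i * Q) / r = i * ((A + Q) / r) by ring.
have -> : (- (B * (- (2 * h1) / r ^+ 2) + (A - Q) / r) -
    i * - (B * (- (2 * h2) / r ^+ 2) + i * ((A + Q) / r))) / 2 =
  B * (h1 - i * h2) / r ^+ 2 + ((i * i) * ((A + Q) / r) - (A - Q) / r) / 2 by field.
by rewrite ii; field.
Qed.

(** The antiholomorphic derivative of N drops out of the (1,1) part of the
    Hessian, which therefore involves no third derivatives of F. *)
Lemma KpotC_hess X v j : M (Xhom X) ->
  del (fun Y => delbar (KpotC F) Y (delta_mx 0 j)) X v =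
  - (dot (ext v *m Nc (Xhom X)) (ext (delta_mx 0 j)) / rsq F (Xhom X)) +
  dot ((Xhom X : rV) *m Nc (Xhom X)) (ext (delta_mx 0 j)) *
    dot (ext v *m Nc (Xhom X)) (cj (Xhom X : rV)) / rsq F (Xhom X) ^+ 2.
Proof.
move=> My; set y := Xhom X; set e := ext (delta_mx 0 j).
have re : cj e = e := ext_delta_real j.
have r0 := rsq_neq0 My.
have [D [HD1 HD2]] := dot_N_rder (ext v : Cvec R n.+1) My re.
have HG v' b' : rder (fun t => dot ((y + t%:C *: ext v' : rV) *m Nc (y + t%:C *: ext v')) e) 0 b' ->
    dR (fun Y => delbar (KpotC F) Y (delta_mx 0 j)) X v' =
    - (dot ((y : rV) *m Nc y) e * (- (2 * herm (Nc y) (ext v') y) / rsq F y ^+ 2) + b' / rsq F y).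
  move=> Hb; have [d d0 Hd] := near_segment (cask_open hM) (ext v' : Cvec R n.+1) My.
  have Hr := rsq_rder (ext v' : Cvec R n.+1) My.
  have Hr0 : rsq F (y + 0%:C *: ext v') != 0 by rewrite scale0r addr0.
  apply: rder_ddt; apply: rder_eq (rder_local d0 _ (rderN (rderM Hb (rderV Hr Hr0)))) _ => [t td|].
    by rewrite KpotC_delbar Xhom_line ?re//; exact: Hd.
  by rewrite /= scale0r addr0.
rewrite -extZ in HD2; rewrite (dot_iN (y : rV) e (Nc y) D (extZ 'i v)) in HD2.
rewrite /del (HG v _ HD1) (HG ('i *: v) _ HD2) extZ.
exact: (hess_sum _ _ _ (complexii R) r0 (herm_del _ _ _)).
Qed.

End Potential.

Section SliceAlgebra.
Variables (R : realType) (n : nat).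
Local Notation C := R[i].
Local Notation rV := ('rV[C]_n.+1).
Implicit Types (x y z : rV) (A : 'M[C]_n.+1).

Lemma herm_i_sum (i a b : C) : 2^-1 * (i * a + - i * b) = - (2^-1 * (- i * a + i * b)).
Proof. ring. Qed.

Lemma herm_i A x y : herm A ('i *: x) y = - herm A x ('i *: y).
Proof. by rewrite /herm !cjZ cJi -!scalemxAl !dotZl !dotZr; exact: herm_i_sum. Qed.

Lemma herm_iz A z : herm A ('i *: z) z = 0.
Proof.
by rewrite /herm cjZ cJi -scalemxAl dotZl dotZr mulNr subrr mulr0.
Qed.

Lemma hermNl A x y : herm A (- x) y = - herm A x y.
Proof. by rewrite /herm cjN mulNmx dotNl dotNr -opprD mulrN. Qed.

Lemma hermBl A x x' y : herm A (x - x') y = herm A x y - herm A x' y.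
Proof. by rewrite hermDl hermNl. Qed.

Lemma dK_sum (t K h r : C) : t != 0 -> r != 0 ->
  - (2 * (t * (t * (h - K * r))) / (t * (t * r))) = 2 * K - 2 * h / r.
Proof. by move=> t0 r0; field; rewrite t0 r0. Qed.

(** On the representative e of a tangent vector of the quotient at y = t z, the
    radial component k of the vector shows up as an additive constant. *)
Lemma slice_dK A A' (t k : R) (x y z e : rV) (r r' : C) : A' = A ->
  e = t%:C *: (x - k%:C *: z) -> y = t%:C *: z -> r' = t%:C * (t%:C * r) ->
  r = herm A z z -> t%:C != 0 :> C -> r != 0 ->
  - (2 * herm A' e y / r') = 2 * k%:C - 2 * herm A x z / r.
Proof.
move=> -> -> -> -> rE t0 r0; rewrite hermZl hermZr hermBl hermZl -rE; exact: dK_sum.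
Qed.

Lemma slice_dcK A A' (t k : R) (x y z e : rV) (r r' : C) : A' = A ->
  e = 'i *: (t%:C *: (x - k%:C *: z)) -> y = t%:C *: z -> r' = t%:C * (t%:C * r) ->
  t%:C != 0 :> C -> r != 0 ->
  - (2 * herm A' e y / r') = - (2 * herm A ('i *: x) z / r).
Proof.
move=> -> -> -> -> t0 r0.
have -> : 'i *: (t%:C *: (x - k%:C *: z)) = t%:C *: ('i *: x - k%:C *: ('i *: z)).
  rewrite scalerA mulrC -scalerA scalerBr; congr (_ *: (_ - _)).
  by rewrite scalerA mulrC -scalerA.
rewrite hermZl hermZr hermBl hermZl herm_iz mulr0 subr0.
by move: (herm _ _ _) => h; field; rewrite t0 r0.
Qed.

Lemma dcK_sum (i a h : C) : i * i = -1 ->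
  i * ((a + i * - h) / 2 - (a - i * - h) / 2) = h.
Proof.
move=> ii; have -> : i * ((a + i * - h) / 2 - (a - i * - h) / 2) = - (i * i) * h by field.
by rewrite ii opprK mul1r.
Qed.

Lemma etatilde_sum (a b r : C) : r != 0 -> a = - b -> r^-1 * a = - (2 * b / r / 2).
Proof. by move=> r0 ->; field. Qed.

Lemma DXg_sum (q r z Zu Zz h k : C) : q != 0 -> r != 0 -> z != 0 ->
  z^-1 * (Zu - k / z * Zz) + Zz / z * (4 * q * h / (2 * (2 * q * r)) + (2 * (k / z) - 2 * h / r) / 2)
  = Zu / z.
Proof. by move=> q0 r0 z0; field; rewrite q0 r0 z0. Qed.

Lemma expK_sum (r t s : C) : r != 0 -> t = s^-1 -> s != 0 -> (t * (t * r))^-1 = s ^+ 2 / r.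
Proof. by move=> r0 -> s0; field; rewrite r0 s0. Qed.

(** The mixed second derivative of K = - log r^2 at y, where A and r are the
    values of N and r^2 at y. *)
Definition hess_form A y (r : C) x x' : C :=
  - (dot (x *m A) x' / r) + dot (y *m A) x' * dot (x *m A) (cj y) / r ^+ 2.

Lemma hess_formDl A y r x1 x2 x' :
  hess_form A y r (x1 + x2) x' = hess_form A y r x1 x' + hess_form A y r x2 x'.
Proof.
rewrite /hess_form mulmxDl !dotDl.
move: (dot _ _) (dot _ _) (dot _ _) (dot _ _) (dot _ _) => a b c d e; ring.
Qed.

Lemma hess_formDr A y r x x1 x2 :
  hess_form A y r x (x1 + x2) = hess_form A y r x x1 + hess_form A y r x x2.
Proof.
rewrite /hess_form !dotDr.
move: (dot _ _) (dot _ _) (dot _ _) (dot _ _) (dot _ _) => a b c d e; ring.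
Qed.

Lemma hess_formZl A y r k x x' : hess_form A y r (k *: x) x' = k * hess_form A y r x x'.
Proof.
rewrite /hess_form -scalemxAl !dotZl.
move: (dot _ _) (dot _ _) (dot _ _) => a b c; ring.
Qed.

Lemma hess_formZr A y r k x x' : hess_form A y r x (k *: x') = k * hess_form A y r x x'.
Proof.
rewrite /hess_form !dotZr.
move: (dot _ _) (dot _ _) (dot _ _) => a b c; ring.
Qed.

Lemma hess_form0l A y r x' : hess_form A y r 0 x' = 0.
Proof. by rewrite -(scale0r (0 : rV)) hess_formZl mul0r. Qed.
Lemma hess_form0r A y r x : hess_form A y r x 0 = 0.
Proof. by rewrite -(scale0r (0 : rV)) hess_formZr mul0r. Qed.

Lemma hess_form_sum A y r m (a b : 'I_m -> C) (e : 'I_m -> rV) :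
  hess_form A y r (\sum_i a i *: e i) (\sum_j b j *: e j) =
  \sum_i \sum_j hess_form A y r (e i) (e j) * (a i * b j).
Proof.
rewrite (big_morph (fun x => hess_form A y r x _) (fun x1 x2 => hess_formDl A y r x1 x2 _) (hess_form0l A y r _)).
apply: eq_bigr => i _.
rewrite (big_morph (hess_form A y r (a i *: e i)) (hess_formDr A y r _) (hess_form0r A y r _)).
apply: eq_bigr => j _; rewrite hess_formZl hess_formZr.
by rewrite mulrA mulrC.
Qed.

Lemma hess_form_rows A y r m (a b : 'I_m -> C) (e : 'I_m -> rV) x x' :
  x = \sum_i a i *: e i -> x' = \sum_j b j *: e j ->
  hess_form A y r x x' = \sum_i \sum_j hess_form A y r (e i) (e j) * (a i * b j).
Proof. by move=> -> ->; exact: hess_form_sum. Qed.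

Lemma sprod_sum (h a b c d : C) :
  h * ((a * b + c * d) / 2) = (h * (a * b) + h * (c * d)) / 2.
Proof. ring. Qed.

Lemma dot_real_conj A x y : A^T = A -> cj A = A ->
  (dot (x *m A) (cj y))^*%C = dot (y *m A) (cj x).
Proof. by move=> sA rA; rewrite dotJ cjM rA cjK (dot_sym _ _ sA). Qed.

Lemma gMbar_sum (a b r Lu Lv Lu' Lv' t ku kv : C) : r != 0 -> t != 0 ->
  (- (t * (t * (a - kv * Lu - ku * Lv' + ku * kv * r)) / (t * (t * r))) +
    (t * (t * (Lv' - kv * r))) * (t * (t * (Lu - ku * r))) / (t * (t * r)) ^+ 2 +
   (- (t * (t * (b - ku * Lv - kv * Lu' + kv * ku * r)) / (t * (t * r))) +
    (t * (t * (Lu' - ku * r))) * (t * (t * (Lv - kv * r))) / (t * (t * r)) ^+ 2)) / 2 =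
  - (2^-1 * (a + b) / r) + (Lu * Lv' + Lv * Lu') / 2 / r ^+ 2.
Proof. by move=> r0 t0; field; rewrite r0 t0. Qed.

Lemma hess_form_val A y r x x' (a b c : C) : dot (x *m A) x' = a ->
  dot (y *m A) x' = b -> dot (x *m A) (cj y) = c ->
  hess_form A y r x x' = - (a / r) + b * c / r ^+ 2.
Proof. by move=> <- <- <-. Qed.

Lemma hess_form_slice A (t ku kv : R) xu xv y z eu ev (r r' : C) : A^T = A -> cj A = A ->
  eu = t%:C *: (xu - ku%:C *: z) -> ev = t%:C *: (xv - kv%:C *: z) ->
  y = t%:C *: z -> r' = t%:C * (t%:C * r) -> r = dot (z *m A) (cj z) ->
  t%:C != 0 :> C -> r != 0 ->
  (hess_form A y r' eu (cj ev) + hess_form A y r' ev (cj eu)) / 2 =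
  - (herm A xu xv / r) +
    (dot (xu *m A) (cj z) * (dot (xv *m A) (cj z))^*%C +
     dot (xv *m A) (cj z) * (dot (xu *m A) (cj z))^*%C) / 2 / r ^+ 2.
Proof.
move=> sA rA -> -> -> -> rE t0 r0; rewrite !(dot_real_conj _ _ sA rA).
have e x x' k k' : dot ((t%:C *: (x - k%:C *: z)) *m A) (cj (t%:C *: (x' - k'%:C *: z))) =
    t%:C * (t%:C * (dot (x *m A) (cj x') - k'%:C * dot (x *m A) (cj z) - k%:C * dot (z *m A) (cj x')
      + k%:C * k'%:C * r)).
  rewrite cjZ cjB cjZ !cJ_real -scalemxAl mulmxBl -scalemxAl dotZl dotZr dotBl !dotBr !dotZl !dotZr -rE.
  by rewrite -[_ * k'%:C * r]mulrA opprB addrA addrAC.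
have e0 x k : dot ((t%:C *: (x - k%:C *: z)) *m A) (cj (t%:C *: z)) =
    t%:C * (t%:C * (dot (x *m A) (cj z) - k%:C * r)).
  by rewrite cjZ cJ_real -scalemxAl mulmxBl -scalemxAl dotZl dotZr dotBl dotZl -rE.
have e1 x k : dot ((t%:C *: z) *m A) (cj (t%:C *: (x - k%:C *: z))) =
    t%:C * (t%:C * (dot (z *m A) (cj x) - k%:C * r)).
  by rewrite cjZ cjB cjZ !cJ_real -scalemxAl dotZl dotZr dotBr dotZr -rE.
apply: etrans (f_equal2 (fun a b => (a + b) / 2)
  (hess_form_val _ (e xu xv ku kv) (e1 xv kv) (e0 xu ku))
  (hess_form_val _ (e xv xu kv ku) (e1 xu ku) (e0 xv kv))) _.
exact: gMbar_sum.
Qed.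

Lemma herm_i_antisym A x y : herm A ('i *: x) y = - herm A ('i *: y) x.
Proof. by rewrite herm_i (herm_swap A). Qed.

End SliceAlgebra.

Section Slice.
Variables (R : realType) (n : nat) (M : set (Cvec R n.+1)) (F : Cvec R n.+1 -> R[i]^o).
Local Notation C := R[i].
Local Notation rV := ('rV[C]_n.+1).
Local Notation piC := ((pi : R)%:C).
Hypothesis hM : CASK_domain M F.
Variable p : TN R n.
Hypothesis Mp : M (zN p).
Hypothesis z0_gt0 : 0 < zN p 0 ord0.
Implicit Types (g : Lambda n) (u v : TN R n).
Local Notation Nc z := (rc (Nmx F z)).
Local Notation N := (Nc (zN p)).
Local Notation zz := (zr p).
Local Notation z0 := (zN p 0 ord0).
Local Notation r2 := (rsq F (zN p)).
Local Notation X := (Xcoord (zN p)).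

Let s : R := complex.Re z0.
Lemma z0E : z0 = s%:C. Proof. by have [] := gt0_complex z0_gt0. Qed.
Lemma s_gt0 : 0 < s. Proof. by have [] := gt0_complex z0_gt0. Qed.
Lemma z0_neq0 : z0 != 0. Proof. by rewrite gt_eqF. Qed.

Lemma Xhom_Xcoord : Xhom X = z0^-1 *: zN p.
Proof.
apply: row_coords => [|i].
  by rewrite Xhom0 mxE mulVf// z0_neq0.
by rewrite XhomS !mxE mulrC.
Qed.

Lemma Nmx_scale (l : C) z : l != 0 -> M z -> Nmx F (l *: z) = Nmx F z.
Proof.
move=> l0 Mz; apply/matrixP => i j; rewrite [LHS]mxE [RHS]mxE.
by apply: f_equal; exact: (tau_homogeneous hM).
Qed.

Lemma MX : M (Xhom X).
Proof. by rewrite Xhom_Xcoord; apply: (cask_scale hM) => //; rewrite invr_eq0 z0_neq0. Qed.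

Lemma NX : Nc (Xhom X) = N.
Proof. by rewrite Xhom_Xcoord Nmx_scale// invr_eq0 z0_neq0. Qed.

Lemma XhomE : Xhom X = (s^-1)%:C *: zz :> rV.
Proof. by rewrite Xhom_Xcoord z0E fmorphV. Qed.

Lemma rsqX : rsq F (Xhom X) = (s^-1)%:C * ((s^-1)%:C * r2).
Proof. by rewrite rsq_herm NX XhomE hermZl hermZr -rsq_herm. Qed.

(** The derivative of z / z^0 in the direction u. *)
Definition dXhom u : rV := z0^-1 *: (zr u - (zN u 0 ord0 / z0) *: zz).

Lemma quotient_rder (a b a' b' : C) : b != 0 ->
  rder (fun t => (a + t%:C * a') / (b + t%:C * b')) 0 (b^-1 * (a' - b' / b * a)).
Proof.
move=> b0; have b0' : b + 0%:C * b' != 0 by rewrite mul0r addr0.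
apply: rder_eq (rderM (rder_lin a a' 0) (rderV (rder_lin b b' 0) b0')) _.
by rewrite /= !mul0r !addr0; field.
Qed.

Lemma dXE i u : dX i p u = dXhom u 0 (lift ord0 i).
Proof.
apply: rder_ddt; apply: rder_eq (rder_ext _ (quotient_rder _ _ _ z0_neq0)) _ => [t|].
  by rewrite mxE /zN /= !mxE.
by rewrite !mxE.
Qed.

Lemma ext_dX u : ext (dXrow p u) = dXhom u.
Proof.
apply: row_coords => [|i]; last by rewrite extS mxE dXE.
by rewrite ext0 !mxE divfK ?z0_neq0// subrr mulr0.
Qed.

Lemma ZyB g (x y : rV) : Zy g (x - y) = Zy g x - Zy g y.
Proof. by have := ZyD g x y (-1); rewrite scaleN1r mulN1r. Qed.

Lemma dXgE g u : g.1 = 0 -> dXg F g p u = Zy g (dXhom u).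
Proof.
move=> g0; apply: rder_ddt.
apply: rder_eq (rder_ext _ (quotient_rder (Zy g (zN p)) (Zy g (zN u)) (zN u 0 ord0) z0_neq0)) _ => [t|].
  by rewrite /Xg Z_Zy// /zN /= ZyD !mxE.
by rewrite /dXhom Zy_scale ZyB Zy_scale.
Qed.

Lemma rho_rder (c : R) u :
  rder (fun t => rho F c (line p u t)) 0 (4 * piC * herm N (zr u) zz).
Proof.
have H := rderB (rderZ (2 * piC) (rsq_rder hM (zN u) Mp)) (rder_cst c%:C 0).
apply: rder_eq H _; rewrite subr0 mulrA; congr (_ * _).
by rewrite mulrAC -natrM.
Qed.

Lemma dN_rho (c : R) u : dN (rho F c) p u = 4 * piC * herm N (zr u) zz.
Proof. exact/rder_ddt/rho_rder. Qed.

Lemma etatilde_herm u : etatilde F p u = r2^-1 * herm N ('i *: zz) (zr u).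
Proof. by rewrite /etatilde gME. Qed.

Section Tangent.
Variable u : TN R n.
Hypothesis tu : complex.Im (zN u 0 ord0) = 0.
Let k : R := complex.Re (zN u 0 ord0) / s.

Lemma u0E : zN u 0 ord0 / z0 = k%:C.
Proof.
rewrite z0E /k rmorphM fmorphV; congr (_ / _).
by move: tu; case: (zN u 0 ord0) => a b /= ->.
Qed.

Lemma dXhomE : dXhom u = (s^-1)%:C *: (zr u - k%:C *: zz).
Proof. by rewrite /dXhom u0E z0E fmorphV. Qed.

Lemma sV_neq0 : (s^-1)%:C != 0 :> C.
Proof. by rewrite fmorph_eq0 invr_eq0 gt_eqF// s_gt0. Qed.

Lemma dKE : dK F p u = 2 * (zN u 0 ord0 / z0) - 2 * herm N (zr u) zz / r2.
Proof.
rewrite u0E; apply: etrans (KpotC_dR hM _ MX) _.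
exact: (slice_dK NX (etrans (ext_dX u) dXhomE) XhomE rsqX (rsq_herm _ _) sV_neq0 (rsq_neq0 hM Mp)).
Qed.

Lemma dcKE : dcK F p u = 2 * herm N ('i *: zr u) zz / r2.
Proof.
have e : dR (KpotC F) X ('i *: dXrow p u) = - (2 * herm N ('i *: zr u) zz / r2).
  apply: etrans (KpotC_dR hM _ MX) _.
  have eu : ext ('i *: dXrow p u) = 'i *: ((s^-1)%:C *: (zr u - k%:C *: zz)).
    by rewrite extZ ext_dX dXhomE.
  exact: (slice_dcK NX eu XhomE rsqX sV_neq0 (rsq_neq0 hM Mp)).
rewrite /dcK /dc /delbar /del e; exact: (dcK_sum _ _ (complexii R)).
Qed.

(** On M, - d^c K / 2 and the contact form differ by the differential of the
    argument of z^0, which vanishes along the slice. *)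
Lemma etatildeE : etatilde F p u = - (dcK F p u / 2).
Proof.
rewrite etatilde_herm dcKE; exact: (etatilde_sum (rsq_neq0 hM Mp) (herm_i_antisym _ _ _)).
Qed.


(** The slice arg z^0 = 0 fixes the phase of the lift of dX_gamma, and
    d rho / (2 (rho + c)) + dK / 2 its modulus. *)
Lemma DXgE (c : R) g : g.1 = 0 -> DXg F c g p u = Zy g (zr u) / z0.
Proof.
move=> g0; rewrite /DXg (dXgE u g0) dN_rho dKE.
have -> : rho F c p + c%:C = 2 * piC * r2 by rewrite /rho subrK.
rewrite /Xg (Z_Zy F _ g0) /dXhom Zy_scale ZyB Zy_scale.
exact: (DXg_sum _ _ _ _ (piC_neq0 R) (rsq_neq0 hM Mp) z0_neq0).
Qed.

(** r^2 is homogeneous, and the point of the quotient is represented by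
    z / z^0. *)
Lemma expKE : expK F p = z0 ^+ 2 / r2.
Proof.
rewrite /expK /Kpot; have h := rsq_gt0 hM MX.
rewrite expRN lnK; last by rewrite posrE.
apply: etrans (fmorphV (@real_complex R) _) _.
apply: etrans (congr1 GRing.inv (etrans (esym (rsq_real hM MX)) rsqX)) _.
rewrite z0E; apply: (expK_sum (rsq_neq0 hM Mp) (fmorphV (@real_complex R) s)).
by have := z0_neq0; rewrite z0E.
Qed.

End Tangent.

Lemma ext_sum (v : Cvec R n) : ext v = \sum_i v 0 i *: ext (delta_mx 0 i).
Proof.
apply: row_coords => [|i]; rewrite summxE.
  by rewrite ext0 big1// => i _; rewrite mxE ext0 mulr0.
rewrite extS (bigD1 i)//= big1 => [|j ji]; rewrite mxE extS mxE eqxx /=.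
  by rewrite eqxx mulr1 addr0.
by rewrite eq_sym (negbTE ji) mulr0.
Qed.

Lemma conj_dXrow u : cj (dXhom u) = \sum_i (dX i p u)^*%C *: ext (delta_mx 0 i).
Proof.
rewrite -ext_dX ext_sum; apply/rowP => k; rewrite cjE !summxE cJ_sum.
by apply: eq_bigr => i _; rewrite [in RHS]mxE mxE cJM mxE -cjE ext_delta_real.
Qed.

Lemma dXhom_sum u : dXhom u = \sum_i dX i p u *: ext (delta_mx 0 i).
Proof. by rewrite -ext_dX ext_sum; apply: eq_bigr => i _; rewrite mxE. Qed.

Lemma hessX i j :
  del (fun Y => delbar (KpotC F) Y (delta_mx 0 j)) X (delta_mx 0 i) =
  hess_form N (Xhom X) (rsq F (Xhom X)) (ext (delta_mx 0 i)) (ext (delta_mx 0 j)).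
Proof.
apply: etrans (KpotC_hess hM _ _ MX) _.
exact: (congr1 (fun A => hess_form A (Xhom X) (rsq F (Xhom X)) (ext (delta_mx 0 i)) (ext (delta_mx 0 j))) NX).
Qed.

Lemma gMbar_hess u v : gMbar F p u v =
  (hess_form N (Xhom X) (rsq F (Xhom X)) (dXhom u) (cj (dXhom v)) +
   hess_form N (Xhom X) (rsq F (Xhom X)) (dXhom v) (cj (dXhom u))) / 2.
Proof.
have h1 := hess_form_rows N (Xhom X) (rsq F (Xhom X)) (dXhom_sum u) (conj_dXrow v).
have h2 := hess_form_rows N (Xhom X) (rsq F (Xhom X)) (dXhom_sum v) (conj_dXrow u).
apply: etrans _ (esym (f_equal2 (fun a b => (a + b) / 2) h1 h2)).
rewrite -big_split mulr_suml; apply: eq_bigr => i _.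
rewrite -big_split mulr_suml; apply: eq_bigr => j _.
rewrite hessX; exact: sprod_sum.
Qed.

(** The metric of the quotient is insensitive to the component of a vector along
    z, so that dz may replace the derivative of z / z^0. *)
Lemma gMbar_slice u v : complex.Im (zN u 0 ord0) = 0 -> complex.Im (zN v 0 ord0) = 0 ->
  gMbar F p u v = - (gM F p u v / r2) +
    (dot (zr u *m N) (cj zz) * (dot (zr v *m N) (cj zz))^*%C +
     dot (zr v *m N) (cj zz) * (dot (zr u *m N) (cj zz))^*%C) / 2 / r2 ^+ 2.
Proof.
move=> tu tv; rewrite gMbar_hess gME.
exact: (hess_form_slice (rcNmx_sym hM Mp) (cj_rc _) (dXhomE tu) (dXhomE tv) XhomE rsqX (rsqE F _)
  sV_neq0 (rsq_neq0 hM Mp)).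
Qed.


Lemma rlog_split (h a b e r i : C) : r != 0 -> i * i = -1 -> e = r^-1 * (2^-1 * (i * b + - i * a)) ->
  h = 2^-1 * (a + b) -> a = r * (h / r + i * e) /\ b = r * (h / r - i * e).
Proof.
move=> r0 ii -> ->.
have h1 : i * (r^-1 * (2^-1 * (i * b + - i * a))) = (i * i) * ((b - a) / 2 / r) by field.
by rewrite h1 ii; split; field.
Qed.

Lemma rlog_prod (q r hu hv eu ev i : C) : q != 0 -> r != 0 -> i * i = -1 ->
  (r * (hu / r + i * eu) * (r * (hv / r - i * ev)) +
   r * (hv / r + i * ev) * (r * (hu / r - i * eu))) / 2 / r ^+ 2 =
  (4 * q * hu) * (4 * q * hv) / (4 * (2 * q * r) ^+ 2) + eu * ev.
Proof.
move=> q0 r0 ii.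
have -> : (r * (hu / r + i * eu) * (r * (hv / r - i * ev)) +
   r * (hv / r + i * ev) * (r * (hu / r - i * eu))) / 2 / r ^+ 2 =
   hu * hv / r ^+ 2 - (i * i) * (eu * ev) by field.
by rewrite ii; field; rewrite r0 q0.
Qed.

(** The Hermitian product with z has d r^2 / 2 as real part and r^2 times the
    contact form as imaginary part. *)
Lemma dot_rlog u :
  dot (zr u *m N) (cj zz) = r2 * (herm N (zr u) zz / r2 + 'i * etatilde F p u) /\
  (dot (zr u *m N) (cj zz))^*%C = r2 * (herm N (zr u) zz / r2 - 'i * etatilde F p u).
Proof.
rewrite (dot_real_conj _ _ (rcNmx_sym hM Mp) (cj_rc _)).
apply: (rlog_split (rsq_neq0 hM Mp) (complexii R)) => //.
by rewrite etatilde_herm /herm cjZ cJi -scalemxAl dotZl dotZr.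
Qed.

(** The metric of M is a cone over the quotient, up to sign: its radial part is
    d rho and its angular part the contact form. *)
Lemma gMbarE (c : R) u v : complex.Im (zN u 0 ord0) = 0 -> complex.Im (zN v 0 ord0) = 0 ->
  gMbar F p u v = - (gM F p u v / r2) +
    (dN (rho F c) p u * dN (rho F c) p v / (4 * (rho F c p + c%:C) ^+ 2) +
     etatilde F p u * etatilde F p v).
Proof.
move=> tu tv; rewrite (gMbar_slice tu tv) !dN_rho.
have -> : rho F c p + c%:C = 2 * piC * r2 by rewrite /rho subrK.
have [-> ->] := dot_rlog u; have [-> ->] := dot_rlog v.
by rewrite (rlog_prod _ _ _ _ (piC_neq0 R) (rsq_neq0 hM Mp) (complexii R)).
Qed.

End Slice.

(** * Scalar identities *)

Section Scalars.
Variable R : realType.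
Local Notation C := R[i].
Implicit Types (p r G e f : C).

Lemma f1_sum p r G e : 4 * p * (e - (G - r)) = 4 * p * e - 4 * p * G + 4 * p * r.
Proof. ring. Qed.

Lemma f1N_sum p r G e c : - (2 * p * r) - c + (e - 4 * p * G + 4 * p * r) =
  2 * p * r - c + e - 4 * p * G.
Proof. ring. Qed.

Lemma fminus_sum p r G e : (e - (e - 4 * p * G + 4 * p * r)) / 2 = 2 * p * G - 2 * p * r.
Proof. by field. Qed.

Lemma theta1_sum p r s t g n : s + 2 * p * (- 2^-1 * r * t + (g - (n - r * t))) +
  2^-1 * (2 * p * (2 * n)) = s + p * r * t + 2 * p * g :> C.
Proof. by field. Qed.

Lemma eta_sum p r s t g n : s + 2 * p * (- 2^-1 * r * t + (g - (n - r * t))) =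
  s + p * r * t + 2 * p * g - 2 * p * n :> C.
Proof. by field. Qed.

Lemma etaminus_sum p r G e t g n :
  2^-1 * ((2 * p * (g - (n - r * t)) - (e - 4 * p * G + 4 * p * r) / 2 * t) -
    (2 * p * g - e / 2 * t)) = p * r * t - p * n + (p * G - p * r) * t.
Proof. by field. Qed.

Lemma etaplus_sum p r G e t g n :
  2^-1 * ((2 * p * (g - (n - r * t)) - (e - 4 * p * G + 4 * p * r) / 2 * t) +
    (2 * p * g - e / 2 * t)) = p * r * t - p * n + 2 * p * g - (e / 2 - p * G + p * r) * t.
Proof. by field. Qed.

Lemma omega12_X_sum p (i a b : C) : p != 0 -> i * i = -1 ->
  (2 * p)^-1 * (2 * i * a - 2 * b) = p^-1 * (i * (a + i * b)).
Proof.
move=> p0 ii; have -> : i * (a + i * b) = i * a + (i * i) * b by ring.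
by rewrite ii; field.
Qed.

Lemma real_scaleV (a b : R) : (a^-1 * b)%:C = a%:C^-1 * b%:C :> C.
Proof. by rewrite rmorphM fmorphV. Qed.

Lemma theta_scale (x : C) (k : R) : k != 0 ->
  2^-1 * (2 * k%:C * (k%:C^-1 * x)) = x.
Proof.
move=> k0; have : k%:C != 0 :> C by rewrite fmorph_eq0.
by move: k%:C => p p0; field.
Qed.

Lemma theta2_val (b : C) :
  2^-1 * (2 * (pi : R)%:C * (complex.Im ((pi : R)%:C^-1 * ('i * b)))%:C) = (complex.Re b)%:C.
Proof.
rewrite -(fmorphV (@real_complex R)) Im_scale real_scaleV.
have -> : complex.Im ('i * b) = complex.Re b by case: b => x y /=; rewrite mul0r mul1r add0r.
by rewrite theta_scale// gt_eqF// pi_gt0.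
Qed.

Lemma theta3_val (b : C) :
  - 2^-1 * (2 * (pi : R)%:C * (complex.Re ((pi : R)%:C^-1 * ('i * b)))%:C) = (complex.Im b)%:C.
Proof.
rewrite -(fmorphV (@real_complex R)) Re_scale real_scaleV.
have -> : complex.Re ('i * b) = - complex.Im b by case: b => x y /=; rewrite mul0r mul1r sub0r.
have -> : (- complex.Im b)%:C = - (complex.Im b)%:C :> C by rewrite rmorphN.
by rewrite mulNr !mulrN opprK theta_scale// gt_eqF// pi_gt0.
Qed.

Lemma re_im_sum (a b : C) :
  ((complex.Re a)%:C * (complex.Re b)%:C + (complex.Re b)%:C * (complex.Re a)%:C) / 2 +
  ((complex.Im a)%:C * (complex.Im b)%:C + (complex.Im b)%:C * (complex.Im a)%:C) / 2 =
  (a * b^*%C + b * a^*%C) / 2.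
Proof.
have h (x : C) : x^*%C = (complex.Re x)%:C - 'i * (complex.Im x)%:C.
  by rewrite {1}(complex_split x) cJD cJM !cJ_real cJi mulNr.
have key (x y z t : C) : (x * y + y * x) / 2 + (z * t + t * z) / 2 =
    ((x + 'i * z) * (y - 'i * t) + (y + 'i * t) * (x - 'i * z)) / 2.
  have -> : ((x + 'i * z) * (y - 'i * t) + (y + 'i * t) * (x - 'i * z)) / 2 =
    x * y - ('i * 'i) * z * t by field.
  by rewrite complexii; field.
by rewrite key -(h a) -(h b) -(complex_split a) -(complex_split b).
Qed.

(** The square of theta_0 = - df / 2, with f = m - cc + e and m = rho + cc. The
    coefficient of (d rho)^2 exceeds that of line 2 by the radial part of the
    metric of the quotient. *)
Lemma radial_part m cc e du dv eu ev : m != 0 -> m - cc + e != 0 ->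
  2 / (m - cc + e) * (m - cc + e)^-1 *
    ((- 2^-1 * (du + eu) * (- 2^-1 * (dv + ev)) + - 2^-1 * (dv + ev) * (- 2^-1 * (du + eu))) / 2) =
  (2 * (m - cc + e) ^+ 2)^-1 * ((m - cc + 2 * cc - e) / (2 * m) * ((du * dv + dv * du) / 2) +
    2 * ((du * ev + dv * eu) / 2) + (eu * ev + ev * eu) / 2) +
  m / (m - cc + e) * (du * dv / (4 * m ^+ 2)) :> C.
Proof. by move=> m0 f0; field; rewrite m0 f0. Qed.

(** What remains of the metric when the radial and contact parts are removed:
    hN, hI and hY are the values of N, of N^inst and of the inverse of H on the
    respective coframes, b that of theta_2^2 + theta_3^2, and t = 1 / z^0. *)
Lemma rest_part p r cc e z t hN hI hY b : p != 0 -> r != 0 -> z != 0 -> t = z^-1 ->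
  2 * p * r - cc + e != 0 ->
  - (2 * p * r - cc + e)^-1 * (2 * p * (hN + hI + (4 * p ^+ 2)^-1 * hY)) +
    2 / (2 * p * r - cc + e) * (2 * p * r - cc + e)^-1 * b =
  2 * p * r / (2 * p * r - cc + e) * (- (hN / r) - z ^+ 2 / r * (t * (t * hI))) +
  - (2 * p * (2 * p * r - cc + e))^-1 * hY +
  2 * p * r * (z ^+ 2 / r) / (p * (2 * p * r - cc + e) ^+ 2) * (t * (t * b)) :> C.
Proof. by move=> p0 r0 z0 -> f0; field; rewrite p0 r0 z0 f0. Qed.

(** The squares of eta and theta_1, for eta = theta_1 - 2 p n where n stands for
    g_N(V, .), form a quadratic form in theta_1 and n. Completing the square in
    theta_1 gives the square l of line 3 and a multiple of n ^ 2, which is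
    line 6; the squares of the contact form t cancel. *)
Lemma contact_core p r f G su sv tu tv gu gv nu nv : p != 0 -> G != 0 ->
  f != 0 -> f - 4 * p * G != 0 ->
  let eta s t g n := s + p * r * t + 2 * p * g - 2 * p * n in
  let theta1 s t g := s + p * r * t + 2 * p * g in
  let l s t g n := s + p * r * t + 2 * p * g - f / (2 * p * G) * (p * n) in
  let k n := - (p * n) / (p * G) in
  - f^-1 * (2 / (f - 4 * p * G) *
      ((eta su tu gu nu * eta sv tv gv nv + eta sv tv gv nv * eta su tu gu nu) / 2)) +
    2 / f * f^-1 * ((theta1 su tu gu * theta1 sv tv gv + theta1 sv tv gv * theta1 su tu gu) / 2) =
  4 * (2 * p * G) / (f ^+ 2 * - (f - 4 * p * G)) *
    ((l su tu gu nu * l sv tv gv nv + l sv tv gv nv * l su tu gu nu) / 2) +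
  (2 * p * G / f * ((k nu * k nv + k nv * k nu) / 2) -
   2 * p * r / f * ((- (2 * tu) / 2 * (- (2 * tv) / 2) + - (2 * tv) / 2 * (- (2 * tu) / 2)) / 2)) +
  2 * p * r / f * (tu * tv) :> C.
Proof. by move=> p0 G0 f0 f10 eta theta1 l k; rewrite /eta /theta1 /l /k; field; rewrite G0 p0 f0 f10. Qed.

(** The preceding identity, with the forms of lines 3 and 6 written in terms of
    eta_+^inst and eta_-^inst as in the coordinate expression. *)
Lemma contact_part p r cc e G su sv tu tv gu gv nu nv : p != 0 -> G != 0 ->
  2 * p * r - cc + e != 0 -> 2 * p * r - cc + e - 4 * p * G != 0 ->
  let f := 2 * p * r - cc + e in
  let eta s t g n := s + p * r * t + 2 * p * g - 2 * p * n in
  let theta1 s t g := s + p * r * t + 2 * p * g in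
  let fm := 2 * p * G - 2 * p * r in
  let f1i := e - 4 * p * G + 4 * p * r in
  let em t n := p * r * t - p * n + (p * G - p * r) * t in
  let ep t g n := p * r * t - p * n + 2 * p * g - (e / 2 - p * G + p * r) * t in
  let l s t g n := s - cc / 4 * (- (2 * t)) + ep t g n +
    ((e + f1i) / 2 - cc) / (2 * p * r + fm) * em t n in
  let k t n := - (2 * t) / 2 + 2 / (2 * p * r + fm) * em t n in
  - f^-1 * (2 / (f - 4 * p * G) *
      ((eta su tu gu nu * eta sv tv gv nv + eta sv tv gv nv * eta su tu gu nu) / 2)) +
    2 / f * f^-1 * ((theta1 su tu gu * theta1 sv tv gv + theta1 sv tv gv * theta1 su tu gu) / 2) =
  4 * (2 * p * r + fm) / (f ^+ 2 * (2 * p * r - cc + 2 * cc - f1i)) *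
    ((l su tu gu nu * l sv tv gv nv + l sv tv gv nv * l su tu gu nu) / 2) +
  ((2 * p * r + fm) / f * ((k tu nu * k tv nv + k tv nv * k tu nu) / 2) -
   2 * p * r / f * ((- (2 * tu) / 2 * (- (2 * tv) / 2) + - (2 * tv) / 2 * (- (2 * tu) / 2)) / 2)) +
  2 * p * r / f * (tu * tv) :> C.
Proof.
move=> p0 G0 f0 f10 f eta theta1 fm f1i em ep l k.
have e1 : 2 * p * r + fm = 2 * p * G by rewrite /fm subrKC.
have e2 : 2 * p * r - cc + 2 * cc - f1i = - (f - 4 * p * G) by rewrite /f1i /f; ring.
have ek t n : k t n = - (p * n) / (p * G) by rewrite /k e1 /em; field; rewrite G0 p0.
have el s t g n : l s t g n = s + p * r * t + 2 * p * g - f / (2 * p * G) * (p * n) .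
  by rewrite /l e1 /ep /em /f1i /f; field; rewrite G0 p0.
rewrite !ek !el e1 e2 /eta /theta1.
exact: contact_core.
Qed.

Lemma line5_sum p t a b (i : C) : p != 0 ->
  t * a + 2 * p * i * ((2 * p)^-1 * (t * b)) = t * (a + i * b).
Proof. by move=> p0; field. Qed.

Lemma dcK_val (d : C) : d = - (2 * - (d / 2)).
Proof. by field. Qed.

(** T0, T1 and b stand for the squares of theta_0, of theta_1 and of theta_2 and
    theta_3 together; A and B for the two terms of g_P. The radial square d and
    the contact square t complete h to the metric of the quotient, which is
    line 1 without its instanton term K. *)
Lemma sum_lines (k k' A B T0 T1 b g1 d t h K l2 l3 l4 l5 l6 l6' : C) :
  k * k' * T0 = l2 + g1 * d ->
  - k' * A + k * k' * T1 = l3 + (l6 - l6') + g1 * t ->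
  - k' * B + k * k' * b = g1 * (- h - K) + l4 + l5 ->
  - k' * (A + B - k * (T0 + T1 + b)) =
  g1 * (- h + (d + t) - K) + l2 + l3 + l4 + l5 + (l6 - l6').
Proof.
move=> e1 e2 e3.
have -> : - k' * (A + B - k * (T0 + T1 + b)) =
  k * k' * T0 + (- k' * A + k * k' * T1) + (- k' * B + k * k' * b) by ring.
by rewrite e1 e2 e3; ring.
Qed.

Lemma abs2_scale (t : R) (a b a' b' : C) : a = t%:C * a' -> b = t%:C * b' ->
  (a * b^*%C + b * a^*%C) / 2 = t%:C * (t%:C * ((a' * b'^*%C + b' * a'^*%C) / 2)).
Proof. by move=> -> ->; rewrite !cJM !cJ_real; ring. Qed.

End Scalars.

(** * The metric on the slice *)

Section Assembly.
Variables (R : realType) (n : nat) (M : set (Cvec R n.+1)) (F : Cvec R n.+1 -> R[i]^o).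
Variables (Minf : set (Cvec R n.+1)) (Om : Cvec R n.+1 -> Lambda n -> int) (c : R).
Local Notation C := R[i].
Local Notation rV := ('rV[R[i]]_n.+1).
Local Notation P := ((pi : R)%:C).
Hypothesis hM : CASK_domain M F.
Hypothesis hMinf_open : open Minf.
Hypothesis hMinf_sub : Minf `<=` M.
Hypothesis hOm : local_BPS_variation F Minf Om.
Hypothesis hOm_compatible : compatible F Om Minf.
Hypothesis hOm_support : forall z g, Minf z -> supp Om z g -> g.1 = 0.
Implicit Types (g : Lambda n) (u v : TN R n).

Variable p : TN R n.
Hypothesis Mp : Minf (zN p).
Let MMp : M (zN p) := hMinf_sub Mp.
Local Notation N := (rc (Nmx F (zN p))).
Local Notation H := (Ntot F Om p).
Local Notation zz := (zr p).
Local Notation r2 := (rsq F (zN p)).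
Local Notation V := (Vvec p).
Local Notation Y u := (Yvec F Om p u).
Local Notation G := (gN F Om p V V).

Lemma zr_V : zr V = 'i *: zz. Proof. by []. Qed.

Lemma Yvec_horizontal u : theta_x u = 0 -> theta_y u = 0 -> Y u = avec F Om p u.
Proof.
move=> hx hy; rewrite (YvecE hM hMinf_sub hOm hOm_support Mp) /thx /thy hx hy.
have -> : rc (0 : 'rV[R]_n.+1) = 0 by apply/rowP => i; rewrite !mxE.
by rewrite mul0mx subr0 add0r.
Qed.

Lemma Y_V : Y V = avec F Om p V.
Proof. exact: Yvec_horizontal. Qed.

Lemma dlogZ_scale u v (k : R) g : supp Om (zN p) g -> zr u = k%:C *: zr v ->
  dlogZ F g p u = k%:C * dlogZ F g p v.
Proof.
move=> sg uv; rewrite !(dlogZ_Zy F hOm_support Mp _ sg).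
have -> : Zy g (zN u) = k%:C * Zy g (zN v) by rewrite -Zy_scale; exact: (congr1 (Zy g) uv).
by rewrite -mulrA cJM cJ_real mulrBr.
Qed.

Lemma mul_scaled (a k b b' : C) : b = k * b' -> a * b = k * (a * b').
Proof. by move=> ->; rewrite mulrCA. Qed.

Lemma Ainst_scale u v (k : R) g : supp Om (zN p) g -> zr u = k%:C *: zr v ->
  Ainst F g p u = k%:C * Ainst F g p v.
Proof.
move=> sg uv.
apply: etrans (AinstE hOm hOm_support Mp u sg) _.
apply: etrans _ (congr1 (fun x => k%:C * x) (esym (AinstE hOm hOm_support Mp v sg))).
exact: mul_scaled (dlogZ_scale sg uv).
Qed.

Lemma avec_scale u v (k : R) : zr u = k%:C *: zr v ->
  avec F Om p u = k%:C *: avec F Om p v.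
Proof.
move=> uv; apply/rowP => i; apply: etrans (avecE F Om p u i) _.
apply: etrans _ (esym (mxE _ _ _ _)).
apply: etrans _ (congr1 (fun x => k%:C * x) (esym (avecE F Om p v i))).
apply: mul_scaled; rewrite -(bpsZ hOm hOm_support Mp); last first.
  by apply: bps_dom_ncoef; exact: (Ainst_dom hOm hOm_support Mp).
by apply: eq_bps_sum => g sg; exact: mul_scaled (Ainst_scale sg uv).
Qed.

Local Notation gNE := (gNE hM hMinf_sub hOm hOm_support Mp hOm_compatible).

Lemma real2 : 2 = (2 : R)%:C :> C. Proof. by rewrite rmorph_nat. Qed.

Lemma zr_X : zr (Xvec p) = (2 : R)%:C *: zr V.
Proof.
apply/rowP => i; rewrite [RHS]mxE -real2 mulr_natl mulr2n.
by rewrite /zr /Xvec /zN /= !mxE.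
Qed.

Lemma Y_X : Y (Xvec p) = (2 : R)%:C *: Y V.
Proof.
rewrite Y_V -(avec_scale zr_X); apply: Yvec_horizontal.
  by apply/rowP => i; rewrite /theta_x /= !mxE addr0.
by apply/rowP => i; rewrite /theta_y /= !mxE addr0.
Qed.

Lemma herm0r A (x : rV) : herm A x 0 = 0.
Proof. by rewrite -(scale0r (0 : rV)) -(rmorph0 (@real_complex R)) hermZr rmorph0 mul0r. Qed.

Lemma gN_X_sum (k a b t : C) : t * a + k * (t * b) = t * (a + k * b).
Proof. ring. Qed.

Lemma gN_X u : gN F Om p (Xvec p) u = 2 * gN F Om p V u.
Proof.
rewrite real2; apply: etrans (gNE _ _) (etrans _ (congr1 (fun x => _ * x) (esym (gNE _ _)))).
rewrite zr_X Y_X !hermZl; exact: gN_X_sum.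
Qed.

Lemma gN_sym u v : gN F Om p u v = gN F Om p v u.
Proof.
apply: etrans (gNE _ _) (etrans _ (esym (gNE _ _))).
exact: (f_equal2 (fun a b => a + _ * b) (herm_swap H _ _) (herm_swap (invmx H) _ _)).
Qed.

Lemma gM_V u : gM F p V u = r2 * etatilde F p u.
Proof. by rewrite /etatilde mulrA mulfV ?mul1r// (rsq_neq0 hM MMp). Qed.

Lemma gM_VV : gM F p V V = r2.
Proof.
rewrite (gME F p V V) rsq_herm zr_V herm_i scalerA complexii scaleN1r.
by rewrite (herm_swap N) hermNl opprK.
Qed.

Lemma f1instE : f1inst F Om p = finst F Om p - 4 * P * G + 4 * P * r2.
Proof. rewrite /f1inst /etainst gM_VV; exact: f1_sum. Qed.

(** The term g_M(V, V) = r^2 of eta^inst turns the - 2 pi r^2 of f_1 into the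
    2 pi r^2 of f. *)
Lemma f1NE : f1N F Om c p = fN F Om c p - 4 * P * G.
Proof. rewrite /f1N f1instE; exact: f1N_sum. Qed.

Lemma fminusE : fminus F Om p = 2 * P * G - 2 * P * r2.
Proof. by rewrite /fminus f1instE; exact: fminus_sum. Qed.

(** Both summands have to be differentiable for the derivative to be additive;
    for f^inst this is termwise differentiation. *)
Lemma dN_fN u : dN (fN F Om c) p u = dN (rho F c) p u + dN (finst F Om) p u.
Proof.
have [d Hd] := finst_rder hOm hOm_support hMinf_open u Mp.
have Hr := rho_rder hM MMp c u.
rewrite [dN (rho _ _) _ _](rder_ddt Hr) [dN (finst _ _) _ _](rder_ddt Hd).
exact/rder_ddt/(rderD Hr Hd).
Qed.

(** g_N(X, .) = 2 g_N(V, .) removes from eta the only term in which g_N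
    occurs. *)
Lemma thetaP1E (q : TP R n) (u : TP R n) : q.1 = p -> thetaP1 F Om q u =
  u.2%:C - (4 * P)^-1 * theta_dtheta p u.1 + P * r2 * etatilde F p u.1
  + 2 * P * etagsum F Om p u.1.
Proof. move=> qp; rewrite /thetaP1 /Defs.eta /etainst qp gN_X gM_V; exact: theta1_sum. Qed.

Lemma etaE (q : TP R n) (u : TP R n) : q.1 = p -> Defs.eta F Om q u =
  u.2%:C - (4 * P)^-1 * theta_dtheta p u.1 + P * r2 * etatilde F p u.1
  + 2 * P * etagsum F Om p u.1 - 2 * P * gN F Om p V u.1.
Proof. move=> qp; rewrite /Defs.eta /etainst qp gM_V; exact: eta_sum. Qed.

Lemma etaminusE u : etaminus F Om p u =
  P * r2 * etatilde F p u - P * gN F Om p V u + (P * G - P * r2) * etatilde F p u.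
Proof. rewrite /etaminus f1instE /etainst gM_V; exact: etaminus_sum. Qed.

Lemma etaplusE u : etaplus F Om p u =
  P * r2 * etatilde F p u - P * gN F Om p V u + 2 * P * etagsum F Om p u
  - (finst F Om p / 2 - P * G + P * r2) * etatilde F p u.
Proof. rewrite /etaplus f1instE /etainst gM_V; exact: etaplus_sum. Qed.

(** Up to a constant factor, the contraction of omega_1 + i omega_2 with X: its
    real and imaginary parts are theta_2^P and theta_3^P, and line 5 is a
    multiple of its square. *)
Definition Bform u : C := dot zz (Y u) + 'i * dot (zr u) (avec F Om p V).

Lemma omega12_X u : omega12 F Om p (Xvec p) u = P^-1 * ('i * Bform u).
Proof.
apply: etrans (omega12E hM hMinf_sub hOm hOm_support Mp _ _) _.
rewrite zr_X Y_X zr_V Y_V scalerA !dotZl !dotZr -real2; exact: (omega12_X_sum _ _ (piC_neq0 R) (complexii R)).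
Qed.

(** theta_2 and theta_3 are contractions of omega_1 + i omega_2 with X, on which the coframe
    dz^i, W_i + W_i^inst takes the values 2 i z^i and 2 alpha_i(V), with alpha_i
    the part of W_i^inst that comes from A_gamma. *)
Lemma theta23 (q u v : TP R n) : q.1 = p ->
  sq (thetaP2 F Om q) u v + sq (thetaP3 F Om q) u v = abs2 Bform u.1 v.1.
Proof.
move=> qp.
have t2 w : thetaP2 F Om q w = (complex.Re (Bform w.1))%:C.
  rewrite /thetaP2 qp /omega2 omega12_X; exact: theta2_val.
have t3 w : thetaP3 F Om q w = (complex.Im (Bform w.1))%:C.
  rewrite /thetaP3 qp /omega1 omega12_X; exact: theta3_val.
rewrite /sq /abs2 /sprod /conjf !t2 !t3; exact: re_im_sum.
Qed.


Section Slice.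
Hypothesis z0_gt0 : 0 < zN p 0 ord0.
Variables u v : TN R n.
Hypothesis tu : complex.Im (zN u 0 ord0) = 0.
Hypothesis tv : complex.Im (zN v 0 ord0) = 0.
Local Notation z0 := (zN p 0 ord0).
Local Notation X := (Xcoord (zN p)).
Let t : R := (complex.Re z0)^-1.

Lemma tE : t%:C = z0^-1. Proof. by rewrite [in RHS](z0E z0_gt0) fmorphV. Qed.

Lemma rho_c : rho F c p + c%:C = 2 * P * r2.
Proof. by rewrite /rho subrK. Qed.

Lemma DXg_row g x : complex.Im (zN x 0 ord0) = 0 -> supp Om (zN p) g ->
  DXg F c g p x = Zy g (t%:C *: zr x).
Proof.
move=> tx sg; apply: etrans (DXgE hM MMp z0_gt0 tx c (hOm_support Mp sg)) _.
by rewrite Zy_scale tE mulrC.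
Qed.

Lemma line1E : line1 F Om c p u v = 2 * P * r2 / (rho F c p + finst F Om p) *
  (- (gM F p u v / r2) +
    (dN (rho F c) p u * dN (rho F c) p v / (4 * (2 * P * r2) ^+ 2) +
     etatilde F p u * etatilde F p v)
   - z0 ^+ 2 / r2 * (t%:C * (t%:C * herm (NIm F Om p) (zr u) (zr v)))).
Proof.
rewrite /line1 rho_c (gMbarE hM MMp z0_gt0 c tu tv) rho_c (expKE hM MMp z0_gt0).
rewrite (bps_abs2 hOm hOm_support Mp (fun g => DXg_row tu) (fun g => DXg_row tv)).
by rewrite hermZl hermZr.
Qed.

Lemma line4E : line4 F Om c p u v =
  - (2 * P * (rho F c p + finst F Om p))^-1 * herm (invmx H) (Y u) (Y v).
Proof.
rewrite /line4; apply: (congr1 (fun x => _ * x)).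
by apply: (sum_sprod (invmx H)) => i x; rewrite mxE.
Qed.

(** Along the slice dX_gamma + X_gamma (d rho / (2 (rho + c)) + dK / 2) is
    dZ_gamma / z^0, so that the form of line 5 is a multiple of the contraction
    with X. *)
Lemma line5_form x : complex.Im (zN x 0 ord0) = 0 ->
  \sum_i Xhom X 0 i * Wtot F Om i p x + 2 * P * 'i *
    bps_sum Om p (fun g => Ainst F g p V * DXg F c g p x) = t%:C * Bform x.
Proof.
move=> tx.
have e1 : \sum_i Xhom X 0 i * Wtot F Om i p x = t%:C * dot zz (Y x).
  rewrite -dotZl -(XhomE z0_gt0); apply: eq_bigr => i _.
  by apply: (congr1 (fun y => _ * y)); rewrite mxE.
have e2 g : supp Om (zN p) g -> Ainst F g p V * DXg F c g p x = Zy g (t%:C *: zr x) * Ainst F g p V.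
  by move=> sg; rewrite (DXg_row tx sg) mulrC.
rewrite (eq_bps_sum e2) (bps_AZ hOm hOm_support Mp) e1 dotZl.
exact: (line5_sum _ _ _ _ (piC_neq0 R)).
Qed.

Lemma line5E : line5 F Om c p u v = 2 * P * r2 * (z0 ^+ 2 / r2) /
  (P * (rho F c p + finst F Om p) ^+ 2) * (t%:C * (t%:C * abs2 Bform u v)).
Proof.
rewrite /line5 rho_c (expKE hM MMp z0_gt0); apply: (congr1 (fun x => _ * x)).
exact: (abs2_scale (line5_form tu) (line5_form tv)).
Qed.

Lemma dcK_etatilde x : complex.Im (zN x 0 ord0) = 0 -> dcK F p x = - (2 * etatilde F p x).
Proof. by move=> tx; rewrite (etatildeE hM MMp z0_gt0 tx); exact: dcK_val. Qed.

End Slice.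

Lemma G_neq0 : gN F Om p (Xvec p) (Xvec p) != 0 -> G != 0.
Proof. by apply: contraNneq => G0; rewrite gN_X gN_sym gN_X G0 !mulr0. Qed.

Lemma rhoE : rho F c p = 2 * P * r2 - c%:C. Proof. by []. Qed.
Lemma fNE : fN F Om c p = 2 * P * r2 - c%:C + finst F Om p. Proof. by []. Qed.

Lemma radial_metric u v : 2 * P * r2 - c%:C + finst F Om p != 0 ->
  2 / fN F Om c p * (fN F Om c p)^-1 *
  ((- 2^-1 * dN (fN F Om c) p u * (- 2^-1 * dN (fN F Om c) p v) +
    - 2^-1 * dN (fN F Om c) p v * (- 2^-1 * dN (fN F Om c) p u)) / 2) =
  line2 F Om c p u v + 2 * P * r2 / (rho F c p + finst F Om p) *
  (dN (rho F c) p u * dN (rho F c) p v / (4 * (2 * P * r2) ^+ 2)).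
Proof.
move=> f0; have m0 : 2 * P * r2 != 0.
  by rewrite mulf_neq0 ?pi2_neq0// (rsq_neq0 hM MMp).
rewrite (dN_fN u) (dN_fN v) /line2 rho_c rhoE fNE; exact: radial_part.
Qed.

Lemma contact_metric (q u v : TP R n) : q.1 = p -> 0 < zN p 0 ord0 ->
  2 * P * r2 - c%:C + finst F Om p != 0 ->
  2 * P * r2 - c%:C + finst F Om p - 4 * P * G != 0 -> G != 0 ->
  tangent_Nbar u -> tangent_Nbar v ->
  - (fN F Om c p)^-1 * (2 / (fN F Om c p - 4 * P * G) * sq (Defs.eta F Om q) u v) +
  2 / fN F Om c p * (fN F Om c p)^-1 * sq (thetaP1 F Om q) u v =
  line3 F Om c q u v + line6 F Om c p u.1 v.1 +
  2 * P * r2 / (rho F c p + finst F Om p) * (etatilde F p u.1 * etatilde F p v.1).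
Proof.
move=> qp z0 f0 f10 G0 tu tv.
rewrite /line3 /line6 qp rho_c /sq /sprod (etaE u qp) (etaE v qp) (thetaP1E u qp) (thetaP1E v qp).
rewrite (dcK_etatilde z0 tu) (dcK_etatilde z0 tv) (etaplusE u.1) (etaplusE v.1).
rewrite (etaminusE u.1) (etaminusE v.1) /fplus fminusE f1instE rhoE fNE.
exact: (contact_part _ _ _ _ _ _ _ _ (piC_neq0 R) G0 f0 f10).
Qed.

Lemma metric_identity (q u v : TP R n) : q.1 = p -> 0 < zN p 0 ord0 ->
  fN F Om c p != 0 -> f1N F Om c p != 0 -> G != 0 ->
  tangent_Nbar u -> tangent_Nbar v ->
  gNbar F Om c q u v = gNbar_coord F Om c q u v.
Proof.
move=> qp z0 f0 f10 G0 tu tv; rewrite f1NE in f10.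
rewrite /gNbar_coord /gNbar qp (line1E z0 tu tv) line4E (line5E z0 tu tv).
have -> : forall a b d e : C, a + b + d + e = a + b + (d + e) by move=> *; rewrite addrA.
rewrite (theta23 u v qp).
rewrite /gP qp f1NE (gNE u.1 v.1) (HmE F Om p) hermD -(gME F p u.1 v.1).
apply: sum_lines.
- by rewrite /sq /sprod /thetaP0 qp; exact: radial_metric f0.
- exact: (contact_metric qp z0 f0 f10 G0 tu tv).
- apply: (rest_part _ _ _ _ (piC_neq0 R) (rsq_neq0 hM MMp) _ _ f0) => //; last exact: tE.
  by rewrite gt_eqF.
Qed.

(** * No d rho component *)
Section RadialLine.
Variable u : TN R n.
Hypothesis z0_gt0 : 0 < zN p 0 ord0.
Hypothesis tu : complex.Im (zN u 0 ord0) = 0.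
Hypothesis dX0 : forall i, dX i p u = 0.
Hypothesis thx0 : theta_x u = 0.
Hypothesis thy0 : theta_y u = 0.

(** The coordinate field of rho is a real multiple of z: the X^i fix z up to a
    scalar, and the slice makes the scalar real. *)
Lemma radial_vector : exists k : R, zr u = k%:C *: zz.
Proof.
exists (complex.Re (zN u 0 ord0) / complex.Re (zN p 0 ord0)).
rewrite -(u0E z0_gt0 tu); apply/eqP; rewrite -subr_eq0; apply/eqP.
have : dXhom p u = 0.
  apply: row_coords => [|i]; last by rewrite -(dXE z0_gt0) dX0 mxE.
  by rewrite !mxE divfK ?z0_neq0// subrr mulr0.
move=> /(congr1 (fun x => zN p 0 ord0 *: x)).
by rewrite scaler0 /dXhom scalerA mulfV ?scale1r// z0_neq0.
Qed.

(** Z_gamma changes by a real factor, which does not affect its phase. *)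
Lemma dlogZ_radial g : supp Om (zN p) g -> dlogZ F g p u = 0.
Proof.
move=> sg; have [k uk] := radial_vector.
have uk' : zr u = k%:C *: zr p by [].
rewrite (dlogZ_scale sg uk') (dlogZ_Zy F hOm_support Mp p sg) divff ?(Z_neq0 hOm hOm_support Mp sg)//.
by rewrite -[1]/(1%:R) cJ_nat subrr mulr0.
Qed.

Lemma Ainst_radial g : supp Om (zN p) g -> Ainst F g p u = 0.
Proof. by move=> sg; rewrite (AinstE hOm hOm_support Mp u sg) dlogZ_radial// mulr0. Qed.

Lemma bps_sum_eq0 a : (forall g, supp Om (zN p) g -> a g = 0) -> bps_sum Om p a = 0.
Proof. by move=> a0; rewrite (eq_bps_sum a0) (bps_sum0 hOm hOm_support Mp). Qed.

Lemma etagsum_radial : etagsum F Om p u = 0.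
Proof.
apply: bps_sum_eq0 => g sg.
by rewrite (etagE hOm hOm_support Mp u sg) dlogZ_radial// mulr0.
Qed.

Lemma Winst_radial i : Winst F Om i p u = 0.
Proof.
apply: bps_sum_eq0 => g sg; rewrite (Ainst_radial sg) dthetaE.
have -> : theta g u = 0.
  by rewrite /theta thx0 thy0 big1// => j _; rewrite !mxE !mulr0 addr0.
by rewrite !mulr0 subrr mulr0.
Qed.

Lemma Y_radial : Y u = 0.
Proof.
rewrite Yvec_horizontal//; apply/rowP => i; apply: etrans (avecE _ _ _ _ _) _.
rewrite bps_sum_eq0; first by rewrite mxE mulr0.
by move=> g sg; rewrite (Ainst_radial sg) mulr0.
Qed.

Lemma etatilde_radial : etatilde F p u = 0.
Proof.
have [k uk] := radial_vector.
by rewrite etatilde_herm uk hermZr herm_iz !mulr0.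
Qed.

Lemma gN_V_radial : gN F Om p V u = 0.
Proof.
have [k uk] := radial_vector.
by rewrite gNE Y_radial herm0r mulr0 addr0 zr_V uk hermZr herm_iz mulr0.
Qed.

Lemma etaplus_radial : etaplus F Om p u = 0.
Proof.
by rewrite etaplusE gN_V_radial etatilde_radial etagsum_radial !mulr0 !subr0 addr0.
Qed.

Lemma etaminus_radial : etaminus F Om p u = 0.
Proof. by rewrite etaminusE gN_V_radial etatilde_radial !mulr0 subr0 addr0. Qed.

End RadialLine.

End Assembly.

Theorem theorem5p4 (R : realType) (n : nat)
  (M : set (Cvec R n.+1)) (F : Cvec R n.+1 -> R[i]^o)
  (Minf : set (Cvec R n.+1)) (Om : Cvec R n.+1 -> Lambda n -> int) (c : R)
  (hM : CASK_domain M F)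
  (hMinf_open : open Minf) (hMinf_sub : Minf `<=` M)
  (hMinf_circle : forall (l : R[i]) z, `|l| = 1 -> Minf z -> Minf (l *: z))
  (hMinf_monoid : forall (t : R) z, 1 <= t -> Minf z -> Minf (t%:C *: z))
  (hOm : local_BPS_variation F Minf Om)
  (hOm_compatible : compatible F Om Minf)
  (hOm_support : forall z g, Minf z -> supp Om z g -> g.1 = 0) :
  (forall q, Nbar F Om c Minf q ->
     forall u v, tangent_Nbar u -> tangent_Nbar v ->
       gNbar F Om c q u v = gNbar_coord F Om c q u v)
  /\ (forall q, Nbar F Om c Minf q ->
        (forall i, no_drho_component (Winst F Om i) q)
        /\ no_drho_component (etaplus F Om) q
        /\ no_drho_component (etaminus F Om) q).
Proof.
split=> q [[Mq f0 f10 gX] z0].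
  move=> u v tu tv.
  have G0 := G_neq0 hM hMinf_sub hOm hOm_compatible hOm_support Mq gX.
  exact: (metric_identity hM hMinf_open hMinf_sub hOm hOm_compatible hOm_support Mq (erefl q.1)).
split=> [i|]; last split.
- by move=> u tu dX0 x0 y0 _; apply: (Winst_radial hOm hOm_support Mq z0 tu).
- by move=> u tu dX0 x0 y0 _; apply: (etaplus_radial hM hMinf_sub hOm hOm_compatible hOm_support Mq z0 tu).
- by move=> u tu dX0 x0 y0 _; apply: (etaminus_radial hM hMinf_sub hOm hOm_compatible hOm_support Mq z0 tu).
Qed.
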